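(* Let $f$ be a transcendental entire function. Then $I(f)$ is a spider's web if and only if $I(f)$ separates some point of $J(f)$ from infinity; and $A(f)$ is a spider's web if and only if $A(f)$ separates some point of $J(f)$ from infinity. Moreover, if $f$ has no multiply connected Fatou components, then $J(f)$ is a spider's web if and only if $J(f)$ separates some point of $J(f)$ from infinity.
   Context: $f^n$ denotes the $n$-th iterate of $f$. $J(f)$ is the Julia set (points in no neighbourhood of which $(f^n)$ is normal), $F(f)=\mathbb{C}\setminus J(f)$ the Fatou set, whose components are Fatou components. $I(f) := \{z : f^n(z)\to\infty\}$. The maximum modulus function is $M(r,f)=\max_{|z|=r}|f(z)|$ and $M^n(r,f)$ denotes its $n$-th iterate in the variable $r$; the fast escaping set is $A(f) := \{z\in\mathbb{C} : \exists \ell\in\mathbb{N} \text{ with } |f^{n+\ell}(z)|\ge M^n(R,f) \text{ for all } n\in\mathbb{N}\}$, where $R>0$ is fixed large enough that $M^n(R,f)\to\infty$. A set $E\subset\mathbb{C}$ separates a point $z$ from infinity if there is a bounded open set $U$ with $z\in U$ and $\partial U\subset E$. A connected set $E\subset\mathbb{C}$ is a spider's web if there is a sequence $(G_n)$ of bounded simply connected domains with $\partial G_n\subset E$, $G_n\subset G_{n+1}$, and $\bigcup_n G_n=\mathbb{C}$. *)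

(* Defs.v *)
From HB Require Import structures.
From mathcomp Require Import all_boot all_order all_algebra.
From mathcomp Require Import all_classical all_reals all_analysis.
From mathcomp Require Import complex.
Import Order.TTheory GRing.Theory Num.Theory.
Import numFieldTopology.Exports numFieldNormedType.Exports.

Set Implicit Arguments.
Unset Strict Implicit.
Unset Printing Implicit Defensive.

Local Open Scope ring_scope.
Local Open Scope classical_set_scope.

(* The (metric) topology and normed-module structure of R[i] (over itself),
   i.e. the usual topology of the complex plane, |z - w| being the distance. *)
HB.instance Definition _ (R : rcfType) := PseudoPointedMetric.copy R[i] (R[i])^o.
HB.instance Definition _ (R : rcfType) := NormedModule.copy R[i] (R[i])^o.

Section Dynamics.
Variable R : realType.
Local Notation C := (R[i]).

Definition cabs (z : C) : R := Num.sqrt (complex.Re z ^+ 2 + complex.Im z ^+ 2).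

(* f is entire: complex differentiable at every point of C
   (derivable f z 1 : the limit of (f (z + h) - f z) / h, h -> 0 in C, exists) *)
Definition entire (f : C -> C) := forall z : C, derivable f z 1.

Definition transcendental_entire (f : C -> C) :=
  entire f /\ ~ (exists p : {poly C}, forall z, f z = p.[z]).

Definition unif_cvg_on (F : nat -> C -> C) (g : C -> C) (K : set C) :=
  forall e : R, 0 < e -> \forall n \near \oo, forall z, K z -> cabs (F n z - g z) < e.

Definition unif_cvg_infty_on (F : nat -> C -> C) (K : set C) :=
  forall M : R, \forall n \near \oo, forall z, K z -> M < cabs (F n z).

Definition loc_unif_cvg (F : nat -> C -> C) (g : C -> C) (U : set C) :=
  forall K, K `<=` U -> compact K -> unif_cvg_on F g K.
Definition loc_unif_cvg_infty (F : nat -> C -> C) (U : set C) :=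
  forall K, K `<=` U -> compact K -> unif_cvg_infty_on F K.

Definition normal_family_on (F : nat -> C -> C) (U : set C) :=
  forall m : nat -> nat, exists psi : nat -> nat,
    (forall k, (psi k < psi k.+1)%N) /\
    ((exists g : C -> C, loc_unif_cvg (fun k => F (m (psi k))) g U) \/
     loc_unif_cvg_infty (fun k => F (m (psi k))) U).

Definition julia (f : C -> C) : set C :=
  [set z | ~ exists U : set C, open U /\ U z /\ normal_family_on (fun n => iter n f) U].

Definition fatou (f : C -> C) : set C := ~` julia f.

Definition fatou_component (f : C -> C) (U : set C) :=
  exists2 z, fatou f z & U = connected_component (fatou f) z.

Definition I01 : set R := [set t | 0 <= t <= 1].
Definition sq01 : set (R * R) := [set p | I01 p.1 /\ I01 p.2].

Definition loop_in (D : set C) (gamma : R -> C) :=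
  {within I01, continuous gamma} /\ gamma 0 = gamma 1 /\
  (forall t, I01 t -> D (gamma t)).

Definition null_homotopic_in (D : set C) (gamma : R -> C) :=
  exists H : R * R -> C,
    [/\ {within sq01, continuous H},
        (forall p, sq01 p -> D (H p)),
        (forall t, I01 t -> H (0, t) = gamma t),
        (forall t, I01 t -> H (1, t) = H (1, 0)) &
        (forall s, I01 s -> H (s, 0) = H (s, 1))].

Definition simply_connected (D : set C) :=
  connected D /\ forall gamma, loop_in D gamma -> null_homotopic_in D gamma.

Definition multiply_connected (D : set C) := ~ simply_connected D.

Definition domain (D : set C) := open D /\ connected D /\ D !=set0.

Definition bounded (D : set C) := exists M : R, forall z, D z -> cabs z <= M.

Definition boundary (U : set C) : set C := closure U `\` interior U.

Definition separates (E : set C) (z : C) :=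
  exists U : set C, [/\ open U, bounded U, U z & boundary U `<=` E].

Definition spiders_web (E : set C) :=
  connected E /\
  exists G : nat -> set C,
    (forall n, [/\ bounded (G n), domain (G n), simply_connected (G n),
                   boundary (G n) `<=` E & G n `<=` G n.+1]) /\
    \bigcup_n G n = setT.

Definition escaping (f : C -> C) : set C :=
  [set z | forall M : R, \forall n \near \oo, M < cabs (iter n f z)].

Definition maxmod (f : C -> C) (r : R) : R :=
  sup [set cabs (f z) | z in [set z : C | cabs z = r]].

Definition fast_escaping (f : C -> C) (R0 : R) : set C :=
  [set z | exists l : nat, forall n : nat,
     iter n (maxmod f) R0 <= cabs (iter (n + l) f z)].

End Dynamics.

(* Main.v *)
(* Let [hull V] be the union of an open set V and the bounded components of its complement.
   If w lies outside the hull of f^n(U), every circle about w contains points outside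
   f^n(U), and Bloch's argument applied to a logarithm of f^n - w gives a Harnack
   inequality for |f^n - w|. Hence, if U meets J(f), the hulls of the f^n(U) eventually contain
   every disc, as otherwise Montel's theorem would make the iterates normal on U; and since
   M(2s)/M(s) is unbounded they contain the discs of radius M^n(r) from then on.

   If E is forward invariant and U is a bounded domain meeting J(f) with boundary in E, the
   hulls of suitable f^n(U) are simply connected, have connected boundaries inside E and exhaust
   the plane. Then E is connected as soon as the boundary of every bounded open set W meeting E
   meets E. For A(f) this is the maximum principle. For J(f) it holds because a simply connected
   domain contains its hull. For I(f), either W meets J(f) and its boundary contains fast escaping
   points, or a component of W lies in the Fatou set and in I(f); its images then are disjoint and
   each boundary of the web meets at most one of them, which drives their boundaries to infinity.

   Conversely a web separates all points of the plane, so only the existence of a point of J(f)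
   is needed: if J(f) were empty the iterates would tend to infinity locally uniformly, and
   Harnack's inequality for log |f^n| would bound log |f^(n+1)(0)| by 3 log |f^n(0)|, against the
   growth of M^n. *)
Require Import Defs.
From HB Require Import structures.
From mathcomp Require Import all_boot all_order all_algebra.
From mathcomp Require Import all_classical all_reals all_analysis.
From mathcomp Require Import complex.
From mathcomp Require Import ring lra zify.
Import Order.TTheory GRing.Theory Num.Theory.
Import numFieldTopology.Exports numFieldNormedType.Exports.

Set Implicit Arguments.
Unset Strict Implicit.
Unset Printing Implicit Defensive.

Local Open Scope ring_scope.
Local Open Scope classical_set_scope.

(** Function theory is built on squares. Cauchy's formula keeps the integral of the kernel 1/(z - b)
    as a nonzero factor that is divided out, and absolute constants may be wasteful:
    [transcendental_growth] beats any fixed Harnack constant, and weak bounds become sharp on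
    passing to powers. Hulls replace images because f(V) may miss points that it surrounds; f maps
    hull V into hull f(V) and hulls are idempotent, so one covering step can be iterated. The
    obstacle is plane topology, since simple connectedness is given by contracting loops. Two
    discrete devices handle it. A real function on the plane that is almost continuous modulo 1 at a
    fixed scale lifts to one that is almost continuous ([lift]): with a bump function this yields
    connected boundaries of hulls, with the angle it yields winding numbers, and from them that a
    simply connected open set contains its hull. Conversely, a loop in a hull is replaced by a
    closed walk on the cells of a fine grid, which is contracted by cutting out subloops and pushing
    extremal corners; a signed crossing number shows that the cell onto which a corner is pushed
    lies in the hull. *)

Section ComplexPlane.
Variable R : realType.
Local Notation C := (R[i]).
Implicit Types (z w : C) (U V : set C).

(** * Modulus, topology and cluster points of the complex plane *)

Lemma normcE z : `|z| = (cabs z)%:C%C.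
Proof. by case: z. Qed.

Lemma cabs_ge0 z : 0 <= cabs z.
Proof. exact: sqrtr_ge0. Qed.

Lemma cabs0 : cabs (0 : C) = 0.
Proof. by rewrite /cabs /= expr0n /= addr0 sqrtr0. Qed.

Lemma cabs_eq0 z : cabs z = 0 -> z = 0.
Proof.
move=> h; apply/eqP; rewrite -normr_eq0 normcE h; exact/eqP.
Qed.

Lemma cabs_gt0 z : z != 0 -> 0 < cabs z.
Proof.
by move=> h; rewrite lt0r cabs_ge0 andbT; apply/eqP => /cabs_eq0 /eqP; apply/negP.
Qed.

Lemma cabsM z w : cabs (z * w) = cabs z * cabs w.
Proof. by apply: complexI; rewrite rmorphM /= -!normcE normrM. Qed.

Lemma cabsN z : cabs (- z) = cabs z.
Proof. by apply: complexI; rewrite -!normcE normrN. Qed.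

Lemma cabsB z w : cabs (z - w) = cabs (w - z).
Proof. by rewrite -cabsN opprB. Qed.

Lemma cabsD z w : cabs (z + w) <= cabs z + cabs w.
Proof. by rewrite -lecR rmorphD /= -!normcE ler_normD. Qed.

Lemma cabs_tri w z v : cabs (z - v) <= cabs (z - w) + cabs (w - v).
Proof. by rewrite -[z - v](subrKA w) cabsD. Qed.

Lemma cabsDB z w : cabs z <= cabs (z - w) + cabs w.
Proof. by rewrite -{1}(subrK w z) cabsD. Qed.

Lemma cabsV z : cabs z^-1 = (cabs z)^-1.
Proof. by apply: complexI; rewrite fmorphV /= -!normcE normfV. Qed.

Lemma cabsf z w : cabs (z / w) = cabs z / cabs w.
Proof. by rewrite cabsM cabsV. Qed.

Lemma cabs1 : cabs (1 : C) = 1.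
Proof. by apply: complexI; rewrite -normcE normr1. Qed.

Lemma cabsX z n : cabs (z ^+ n) = cabs z ^+ n.
Proof. by elim: n => [|n ih]; rewrite ?expr0 ?cabs1 // !exprS cabsM ih. Qed.

Lemma cabsR (x : R) : cabs (x%:C%C) = `|x|.
Proof. by rewrite /cabs /= expr0n /= addr0 sqrtr_sqr. Qed.

Lemma cabs_nat n : cabs (n%:R : C) = n%:R.
Proof. by rewrite -[n%:R](rmorph_nat (real_complex R)) cabsR ger0_norm. Qed.

Lemma Re_le_cabs z : `|complex.Re z| <= cabs z.
Proof. by rewrite -sqrtr_sqr ler_sqrt ?addr_ge0 ?sqr_ge0 // lerDl sqr_ge0. Qed.

Lemma Im_le_cabs z : `|complex.Im z| <= cabs z.
Proof. by rewrite -sqrtr_sqr ler_sqrt ?addr_ge0 ?sqr_ge0 // lerDr sqr_ge0. Qed.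

Lemma ReB z w : complex.Re (z - w) = complex.Re z - complex.Re w.
Proof. by case: z w => ? ? []. Qed.
Lemma ImB z w : complex.Im (z - w) = complex.Im z - complex.Im w.
Proof. by case: z w => ? ? []. Qed.
Lemma ReD z w : complex.Re (z + w) = complex.Re z + complex.Re w.
Proof. by case: z w => ? ? []. Qed.
Lemma ImD z w : complex.Im (z + w) = complex.Im z + complex.Im w.
Proof. by case: z w => ? ? []. Qed.

Lemma Creim z : z = (complex.Re z)%:C%C + 'i%C * (complex.Im z)%:C%C.
Proof. by apply/eqP; case: z => a b; rewrite eq_complex /=; apply/andP; split; apply/eqP; ring. Qed.

Lemma cabsi : cabs ('i%C : C) = 1.
Proof. by rewrite /cabs /= expr0n /= add0r expr1n sqrtr1. Qed.

Lemma cabs_le_ReIm z : cabs z <= `|complex.Re z| + `|complex.Im z|.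
Proof. by rewrite {1}(Creim z) (le_trans (cabsD _ _)) // cabsM cabsi mul1r !cabsR. Qed.

Lemma cabs_sqr z : cabs z ^+ 2 = complex.Re z ^+ 2 + complex.Im z ^+ 2.
Proof. by rewrite sqr_sqrtr // addr_ge0 // sqr_ge0. Qed.

Definition cball (c : C) (r : R) : set C := [set z | cabs (z - c) < r].

Lemma cballxx c r : 0 < r -> cball c r c.
Proof. by move=> h; rewrite /cball /= subrr cabs0. Qed.

Lemma nbhsCP z (A : set C) : nbhs z A <-> exists2 r : R, 0 < r & cball z r `<=` A.
Proof.
split.
  move/nbhs_ballP => [e /= e0 he].
  have er : e = (complex.Re e)%:C%C by case: e e0 {he} => a b /=; rewrite ltcE /= => /andP[/eqP -> _].
  exists (complex.Re e); first by move: e0; rewrite er /= ltcR.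
  move=> w hw; apply: he; rewrite /ball /= er normcE ltcR cabsB; exact: hw.
move=> [r r0 hr]; apply/nbhs_ballP; exists (r%:C%C) => /=; first by rewrite ltcR.
move=> w; rewrite /ball /= normcE ltcR cabsB => h; exact: hr.
Qed.

Lemma openCP U : open U <-> forall z, U z -> exists2 r : R, 0 < r & cball z r `<=` U.
Proof.
rewrite openE; split => h z /h; first by rewrite /interior => /nbhsCP.
by move=> hz; apply/nbhsCP.
Qed.

Lemma open_cball c r : open (cball c r).
Proof.
apply/openCP => z /= hz; exists (r - cabs (z - c)); first by rewrite subr_gt0.
move=> w hw; rewrite /cball /=; have := cabs_tri z w c; rewrite /cball /= in hw *; lra.
Qed.

Lemma closureCP U z : closure U z <-> forall r : R, 0 < r -> exists2 w, U w & cball z r w.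
Proof.
split=> h.
  move=> r r0; have /h [w [Uw hw]] : nbhs z (cball z r) by apply/nbhsCP; exists r.
  by exists w.
move=> B /nbhsCP[r r0 hr]; have [w Uw hw] := h r r0; exists w; split => //; exact: hr.
Qed.

Lemma boundary_open U z : open U -> (boundary U z <-> closure U z /\ ~ U z).
Proof. by move=> oU; rewrite /boundary (interior_id _).1. Qed.

Lemma closure_open_boundary U z : open U -> closure U z -> U z \/ boundary U z.
Proof.
move=> oU hz; have [Uz|nUz] := pselect (U z); first by left.
by right; apply/boundary_open.
Qed.

Definition ccont (g : C -> C) z := forall e : R, 0 < e ->
  exists2 d : R, 0 < d & forall w, cball z d w -> cabs (g w - g z) < e.

Lemma ccontP (g : C -> C) z : {for z, continuous g} <-> ccont g z.
Proof.
split=> h.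
  move=> e e0; have /nbhsCP [d d0 hd] : nbhs z (g @^-1` cball (g z) e).
    by apply: h; apply/nbhsCP; exists e.
  by exists d.
move=> A /nbhsCP[e e0 he]; have [d d0 hd] := h e e0.
by apply/nbhsCP; exists d => // w hw; apply: he; exact: hd.
Qed.

Lemma ccont_continuous (g : C -> C) : (forall z, ccont g z) <-> continuous g.
Proof. by split=> h z; apply/ccontP/h. Qed.

Lemma bounded_cabs_lt U : bounded U -> exists2 M : R, 0 < M & forall z, U z -> cabs z < M.
Proof.
move=> [M hM]; exists (`|M| + 1); first by rewrite ltr_wpDl.
move=> z /hM; have := ler_norm M; lra.
Qed.

Lemma cluster_real (u : nat -> R) (M : R) : (forall n, `|u n| <= M) ->
  exists l, forall e : R, 0 < e -> forall N, exists2 n, (N <= n)%N & `|u n - l| < e.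
Proof.
move=> hu.
have cp := @segment_compact R (- M) M.
have [l [_ hl]] : `[- M, M]%classic `&` cluster (u @ \oo) !=set0.
  by apply: cp; exists 0%N => // n _; rewrite /= in_itv /= -ler_norml.
exists l => e e0 N.
have /(_ [set u n | n in [set n | (N <= n)%N]] (ball l e)) := hl.
case=> //.
- by exists N => // n /= hn; exists n.
- exact: nbhsx_ballx.
- by move=> x [[n /= Nn <-]]; rewrite /ball /= distrC => h; exists n.
Qed.

(** Bolzano-Weierstrass in two passes: indices [phi k] are chosen along which the real parts
    converge, then the imaginary parts are clustered along [phi]. *)
Lemma cluster_seq (u : nat -> C) (M : R) : (forall n, cabs (u n) <= M) ->
  exists l, forall e : R, 0 < e -> forall N, exists2 n, (N <= n)%N & cabs (u n - l) < e.
Proof.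
move=> hu.
have [a ha] := @cluster_real (fun n => complex.Re (u n)) M (fun n => le_trans (Re_le_cabs _) (hu n)).
have h1 N (k : nat) : exists n, (N <= n)%N /\ `|complex.Re (u n) - a| < k.+1%:R^-1.
  by have [|n] := ha k.+1%:R^-1 _ N; [rewrite invr_gt0 | exists n].
have [phi hphi] := choice (fun k => h1 k k).
have [b hb] := @cluster_real (fun k => complex.Im (u (phi k))) M (fun n => le_trans (Im_le_cabs _) (hu _)).
exists (a +i* b)%C => e e0 N.
have e20 : 0 < e / 2 by rewrite divr_gt0.
have [m mm] : exists m : nat, (e / 2)^-1 < m%:R.
  by exists (Num.truncn (e / 2)^-1).+1; rewrite truncnS_gt.
have [k hk hk2] := hb _ e20 (maxn N m).
have [h3 h4] := hphi k.
exists (phi k); first by rewrite (leq_trans _ h3) // (leq_trans (leq_maxl N m)).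
apply: (le_lt_trans (cabs_le_ReIm _)); rewrite ReB ImB /=.
have : `|complex.Re (u (phi k)) - a| < e / 2.
  apply: (lt_trans h4); rewrite invf_plt ?posrE //.
  apply: (lt_le_trans mm); rewrite ler_nat.
  by rewrite (leq_trans (leq_maxr N m)) // (leq_trans hk).
by move=> ?; rewrite [e]splitr ltrD.
Qed.

End ComplexPlane.

(** * Closed bounded sets: Lebesgue numbers, extrema, finite nets *)

Section Compactness.
Variable R : realType.
Local Notation C := (R[i]).
Implicit Types (z w : C) (U V K : set C).

(** Compactness arguments below run through cluster points of sequences, for which this form is the
    convenient one; [clbd_compact] links it to [compact], the notion in the definition of
    normality. *)
Definition clbd K := closed K /\ bounded K.

Lemma closedCP K : closed K <-> forall z, (forall r : R, 0 < r -> exists2 w, K w & cball z r w) -> K z.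
Proof.
split=> [cK z hz|h z /closureCP hz]; last exact: h.
by apply: cK; apply/closureCP.
Qed.

Lemma small_inv (e : R) : 0 < e -> exists m : nat, forall k, (m <= k)%N -> k.+1%:R^-1 < e.
Proof.
move=> e0; exists (Num.truncn e^-1) => k hk.
rewrite invf_plt ?posrE //.
by apply: (lt_le_trans (truncnS_gt _)); rewrite ler_nat.
Qed.

Lemma clbd_cluster K (u : nat -> C) : clbd K -> (forall n, K (u n)) ->
  exists2 l, K l & forall e : R, 0 < e -> forall N, exists2 n, (N <= n)%N & cball l e (u n).
Proof.
move=> [/closedCP cK [M hM]] hu.
have [l hl] := cluster_seq (fun n => hM _ (hu n)).
by exists l => //; apply: cK => r r0; have [n _ h] := hl r r0 0; exists (u n).
Qed.

(** Lebesgue's number lemma for any property inherited by subsets: centres of bad discs of radius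
    1/(n+1) would cluster at a point that has a good disc. The abstract [Q] serves open covers,
    uniform continuity and the idempotence of hulls alike. *)
Lemma clbd_radius K (Q : set C -> Prop) : clbd K ->
  (forall A B : set C, A `<=` B -> Q B -> Q A) ->
  (forall z, K z -> exists2 r : R, 0 < r & Q (cball z r)) ->
  exists2 r : R, 0 < r & forall z, K z -> Q (cball z r).
Proof.
move=> cK mQ hQ; apply: contrapT => hn.
have h1 (n : nat) : exists z, K z /\ ~ Q (cball z n.+1%:R^-1).
  apply: contrapT => h2; apply: hn; exists n.+1%:R^-1; first by rewrite invr_gt0.
  by move=> z Kz; apply: contrapT => h3; apply: h2; exists z.
have [u hu] := choice h1.
have [l Kl hl] := clbd_cluster cK (fun n => (hu n).1).
have [r r0 hr] := hQ l Kl.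
have r20 : 0 < r / 2 by rewrite divr_gt0.
have [m hm] := small_inv r20.
have [n mn hn1] := hl _ r20 m.
apply: (hu n).2; apply: mQ hr => w; rewrite /cball /mkset => hw.
move: hw (hm n mn); set q := _^-1 => hw h5; have := cabs_tri (u n) w l; rewrite /cball /mkset in hn1; lra.
Qed.

Lemma clbd_lebesgue K U : clbd K -> open U -> K `<=` U ->
  exists2 r : R, 0 < r & forall z, K z -> cball z r `<=` U.
Proof.
move=> cK /openCP oU KU; apply: (clbd_radius (Q := fun A => A `<=` U)) => //.
  by move=> A B AB BU; apply: subset_trans BU.
by move=> z /KU /oU.
Qed.

Lemma clbd_unif K (g : C -> C) : clbd K -> (forall z, K z -> ccont g z) ->
  forall e : R, 0 < e -> exists2 d, 0 < d & forall z w, K z -> cball z d w -> cabs (g w - g z) < e.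
Proof.
move=> cK hg e e0.
have [r r0 hr] : exists2 r : R, 0 < r & forall z, K z ->
    (fun A => forall x y, A x -> A y -> cabs (g x - g y) < e) (cball z r).
  apply: (clbd_radius (Q := fun A : set C => forall x y, A x -> A y -> cabs (g x - g y) < e)) => //.
    by move=> A B AB h x y /AB Ax /AB Ay; apply: h.
  move=> z Kz.
  have e20 : 0 < e / 2 by rewrite divr_gt0.
  have [d d0 hd] := hg z Kz _ e20; exists d => // x y /hd hx /hd hy.
  have := cabs_tri (g z) (g x) (g y); rewrite (cabsB (g z) (g y)); lra.
exists r => // z w Kz hw; apply: (hr z) => //; exact: cballxx.
Qed.

(** The hypothesis is upper semicontinuity relative to K, a form that applies both to |g| and to
    -|g|. *)
Lemma clbd_max K (phi : C -> R) : clbd K -> K !=set0 ->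
  (forall z, K z -> forall e, 0 < e -> exists2 d : R, 0 < d & forall w, K w -> cball z d w -> phi w < phi z + e) ->
  exists2 z, K z & forall w, K w -> phi w <= phi z.
Proof.
move=> cK [z0 Kz0] hphi.
have [bd|nb] := pselect (exists M, forall z, K z -> phi z <= M); last first.
  have h1 (n : nat) : exists z, K z /\ n%:R < phi z.
    apply: contrapT => h2; apply: nb; exists n%:R => z Kz; rewrite leNgt; apply/negP => h3.
    by apply: h2; exists z.
  have [u hu] := choice h1.
  have [l Kl hl] := clbd_cluster cK (fun n => (hu n).1).
  have [d d0 hd] := hphi l Kl 1 ltr01.
  have [n hn1 hn2] := hl d d0 (Num.truncn (phi l + 1)).+1.
  have h3 := hd _ (hu n).1 hn2; have h4 := (hu n).2.
  have h5 := truncnS_gt (phi l + 1).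
  have h6 : (Num.truncn (phi l + 1)).+1%:R <= n%:R :> R by rewrite ler_nat.
  lra.
set A := [set phi z | z in K].
have hA : has_sup A.
  split; first by exists (phi z0), z0.
  by case: bd => M hM; exists M => _ [z Kz <-]; apply: hM.
have h1 (n : nat) : exists z, K z /\ sup A - n.+1%:R^-1 < phi z.
  have : 0 < n.+1%:R^-1 :> R by rewrite invr_gt0.
  by move/sup_adherent => /(_ _ hA) [_ [z Kz <-] ?]; exists z.
have [u hu] := choice h1.
have [l Kl hl] := clbd_cluster cK (fun n => (hu n).1).
exists l => // w Kw; apply: (@le_trans _ _ (sup A)).
  by apply: ub_le_sup; [case: hA | exists w].
rewrite leNgt; apply/negP => h2.
have h3 : 0 < (sup A - phi l) / 2 by rewrite divr_gt0 // subr_gt0.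
have [d d0 hd] := hphi l Kl _ h3.
have [m hm] := small_inv h3.
have [n mn hn] := hl d d0 m.
move: (hu n).2 (hm n mn); set q := _^-1 => h5 h6; have := hd _ (hu n).1 hn; lra.
Qed.

Lemma clbd_max_cabs K (g : C -> C) : clbd K -> K !=set0 -> (forall z, K z -> ccont g z) ->
  exists2 z, K z & forall w, K w -> cabs (g w) <= cabs (g z).
Proof.
move=> cK K0 hg; apply: clbd_max => // z Kz e e0.
have [d d0 hd] := hg z Kz e e0; exists d => // w _ /hd.
have := cabsDB (g w) (g z); lra.
Qed.

Lemma clbd_min_cabs K (g : C -> C) : clbd K -> K !=set0 -> (forall z, K z -> ccont g z) ->
  exists2 z, K z & forall w, K w -> cabs (g z) <= cabs (g w).
Proof.
move=> cK K0 hg; have [|z Kz h] := @clbd_max K (fun z => - cabs (g z)) cK K0 _.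
  move=> z Kz e e0; have [d d0 hd] := hg z Kz e e0; exists d => // w _ /hd.
  by rewrite cabsB; have := cabsDB (g z) (g w); lra.
by exists z => // w /h; rewrite lerN2.
Qed.

(** If no finite net existed, points could be chosen greedily at mutual distance at least r, and a
    bounded sequence of such points cannot cluster. *)
Lemma clbd_net K (r : R) : bounded K -> 0 < r ->
  exists s : seq C, (forall z, z \in s -> K z) /\ forall z, K z -> exists2 c, c \in s & cball c r z.
Proof.
move=> [M hM] r0; apply: contrapT => hn.
have h1 (s : seq C) : exists z, K z /\ forall c, c \in s -> K c -> ~ cball c r z.
  apply: contrapT => h2; apply: hn; exists [seq c <- s | `[< K c >]]; split.
    by move=> z; rewrite mem_filter => /andP[/asboolP].
  move=> z Kz; apply: contrapT => h3; apply: h2; exists z; split => // c cs Kc h4; apply: h3.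
  by exists c => //; rewrite mem_filter cs andbT; apply/asboolP.
have [nx hnx] := choice h1.
pose L := fix L n := if n is k.+1 then nx (L k) :: L k else [::].
pose u n := nx (L n).
have uL m n : (m < n)%N -> u m \in L n.
  elim: n => // n ih; rewrite ltnS leq_eqVlt /= inE => /orP[/eqP ->|/ih ->]; first by rewrite eqxx.
  by rewrite orbT.
have [l hl] := cluster_seq (fun n => hM _ (hnx (L n)).1).
have r20 : 0 < r / 2 by rewrite divr_gt0.
have [m _ hm] := hl _ r20 0; have [n mn hn1] := hl _ r20 m.+1.
apply: (hnx (L n)).2 (uL _ _ mn) (hnx (L m)).1 _.
rewrite /cball /mkset; have := cabs_tri l (u n) (u m); rewrite (cabsB l (u m)) /u; lra.
Qed.

Lemma closed_closure_bd U : bounded U -> clbd (closure U).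
Proof.
move=> [M hM]; split; first exact: closed_closure.
exists M => z /closureCP hz; rewrite leNgt; apply/negP => h.
have [|w Uw] := hz (cabs z - M); first by rewrite subr_gt0.
rewrite /cball /mkset => h2; have := hM w Uw; have := cabsDB z w; rewrite cabsB; lra.
Qed.

Lemma clbd_boundary U : open U -> bounded U -> clbd (boundary U).
Proof.
move=> oU bU; have [cl [M hM]] := closed_closure_bd bU; split; last first.
  by exists M => z [/hM].
rewrite /boundary setDE; apply: closedI => //; apply: open_closedC; exact: open_interior.
Qed.

Lemma clbd_cdisc (c : C) (r : R) : clbd [set z | cabs (z - c) <= r].
Proof.
split; last first.
  by exists (r + cabs c) => z /= h; have := cabsDB z c; lra.
apply/closedCP => z hz /=; rewrite leNgt; apply/negP => h.
have [|w /= h1] := hz (cabs (z - c) - r); first by rewrite subr_gt0.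
rewrite /cball /mkset => h2; have := cabs_tri w z c; rewrite (cabsB z w); lra.
Qed.

Lemma clbd_circle (c : C) (r : R) : clbd [set z | cabs (z - c) = r].
Proof.
split; last first.
  by exists (r + cabs c) => z /= h; have := cabsDB z c; lra.
apply/closedCP => z hz /=; apply: contrapT => /eqP h.
have [|w /= h1] := hz `|cabs (z - c) - r|; first by rewrite normr_gt0 subr_eq0.
rewrite /cball /mkset -h1; have := cabs_tri w z c; have := cabs_tri z w c; rewrite (cabsB z w) => h2 h3.
by apply/negP; rewrite -leNgt ler_norml; apply/andP; split; lra.
Qed.

Lemma clbd_sub K V : closed K -> clbd V -> K `<=` V -> clbd K.
Proof. by move=> cK [_ [M hM]] h; split => //; exists M => z /h/hM. Qed.

End Compactness.

(** * Connected sets, components and boundaries *)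

Section Connectedness.
Variable R : realType.
Local Notation C := (R[i]).
Implicit Types (z w : C) (U V K : set C).

(** A relatively clopen piece is thickened to open sets of the plane: every point gets half the
    radius of a disc that separates it from the other piece, and the halving makes the two unions
    disjoint. *)
Lemma disconnectedP (E : set C) : ~ connected E -> exists O1 O2 : set C,
  [/\ open O1, open O2, O1 `&` O2 = set0, E `<=` O1 `|` O2 & E `&` O1 !=set0 /\ E `&` O2 !=set0].
Proof.
move=> h; apply: contrapT => hn; apply: h => B B0 [W oW BW] [K cK BK].
apply: contrapT => BE.
have BsE : B `<=` E by rewrite BW; apply: subIsetl.
have r1 z : B z -> exists2 r : R, 0 < r & cball z r `&` E `<=` B.
  move=> Bz; have /(openCP _).1 : open W by [].
  move=> /(_ z) []; first by move: Bz; rewrite BW => -[].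
  by move=> r r0 hr; exists r => // w [/hr ? ?]; rewrite BW.
have r2 z : (E `\` B) z -> exists2 r : R, 0 < r & cball z r `&` E `<=` ~` B.
  move=> [Ez nBz]; have /openCP : open (~` K) by exact: closed_openC.
  move=> /(_ z) []; first by move=> Kz; apply: nBz; rewrite BK.
  by move=> r r0 hr; exists r => // w [/hr nK Ew]; rewrite BK => -[_ /nK].
pose O1 := [set w | exists z r, [/\ B z, 0 < r, cball z r `&` E `<=` B & cball z (r / 2) w]].
pose O2 := [set w | exists z r, [/\ (E `\` B) z, 0 < r, cball z r `&` E `<=` ~` B & cball z (r / 2) w]].
apply: hn; exists O1, O2; split.
- apply/openCP => w [z [r [Bz r0 h1 h2]]].
  have /openCP/(_ w h2) [d d0 hd] := @open_cball R z (r / 2).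
  by exists d => // v /hd hv; exists z, r.
- apply/openCP => w [z [r [Bz r0 h1 h2]]].
  have /openCP/(_ w h2) [d d0 hd] := @open_cball R z (r / 2).
  by exists d => // v /hd hv; exists z, r.
- apply/seteqP; split => // w [[z [r [Bz r0 h1 h2]]] [z' [r' [[Ez' Bz'] r0' h1' h2']]]].
  have h3 : cabs (z - z') < r / 2 + r' / 2.
    rewrite /cball /mkset in h2 h2'; have := cabs_tri w z z'; rewrite (cabsB z w); lra.
  have [rr|rr] := leP r r'.
    apply: (h1' z) => //; split; last exact: BsE.
    rewrite /cball /mkset; lra.
  apply: Bz'; apply: h1; split => //; rewrite /cball /mkset cabsB; lra.
- move=> z Ez; have [Bz|Bz] := pselect (B z).
    by left; have [r r0 hr] := r1 z Bz; exists z, r; split => //; apply: cballxx; rewrite divr_gt0.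
  by right; have [r r0 hr] := r2 z (conj Ez Bz); exists z, r; split => //; apply: cballxx; rewrite divr_gt0.
- split.
  case: B0 => z Bz; exists z; split; first exact: BsE.
  by have [r r0 hr] := r1 z Bz; exists z, r; split => //; apply: cballxx; rewrite divr_gt0.
have [z Ez Bz] : exists2 z, E z & ~ B z.
    apply: contrapT => h3; apply: BE; apply/seteqP; split => // z Ez.
    by apply: contrapT => h4; apply: h3; exists z.
exists z; split => //.
by have [r r0 hr] := r2 z (conj Ez Bz); exists z, r; split => //; apply: cballxx; rewrite divr_gt0.
Qed.

Lemma connected_open_sub (E O1 O2 : set C) : connected E -> open O1 -> open O2 ->
  E `&` (O1 `&` O2) = set0 -> E `<=` O1 `|` O2 -> E `&` O1 !=set0 -> E `<=` O1.
Proof.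
move=> cE o1 o2 d12 cov n0.
have -> : E = E `&` O1; last exact: subIsetr.
apply/esym; apply: cE => //; first by exists O1.
exists (~` O2); first exact: open_closedC.
apply/seteqP; split => z [Ez h]; split => //.
  by move=> h2; suff : (E `&` (O1 `&` O2)) z by rewrite d12.
by case: (cov z Ez).
Qed.

Lemma connected_boundary_sub (E U : set C) : connected E -> open U ->
  E `&` boundary U = set0 -> E `&` U !=set0 -> E `<=` U.
Proof.
move=> cE oU EU n0; apply: (@connected_open_sub E U (~` closure U)) => //.
- exact/closed_openC/closed_closure.
- by apply/seteqP; split => // z [_ [Uz h]]; apply: h; apply: subset_closure.
- move=> z Ez; have [h|h] := pselect (closure U z); last by right.
  have [?|h2] := closure_open_boundary oU h; first by left.
  by have : (E `&` boundary U) z by []; rewrite EU.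
Qed.

Definition csegment (a b : C) : set C := [set a + t%:C%C * (b - a) | t in `[0, 1]%classic].

Lemma affine_continuous (a b : C) : continuous (fun t : R => a + t%:C%C * (b - a)).
Proof.
move=> t A /nbhsCP [e e0 he]; apply/nbhs_ballP.
have h0 : 0 < cabs (b - a) + 1 by rewrite ltr_wpDl // cabs_ge0.
exists (e / (cabs (b - a) + 1)) => /=; first by rewrite divr_gt0.
move=> s; rewrite /ball /= => hs; apply: he; rewrite /cball /mkset.
have -> : a + s%:C%C * (b - a) - (a + t%:C%C * (b - a)) = (s - t)%:C%C * (b - a) by rewrite rmorphB; ring.
rewrite cabsM cabsR distrC; rewrite ltr_pdivlMr // in hs.
apply: le_lt_trans hs; rewrite ler_wpM2l //; lra.
Qed.

Lemma csegment_connected (a b : C) : connected (csegment a b).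
Proof.
apply: connected_continuous_connected; first exact: segment_connected.
by apply: continuous_subspaceT; exact: affine_continuous.
Qed.

Lemma csegmentl (a b : C) : csegment a b a.
Proof. by exists 0 => /=; rewrite ?in_itv /= ?lexx ?ler01 // mul0r addr0. Qed.

Lemma csegmentr (a b : C) : csegment a b b.
Proof. by exists 1 => /=; rewrite ?in_itv /= ?lexx ?ler01 // rmorph1 mul1r addrC subrK. Qed.

Lemma csegment_cball (c : C) (r : R) (a b : C) : cball c r a -> cball c r b -> csegment a b `<=` cball c r.
Proof.
move=> ha hb _ [t /= /andP[t0 t1] <-]; rewrite /cball /mkset !bnd_simp in t0 t1 ha hb *.
have -> : a + t%:C%C * (b - a) - c = (1 - t)%:C%C * (a - c) + t%:C%C * (b - c).
  by rewrite rmorphB rmorph1; ring.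
apply: (le_lt_trans (cabsD _ _)); rewrite !cabsM !cabsR !ger0_norm ?subr_ge0 //.
have [->|t00] := eqVneq t 0; first by rewrite subr0 mul1r mul0r addr0.
have t0' : 0 < t by rewrite lt0r t00.
have h1 : t * cabs (b - c) < t * r by rewrite ltr_pM2l.
have h2 : (1 - t) * cabs (a - c) <= (1 - t) * r by rewrite ler_wpM2l ?subr_ge0 // ltW.
lra.
Qed.

Lemma cball_connected (c : C) (r : R) : connected (cball c r).
Proof.
have [[z0 hz0]|h] := pselect (exists z, cball c r z); last first.
  have -> : cball c r = set0 by apply/seteqP; split => // z hz; apply: h; exists z.
  exact: connected0.
have -> : cball c r = \bigcup_(w in cball c r) csegment z0 w.
  apply/seteqP; split => z; first by move=> hz; exists z => //; apply: csegmentr.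
  by move=> [w hw]; apply: csegment_cball.
apply: bigcup_connected; first by exists z0 => w _; apply: csegmentl.
by move=> w _; apply: csegment_connected.
Qed.

Lemma setT_connected : connected (setT : set C).
Proof.
have -> : setT = \bigcup_(w in (setT : set C)) csegment 0 w.
  by apply/seteqP; split => // z _; exists z => //; apply: csegmentr.
apply: bigcup_connected; first by exists 0 => w _; apply: csegmentl.
by move=> w _; apply: csegment_connected.
Qed.

Lemma open_component U z : open U -> open (connected_component U z).
Proof.
move=> /openCP oU; apply/openCP => w hw.
have [r r0 hr] := oU w (connected_component_sub hw).
exists r => //; rewrite (same_connected_component hw).
by apply: connected_component_max => //; [exact: cballxx | exact: cball_connected].
Qed.

Lemma boundary_component U z : open U -> boundary (connected_component U z) `<=` boundary U.
Proof.
move=> oU w /(boundary_open _ (open_component (z := z) oU)) [clw nw].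
apply/(boundary_open _ oU); split.
  by apply: closure_subset clw; exact: connected_component_sub.
move=> Uw; have /openCP /(_ w Uw) [r r0 hr] := oU.
have /closureCP /(_ r r0) [v hv hvr] := clw.
apply: nw; rewrite (same_connected_component hv).
apply: (connected_component_max (B := cball w r)) => //; [exact: cball_connected | exact: cballxx].
Qed.

Lemma boundary_nonempty U : open U -> bounded U -> U !=set0 -> boundary U !=set0.
Proof.
move=> oU [M hM] [z Uz]; apply: contrapT => h.
have hT : setT `<=` U.
  apply: connected_boundary_sub => //; first exact: setT_connected.
    by apply/seteqP; split => // w [_ hw]; apply: h; exists w.
  by exists z.
have := hM (`|M| + 1)%:C%C (hT _ I); rewrite cabsR ger0_norm; last by rewrite addr_ge0.
have := ler_norm M; lra.
Qed.

End Connectedness.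

(** * Hulls of open sets, chains in complements, connectedness of webs *)

Section Hull.
Variable R : realType.
Local Notation C := (R[i]).
Implicit Types (z w : C) (U V W K E : set C).

(* the union of an open set with the bounded components of its complement *)
Definition hull V : set C := [set z | separates V z].

Lemma boundary_cball (c : C) (r : R) z : boundary (cball c r) z -> cabs (z - c) = r.
Proof.
move=> /(boundary_open _ (@open_cball R c r)) [hz nz].
have [/closedCP h _] := clbd_cdisc c r.
have : cabs (z - c) <= r.
  apply: h => d d0; have /closureCP /(_ d d0) [w hw hd] := hz; exists w => //.
  by move: hw; rewrite /cball /mkset => /ltW.
rewrite /cball /mkset in nz; move/negP: nz; rewrite -leNgt => h1 h2; lra.
Qed.

Lemma bounded_cball (c : C) (r : R) : bounded (cball c r).
Proof. by exists (r + cabs c) => z; rewrite /cball /mkset; have := cabsDB z c; lra. Qed.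

Lemma open_hull V : open (hull V).
Proof.
apply/openCP => z [W [oW bW Wz hW]]; have /openCP /(_ z Wz) [r r0 hr] := oW.
by exists r => // w /hr Ww; exists W.
Qed.

Lemma sub_hull V : open V -> V `<=` hull V.
Proof.
move=> /openCP oV z /oV [r r0 hr]; exists (cball z (r / 2)); split.
- exact: open_cball.
- exact: bounded_cball.
- by apply: cballxx; rewrite divr_gt0.
- move=> w /boundary_cball h; apply: hr; rewrite /cball /mkset h; lra.
Qed.

Lemma hull_mono V V' : V `<=` V' -> hull V `<=` hull V'.
Proof. by move=> h z [W [oW bW Wz hW]]; exists W; split => // w /hW /h. Qed.

(** From a point outside the disc the radial ray avoids V, hence the boundary of W, so it would stay
    in the bounded set W. *)
Lemma hull_sub_cball V (M : R) : 0 < M -> V `<=` cball 0 M -> hull V `<=` cball 0 M.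
Proof.
move=> M0 VM z [W [oW bW Wz hW]]; rewrite /cball /mkset subr0 ltNge; apply/negP => h.
have [B B0 hB] := bounded_cabs_lt bW.
have z0 : 0 < cabs z by exact: lt_le_trans h.
(* The factor is chosen so that |k z| = |z| + B exceeds the bound B of W. *)
pose k : R := 1 + B / cabs z.
have k1 : 1 <= k by rewrite lerDl divr_ge0 // ltW.
have sW : csegment z (k%:C%C * z) `<=` W.
  apply: connected_boundary_sub => //; first exact: csegment_connected.
    apply/seteqP; split => // w [[t /andP[/= t0 t1] <-] /hW /VM].
    rewrite /cball /mkset subr0 !bnd_simp in t0 t1 *.
    have -> : z + t%:C%C * (k%:C%C * z - z) = (1 + t * (k - 1))%:C%C * z.
      by rewrite !(rmorphD, rmorphM, rmorphB, rmorph1) /=; ring.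
    have h1 : 0 <= t * (k - 1) by rewrite mulr_ge0 // subr_ge0.
    rewrite cabsM cabsR ger0_norm; last by rewrite addr_ge0.
    move=> h2; have : 1 * cabs z <= (1 + t * (k - 1)) * cabs z by rewrite ler_wpM2r ?cabs_ge0 // lerDl.
    lra.
  by exists z; split => //; apply: csegmentl.
have := hB _ (sW _ (csegmentr _ _)); rewrite cabsM cabsR ger0_norm; last lra.
rewrite mulrDl mul1r divfK ?gt_eqF //; lra.
Qed.

Lemma hull_bounded V : bounded V -> bounded (hull V).
Proof.
move=> /bounded_cabs_lt [M M0 hM]; have h : V `<=` cball 0 M.
  by move=> z /hM; rewrite /cball /mkset subr0.
by exists M => z /(hull_sub_cball M0 h); rewrite /cball /mkset subr0 => /ltW.
Qed.

(** The hull absorbs connected pieces of the complement of V entirely or not at all. *)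
Lemma connected_hull_sub V K : connected K -> K `&` V = set0 -> K `&` hull V !=set0 -> K `<=` hull V.
Proof.
move=> cK KV [z [Kz [W [oW bW Wz hW]]]].
have : K `<=` W.
  apply: connected_boundary_sub => //; last by exists z.
  by apply/seteqP; split => // w [Kw /hW Vw]; have : (K `&` V) w by []; rewrite KV.
by move=> h w /h Ww; exists W.
Qed.

(** A disc about a boundary point of the hull that missed V would be connected and meet the hull, so
    it would be absorbed by it. *)
Lemma boundary_hull V : open V -> boundary (hull V) `<=` boundary V.
Proof.
move=> oV b /(boundary_open _ (@open_hull V)) [/closureCP cb nb].
apply/(boundary_open _ oV); split; last by move=> /(sub_hull oV).
apply/closureCP => r r0; apply: contrapT => h.
apply: nb; apply: (@connected_hull_sub V (cball b r)).
- exact: cball_connected.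
- by apply/seteqP; split => // w [hw Vw]; apply: h; exists w.
- by have [w hw hwr] := cb r r0; exists w.
- exact: cballxx.
Qed.

(** If V lies in the first half [X1] of a separation, take W surrounding a point in [X2]. A boundary
    point of W intersected with [X2] cannot lie in [X1], so it is in [X2]; then it must be on the
    boundary of W, hence in V and in [X1] after all. *)
Lemma hull_connected V : open V -> connected V -> connected (hull V).
Proof.
move=> oV cV; apply: contrapT => /disconnectedP [X1 [X2 [u1 u2 d12 cov [n1 n2]]]].
wlog V1 : X1 X2 u1 u2 d12 cov n1 n2 / V `<=` X1.
  have [[z Vz]|V0] := pselect (exists z, V z); last first.
    by move=> /(_ X1 X2); apply => // z Vz; exfalso; apply: V0; exists z.
  have hd A B : A `&` B = set0 -> V `&` (A `&` B) = set0 by move=> ->; rewrite setI0.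
  have covV : V `<=` X1 `|` X2 by move=> w /(sub_hull oV) /cov.
  case: (covV z Vz) => hz.
    move=> /(_ X1 X2); apply => //.
    by apply: (@connected_open_sub _ V X1 X2) => //; [exact: hd | exists z].
  move=> /(_ X2 X1); apply => //; [by rewrite setIC | by rewrite setUC | ].
  by apply: (@connected_open_sub _ V X2 X1) => //; [apply: hd; rewrite setIC | rewrite setUC | exists z].
have disj w : X1 w -> X2 w -> False by move=> h1 h2; have : (X1 `&` X2) w by []; rewrite d12.
case: n2 => z [[W [oW bW Wz hW]] X2z].
have [] := @boundary_nonempty R (W `&` X2).
- exact: openI.
- by case: bW => M hM; exists M => w [/hM].
- by exists z.
move=> p /(boundary_open _ (openI oW u2)) [/closureCP cp np].
have clW : closure W p by apply/closureCP => r /cp [w [Ww _] ?]; exists w.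
have hp : hull V p.
  have [Wp|/hW /(sub_hull oV) //] := closure_open_boundary oW clW.
  by exists W.
have O1p : X1 p -> False.
  move=> h1; have /openCP /(_ p h1) [r r0 hr] := u1.
  by have [w [_ h2] /hr /disj] := cp r r0; apply.
have [//|O2p] := cov p hp.
have [Wp|/hW /V1 //] := closure_open_boundary oW clW.
by apply: np.
Qed.

Lemma closureU_or (A B : set C) z : closure (A `|` B) z -> closure A z \/ closure B z.
Proof. by rewrite closureU. Qed.

Lemma boundaryU_sub (A B : set C) : open A -> open B ->
  boundary (A `|` B) `<=` (boundary A `&` ~` B) `|` (boundary B `&` ~` A).
Proof.
move=> oA oB z /(boundary_open _ (openU oA oB)) [/closureU_or h nh].
have nA : ~ A z by move=> ?; apply: nh; left.
have nB : ~ B z by move=> ?; apply: nh; right.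
by case: h => h; [left | right]; split => //; apply/boundary_open.
Qed.

(** The boundary of W is compact and covered by bounded open sets with boundary in V; finitely many
    suffice, and their union with W is bounded and has its boundary in V. *)
Lemma hull_hull V : hull (hull V) `<=` hull V.
Proof.
move=> z [W [oW bW Wz hW]].
have cK := clbd_boundary oW bW.
have [r r0 hr] : exists2 r : R, 0 < r & forall b, boundary W b ->
    exists B, [/\ open B, bounded B, boundary B `<=` V & cball b r `<=` B].
  apply: (clbd_radius (Q := fun A => exists B, [/\ open B, bounded B, boundary B `<=` V & A `<=` B])) => //.
    by move=> A A' AA' [B [? ? ? h]]; exists B; split => // w /AA' /h.
  move=> b /hW [B [oB bB Bb hB]]; have /openCP /(_ b Bb) [r r0 hr] := oB.
  by exists r => //; exists B.
have [s [sK hs]] := clbd_net cK.2 r0.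
have [B [oB bB hB sB]] : exists B, [/\ open B, bounded B, boundary B `<=` V & forall c, c \in s -> cball c r `<=` B].
  elim: s sK {hs} => [_|c s ih sK].
    exists set0; split => //; first by exists 0.
    by move=> w /(boundary_open _ (@open0 C)) [] /closureCP /(_ 1 ltr01) [].
  have [B [oB bB hB sB]] := ih (fun w h => sK w (mem_behead (s := c :: s) h)).
  have [D [oD bD hD sD]] := hr c (sK c (mem_head _ _)).
  exists (B `|` D); split.
  - exact: openU.
  - case: bB bD => [M hM] [M' hM']; exists (Num.max M M') => w [/hM h|/hM' h]; rewrite le_max h ?orbT //.
  - by move=> w /(boundaryU_sub oB oD) [[/hB]|[/hD]].
  - move=> c'; rewrite inE => /orP[/eqP ->|/sB h] w; last by move=> /h; left.
    by move=> /sD; right.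
exists (W `|` B); split.
- exact: openU.
- case: bB bW => [M hM] [M' hM']; exists (Num.max M M') => w [/hM' h|/hM h]; rewrite le_max h ?orbT //.
- by left.
- move=> w /(boundaryU_sub oW oB) [[/hs [c cs hc] nB]|[/hB]] //.
  by exfalso; apply: nB; apply: (sB c).
Qed.

Definition open_map (f : C -> C) := forall U, open U -> open (f @` U).

(** A limit of images f(u n) is the image of a cluster point of the u n; openness of f forbids that
    cluster point from being interior when the limit is not in f(U). *)
Lemma boundary_image (f : C -> C) U : (forall z, ccont f z) -> open_map f -> open U -> bounded U ->
  bounded (f @` U) /\ boundary (f @` U) `<=` f @` boundary U.
Proof.
move=> cf of_ oU bU.
have cK := closed_closure_bd bU.
split.
  have [[z Uz]|U0] := pselect (exists z, U z); last first.
    by exists 0 => w [z Uz]; exfalso; apply: U0; exists z.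
  have [||m _ hm] := @clbd_max_cabs R _ f cK; first by exists z; apply: subset_closure.
    by move=> *; exact: cf.
  by exists (cabs (f m)) => w [v Uv <-]; apply: hm; apply: subset_closure.
move=> p /(boundary_open _ (of_ U oU)) [/closureCP hp np].
have h1 (n : nat) : exists z, U z /\ cball p n.+1%:R^-1 (f z).
  have [|w [z Uz <-] h] := hp n.+1%:R^-1; first by rewrite invr_gt0.
  by exists z.
have [u hu] := choice h1.
have [l Kl hl] := clbd_cluster cK (fun n => subset_closure (hu n).1).
have fl : f l = p.
  apply/eqP; rewrite -subr_eq0; apply/eqP; apply: cabs_eq0; apply: contrapT => /eqP h.
  have e0 : 0 < cabs (f l - p) / 2 by rewrite divr_gt0 // lt0r h cabs_ge0.
  have [d d0 hd] := cf l _ e0; have [m hm] := small_inv e0.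
  have [n mn hn] := hl d d0 m.
  have h2 := hd _ hn; have h3 := (hu n).2; move: h3 (hm n mn); rewrite /cball /mkset.
  set q := _^-1 => h3 h4.
  have := cabs_tri (f (u n)) (f l) p; rewrite (cabsB (f l) (f (u n))); lra.
exists l => //; have [Ul|//] := closure_open_boundary oU Kl.
by exfalso; apply: np; exists l.
Qed.

Lemma hull_image (f : C -> C) V : (forall z, ccont f z) -> open_map f ->
  f @` hull V `<=` hull (f @` V).
Proof.
move=> cf of_ _ [z [W [oW bW Wz hW]] <-].
have [b1 b2] := boundary_image cf of_ oW bW.
exists (f @` W); split => //; first exact: of_.
by move=> w /b2 [v /hW Vv <-]; exists v.
Qed.

(** Chains with steps shorter than e stand in for paths, since the closed complement of a hull may
    contain no path to infinity. *)
Inductive chain K (e : R) z : C -> Prop :=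
| chain_refl : K z -> chain K e z z
| chain_step w v : chain K e z w -> K v -> cabs (v - w) < e -> chain K e z v.

Lemma chainK K e z w : chain K e z w -> K w.
Proof. by case. Qed.

(** If all chains off V from z stayed bounded, the e/2-neighbourhood of the points reached would be
    a bounded open set around z whose boundary lies in V, which puts z in the hull. *)
Lemma hull_chain V z (e M : R) : 0 < e -> ~ V z -> ~ hull V z -> exists2 w, chain (~` V) e z w & M < cabs w.
Proof.
move=> e0 nV nh; apply: contrapT => hn; apply: nh.
exists [set w | exists2 c, chain (~` V) e z c & cball c (e / 2) w]; split.
- apply/openCP => w [c hc hw]; have /openCP /(_ w hw) [r r0 hr] := @open_cball R c (e / 2).
  by exists r => // v /hr hv; exists c.
- exists (M + e / 2) => w [c hc]; rewrite /cball /mkset => hw.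
  have : cabs c <= M by rewrite leNgt; apply/negP => h; apply: hn; exists c.
  have := cabsDB w c; lra.
- by exists z; [exact: chain_refl | apply: cballxx; rewrite divr_gt0].
- move=> w [/closureCP hw nint]; apply: contrapT => nVw.
  have [|v [c hc hv] hwv] := hw (e / 2); first by rewrite divr_gt0.
  have hcw : cabs (w - c) < e.
    by move: hv hwv; rewrite /cball /mkset => h1 h2; have := cabs_tri v w c; rewrite (cabsB w v); lra.
  apply: nint; apply/nbhsCP; exists (e / 2); first by rewrite divr_gt0.
  by move=> v' hv'; exists w => //; apply: chain_step hc _ hcw.
Qed.

Lemma hull_circle V w (s : R) : 0 < s -> ~ hull V w -> exists2 p, cabs (p - w) = s & ~ V p.
Proof.
move=> s0 nh; apply: contrapT => hn; apply: nh; exists (cball w s); split.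
- exact: open_cball.
- exact: bounded_cball.
- exact: cballxx.
- by move=> p /boundary_cball h; apply: contrapT => h2; apply: hn; exists p.
Qed.

(** Each connected boundary lies on one side of a separation of E. If a point of E on the other side
    lay inside that [G n], the part of [G n] on its side would be an open set meeting E whose
    boundary misses E. *)
Lemma web_connected E (G : nat -> set C) :
  (forall n, open (G n)) -> (forall n, bounded (G n)) -> (forall n, G n !=set0) ->
  (forall n, connected (boundary (G n))) -> (forall n, boundary (G n) `<=` E) ->
  (forall n, G n `<=` G n.+1) -> \bigcup_n G n = setT ->
  (forall W, open W -> bounded W -> W `&` E !=set0 -> boundary W `&` E !=set0) ->
  connected E.
Proof.
move=> oG bG nG cG GE Gm GT star; apply: contrapT => /disconnectedP [X1 [X2 [u1 u2 d12 cov [n1 n2]]]].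
have Gmono z m n : (m <= n)%N -> G m z -> G n z.
  elim: n => [|n ih]; first by rewrite leqn0 => /eqP ->.
  by rewrite leq_eqVlt => /orP[/eqP -> //|]; rewrite ltnS => /ih h /h /Gm.
have core A B z n : open A -> open B -> A `&` B = set0 -> E `<=` A `|` B ->
    E z -> B z -> G n z -> boundary (G n) `<=` A -> False.
  move=> oA oB dAB cAB Ez Bz Gz hA.
  have disj w : A w -> B w -> False by move=> h1 h2; have : (A `&` B) w by []; rewrite dAB.
  have [] := star (G n `&` B).
  - exact: openI.
  - by case: (bG n) => M hM; exists M => w [/hM].
  - by exists z.
  move=> p [/(boundary_open _ (openI (oG n) oB)) [/closureCP cp np] Ep].
  have [Ap|Bp] := cAB p Ep.
    have /openCP /(_ p Ap) [r r0 hr] := oA.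
    by have [w [_ h2] /hr /disj] := cp r r0; apply.
  have clG : closure (G n) p by apply/closureCP => r /cp [w [Ww _] ?]; exists w.
  have [Gp|/hA /disj /(_ Bp)//] := closure_open_boundary (oG n) clG.
  by apply: np.
have dich n : boundary (G n) `<=` X1 \/ boundary (G n) `<=` X2.
  have [b hb] := boundary_nonempty (oG n) (bG n) (nG n).
  have c' : boundary (G n) `<=` X1 `|` X2 by move=> w /GE /cov.
  case: (c' b hb) => h; [left|right].
    apply: (@connected_open_sub _ _ X1 X2) => //; first by rewrite d12 setI0.
    by exists b.
  apply: (@connected_open_sub _ _ X2 X1) => //; first by rewrite (setIC X2) d12 setI0.
    by rewrite setUC.
  by exists b.
have inG z : exists n, G n z by have : setT z by []; rewrite -GT => -[n _]; exists n.
case: n1 n2 => z1 [Ez1 h1] [z2 [Ez2 h2]].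
have [k1 hk1] := inG z1; have [k2 hk2] := inG z2.
case: (dich (maxn k1 k2)) => hd.
  by apply: (core X1 X2 z2 (maxn k1 k2)) => //; apply: Gmono hk2; apply: leq_maxr.
apply: (core X2 X1 z1 (maxn k1 k2)) => //; [by rewrite setIC | by rewrite setUC |].
by apply: Gmono hk1; apply: leq_maxl.
Qed.

End Hull.

(** * Complex derivatives in difference form *)

Section ComplexDerivative.
Variable R : realType.
Local Notation C := (R[i]).
Implicit Types (z w l : C) (g h : C -> C).

(** The derivative is stated without a quotient, so w = z is no exception and the chain rule needs
    no case distinction. *)
Definition cder g z l := forall e : R, 0 < e -> exists2 d : R, 0 < d &
  forall w, cball z d w -> cabs (g w - g z - l * (w - z)) <= e * cabs (w - z).

Definition cdif g z := exists l, cder g z l.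

Lemma cder_cont g z l : cder g z l -> ccont g z.
Proof.
move=> h e e0; have [d d0 hd] := h 1 ltr01.
have K0 : 0 < 1 + cabs l by rewrite ltr_pwDl // cabs_ge0.
exists (Num.min d (e / (1 + cabs l))); first by rewrite lt_min d0 divr_gt0.
move=> w; rewrite /cball /mkset lt_min => /andP[h1 h2].
have h3 := hd w h1; rewrite mul1r in h3.
rewrite ltr_pdivlMr // in h2.
have := cabsDB (g w - g z) (l * (w - z)); rewrite cabsM => h4.
have : cabs (w - z) * (1 + cabs l) = cabs (w - z) + cabs l * cabs (w - z) by ring.
lra.
Qed.

Lemma cdif_cont g z : cdif g z -> ccont g z.
Proof. by move=> [l /cder_cont]. Qed.

Lemma ccont_ext g h z (r : R) : 0 < r -> (forall w, cball z r w -> g w = h w) -> ccont g z -> ccont h z.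
Proof.
move=> r0 gh hg e e0; have [d d0 hd] := hg e e0.
exists (Num.min d r); first by rewrite lt_min d0.
move=> w; rewrite /cball /mkset lt_min => /andP[h1 h2].
by rewrite -!gh ?hd //; exact: cballxx.
Qed.

Lemma cder_ext g h z l (r : R) : 0 < r -> (forall w, cball z r w -> g w = h w) -> cder g z l -> cder h z l.
Proof.
move=> r0 gh hg e e0; have [d d0 hd] := hg e e0.
exists (Num.min d r); first by rewrite lt_min d0.
move=> w; rewrite /cball /mkset lt_min => /andP[h1 h2].
by rewrite -!gh ?hd //; exact: cballxx.
Qed.

Lemma cdif_ext g h z (r : R) : 0 < r -> (forall w, cball z r w -> g w = h w) -> cdif g z -> cdif h z.
Proof. by move=> r0 gh [l hl]; exists l; apply: (cder_ext r0 gh hl). Qed.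

Lemma cder_cst (a : C) z : cder (fun=> a) z 0.
Proof.
move=> e e0; exists 1 => // w _; rewrite mul0r subr0 subrr cabs0 mulr_ge0 ?cabs_ge0 //.
exact: ltW.
Qed.

Lemma cder_id z : cder id z 1.
Proof.
move=> e e0; exists 1 => // w _; rewrite mul1r subrr cabs0 mulr_ge0 ?cabs_ge0 //.
exact: ltW.
Qed.

Lemma cderD g h z l l' : cder g z l -> cder h z l' -> cder (fun w => g w + h w) z (l + l').
Proof.
move=> hg hh e e0; have e20 : 0 < e / 2 by rewrite divr_gt0.
have [d d0 hd] := hg _ e20; have [d' d0' hd'] := hh _ e20.
exists (Num.min d d'); first by rewrite lt_min d0.
move=> w; rewrite /cball /mkset lt_min => /andP[h1 h2].
have -> : g w + h w - (g z + h z) - (l + l') * (w - z) =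
  (g w - g z - l * (w - z)) + (h w - h z - l' * (w - z)) by ring.
apply: (le_trans (cabsD _ _)); have := hd _ h1; have := hd' _ h2.
have : e * cabs (w - z) = e / 2 * cabs (w - z) + e / 2 * cabs (w - z) by field.
lra.
Qed.

Lemma cder_comp g h z l l' : cder g z l -> cder h (g z) l' -> cder (fun w => h (g w)) z (l' * l).
Proof.
move=> hg hh e e0.
pose K := cabs l + 1; pose K' := cabs l' + 1.
have K0 : 0 < K by rewrite ltr_wpDl // cabs_ge0.
have K0' : 0 < K' by rewrite ltr_wpDl // cabs_ge0.
have e1 : 0 < e / 2 / K' by rewrite !divr_gt0.
have e2 : 0 < e / 2 / K by rewrite !divr_gt0.
have [d1 d10 hd1] := hg _ e1; have [d2 d20 hd2] := hg _ ltr01.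
have [d3 d30 hd3] := hh _ e2; have [d4 d40 hd4] := cder_cont hg d30.
exists (Num.min (Num.min d1 d2) d4); first by rewrite !lt_min d10 d20.
move=> w; rewrite /cball /mkset !lt_min => /andP[/andP[h1 h2] h4].
have -> : h (g w) - h (g z) - l' * l * (w - z) =
  (h (g w) - h (g z) - l' * (g w - g z)) + l' * (g w - g z - l * (w - z)) by ring.
apply: (le_trans (cabsD _ _)); rewrite cabsM.
have q1 := hd1 _ h1; have q2 := hd2 _ h2; have q3 := hd3 _ (hd4 _ h4).
have q4 : cabs (g w - g z) <= K * cabs (w - z).
  have := cabsDB (g w - g z) (l * (w - z)); rewrite cabsM /K mulrDl mul1r; rewrite mul1r in q2; lra.
have q5 : e / 2 / K * cabs (g w - g z) <= e / 2 * cabs (w - z).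
  rewrite -mulrA ler_pM2l ?divr_gt0 // mulrC ler_pdivrMr //; lra.
have q6 : cabs l' * cabs (g w - g z - l * (w - z)) <= e / 2 * cabs (w - z).
  have h5 : cabs l' * cabs (g w - g z - l * (w - z)) <= K' * (e / 2 / K' * cabs (w - z)).
    apply: ler_pM; rewrite ?cabs_ge0 // /K'; lra.
  apply: (le_trans h5); have -> : K' * (e / 2 / K' * cabs (w - z)) = e / 2 * cabs (w - z) by field; rewrite gt_eqF.
  exact: lexx.
have : e * cabs (w - z) = e / 2 * cabs (w - z) + e / 2 * cabs (w - z) by field.
lra.
Qed.

Lemma cder_sqr z : cder (fun w => w * w) z (2 * z).
Proof.
move=> e e0; exists e => // w; rewrite /cball /mkset => h.
have -> : w * w - z * z - 2 * z * (w - z) = (w - z) * (w - z) by ring.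
by rewrite cabsM ler_wpM2r ?cabs_ge0 // ltW.
Qed.

Lemma cder_inv z : z != 0 -> cder (fun w => w^-1) z (- (z^-1) ^+ 2).
Proof.
move=> z0 e e0; have cz := cabs_gt0 z0.
have K0 : 0 < cabs z ^+ 3 / 2 * e by rewrite !mulr_gt0 // ?invr_gt0 // exprn_gt0.
exists (Num.min (cabs z / 2) (cabs z ^+ 3 / 2 * e)); first by rewrite lt_min K0 divr_gt0.
move=> w; rewrite /cball /mkset lt_min => /andP[h1 h2].
have hw : cabs z / 2 < cabs w by have := cabsDB z w; rewrite (cabsB z w); lra.
have w0 : w != 0 by apply/eqP => w0; rewrite w0 cabs0 in hw; lra.
have -> : w^-1 - z^-1 - - z^-1 ^+ 2 * (w - z) = (w - z) * (w - z) / (w * z ^+ 2) by field; rewrite w0 z0.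
rewrite !(cabsM, cabsV, cabsX) -mulrA mulrC ler_wpM2r ?cabs_ge0 //.
rewrite ler_pdivrMr; last by rewrite mulr_gt0 ?exprn_gt0 //; apply: lt_trans hw; rewrite divr_gt0.
have h3 : e * (cabs z / 2 * cabs z ^+ 2) <= e * (cabs w * cabs z ^+ 2).
  by rewrite ler_pM2l // ler_wpM2r ?sqr_ge0 // ltW.
apply: le_trans h3; apply: le_trans (ltW h2) _.
by rewrite le_eqVlt; apply/orP; left; apply/eqP; field.
Qed.

Lemma cderZ (a : C) g z l : cder g z l -> cder (fun w => a * g w) z (a * l).
Proof.
move=> hg; apply: (cder_comp (h := fun w => a * w) hg).
move=> e e0; exists 1 => // w _.
have -> : a * w - a * g z - a * (w - g z) = 0 by ring.
by rewrite cabs0 mulr_ge0 ?cabs_ge0 // ltW.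
Qed.

Lemma cderN g z l : cder g z l -> cder (fun w => - g w) z (- l).
Proof.
move=> /(cderZ (-1)) h; rewrite mulN1r in h.
by apply: (cder_ext (r := 1)) h => // w _; rewrite mulN1r.
Qed.

Lemma cderB g h z l l' : cder g z l -> cder h z l' -> cder (fun w => g w - h w) z (l - l').
Proof. by move=> hg hh; apply: cderD => //; apply: cderN. Qed.

(* polarization: [g h = ((g + h)^2 - (g - h)^2) / 4] *)
Lemma cderM g h z l l' : cder g z l -> cder h z l' -> cder (fun w => g w * h w) z (l * h z + g z * l').
Proof.
move=> hg hh.
have h1 := cder_comp (cderD hg hh) (cder_sqr _).
have h2 := cder_comp (cderB hg hh) (cder_sqr _).
have h3 := cderZ (4^-1) (cderB h1 h2).
have -> : l * h z + g z * l' =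
  4^-1 * (2 * (g z + h z) * (l + l') - 2 * (g z - h z) * (l - l')) by field.
by apply: (cder_ext (r := 1)) h3 => // w _; field.
Qed.

Lemma cderV g z l : g z != 0 -> cder g z l -> cder (fun w => (g w)^-1) z (- (g z)^-1 ^+ 2 * l).
Proof. by move=> g0 hg; apply: cder_comp hg (cder_inv g0). Qed.

Lemma cdif_cst (a : C) z : cdif (fun=> a) z. Proof. exists 0; exact: cder_cst. Qed.
Lemma cdif_id z : cdif id z. Proof. exists 1; exact: cder_id. Qed.
Lemma cdifD g h z : cdif g z -> cdif h z -> cdif (fun w => g w + h w) z.
Proof. by move=> [l hl] [l' hl']; exists (l + l'); apply: cderD. Qed.
Lemma cdifB g h z : cdif g z -> cdif h z -> cdif (fun w => g w - h w) z.
Proof. by move=> [l hl] [l' hl']; exists (l - l'); apply: cderB. Qed.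
Lemma cdifM g h z : cdif g z -> cdif h z -> cdif (fun w => g w * h w) z.
Proof. by move=> [l hl] [l' hl']; eexists; apply: cderM hl hl'. Qed.
Lemma cdifV g z : g z != 0 -> cdif g z -> cdif (fun w => (g w)^-1) z.
Proof. by move=> g0 [l hl]; eexists; apply: cderV hl. Qed.
Lemma cdif_div g h z : h z != 0 -> cdif g z -> cdif h z -> cdif (fun w => g w / h w) z.
Proof. by move=> h0 hg hh; apply: cdifM hg (cdifV h0 hh). Qed.
Lemma cdif_comp g h z : cdif g z -> cdif h (g z) -> cdif (fun w => h (g w)) z.
Proof. by move=> [l hl] [l' hl']; eexists; apply: cder_comp hl hl'. Qed.
Lemma cdifX g n z : cdif g z -> cdif (fun w => g w ^+ n) z.
Proof.
move=> hg; elim: n => [|n ih].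
  by apply: (cdif_ext (r := 1)) (cdif_cst 1 z) => // w _; rewrite expr0.
by apply: (cdif_ext (r := 1)) (cdifM hg ih) => // w _; rewrite exprS.
Qed.

Lemma cder_uniq g z l l' : cder g z l -> cder g z l' -> l = l'.
Proof.
move=> h1 h2; apply/eqP; rewrite -subr_eq0; apply/eqP; apply: cabs_eq0; apply: contrapT => /eqP h0.
have e0 : 0 < cabs (l - l') / 3 by rewrite divr_gt0 // lt0r h0 cabs_ge0.
have [d d0 hd] := h1 _ e0; have [d' d0' hd'] := h2 _ e0.
pose t := Num.min d d' / 2.
have t0 : 0 < t by rewrite divr_gt0 // lt_min d0.
have m0 : 0 < Num.min d d' by rewrite lt_min d0.
have td : t < Num.min d d' by rewrite /t; lra.
move: td; rewrite lt_min => /andP[t1 t2].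
pose w := z + t%:C%C.
have wz : w - z = t%:C%C by rewrite /w addrC addKr.
have aw : cabs (w - z) = t by rewrite wz cabsR gtr0_norm.
have q1 := hd w; have q2 := hd' w; rewrite /cball /mkset aw in q1 q2.
have {}q1 := q1 t1; have {}q2 := q2 t2.
have : cabs ((l - l') * (w - z)) <= 2 * (cabs (l - l') / 3 * t).
  have -> : (l - l') * (w - z) = (g w - g z - l' * (w - z)) - (g w - g z - l * (w - z)) by ring.
  apply: (le_trans (cabsD _ _)); rewrite cabsN; lra.
rewrite cabsM aw => h3.
have : 0 < cabs (l - l') / 3 * t by rewrite mulr_gt0.
have : cabs (l - l') * t = 3 * (cabs (l - l') / 3 * t) by field.
lra.
Qed.

Lemma ccontD g h z : ccont g z -> ccont h z -> ccont (fun w => g w + h w) z.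
Proof.
move=> hg hh e e0; have e20 : 0 < e / 2 by rewrite divr_gt0.
have [d d0 hd] := hg _ e20; have [d' d0' hd'] := hh _ e20.
exists (Num.min d d'); first by rewrite lt_min d0.
move=> w; rewrite /cball /mkset lt_min => /andP[/hd h1 /hd' h2].
have -> : g w + h w - (g z + h z) = (g w - g z) + (h w - h z) by ring.
apply: (le_lt_trans (cabsD _ _)); lra.
Qed.

Lemma ccont_comp g h z : ccont g z -> ccont h (g z) -> ccont (fun w => h (g w)) z.
Proof.
move=> hg hh e e0; have [d d0 hd] := hh _ e0; have [d' d0' hd'] := hg _ d0.
by exists d' => // w /hd' /hd.
Qed.

Lemma ccontM g h z : ccont g z -> ccont h z -> ccont (fun w => g w * h w) z.
Proof.
move=> hg hh e e0.
pose K := cabs (g z) + cabs (h z) + 1.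
have gz := cabs_ge0 (g z); have hz := cabs_ge0 (h z).
have K0 : 0 < K by rewrite /K; lra.
have e1 : 0 < Num.min 1 (e / K / 2) by rewrite lt_min ltr01 !divr_gt0.
have [d d0 hd] := hg _ e1; have [d' d0' hd'] := hh _ e1.
exists (Num.min d d'); first by rewrite lt_min d0.
move=> w; rewrite /cball /mkset lt_min => /andP[/hd + /hd'].
rewrite !lt_min => /andP[q1 q2] /andP[q3 q4].
have -> : g w * h w - g z * h z = (g w - g z) * h z + (g w - g z) * (h w - h z) + g z * (h w - h z) by ring.
apply: (le_lt_trans (cabsD _ _)); apply: (le_lt_trans (y := e / K / 2 * cabs (h z) + e / K / 2 * 1 + cabs (g z) * (e / K / 2))).
  apply: lerD; last by rewrite cabsM ler_wpM2l // ltW.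
  apply: (le_trans (cabsD _ _)); rewrite !cabsM; apply: lerD; first by rewrite ler_wpM2r // ltW.
  by apply: ler_pM; rewrite ?cabs_ge0 // ltW.
have -> : e / K / 2 * cabs (h z) + e / K / 2 * 1 + cabs (g z) * (e / K / 2) = (e / 2) * (K / K) by rewrite /K; ring.
rewrite divff ?gt_eqF // mulr1; lra.
Qed.

Lemma derivable_cdif g z : derivable g z 1 -> cdif g z.
Proof.
move=> /cvg_ex [l hl]; exists l => e e0.
have /hl : nbhs l (cball l e) by apply/nbhsCP; exists e.
move=> /nbhsCP [d d0 hd]; exists d => // w hw.
have [->|wz] := eqVneq w z.
  by rewrite !subrr mulr0 subr0 cabs0 mulr0.
have wz0 : w - z != 0 by rewrite subr_eq0.
have /= := hd (w - z); rewrite /cball /mkset subr0 => /(_ hw wz0).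
rewrite /= /shift /= /GRing.scale /= mulr1 subrK => h.
have -> : g w - g z - l * (w - z) = ((w - z)^-1 * (g w - g z) - l) * (w - z).
  by rewrite mulrBl mulrAC mulVf // mul1r.
by rewrite cabsM ler_wpM2r ?cabs_ge0 // ltW.
Qed.

End ComplexDerivative.

(** * Primitives and integrals of complex functions of a real variable *)

Section PathIntegral.
Variable R : realType.
Local Notation C := (R[i]).
Local Notation mu := (@lebesgue_measure R).

Definition rder (phi : R -> C) (x : R) (l : C) := forall e : R, 0 < e -> exists2 d : R, 0 < d &
  forall y, `|y - x| < d -> cabs (phi y - phi x - l * (y - x)%:C%C) <= e * `|y - x|.

Definition rcont (phi : R -> C) := forall x (e : R), 0 < e -> exists2 d : R, 0 < d &
  forall y, `|y - x| < d -> cabs (phi y - phi x) < e.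

Lemma is_derive_eps (u : R -> R) (x l : R) :
  (forall e : R, 0 < e -> exists2 d : R, 0 < d &
    forall y, `|y - x| < d -> `|u y - u x - l * (y - x)| <= e * `|y - x|) ->
  is_derive x 1 u l.
Proof.
move=> h.
have H : (fun k : R => k^-1 *: ((u \o shift x) (k *: 1) - u x)) @ 0^' --> l.
  apply/cvgrPdist_lt => e e0; have e20 : 0 < e / 2 by rewrite divr_gt0.
  have [d d0 hd] := h _ e20.
  apply/nbhs_ballP; exists d => //= k; rewrite /ball /= sub0r normrN => kd k0.
  have := hd (k + x); rewrite addrK => /(_ kd) h1.
  rewrite /= /shift /= /GRing.scale /= mulr1.
  have -> : l - k^-1 * (u (k + x) - u x) = - (k^-1 * (u (k + x) - u x - l * k)) by field.
  rewrite normrN normrM normfV.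
  apply: (@le_lt_trans _ _ (`|k|^-1 * (e / 2 * `|k|))).
    by rewrite ler_wpM2l ?invr_ge0.
  have -> : `|k|^-1 * (e / 2 * `|k|) = e / 2 by field; rewrite normr_eq0.
  lra.
apply: DeriveDef; first by apply/cvg_ex; exists l.
exact: cvg_lim H.
Qed.

Lemma derivable_eps (u : R -> R) (x l : R) : is_derive x 1 u l ->
  (forall e : R, 0 < e -> exists2 d : R, 0 < d &
    forall y, `|y - x| < d -> `|u y - u x - l * (y - x)| <= e * `|y - x|).
Proof.
move=> [h1 h2] e e0.
have H : (fun k : R => k^-1 *: ((u \o shift x) (k *: 1) - u x)) @ 0^' --> l.
  by rewrite -h2; exact: h1.
have /cvgrPdist_lt /(_ e e0) /nbhs_ballP [d d0 hd] := H.
exists d => // y yd; have [->|yx] := eqVneq y x; first by rewrite !subrr mulr0 subr0 normr0 mulr0.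
have yx0 : y - x != 0 by rewrite subr_eq0.
have := hd (y - x); rewrite /ball /= sub0r normrN => /(_ yd yx0).
rewrite /= /shift /= /GRing.scale /= mulr1 subrK => h3.
have -> : u y - u x - l * (y - x) = - ((l - (y - x)^-1 * (u y - u x)) * (y - x)) by field.
by rewrite normrN normrM ler_wpM2r // ltW.
Qed.

Lemma mvt_segment (u v : R -> R) (a b : R) : a <= b ->
  (forall x, a <= x <= b -> is_derive x 1 u (v x)) ->
  exists2 c, a <= c <= b & u b - u a = v c * (b - a).
Proof.
move=> ab h; have [||c] := @MVT_segment R u v a b ab.
- by move=> x; rewrite in_itv /= => /andP[/ltW h1 /ltW h2]; apply: h; rewrite h1.
- apply: derivable_within_continuous => x; rewrite in_itv /= => /h hx; exact: ex_derive.
- by rewrite in_itv /= => hc e; exists c.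
Qed.

(** An integral from c is differentiable only to the right of c, so no single base point serves the
    whole line. The base point moves with x, and [agree] shows that after normalisation at 0 the
    choice does not matter. *)
Lemma real_primitive (phi : R -> R) : continuous phi -> exists Phi : R -> R, forall x : R, is_derive x 1 Phi (phi x).
Proof.
move=> cphi.
pose F (c x : R) := \int[mu]_(t in `[c, x]) phi t.
have dF (c x : R) : c < x -> is_derive x 1 (F c) (phi x).
  move=> cx; have [] := @continuous_FTC1_closed R phi c x (x + 1).
  - by rewrite ltrDl.
  - apply: continuous_compact_integrable; first exact: segment_compact.
    exact: continuous_subspaceT.
  - exact: cx.
  - exact: cphi.
  by move=> d1 d2; apply: DeriveDef; [exact: d1 | rewrite -derive1E; exact: d2].
have agree (c c' x : R) : c < 0 -> c' < 0 -> c < x -> c' < x -> F c x - F c 0 = F c' x - F c' 0.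
  move=> c0 c0' cx cx'.
  have D y : c < y -> c' < y -> is_derive y 1 (fun t => F c t - F c' t) 0.
    move=> h1 h2; have q1 := dF c y h1; have q2 := dF c' y h2.
    by apply: is_derive_eq; rewrite subrr.
  have [x0|x0] := leP 0 x.
    have [|k _] := @mvt_segment (fun t => F c t - F c' t) (fun=> 0) 0 x x0.
      by move=> y /andP[y0 _]; apply: D; [exact: lt_le_trans c0 y0 | exact: lt_le_trans c0' y0].
    rewrite mul0r; lra.
  have [|k _] := @mvt_segment (fun t => F c t - F c' t) (fun=> 0) x 0 (ltW x0).
    by move=> y /andP[y0 _]; apply: D; [exact: lt_le_trans cx y0 | exact: lt_le_trans cx' y0].
  rewrite mul0r; lra.
(* A base point below both 0 and x; in the local argument [N x - 1] leaves a margin for the points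
   near x. *)
pose N (x : R) : R := - (Num.truncn `|x|).+1%:R.
have N0 x : N x < 0 by rewrite oppr_lt0 ltr0n.
have Nx x : N x < x.
  rewrite /N ltrNl; apply: le_lt_trans (truncnS_gt _).
  by rewrite -normrN ler_norm.
exists (fun x => F (N x) x - F (N x) 0) => x.
pose c := N x - 1.
have c0 : c < 0 by rewrite /c; have := N0 x; lra.
have cx : c + 1 / 2 < x by rewrite /c; have := Nx x; lra.
apply: is_derive_eps => e e0.
have cx' : c < x by lra.
have [d d0 hd] := derivable_eps (dF c x cx') e0.
exists (Num.min d (1 / 2)); first by rewrite lt_min d0 /=; lra.
move=> y; rewrite lt_min => /andP[h1 h2].
have cy : c < y by move: h2; rewrite ltr_norml => /andP[]; lra.
rewrite (agree _ c y) // (agree _ c x) //.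
have := hd y h1.
by have -> : F c y - F c 0 - (F c x - F c 0) - phi x * (y - x) = F c y - F c x - phi x * (y - x) by ring.
Qed.

Lemma ReMr (z : C) (t : R) : complex.Re (z * t%:C%C) = complex.Re z * t.
Proof. by case: z => a b /=; rewrite mulr0 subr0. Qed.
Lemma ImMr (z : C) (t : R) : complex.Im (z * t%:C%C) = complex.Im z * t.
Proof. by case: z => a b /=; rewrite mulr0 add0r. Qed.

Lemma rder_Re phi x l : rder phi x l -> is_derive x 1 (fun t => complex.Re (phi t)) (complex.Re l).
Proof.
move=> h; apply: is_derive_eps => e /h [d d0 hd]; exists d => // y /hd; apply: le_trans.
by rewrite -ReMr -!ReB; exact: Re_le_cabs.
Qed.
Lemma rder_Im phi x l : rder phi x l -> is_derive x 1 (fun t => complex.Im (phi t)) (complex.Im l).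
Proof.
move=> h; apply: is_derive_eps => e /h [d d0 hd]; exists d => // y /hd; apply: le_trans.
by rewrite -ImMr -!ImB; exact: Im_le_cabs.
Qed.

(** The mean value theorem is applied to real and imaginary part separately, which costs the factor
    2. *)
Lemma rder_bound (Phi phi : R -> C) (a b M : R) : a <= b ->
  (forall x, a <= x <= b -> rder Phi x (phi x)) -> (forall x, a <= x <= b -> cabs (phi x) <= M) ->
  cabs (Phi b - Phi a) <= 2 * M * (b - a).
Proof.
move=> ab h hM.
have [c hc e1] := mvt_segment ab (fun x hx => rder_Re (h x hx)).
have [c' hc' e2] := mvt_segment ab (fun x hx => rder_Im (h x hx)).
apply: (le_trans (cabs_le_ReIm _)); rewrite ReB ImB e1 e2 !normrM !(@ger0_norm _ (b - a)) ?subr_ge0 //.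
rewrite -mulrDl ler_wpM2r ?subr_ge0 //.
have := hM _ hc; have := hM _ hc'; have := Re_le_cabs (phi c); have := Im_le_cabs (phi c'); lra.
Qed.

Lemma rder_Im_pos (Phi phi : R -> C) (a b : R) : a < b ->
  (forall x, a <= x <= b -> rder Phi x (phi x)) -> (forall x, a <= x <= b -> 0 < complex.Im (phi x)) ->
  0 < complex.Im (Phi b - Phi a).
Proof.
move=> ab h hM.
have [c' hc' e2] := mvt_segment (ltW ab) (fun x hx => rder_Im (h x hx)).
by rewrite ImB e2 mulr_gt0 ?subr_gt0 // hM.
Qed.

Lemma rcont_ReP phi : rcont phi -> continuous (fun t => complex.Re (phi t)).
Proof.
move=> h x; apply/cvgrPdist_lt => e /(h x) [d d0 hd]; apply/nbhs_ballP; exists d => // y.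
rewrite /ball /= distrC => /hd; apply: le_lt_trans; rewrite distrC -ReB; exact: Re_le_cabs.
Qed.
Lemma rcont_ImP phi : rcont phi -> continuous (fun t => complex.Im (phi t)).
Proof.
move=> h x; apply/cvgrPdist_lt => e /(h x) [d d0 hd]; apply/nbhs_ballP; exists d => // y.
rewrite /ball /= distrC => /hd; apply: le_lt_trans; rewrite distrC -ImB; exact: Im_le_cabs.
Qed.

Lemma rcont_primitive phi : rcont phi -> exists Phi, forall x, rder Phi x (phi x).
Proof.
move=> h; have [U hU] := real_primitive (rcont_ReP h); have [V hV] := real_primitive (rcont_ImP h).
exists (fun x => (U x +i* V x)%C) => x e e0.
have e20 : 0 < e / 2 by rewrite divr_gt0.
have [d d0 hd] := derivable_eps (hU x) e20; have [d' d0' hd'] := derivable_eps (hV x) e20.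
exists (Num.min d d'); first by rewrite lt_min d0.
move=> y; rewrite lt_min => /andP[/hd h1 /hd' h2].
apply: (le_trans (cabs_le_ReIm _)); rewrite !(ReB, ImB) ReMr ImMr.
have -> : e * `|y - x| = e / 2 * `|y - x| + e / 2 * `|y - x| by field.
exact: lerD.
Qed.

Lemma rderD Phi Psi x l l' : rder Phi x l -> rder Psi x l' -> rder (fun t => Phi t + Psi t) x (l + l').
Proof.
move=> hg hh e e0; have e20 : 0 < e / 2 by rewrite divr_gt0.
have [d d0 hd] := hg _ e20; have [d' d0' hd'] := hh _ e20.
exists (Num.min d d'); first by rewrite lt_min d0.
move=> y; rewrite lt_min => /andP[/hd h1 /hd' h2].
have -> : Phi y + Psi y - (Phi x + Psi x) - (l + l') * (y - x)%:C%C =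
  (Phi y - Phi x - l * (y - x)%:C%C) + (Psi y - Psi x - l' * (y - x)%:C%C) by ring.
apply: (le_trans (cabsD _ _)).
have : e * `|y - x| = e / 2 * `|y - x| + e / 2 * `|y - x| by field.
lra.
Qed.

Lemma rderZ (a : C) Phi x l : rder Phi x l -> rder (fun t => a * Phi t) x (a * l).
Proof.
move=> h e e0; have K0 : 0 < cabs a + 1 by rewrite ltr_wpDl // cabs_ge0.
have e1 : 0 < e / (cabs a + 1) by rewrite divr_gt0.
have [d d0 hd] := h _ e1; exists d => // y /hd h1.
have -> : a * Phi y - a * Phi x - a * l * (y - x)%:C%C = a * (Phi y - Phi x - l * (y - x)%:C%C) by ring.
rewrite cabsM; apply: (@le_trans _ _ ((cabs a + 1) * (e / (cabs a + 1) * `|y - x|))).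
  by apply: ler_pM; rewrite ?cabs_ge0 // lerDl.
have -> : (cabs a + 1) * (e / (cabs a + 1) * `|y - x|) = e * `|y - x| by field; rewrite gt_eqF.
exact: lexx.
Qed.

Lemma rder_affine (g : C -> C) (a k : C) x l : cder g (a + k * x%:C%C) l ->
  rder (fun t => g (a + k * t%:C%C)) x (k * l).
Proof.
move=> h e e0; have K0 : 0 < cabs k + 1 by rewrite ltr_wpDl // cabs_ge0.
have e1 : 0 < e / (cabs k + 1) by rewrite divr_gt0.
have [d d0 hd] := h _ e1.
exists (d / (cabs k + 1)); first by rewrite divr_gt0.
move=> y; rewrite ltr_pdivlMr // => hy.
have E : a + k * y%:C%C - (a + k * x%:C%C) = k * (y - x)%:C%C by rewrite rmorphB; ring.
have := hd (a + k * y%:C%C); rewrite /cball /mkset E cabsM cabsR.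
have h1 : cabs k * `|y - x| <= `|y - x| * (cabs k + 1).
  by rewrite mulrC ler_wpM2l // lerDl.
move=> /(_ (le_lt_trans h1 hy)) h2.
have -> : k * l * (y - x)%:C%C = l * (k * (y - x)%:C%C) by ring.
apply: (le_trans h2); rewrite -mulrA ler_pM2l //; rewrite mulrC ler_pdivrMr //.
Qed.

(* a primitive of phi (junk if phi is not continuous) *)
Definition pprim (phi : R -> C) : R -> C :=
  if pselect (exists Phi, forall x, rder Phi x (phi x)) is left h then projT1 (cid h) else fun=> 0.

Lemma pprimP phi x : rcont phi -> rder (pprim phi) x (phi x).
Proof.
move=> /rcont_primitive h; rewrite /pprim; case: pselect => // h'.
exact: (projT2 (cid h')).
Qed.

(** Defining the integral as an increment of a primitive makes additivity and orientation pure
    algebra. *)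
Definition pint (phi : R -> C) (a b : R) := pprim phi b - pprim phi a.

Lemma pintE phi Phi a b : rcont phi -> a <= b -> (forall x, a <= x <= b -> rder Phi x (phi x)) ->
  pint phi a b = Phi b - Phi a.
Proof.
move=> cphi ab h; apply/eqP; rewrite -subr_eq0; apply/eqP; apply: cabs_eq0; apply/eqP.
rewrite eq_le cabs_ge0 andbT.
have := @rder_bound (fun t => pprim phi t + (-1) * Phi t) (fun=> 0) a b 0 ab.
have -> : pprim phi b + -1 * Phi b - (pprim phi a + -1 * Phi a) = pint phi a b - (Phi b - Phi a).
  by rewrite /pint; ring.
rewrite mulr0 mul0r; apply; last by move=> *; rewrite cabs0.
move=> x hx; have := rderD (pprimP x cphi) (rderZ (-1) (h x hx)).
by rewrite mulN1r subrr.
Qed.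

Lemma pint_bound phi (a b M : R) : rcont phi -> a <= b -> (forall x, a <= x <= b -> cabs (phi x) <= M) ->
  cabs (pint phi a b) <= 2 * M * (b - a).
Proof. by move=> cphi ab; apply: rder_bound => // x _; apply: pprimP. Qed.

Lemma pint_lin phi psi (k : C) (a b : R) : rcont phi -> rcont psi -> rcont (fun t => phi t + k * psi t) ->
  a <= b -> pint (fun t => phi t + k * psi t) a b = pint phi a b + k * pint psi a b.
Proof.
move=> h1 h2 h3 ab.
rewrite (@pintE _ (fun t => pprim phi t + k * pprim psi t)) //; first by rewrite /pint; ring.
by move=> x _; apply: rderD; [exact: pprimP | apply: rderZ; exact: pprimP].
Qed.

Lemma pint_ext phi psi (a b : R) : rcont phi -> rcont psi -> a <= b ->
  (forall x, a <= x <= b -> phi x = psi x) -> pint phi a b = pint psi a b.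
Proof.
move=> h1 h2 ab e; rewrite (@pintE phi (pprim psi)) // => x hx.
by rewrite e //; apply: pprimP.
Qed.

End PathIntegral.

(** * Goursat's theorem on rectangles, with finitely many exceptional points *)

Section Goursat.
Variable R : realType.
Local Notation C := (R[i]).
Implicit Types (z w : C) (g h : C -> C) (a b c d : R).

Definition rect a b c d : set C := [set z | a <= complex.Re z <= b /\ c <= complex.Im z <= d].

Definition hint g (y a b : R) := pint (fun x => g (x +i* y)%C) a b.
Definition vint g (x c d : R) := pint (fun y => g (x +i* y)%C) c d.
(** The counterclockwise integral along the boundary of the rectangle: bottom, right, top, left. It
    is an algebraic expression in the end points, so it also makes sense for reversed intervals. *)
Definition RI g a b c d := hint g c a b + 'i%C * vint g b c d - hint g d a b - 'i%C * vint g a c d.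

Lemma hlineE (x y : R) : (x +i* y)%C = (0 +i* y)%C + 1 * x%:C%C.
Proof. by rewrite mul1r; apply/eqP; rewrite eq_complex /= add0r addr0 !eqxx. Qed.
Lemma vlineE (x y : R) : (x +i* y)%C = x%:C%C + 'i%C * y%:C%C.
Proof. by apply/eqP; rewrite eq_complex /=; apply/andP; split; apply/eqP; ring. Qed.

Lemma rcont_h g y : (forall x : R, ccont g (x +i* y)%C) -> rcont (fun x => g (x +i* y)%C).
Proof.
move=> hg x e e0; have [d d0 hd] := hg x e e0; exists d => // x' hx; apply: hd.
rewrite /cball /mkset; have -> : (x' +i* y)%C - (x +i* y)%C = (x' - x)%:C%C :> C.
  by apply/eqP; rewrite eq_complex /=; apply/andP; split; apply/eqP; ring.
by rewrite cabsR.
Qed.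
Lemma rcont_v g x : (forall y : R, ccont g (x +i* y)%C) -> rcont (fun y => g (x +i* y)%C).
Proof.
move=> hg y e e0; have [d d0 hd] := hg y e e0; exists d => // x' hx; apply: hd.
rewrite /cball /mkset; have -> : (x +i* x')%C - (x +i* y)%C = 'i%C * (x' - y)%:C%C :> C.
  by apply/eqP; rewrite eq_complex /=; apply/andP; split; apply/eqP; ring.
by rewrite cabsM cabsi mul1r cabsR.
Qed.

Lemma RI_split_x g m a b c d : RI g a b c d = RI g a m c d + RI g m b c d.
Proof. by rewrite /RI /hint /vint /pint; ring. Qed.
Lemma RI_split_y g m a b c d : RI g a b c d = RI g a b c m + RI g a b m d.
Proof. by rewrite /RI /hint /vint /pint; ring. Qed.
Lemma RI_xx g a c d : RI g a a c d = 0.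
Proof. by rewrite /RI /hint /vint /pint; ring. Qed.
Lemma RI_yy g a b c : RI g a b c c = 0.
Proof. by rewrite /RI /hint /vint /pint; ring. Qed.
Lemma RI_swap_x g a b c d : RI g b a c d = - RI g a b c d.
Proof. by rewrite /RI /hint /vint /pint; ring. Qed.
Lemma RI_swap_y g a b c d : RI g a b d c = - RI g a b c d.
Proof. by rewrite /RI /hint /vint /pint; ring. Qed.

(* continuity is only needed on the four lines carrying the sides *)
Definition contlines g a b c d :=
  [/\ forall x : R, ccont g (x +i* c)%C, forall x : R, ccont g (x +i* d)%C,
      forall y : R, ccont g (a +i* y)%C & forall y : R, ccont g (b +i* y)%C].

Lemma contlinesT g a b c d : (forall z, ccont g z) -> contlines g a b c d.
Proof. by move=> h; split. Qed.

Lemma RI_lin g h (k : C) a b c d : contlines g a b c d -> contlines h a b c d -> a <= b -> c <= d ->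
  RI (fun z => g z + k * h z) a b c d = RI g a b c d + k * RI h a b c d.
Proof.
move=> [g1 g2 g3 g4] [h1 h2 h3 h4] ab cd.
have K z : ccont (fun=> k) z by move=> e e0; exists 1 => // w _; rewrite subrr cabs0.
have S z : ccont g z -> ccont h z -> ccont (fun z => g z + k * h z) z.
  by move=> q1 q2; apply: ccontD => //; apply: ccontM => //; apply: K.
have r1 := @rcont_h (fun z => g z + k * h z) c (fun x => S _ (g1 x) (h1 x)).
have r2 := @rcont_h (fun z => g z + k * h z) d (fun x => S _ (g2 x) (h2 x)).
have r3 := @rcont_v (fun z => g z + k * h z) a (fun x => S _ (g3 x) (h3 x)).
have r4 := @rcont_v (fun z => g z + k * h z) b (fun x => S _ (g4 x) (h4 x)).
rewrite /RI /hint /vint !pint_lin //; do ?[exact: rcont_h | exact: rcont_v].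
ring.
Qed.

Definition bdry a b c d : set C := [set z | rect a b c d z /\
  [\/ complex.Re z = a, complex.Re z = b, complex.Im z = c | complex.Im z = d]].

Lemma RI_bound g a b c d (M : R) : contlines g a b c d -> a <= b -> c <= d ->
  (forall z, bdry a b c d z -> cabs (g z) <= M) -> cabs (RI g a b c d) <= 4 * M * ((b - a) + (d - c)).
Proof.
move=> [g1 g2 g3 g4] ab cd hM.
have H y : (forall x : R, ccont g (x +i* y)%C) -> c <= y <= d -> y = c \/ y = d -> cabs (hint g y a b) <= 2 * M * (b - a).
  move=> cg hy yy; apply: pint_bound => //; first exact: rcont_h.
  by move=> x hx; apply: hM; split => //; case: yy => ->; [apply: Or43 | apply: Or44].
have V x : (forall y : R, ccont g (x +i* y)%C) -> a <= x <= b -> x = a \/ x = b -> cabs ('i%C * vint g x c d) <= 2 * M * (d - c).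
  move=> cg hx xx; rewrite cabsM cabsi mul1r; apply: pint_bound => //; first exact: rcont_v.
  by move=> y hy; apply: hM; split => //; case: xx => ->; [apply: Or41 | apply: Or42].
have h1 := H c g1; have h2 := H d g2; have h3 := V a g3; have h4 := V b g4.
rewrite !lexx ?ab ?cd in h1 h2 h3 h4.
have {}h1 := h1 isT (or_introl erefl); have {}h2 := h2 isT (or_intror erefl).
have {}h3 := h3 isT (or_introl erefl); have {}h4 := h4 isT (or_intror erefl).
rewrite /RI; set A := hint _ _ _ _ in h1 *; set B := 'i%C * _ in h4 *; set D := hint _ _ _ _ in h2 *; set E := 'i%C * _ in h3 *.
have := cabsD (A + B - D) (- E); have := cabsD (A + B) (- D); have := cabsD A B; rewrite !cabsN; lra.
Qed.

Lemma RI_prim g G a b c d : contlines g a b c d -> a <= b -> c <= d ->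
  (forall z, bdry a b c d z -> cder G z (g z)) -> RI g a b c d = 0.
Proof.
move=> [g1 g2 g3 g4] ab cd hG.
have H y : (forall x : R, ccont g (x +i* y)%C) -> c <= y <= d -> y = c \/ y = d -> hint g y a b = G (b +i* y)%C - G (a +i* y)%C.
  move=> cg hy yy; apply: (@pintE R _ (fun x => G (x +i* y)%C)) => //; first exact: rcont_h.
  move=> x hx; have hz : cder G (x +i* y)%C (g (x +i* y)%C).
    by apply: hG; split => //; case: yy => ->; [apply: Or43 | apply: Or44].
  have := @rder_affine R G (0 +i* y)%C 1 x (g (x +i* y)%C); rewrite -(hlineE x) => /(_ hz); rewrite mul1r.
  by move=> h e e0; have [dd d0 hd] := h e e0; exists dd => // t /hd; rewrite -(hlineE t) -(hlineE x).
have V x : (forall y : R, ccont g (x +i* y)%C) -> a <= x <= b -> x = a \/ x = b -> 'i%C * vint g x c d = G (x +i* d)%C - G (x +i* c)%C.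
  move=> cg hx xx.
  have -> : vint g x c d = (- 'i%C) * G (x +i* d)%C - (- 'i%C) * G (x +i* c)%C.
    apply: (@pintE R _ (fun y => (- 'i%C) * G (x +i* y)%C)) => //; first exact: rcont_v.
    move=> y hy; have hz : cder G (x +i* y)%C (g (x +i* y)%C).
      by apply: hG; split => //; case: xx => ->; [apply: Or41 | apply: Or42].
    have := @rder_affine R G x%:C%C 'i%C y (g (x +i* y)%C); rewrite -vlineE => /(_ hz) h.
    have := rderZ (- 'i%C) h; rewrite mulrA mulNr -expr2 sqr_i opprK mul1r.
    by move=> {}h e e0; have [dd d0 hd] := h e e0; exists dd => // t /hd; rewrite -!vlineE.
  have i2 : 'i%C * 'i%C = -1 :> C by rewrite -expr2 sqr_i.
  have -> (A B : C) : 'i%C * (- 'i%C * A - - 'i%C * B) = - ('i%C * 'i%C) * (A - B) by ring.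
  by rewrite i2 opprK mul1r.
rewrite /RI (H c) ?lexx ?cd //; last by left.
rewrite (H d) ?lexx ?cd //; last by right.
rewrite (V a) ?lexx ?ab //; last by left.
rewrite (V b) ?lexx ?ab //; last by right.
ring.
Qed.

Lemma bdry_rect a b c d z : bdry a b c d z -> rect a b c d z. Proof. by case. Qed.

Lemma cder_affine_prim (k l p : C) z : cder (fun w => k * w + l * (w * w / 2 - p * w)) z (k + l * (z - p)).
Proof.
have h1 := cderZ k (cder_id z); rewrite mulr1 in h1.
have h2 := cderZ (2^-1) (cder_sqr z).
have h3 := cderZ p (cder_id z); rewrite mulr1 in h3.
have h4 := cderD h1 (cderZ l (cderB h2 h3)).
have -> : k + l * (z - p) = k + l * (2^-1 * (2 * z) - p) by field.
by apply: (cder_ext (r := 1)) h4 => // w _; rewrite (mulrC (2^-1)).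
Qed.

Lemma dist_rect a b c d z w : rect a b c d z -> rect a b c d w -> cabs (w - z) <= (b - a) + (d - c).
Proof.
move=> [/andP[h1 h2] /andP[h3 h4]] [/andP[h5 h6] /andP[h7 h8]].
apply: (le_trans (cabs_le_ReIm _)); rewrite ReB ImB; apply: lerD; rewrite ler_norml; apply/andP; split; lra.
Qed.

Lemma clbd_rect a b c d : clbd (rect a b c d).
Proof.
split.
  apply/closedCP => z hz; split; apply/andP; split; rewrite leNgt; apply/negP => h.
  - have [|w [/andP[h1 _] _] hw] := hz (a - complex.Re z); first by rewrite subr_gt0.
    have := Re_le_cabs (w - z); rewrite ReB; have := ler_norm (complex.Re w - complex.Re z).
    rewrite /cball /mkset in hw; lra.
  - have [|w [/andP[_ h1] _] hw] := hz (complex.Re z - b); first by rewrite subr_gt0.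
    have := Re_le_cabs (z - w); rewrite cabsB ReB; have := ler_norm (complex.Re z - complex.Re w).
    rewrite /cball /mkset in hw; lra.
  - have [|w [_ /andP[h1 _]] hw] := hz (c - complex.Im z); first by rewrite subr_gt0.
    have := Im_le_cabs (w - z); rewrite ImB; have := ler_norm (complex.Im w - complex.Im z).
    rewrite /cball /mkset in hw; lra.
  - have [|w [_ /andP[_ h1]] hw] := hz (complex.Im z - d); first by rewrite subr_gt0.
    have := Im_le_cabs (z - w); rewrite cabsB ImB; have := ler_norm (complex.Im z - complex.Im w).
    rewrite /cball /mkset in hw; lra.
exists (`|a| + `|b| + `|c| + `|d|) => z [/andP[h1 h2] /andP[h3 h4]].
apply: (le_trans (cabs_le_ReIm _)).
have ha := ler_norm a; have hb := ler_norm b; have hc := ler_norm c; have hd := ler_norm d.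
have ha' := ler_norm (- a); have hb' := ler_norm (- b); have hc' := ler_norm (- c); have hd' := ler_norm (- d).
rewrite !normrN in ha' hb' hc' hd'.
have : `|complex.Re z| <= `|a| + `|b| by rewrite ler_norml; apply/andP; split; lra.
have : `|complex.Im z| <= `|c| + `|d| by rewrite ler_norml; apply/andP; split; lra.
lra.
Qed.

(** Bisection: one quarter always keeps a quarter of the integral, while near the common point of
    the nested rectangles g is affine up to a small error and affine functions have primitives. *)
Lemma goursat g a b c d : (forall z, ccont g z) -> a <= b -> c <= d ->
  (forall z, rect a b c d z -> cdif g z) -> RI g a b c d = 0.
Proof.
move=> cg ab cd dg; apply: cabs_eq0; apply: contrapT => /eqP n0.
set kap := cabs (RI g a b c d) in n0.
have kap0 : 0 < kap by rewrite lt0r n0 cabs_ge0.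
pose S := (b - a) + (d - c); pose w0 := b - a; pose h0 := d - c.
have w00 : 0 <= w0 by rewrite subr_ge0.
have h00 : 0 <= h0 by rewrite subr_ge0.
have S0 : 0 < S.
  rewrite lt0r addr_ge0 // andbT; apply/eqP => SE.
  have aa : a = b by rewrite /S in SE; lra.
  by move: n0; rewrite /kap aa RI_xx cabs0 eqxx.
(* Chosen so that the whole rectangle is bad at level 0: its threshold is kap / 2, below the value
   kap of the integral. *)
pose eps := kap / S ^+ 2 / 2.
have eps0 : 0 < eps by rewrite !divr_gt0 // exprn_gt0.
have p2 n : 0 < (2 : R) ^- n by rewrite invr_gt0 exprn_gt0.
pose bad (n : nat) (p : R * R) := eps * (S * 2 ^- n) ^+ 2 <
  cabs (RI g p.1 (p.1 + w0 * 2 ^- n) p.2 (p.2 + h0 * 2 ^- n)).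
have step (np : nat * (R * R)) : exists q : R * R, bad np.1 np.2 -> [/\ bad np.1.+1 q,
   np.2.1 <= q.1, q.1 + w0 * 2 ^- np.1.+1 <= np.2.1 + w0 * 2 ^- np.1,
   np.2.2 <= q.2 & q.2 + h0 * 2 ^- np.1.+1 <= np.2.2 + h0 * 2 ^- np.1].
  case: np => n [x y] /=; apply: contrapT => hn.
  have hb : bad n (x, y) by apply: contrapT => hb; apply: hn; exists (x, y).
  have half : 2 ^- n = 2 ^- n.+1 + 2 ^- n.+1 :> R by rewrite exprS invfM; field; rewrite expf_neq0.
  set r := 2 ^- n.+1 in half hn.
  have r0 : 0 < r by exact: p2.
  have wr : 0 <= w0 * r by rewrite mulr_ge0 // ltW.
  have hr : 0 <= h0 * r by rewrite mulr_ge0 // ltW.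
  have G x' y' : x <= x' -> x' + w0 * r <= x + w0 * 2 ^- n -> y <= y' -> y' + h0 * r <= y + h0 * 2 ^- n ->
      cabs (RI g x' (x' + w0 * r) y' (y' + h0 * r)) <= eps * (S * r) ^+ 2.
    move=> q1 q2 q3 q4; rewrite leNgt; apply/negP => q5; apply: hn; exists (x', y') => _; split => //.
  have e1 := G x y; have e2 := G (x + w0 * r) y; have e3 := G x (y + h0 * r); have e4 := G (x + w0 * r) (y + h0 * r).
  rewrite half in e1 e2 e3 e4.
  have near (u v : R) : 0 <= v * r -> [/\ u <= u + v * r, u + v * r <= u + v * (r + r) & u + v * r + v * r <= u + v * (r + r)].
    by move=> h; rewrite mulrDr addrA lexx !lerDl.
  have [x1 x2 x3] := near x w0 wr; have [y1 y2 y3] := near y h0 hr.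
  have {}e1 := e1 (lexx x) x2 (lexx y) y2; have {}e2 := e2 x1 x3 (lexx y) y2.
  have {}e3 := e3 (lexx x) x2 y1 y3; have {}e4 := e4 x1 x3 y1 y3.
  move: hb; rewrite /bad /= half.
  have -> : x + w0 * (r + r) = x + w0 * r + w0 * r by ring.
  have -> : y + h0 * (r + r) = y + h0 * r + h0 * r by ring.
  rewrite (RI_split_x g (x + w0 * r)) (RI_split_y g (y + h0 * r) x) (RI_split_y g (y + h0 * r) (x + w0 * r)).
  have -> : eps * (S * (r + r)) ^+ 2 = 4 * (eps * (S * r) ^+ 2) by ring.
  set A := RI _ _ _ _ _ in e1 *; set B := RI _ _ _ _ _ in e3 *.
  set D := RI _ _ _ _ _ in e2 *; set E := RI _ _ _ _ _ in e4 *.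
  have := cabsD (A + B) (D + E); have := cabsD A B; have := cabsD D E; lra.
have [nx hnx] := choice step.
pose u := fix u n : R * R := if n is k.+1 then nx (k, u k) else (a, c).
have badu n : bad n (u n).
  elim: n => [|n ih]; last by have [] := hnx (n, u n) ih.
  rewrite /bad /= expr0 invr1 !mulr1 /w0 /h0 !subrKC -/kap /eps.
  have -> : kap / S ^+ 2 / 2 * S ^+ 2 = kap / 2 by field; rewrite gt_eqF.
  lra.
have mono n m : (n <= m)%N -> [/\ (u n).1 <= (u m).1, (u m).1 + w0 * 2 ^- m <= (u n).1 + w0 * 2 ^- n,
    (u n).2 <= (u m).2 & (u m).2 + h0 * 2 ^- m <= (u n).2 + h0 * 2 ^- n].
  elim: m => [|m ih]; first by rewrite leqn0 => /eqP ->.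
  rewrite leq_eqVlt => /orP[/eqP -> //|]; rewrite ltnS => /ih [i1 i2 i3 i4].
  have [_ /= j1 j2 j3 j4] := hnx (m, u m) (badu m).
  by split; [exact: le_trans j1|exact: le_trans i2|exact: le_trans j3|exact: le_trans i4].
pose Q n := rect (u n).1 ((u n).1 + w0 * 2 ^- n) (u n).2 ((u n).2 + h0 * 2 ^- n).
pose z n : C := ((u n).1 +i* (u n).2)%C.
have zQ n m : (n <= m)%N -> Q n (z m).
  move=> /mono [i1 i2 i3 i4].
  have : 0 <= w0 * 2 ^- m by rewrite mulr_ge0 // ltW.
  have : 0 <= h0 * 2 ^- m by rewrite mulr_ge0 // ltW.
  by move=> q1 q2; split => /=; apply/andP; split => //; lra.
have [l _ hl] := clbd_cluster (clbd_rect (u 0).1 ((u 0).1 + w0 * 2 ^- 0) (u 0).2 ((u 0).2 + h0 * 2 ^- 0)) (fun n => zQ 0%N n (leq0n n)).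
have lQ n : Q n l.
  have [/closedCP cl _] := clbd_rect (u n).1 ((u n).1 + w0 * 2 ^- n) (u n).2 ((u n).2 + h0 * 2 ^- n).
  by apply: cl => r r0; have [m nm hm] := hl r r0 n; exists (z m) => //; apply: zQ.
have lR : rect a b c d l.
  by have := lQ 0%N; rewrite /Q /= expr0 invr1 !mulr1 /w0 /h0 !subrKC.
have [lam hlam] := dg l lR.
(* The quotient by 4 cancels the constant 4 of [RI_bound], so that the estimate contradicts [badu]
   exactly. *)
have e40 : 0 < eps / 4 by rewrite divr_gt0.
have [dl dl0 hdl] := hlam _ e40.
have [n hn] : exists n, S * 2 ^- n < dl.
  have [m hm] := small_inv (divr_gt0 dl0 S0).
  exists m; rewrite mulrC -ltr_pdivlMr //; apply: le_lt_trans (hm m (leqnn m)).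
  rewrite lef_pV2 ?posrE ?exprn_gt0 //.
  by rewrite -natrX ler_nat; exact: ltn_expl.
pose r w := g w - (g l + lam * (w - l)).
have caff w : ccont (fun w => g l + lam * (w - l)) w.
  by apply: cdif_cont; apply: cdifD; [exact: cdif_cst | apply: cdifM; [exact: cdif_cst | apply: cdifB; [exact: cdif_id | exact: cdif_cst]]].
have cr w : ccont (fun w => g w + (-1) * (g l + lam * (w - l))) w.
  apply: ccontD => //; apply: ccontM => //; apply: cdif_cont; exact: cdif_cst.
have sw : 0 <= w0 * 2 ^- n by rewrite mulr_ge0 // ltW.
have sh : 0 <= h0 * 2 ^- n by rewrite mulr_ge0 // ltW.
have ab' : (u n).1 <= (u n).1 + w0 * 2 ^- n by lra.
have cd' : (u n).2 <= (u n).2 + h0 * 2 ^- n by lra.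
have aff0 : RI (fun w => g l + lam * (w - l)) (u n).1 ((u n).1 + w0 * 2 ^- n) (u n).2 ((u n).2 + h0 * 2 ^- n) = 0.
  apply: (@RI_prim _ (fun w => g l * w + lam * (w * w / 2 - l * w)) _ _ _ _ (contlinesT _ _ _ _ caff) ab' cd').
  by move=> w _; exact: cder_affine_prim.
have E := @RI_lin g (fun w => g l + lam * (w - l)) (-1) _ _ _ _ (contlinesT _ _ _ _ cg) (contlinesT _ _ _ _ caff) ab' cd'.
rewrite aff0 mulr0 addr0 in E.
have := badu n; rewrite /bad -E.
have SE : w0 * 2 ^- n + h0 * 2 ^- n = S * 2 ^- n by rewrite -mulrDl.
have := @RI_bound (fun w => g w + (-1) * (g l + lam * (w - l))) _ _ _ _ (eps / 4 * (S * 2 ^- n)) (contlinesT _ _ _ _ cr) ab' cd'.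
have -> : (u n).1 + w0 * 2 ^- n - (u n).1 + ((u n).2 + h0 * 2 ^- n - (u n).2) = S * 2 ^- n by rewrite -SE; ring.
have -> : 4 * (eps / 4 * (S * 2 ^- n)) * (S * 2 ^- n) = eps * (S * 2 ^- n) ^+ 2 by field; rewrite expf_neq0.
move=> B1 B2; have : cabs (RI (fun w => g w + -1 * (g l + lam * (w - l))) (u n).1 ((u n).1 + w0 * 2 ^- n)
   (u n).2 ((u n).2 + h0 * 2 ^- n)) <= eps * (S * 2 ^- n) ^+ 2; last by rewrite leNgt B2.
apply: B1 => w /bdry_rect Qw.
have dwl : cabs (w - l) <= S * 2 ^- n.
  apply: (le_trans (dist_rect (lQ n) Qw)); rewrite -SE; lra.
have -> : g w + -1 * (g l + lam * (w - l)) = g w - g l - lam * (w - l) by ring.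
apply: (le_trans (hdl w _)); first by rewrite /cball /mkset; exact: le_lt_trans hn.
by rewrite ler_pM2l.
Qed.

(** Four rectangles without p are cut away; what remains is a rectangle of half-side at most [eta]
    around p, on which boundedness of g makes the integral small. *)
Lemma RI_except g p a b c d : (forall z, ccont g z) -> a <= b -> c <= d ->
  (forall a' b' c' d', a <= a' -> a' <= b' -> b' <= b -> c <= c' -> c' <= d' -> d' <= d ->
     ~ rect a' b' c' d' p -> RI g a' b' c' d' = 0) ->
  RI g a b c d = 0.
Proof.
move=> cg ab cd hz.
have [pr|npr] := pselect (rect a b c d p); last by apply: hz.
have pr' := pr; case: pr' => /andP[pa pb] /andP[pc pd].
have [|m _ hm] := clbd_max_cabs (clbd_rect a b c d) _ (fun z _ => cg z); first by exists p.
apply: cabs_eq0; apply: contrapT => /eqP n0.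
set kap := cabs _ in n0.
have kap0 : 0 < kap by rewrite lt0r n0 cabs_ge0.
pose M := cabs (g m) + 1.
have M0 : 0 < M by rewrite ltr_wpDl // cabs_ge0.
(* The bound on the small rectangle is 4 M times 4 eta, that is kap / 2. *)
pose eta := kap / M / 32.
have eta0 : 0 < eta by rewrite !divr_gt0.
pose x1 := Num.max a (complex.Re p - eta); pose x2 := Num.min b (complex.Re p + eta).
pose y1 := Num.max c (complex.Im p - eta); pose y2 := Num.min d (complex.Im p + eta).
have ax1 : a <= x1 by rewrite le_max lexx.
have x1p : x1 <= complex.Re p by rewrite ge_max pa /=; lra.
have px2 : complex.Re p <= x2 by rewrite le_min pb /=; lra.
have x2b : x2 <= b by rewrite ge_min lexx.
have cy1 : c <= y1 by rewrite le_max lexx.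
have y1p : y1 <= complex.Im p by rewrite ge_max pc /=; lra.
have py2 : complex.Im p <= y2 by rewrite le_min pd /=; lra.
have y2d : y2 <= d by rewrite ge_min lexx.
have x1l : complex.Re p - eta <= x1 by rewrite le_max lexx orbT.
have x2l : x2 <= complex.Re p + eta by rewrite ge_min lexx orbT.
have y1l : complex.Im p - eta <= y1 by rewrite le_max lexx orbT.
have y2l : y2 <= complex.Im p + eta by rewrite ge_min lexx orbT.
have z1 : RI g a x1 c d = 0.
  have [->|/eqP] := pselect (x1 = a); first exact: RI_xx.
  rewrite /x1 maxEle; case: ifP => [h _|_]; last by rewrite eqxx.
  by apply: hz => //; try lra; move=> [/andP[]]; lra.
have z2 : RI g x2 b c d = 0.
  have [->|/eqP] := pselect (x2 = b); first exact: RI_xx.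
  rewrite /x2 minEle; case: ifP => [_|h _]; first by rewrite eqxx.
  have h' : complex.Re p + eta <= b by rewrite ltW // ltNge h.
  by apply: hz => //; try lra; move=> [/andP[]]; lra.
have z3 : RI g x1 x2 c y1 = 0.
  have [->|/eqP] := pselect (y1 = c); first exact: RI_yy.
  rewrite /y1 maxEle; case: ifP => [h _|_]; last by rewrite eqxx.
  by apply: hz => //; try lra; move=> [_ /andP[]]; lra.
have z4 : RI g x1 x2 y2 d = 0.
  have [->|/eqP] := pselect (y2 = d); first exact: RI_yy.
  rewrite /y2 minEle; case: ifP => [_|h _]; first by rewrite eqxx.
  have h' : complex.Im p + eta <= d by rewrite ltW // ltNge h.
  by apply: hz => //; try lra; move=> [_ /andP[]]; lra.
have E : RI g a b c d = RI g x1 x2 y1 y2.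
  rewrite (RI_split_x g x1) z1 add0r (RI_split_x g x2 x1) z2 addr0.
  by rewrite (RI_split_y g y1) z3 add0r (RI_split_y g y2 _ _ y1) z4 addr0.
have := @RI_bound g x1 x2 y1 y2 M (contlinesT _ _ _ _ cg).
rewrite -E -/kap; have -> : kap = 32 * (M * eta) by rewrite /eta; field; rewrite gt_eqF.
have M1 : 0 < M * eta by rewrite mulr_gt0.
have le4 : 4 * M * (x2 - x1 + (y2 - y1)) <= 4 * M * (4 * eta).
  by rewrite ler_pM2l ?mulr_gt0 //; lra.
have e4 : 4 * M * (4 * eta) = 16 * (M * eta) by ring.
move=> B; have : 32 * (M * eta) <= 4 * M * (x2 - x1 + (y2 - y1)); last lra.
apply: B; [lra|lra|] => z [[/andP[q1 q2] /andP[q3 q4]] _].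
have : cabs (g z) <= cabs (g m); last by rewrite /M; lra.
by apply: hm; split; apply/andP; split; lra.
Qed.

Lemma goursat_except g (s : seq C) a b c d : (forall z, ccont g z) -> a <= b -> c <= d ->
  (forall z, rect a b c d z -> z \notin s -> cdif g z) -> RI g a b c d = 0.
Proof.
move=> cg; elim: s a b c d => [|p s ih] a b c d ab cd dg.
  by apply: goursat => // z hz; apply: dg.
apply: (@RI_except g p) => // a' b' c' d' aa ab' bb cc cd' dd np.
apply: ih => // z hz zs; apply: dg.
  by case: hz => /andP[h1 h2] /andP[h3 h4]; split; apply/andP; split; lra.
by rewrite inE negb_or zs andbT; apply/eqP => zp; apply: np; rewrite -zp.
Qed.

End Goursat.

(** * Cauchy's formula on squares *)

Section CauchyFormula.
Variable R : realType.
Local Notation C := (R[i]).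
Local Notation Re := complex.Re.
Local Notation Im := complex.Im.
Implicit Types (z w b c : C) (g h : C -> C) (s t : R).

Definition sq c t : set C := [set z | `|Re z - Re c| < t /\ `|Im z - Im c| < t].
Definition csq c t : set C := rect (Re c - t) (Re c + t) (Im c - t) (Im c + t).

Lemma csqP c t z : csq c t z <-> `|Re z - Re c| <= t /\ `|Im z - Im c| <= t.
Proof.
rewrite /csq /rect /mkset !ler_distl; split=> -[/andP[h1 h2] /andP[h3 h4]]; split; apply/andP; split; lra.
Qed.

Lemma sq_csq c t z : sq c t z -> csq c t z.
Proof. by move=> [h1 h2]; apply/csqP; split; apply: ltW. Qed.

Lemma csq_sq c s t z : t < s -> csq c t z -> sq c s z.
Proof. by move=> ts /csqP[h1 h2]; split; exact: le_lt_trans ts. Qed.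

Lemma sq_sub c s t z : t <= s -> sq c t z -> sq c s z.
Proof. by move=> ts [h1 h2]; split; exact: lt_le_trans ts. Qed.

Lemma sqxx c t : 0 < t -> sq c t c.
Proof. by move=> t0; split; rewrite subrr normr0. Qed.

Lemma sq_open c t z : sq c t z -> exists2 r, 0 < r & forall w, cball z r w -> sq c t w.
Proof.
move=> [h1 h2]; exists (Num.min (t - `|Re z - Re c|) (t - `|Im z - Im c|)).
  by rewrite lt_min !subr_gt0 h1.
move=> w; rewrite /cball /mkset lt_min => /andP[h3 h4].
have := Re_le_cabs (w - z); have := Im_le_cabs (w - z); rewrite ReB ImB => q1 q2.
have := ler_distD (Re z) (Re w) (Re c); have := ler_distD (Im z) (Im w) (Im c).
by split; lra.
Qed.

Lemma cball_sub_sq c r z : cball c r z -> sq c r z.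
Proof.
rewrite /cball /mkset => h; have := Re_le_cabs (z - c); have := Im_le_cabs (z - c).
by rewrite ReB ImB => h1 h2; split; [exact: le_lt_trans h|exact: le_lt_trans h].
Qed.

Lemma sq_sub_cball c t z : sq c t z -> cball c (2 * t) z.
Proof.
move=> [h1 h2]; rewrite /cball /mkset; apply: (le_lt_trans (cabs_le_ReIm _)); rewrite ReB ImB; lra.
Qed.

Definition clampR (m t x : R) : R := Num.max (m - t) (Num.min (m + t) x).

Lemma clampR_in (m t x : R) : 0 <= t -> `|clampR m t x - m| <= t.
Proof.
move=> t0; rewrite ler_distl /clampR le_max lexx /= ge_max; apply/andP; split; first lra.
by rewrite ge_min lexx.
Qed.

Lemma clampR_id (m t x : R) : `|x - m| <= t -> clampR m t x = x.
Proof.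
rewrite ler_distl => /andP[h1 h2]; rewrite /clampR minEle maxEle.
have -> : (m + t <= x) = (m + t == x) by rewrite eq_le h2 andbT.
by case: eqP => [<-|_]; case: ifP => //; lra.
Qed.

Lemma clampR_lip (m t x y : R) : `|clampR m t x - clampR m t y| <= `|x - y|.
Proof.
wlog xy : x y / x <= y.
  by move=> H; case: (leP x y) => [/H //|/ltW /H]; rewrite distrC (distrC y).
rewrite (distrC x) (ger0_norm (x := y - x)) ?subr_ge0 // ler_distl /clampR !minEle !maxEle.
apply/andP; split; case: (leP (m + t) x) => q1; case: (leP (m + t) y) => q2;
  case: (leP (m - t) (m + t)) => q3; case: (leP (m - t) x) => q4; case: (leP (m - t) y) => q5; lra.
Qed.

(** The retraction of the plane onto a closed square. It extends functions to the plane here and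
    exhausts the plane by squares in [lift]. *)
Definition cl c t z : C := (clampR (Re c) t (Re z) +i* clampR (Im c) t (Im z))%C.

Lemma cl_cont c t z : ccont (cl c t) z.
Proof.
move=> e e0; exists (e / 2); first by rewrite divr_gt0.
move=> w; rewrite /cball /mkset => hw; apply: (le_lt_trans (cabs_le_ReIm _)); rewrite ReB ImB /=.
have := clampR_lip (Re c) t (Re w) (Re z); have := clampR_lip (Im c) t (Im w) (Im z).
have := Re_le_cabs (w - z); have := Im_le_cabs (w - z); rewrite ReB ImB; lra.
Qed.

Lemma cl_in c t z : 0 <= t -> csq c t (cl c t z).
Proof. by move=> t0; apply/csqP; split; exact: clampR_in. Qed.

Lemma cl_id c t z : csq c t z -> cl c t z = z.
Proof. by move=> /csqP [h1 h2]; rewrite /cl !clampR_id //; case: z {h1 h2}. Qed.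

(** Allowing a finite exceptional list on which g is merely continuous lets one Cauchy theory also
    prove that such points are removable. *)
Definition holex (lst : seq C) g c s :=
  (forall z, sq c s z -> ccont g z) /\ (forall z, sq c s z -> z \notin lst -> cdif g z).

(* a globally continuous function agreeing with [g] on the square of half-side [(s + t) / 2] *)
Definition ext g c s t z := g (cl c ((s + t) / 2) z).

Lemma ext_cont lst g c s t z : 0 < t -> t < s -> holex lst g c s -> ccont (ext g c s t) z.
Proof.
move=> t0 ts [h _]; apply: ccont_comp; first exact: cl_cont.
by apply: h; apply: (@csq_sq _ _ ((s + t) / 2)); [lra | apply: cl_in; lra].
Qed.

Lemma ext_id g c s t z : t < s -> csq c t z -> exists2 r, 0 < r & forall w, cball z r w -> ext g c s t w = g w.
Proof.
move=> ts hz; have /sq_open [r r0 hr] : sq c ((s + t) / 2) z by apply: csq_sq hz; lra.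
by exists r => // w /hr /sq_csq hw; rewrite /ext cl_id.
Qed.

Lemma ext_val g c s t z : t < s -> csq c t z -> ext g c s t z = g z.
Proof. by move=> ts hz; have [r r0 hr] := ext_id g ts hz; apply: hr; exact: cballxx. Qed.

Lemma ext_cdif lst g c s t z : t < s -> holex lst g c s -> csq c t z -> z \notin lst -> cdif (ext g c s t) z.
Proof.
move=> ts [_ h] hz zl; have [r r0 hr] := ext_id g ts hz.
apply: (cdif_ext r0 (g := g)); first by move=> w /hr.
by apply: h => //; apply: csq_sq hz.
Qed.

Lemma pint_approx (phi : R -> C) (k : C) (a d M : R) : rcont phi ->
  (forall x, `|x - a| <= `|d - a| -> cabs (phi x - k) <= M) ->
  cabs (pint phi a d - k * (d - a)%:C%C) <= 2 * M * `|d - a|.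
Proof.
move=> cphi hM.
pose Psi x := pprim phi x + k * (- (x%:C%C)).
have D x : rder Psi x (phi x - k).
  rewrite -mulrN1; apply: rderD; first exact: pprimP.
  apply: rderZ => e e0; exists 1 => // y _; rewrite rmorphB.
  have -> : - y%:C%C - - x%:C%C - -1 * (y%:C%C - x%:C%C) = 0 :> C by ring.
  by rewrite cabs0 mulr_ge0 // ltW.
have E : pint phi a d - k * (d - a)%:C%C = Psi d - Psi a by rewrite /pint /Psi rmorphB; ring.
rewrite E; have [ad|da] := leP a d.
  rewrite ger0_norm ?subr_ge0 //; apply: (rder_bound ad (fun x _ => D x)) => x /andP[x1 x2]; apply: hM.
  by rewrite !ger0_norm ?subr_ge0 //; lra.
rewrite cabsB (ltr0_norm (x := d - a)) ?subr_lt0 // opprB.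
apply: (rder_bound (ltW da) (fun x _ => D x)) => x /andP[x1 x2]; apply: hM.
by rewrite (ltr0_norm (x := d - a)) ?subr_lt0 // ler0_norm ?subr_le0 //; lra.
Qed.

(** The primitive integrates horizontally and then vertically from the centre. Goursat's theorem
    turns its increment into an integral over two short sides starting at z, on which G is close to
    G z. *)
Lemma primitive_sq lst g c s t : 0 < t -> t < s -> holex lst g c s ->
  exists F, forall z, sq c t z -> cder F z (g z).
Proof.
move=> t0 ts hg; pose G := ext g c s t.
have cG z : ccont G z by exact: (ext_cont z t0 ts hg).
(* The two corners may be in any relative position, so the orientation of each side is corrected by
   a sign. *)
have RI0 z w : csq c t z -> csq c t w -> RI G (Re z) (Re w) (Im z) (Im w) = 0.
  move=> /csqP [z1 z2] /csqP [w1 w2].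
  rewrite !ler_distl in z1 z2 w1 w2.
  have K (a b d e : R) : a <= b -> d <= e -> Re c - t <= a -> b <= Re c + t -> Im c - t <= d -> e <= Im c + t -> RI G a b d e = 0.
    move=> ab de q1 q2 q3 q4; apply: (@goursat_except R G lst) => // v [/andP[v1 v2] /andP[v3 v4]] vl.
    by apply: (ext_cdif ts hg) => //; split; apply/andP; split; lra.
  move: z1 z2 w1 w2 => /andP[? ?] /andP[? ?] /andP[? ?] /andP[? ?].
  case: (leP (Re z) (Re w)) => h1; case: (leP (Im z) (Im w)) => h2.
  - by apply: K.
  - by rewrite RI_swap_y K ?oppr0 // ltW.
  - by rewrite RI_swap_x K ?oppr0 // ltW.
  - by rewrite RI_swap_y RI_swap_x K ?oppr0 // ltW.
exists (fun z => hint G (Im c) (Re c) (Re z) + 'i%C * vint G (Re z) (Im c) (Im z)) => z hz e e0.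
have [r r0 hr] := sq_open hz.
have e80 : 0 < e / 8 by rewrite divr_gt0.
have [d d0 hd] := cG z _ e80.
exists (Num.min r (d / 2)); first by rewrite lt_min r0 divr_gt0.
move=> w; rewrite /cball /mkset lt_min => /andP[h1 h2].
have hw := hr w h1.
have E : hint G (Im c) (Re c) (Re w) + 'i%C * vint G (Re w) (Im c) (Im w) -
   (hint G (Im c) (Re c) (Re z) + 'i%C * vint G (Re z) (Im c) (Im z)) =
   hint G (Im z) (Re z) (Re w) + 'i%C * vint G (Re w) (Im z) (Im w).
  have q : csq c t (Re z +i* Im c)%C.
    case: hz => z1 z2; apply/csqP => /=; rewrite subrr normr0; split; exact: ltW.
  have q2 : csq c t (Re w +i* Im z)%C by apply/csqP; case: hz hw => ? ? [? ?]; split; exact: ltW.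
  have := RI0 _ _ q q2; rewrite /RI /= /hint /vint /pint => /eqP; rewrite subr_eq0 => /eqP <-.
  ring.
rewrite E.
have wz : w - z = (Re w - Re z)%:C%C + 'i%C * (Im w - Im z)%:C%C by rewrite {1}[w - z]Creim ReB ImB.
have gz : g z = G z by rewrite /G ext_val //; exact: sq_csq.
rewrite gz wz.
have -> : hint G (Im z) (Re z) (Re w) + 'i%C * vint G (Re w) (Im z) (Im w) -
  G z * ((Re w - Re z)%:C%C + 'i%C * (Im w - Im z)%:C%C) =
  (hint G (Im z) (Re z) (Re w) - G z * (Re w - Re z)%:C%C) + 'i%C * (vint G (Re w) (Im z) (Im w) - G z * (Im w - Im z)%:C%C) by ring.
rewrite -wz; apply: (le_trans (cabsD _ _)); rewrite cabsM cabsi mul1r.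
have rw := Re_le_cabs (w - z); have iw := Im_le_cabs (w - z); rewrite ReB in rw; rewrite ImB in iw.
have B x y : `|x - Re z| <= `|Re w - Re z| -> `|y - Im z| <= `|Im w - Im z| -> cabs (G (x +i* y)%C - G z) <= e / 8.
  move=> q1 q2; apply: ltW; apply: hd; rewrite /cball /mkset.
  apply: (le_lt_trans (cabs_le_ReIm _)); rewrite ReB ImB /=; lra.
have p1 := @pint_approx (fun x => G (x +i* Im z)%C) (G z) (Re z) (Re w) (e / 8) (rcont_h (fun x => cG _)).
have p2 := @pint_approx (fun y => G (Re w +i* y)%C) (G z) (Im z) (Im w) (e / 8) (rcont_v (fun x => cG _)).
have {}p1 := p1 (fun x hx => B x (Im z) hx (le_trans (eq_ind_r (fun u => u <= 0) (lexx 0) (etrans (congr1 Num.norm (subrr _)) (normr0 _))) (normr_ge0 _))).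
have {}p2 := p2 (fun y hy => B (Re w) y (lexx _) hy).
rewrite /hint /vint.
have f1 : 2 * (e / 8) * `|Re w - Re z| <= e / 4 * cabs (w - z).
  have -> : 2 * (e / 8) = e / 4 by field.
  by rewrite ler_wpM2l // ltW // divr_gt0.
have f2 : 2 * (e / 8) * `|Im w - Im z| <= e / 4 * cabs (w - z).
  have -> : 2 * (e / 8) = e / 4 by field.
  by rewrite ler_wpM2l // ltW // divr_gt0.
have f3 : e / 4 * cabs (w - z) + e / 4 * cabs (w - z) <= e * cabs (w - z).
  by rewrite -mulrDl ler_wpM2r ?cabs_ge0 //; lra.
lra.
Qed.

Definition RIs h c t := RI h (Re c - t) (Re c + t) (Im c - t) (Im c + t).
Definition bsq c t : set C := bdry (Re c - t) (Re c + t) (Im c - t) (Im c + t).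

Lemma bsqP c t z : bsq c t z <-> csq c t z /\ (`|Re z - Re c| = t \/ `|Im z - Im c| = t).
Proof.
split; move=> [hz h]; split => //.
- have t0 : 0 <= t by case: hz => /andP[]; lra.
  case: h => ->; [left|left|right|right]; rewrite addrAC subrr add0r ?normrN ger0_norm //.
- case: h => h; have := h; move: h; [case: (leP 0 (Re z - Re c)) => q | case: (leP 0 (Im z - Im c)) => q].
  + by rewrite ger0_norm // => <- _; apply: Or42; ring.
  + by rewrite ltr0_norm // => <- _; apply: Or41; ring.
  + by rewrite ger0_norm // => <- _; apply: Or44; ring.
  + by rewrite ltr0_norm // => <- _; apply: Or43; ring.
Qed.

(** The full lines carrying the sides, and not just the sides, because [pint] works with functions
    continuous on the whole real line. *)
Definition onlines c t z := [\/ Re z = Re c - t, Re z = Re c + t, Im z = Im c - t | Im z = Im c + t].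

Lemma contlinesS h c t : (forall z, onlines c t z -> ccont h z) ->
  contlines h (Re c - t) (Re c + t) (Im c - t) (Im c + t).
Proof. by move=> H; split => x; apply: H; [apply: Or43|apply: Or44|apply: Or41|apply: Or42]. Qed.

Lemma onlines_dist c t b : sq c t b -> exists2 r, 0 < r & forall z, onlines c t z -> r <= cabs (z - b).
Proof.
move=> [h1 h2]; exists (Num.min (t - `|Re b - Re c|) (t - `|Im b - Im c|)).
  by rewrite lt_min !subr_gt0 h1.
move=> z hz; rewrite ge_min; apply/orP.
have q1 := Re_le_cabs (z - b); have q2 := Im_le_cabs (z - b); rewrite ReB in q1; rewrite ImB in q2.
have q3 := ler_norm (Re b - Re c); have q4 := ler_norm (Re c - Re b); rewrite distrC in q4.
have q5 := ler_norm (Im b - Im c); have q6 := ler_norm (Im c - Im b); rewrite distrC in q6.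
have q7 := ler_norm (Re z - Re b); have q8 := ler_norm (Re b - Re z); rewrite distrC in q8.
have q9 := ler_norm (Im z - Im b); have q10 := ler_norm (Im b - Im z); rewrite distrC in q10.
by case: hz => e; [left|left|right|right]; lra.
Qed.

Lemma bsq_onlines c t z : bsq c t z -> onlines c t z. Proof. by case. Qed.

Lemma ccont_cst (a : C) z : ccont (fun=> a) z.
Proof. by apply: cdif_cont; exact: cdif_cst. Qed.

Lemma ccont_subV b z : z != b -> ccont (fun z => (z - b)^-1) z.
Proof.
move=> h; apply: cdif_cont; apply: cdifV; first by rewrite subr_eq0.
by apply: cdifB; [exact: cdif_id | exact: cdif_cst].
Qed.

Lemma onlines_neq c t b z : sq c t b -> onlines c t z -> z != b.
Proof.
move=> /onlines_dist [r r0 hr] /hr h; apply/eqP => e; rewrite e subrr cabs0 in h; lra.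
Qed.

Lemma contlines_cauchy G c t b : (forall z, ccont G z) -> sq c t b ->
  contlines (fun z => G z * (z - b)^-1) (Re c - t) (Re c + t) (Im c - t) (Im c + t).
Proof.
by move=> cG hb; apply: contlinesS => z /(onlines_neq hb) h; apply: ccontM => //; exact: ccont_subV.
Qed.

Lemma RIs_bound G c t (M : R) : 0 < t -> contlines G (Re c - t) (Re c + t) (Im c - t) (Im c + t) ->
  (forall z, bsq c t z -> cabs (G z) <= M) -> cabs (RIs G c t) <= 16 * t * M.
Proof.
move=> t0 cG hM; have := @RI_bound R G (Re c - t) (Re c + t) (Im c - t) (Im c + t) M cG.
have -> : 4 * M * (Re c + t - (Re c - t) + (Im c + t - (Im c - t))) = 16 * t * M by ring.
by apply => //; lra.
Qed.

(** The difference quotient of G at b, completed by the derivative, is continuous and holomorphic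
    off the finite list with b added, so its integral vanishes. *)
Lemma cauchy_formula lst g c s t b : 0 < t -> t < s -> holex lst g c s -> sq c t b -> b \notin lst ->
  RIs (fun z => ext g c s t z * (z - b)^-1) c t = g b * RIs (fun z => (z - b)^-1) c t.
Proof.
move=> t0 ts hg hb bl; pose G := ext g c s t.
have cG z : ccont G z by exact: (ext_cont z t0 ts hg).
have Gb : G b = g b by rewrite /G ext_val //; exact: sq_csq.
have [l hl] : cdif G b by apply: (ext_cdif ts hg) => //; exact: sq_csq.
pose q z := if z == b then l else (G z - g b) * (z - b)^-1.
have qloc z : z != b -> exists2 r, 0 < r & forall w, cball z r w -> (G w - g b) * (w - b)^-1 = q w.
  move=> zb; exists (cabs (z - b)); first by apply: cabs_gt0; rewrite subr_eq0.
  by move=> w; rewrite /cball /mkset /q; case: eqP => // ->; rewrite cabsB ltxx.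
have cq z : ccont q z.
  have [->|zb] := eqVneq z b; last first.
    have [r r0 hr] := qloc z zb; apply: (ccont_ext r0 hr).
    apply: ccontM; last exact: ccont_subV.
    by apply: ccontD => //; exact: ccont_cst.
  move=> e e0; have e20 : 0 < e / 2 by rewrite divr_gt0.
  have [d d0 hd] := hl _ e20; exists d => // w /hd hw.
  rewrite /q eqxx; case: eqP => [_|/eqP wb]; first by rewrite subrr cabs0.
  have wb0 : w - b != 0 by rewrite subr_eq0.
  have -> : (G w - g b) / (w - b) - l = (G w - G b - l * (w - b)) / (w - b) by rewrite Gb; field.
  rewrite cabsf ltr_pdivrMr ?cabs_gt0 //; apply: (le_lt_trans hw).
  by rewrite ltr_pM2r ?cabs_gt0 //; lra.
have RIq : RIs q c t = 0.
  apply: (@goursat_except R q (b :: lst)) => //; [lra | lra|].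
  move=> z hz; rewrite inE negb_or => /andP[zb zl].
  have [r r0 hr] := qloc z zb; apply: (cdif_ext r0 hr).
  apply: cdifM; last by apply: cdifV; [rewrite subr_eq0 | apply: cdifB; [exact: cdif_id|exact: cdif_cst]].
  by apply: cdifB; [apply: (ext_cdif ts hg) | exact: cdif_cst].
have ab : Re c - t <= Re c + t by lra.
have cd : Im c - t <= Im c + t by lra.
have cl1 : contlines (fun z => (z - b)^-1) (Re c - t) (Re c + t) (Im c - t) (Im c + t).
  by apply: contlinesS => z /(onlines_neq hb); exact: ccont_subV.
have E := @RI_lin R (fun z => G z * (z - b)^-1) (fun z => (z - b)^-1) (- g b) _ _ _ _ (contlines_cauchy cG hb) cl1 ab cd.
apply/eqP; rewrite -subr_eq0 -mulNr -/(RIs _ _ _) in E *.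
rewrite /RIs -E -RIq; apply/eqP.
have -> : (fun z => G z / (z - b) + - g b * (z - b)^-1) = (fun z => (G z - g b) * (z - b)^-1).
  by apply/funext => z; ring.
have cl2 : contlines (fun z => (G z - g b) * (z - b)^-1) (Re c - t) (Re c + t) (Im c - t) (Im c + t).
  apply: contlines_cauchy => // z; apply: ccontD => //; exact: ccont_cst.
have agree z : onlines c t z -> (G z - g b) * (z - b)^-1 = q z by move=> /(onlines_neq hb); rewrite /q => /negbTE ->.
case: cl2 => k1 k2 k3 k4.
rewrite /RIs /RI /hint /vint.
rewrite (@pint_ext R _ _ _ _ (rcont_h k1) (@rcont_h R q _ (fun x => cq _)) ab (fun x _ => agree (x +i* (Im c - t))%C (Or43 _ _ _ erefl))).
rewrite (@pint_ext R _ _ _ _ (rcont_h k2) (@rcont_h R q _ (fun x => cq _)) ab (fun x _ => agree (x +i* (Im c + t))%C (Or44 _ _ _ erefl))).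
rewrite (@pint_ext R _ _ _ _ (rcont_v k3) (@rcont_v R q _ (fun x => cq _)) cd (fun x _ => agree ((Re c - t) +i* x)%C (Or41 _ _ _ erefl))).
by rewrite (@pint_ext R _ _ _ _ (rcont_v k4) (@rcont_v R q _ (fun x => cq _)) cd (fun x _ => agree ((Re c + t) +i* x)%C (Or42 _ _ _ erefl))).
Qed.

(** On each of the four sides, with its orientation, the integrand has positive imaginary part, so
    the four contributions cannot cancel. *)
Lemma cauchy_kernel_neq0 c t b : 0 < t -> sq c t b -> RIs (fun z => (z - b)^-1) c t != 0.
Proof.
move=> t0 hb.
have cn z : onlines c t z -> ccont (fun z => (z - b)^-1) z by move=> /(onlines_neq hb); exact: ccont_subV.
have ab : Re c - t < Re c + t by lra.
have cd : Im c - t < Im c + t by lra.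
have ImV (z : C) : z != 0 -> Im z^-1 = - Im z / cabs z ^+ 2 /\ Re z^-1 = Re z / cabs z ^+ 2.
  move=> z0; have n0 : Re z ^+ 2 + Im z ^+ 2 != 0 by rewrite -cabs_sqr expf_neq0 // gt_eqF // cabs_gt0.
  rewrite cabs_sqr; suff -> : z^-1 = (Re z / (Re z ^+ 2 + Im z ^+ 2) +i* (- Im z / (Re z ^+ 2 + Im z ^+ 2)))%C by [].
  apply: (mulfI z0); rewrite mulfV //; apply/eqP; case: z n0 {z0} => x y /= n0.
  by rewrite eq_complex /=; apply/andP; split; apply/eqP; field.
have [] := hb; rewrite !ltr_distl => /andP[b1 b2] /andP[b3 b4].
have pos1 x : 0 < Im (((x +i* (Im c - t))%C - b)^-1).
  have nz := onlines_neq hb (Or43 _ _ _ (erefl (Im (x +i* (Im c - t))%C))).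
  have [|-> _] := ImV ((x +i* (Im c - t))%C - b); first by rewrite subr_eq0.
  by rewrite divr_gt0 ?exprn_gt0 ?cabs_gt0 ?subr_eq0 // ImB /=; lra.
have pos2 x : 0 < Im (- ((x +i* (Im c + t))%C - b)^-1).
  have nz := onlines_neq hb (Or44 _ _ _ (erefl (Im (x +i* (Im c + t))%C))).
  have -> (v : C) : Im (- v) = - Im v by case: v.
  have [|-> _] := ImV ((x +i* (Im c + t))%C - b); first by rewrite subr_eq0.
  by rewrite -mulNr divr_gt0 ?exprn_gt0 ?cabs_gt0 ?subr_eq0 // ImB /=; lra.
have Imi (v : C) : Im ('i%C * v) = Re v by case: v => p q /=; ring.
have pos3 y : 0 < Im ('i%C * (((Re c + t) +i* y)%C - b)^-1).
  have nz := onlines_neq hb (Or42 _ _ _ (erefl (Re ((Re c + t) +i* y)%C))).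
  rewrite Imi; have [|_ ->] := ImV (((Re c + t) +i* y)%C - b); first by rewrite subr_eq0.
  by rewrite divr_gt0 ?exprn_gt0 ?cabs_gt0 ?subr_eq0 // ReB /=; lra.
have pos4 y : 0 < Im (- 'i%C * (((Re c - t) +i* y)%C - b)^-1).
  have nz := onlines_neq hb (Or41 _ _ _ (erefl (Re ((Re c - t) +i* y)%C))).
  have -> (v : C) : Im (- 'i%C * v) = - Re v by case: v => p q /=; ring.
  have [|_ ->] := ImV (((Re c - t) +i* y)%C - b); first by rewrite subr_eq0.
  by rewrite -mulNr divr_gt0 ?exprn_gt0 ?cabs_gt0 ?subr_eq0 // ReB /=; lra.
pose k (z : C) := (z - b)^-1.
have r1 : rcont (fun x => k (x +i* (Im c - t))%C) by apply: rcont_h => x; apply: cn; apply: Or43.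
have r2 : rcont (fun x => k (x +i* (Im c + t))%C) by apply: rcont_h => x; apply: cn; apply: Or44.
have r3 : rcont (fun y => k ((Re c + t) +i* y)%C) by apply: rcont_v => x; apply: cn; apply: Or42.
have r4 : rcont (fun y => k ((Re c - t) +i* y)%C) by apply: rcont_v => x; apply: cn; apply: Or41.
have i1 := rder_Im_pos ab (fun x _ => pprimP x r1) (fun x _ => pos1 x).
have pos2' x : 0 < Im (-1 * k (x +i* (Im c + t))%C) by rewrite mulN1r; exact: pos2.
have i2 := rder_Im_pos ab (fun x _ => rderZ (-1) (pprimP x r2)) (fun x _ => pos2' x).
have i3 := rder_Im_pos cd (fun x _ => rderZ ('i%C) (pprimP x r3)) (fun x _ => pos3 x).
have i4 := rder_Im_pos cd (fun x _ => rderZ (- 'i%C) (pprimP x r4)) (fun x _ => pos4 x).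
apply/eqP => h0; have : Im (RIs k c t) = 0 by rewrite h0.
have -> : RIs k c t = (pprim (fun x => k (x +i* (Im c - t))%C) (Re c + t) - pprim (fun x => k (x +i* (Im c - t))%C) (Re c - t))
  + (-1 * pprim (fun x => k (x +i* (Im c + t))%C) (Re c + t) - -1 * pprim (fun x => k (x +i* (Im c + t))%C) (Re c - t))
  + ('i%C * pprim (fun y => k ((Re c + t) +i* y)%C) (Im c + t) - 'i%C * pprim (fun y => k ((Re c + t) +i* y)%C) (Im c - t))
  + (- 'i%C * pprim (fun y => k ((Re c - t) +i* y)%C) (Im c + t) - - 'i%C * pprim (fun y => k ((Re c - t) +i* y)%C) (Im c - t)).
  by rewrite /RIs /RI /hint /vint /pint; ring.
by rewrite !ImD in i1 i2 i3 i4 *; lra.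
Qed.

End CauchyFormula.

(** * Removable singularities, maximum bounds, Cauchy estimates, derivatives *)

Section CauchyConsequences.
Variable R : realType.
Local Notation C := (R[i]).
Local Notation Re := complex.Re.
Local Notation Im := complex.Im.
Implicit Types (z w a b c l : C) (g h q : C -> C) (s t : R).

Definition hol g c s := forall z, sq c s z -> cdif g z.

Lemma hol_holex g c s : hol g c s -> holex [::] g c s.
Proof. by move=> h; split => z hz; [apply: cdif_cont; exact: h | move=> _; exact: h]. Qed.

(** Differentiation under the integral: the derivative is the integral with kernel 1/(z - b)^2, and
    the remainder is an integral with an explicit kernel of order (b' - b)^2. *)
Lemma cauchy_type_cdif G c t b : (forall z, ccont G z) -> 0 < t -> sq c t b ->
  cdif (fun b => RIs (fun z => G z * (z - b)^-1) c t) b.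
Proof.
move=> cG t0 hb.
have [r r0 hr] := onlines_dist hb.
have ab : Re c - t <= Re c + t by lra.
have cd : Im c - t <= Im c + t by lra.
pose k3 (z : C) := G z * (z - b)^-1 * (z - b)^-1.
have c3 : contlines k3 (Re c - t) (Re c + t) (Im c - t) (Im c + t).
  apply: contlinesS => z /(onlines_neq hb) h; apply: ccontM; last exact: ccont_subV.
  by apply: ccontM => //; exact: ccont_subV.
exists (RIs k3 c t) => e e0.
have [||m _ hm] := @clbd_max_cabs R _ G (clbd_rect (Re c - t) (Re c + t) (Im c - t) (Im c + t)).
- by exists c; split; apply/andP; split; lra.
- by move=> z _.
pose M := cabs (G m) + 1.
have M0 : 0 < M by rewrite ltr_wpDl // cabs_ge0.
pose K := 16 * t * (2 * M / r ^+ 3).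
have K0 : 0 < K by rewrite !mulr_gt0 // invr_gt0 exprn_gt0.
have [d2 d20 hd2] := sq_open hb.
exists (Num.min (Num.min (r / 2) d2) (e / K)); first by rewrite !lt_min d20 !divr_gt0.
move=> b'; rewrite /cball /mkset !lt_min => /andP[/andP[h1 h2] h3].
have hb' := hd2 b' h2.
pose k1 (z : C) := G z * (z - b')^-1; pose k2 (z : C) := G z * (z - b)^-1.
have c1 := contlines_cauchy cG hb'; have c2 := contlines_cauchy cG hb.
have c23 : contlines (fun z => k2 z + (b' - b) * k3 z) (Re c - t) (Re c + t) (Im c - t) (Im c + t).
  case: c2 c3 => p1 p2 p3 p4 [p5 p6 p7 p8].
  by split => x; apply: ccontD => //; apply: ccontM => //; exact: ccont_cst.
have E1 := RI_lin (b' - b) c2 c3 ab cd.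
have E2 := RI_lin (-1) c1 c23 ab cd.
rewrite -!/(RIs _ _ _) in E1 E2.
have -> : RIs (fun z => G z * (z - b')^-1) c t - RIs (fun z => G z * (z - b)^-1) c t - RIs k3 c t * (b' - b) =
   RIs (fun z => G z * (z - b')^-1 + -1 * (k2 z + (b' - b) * k3 z)) c t by rewrite E2 E1; ring.
have c123 : contlines (fun z => G z * (z - b')^-1 + -1 * (k2 z + (b' - b) * k3 z)) (Re c - t) (Re c + t) (Im c - t) (Im c + t).
  case: c1 c23 => p1 p2 p3 p4 [p5 p6 p7 p8].
  by split => x; apply: ccontD => //; apply: ccontM => //; exact: ccont_cst.
have B := @RIs_bound R _ c t (2 * M / r ^+ 3 * cabs (b' - b) ^+ 2) t0 c123.
apply: (le_trans (B _)); last first.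
  have -> : 16 * t * (2 * M / r ^+ 3 * cabs (b' - b) ^+ 2) = (K * cabs (b' - b)) * cabs (b' - b) by rewrite /K; ring.
  rewrite ler_wpM2r ?cabs_ge0 //; rewrite ltr_pdivlMr // mulrC in h3; exact: ltW.
move=> z zb; have on := bsq_onlines zb.
have zb0 : z - b != 0 by rewrite subr_eq0; exact: onlines_neq on.
have zb0' : z - b' != 0 by rewrite subr_eq0; exact: onlines_neq on.
(* The exact second-order remainder of the kernel; both distances to the sides are at least r /
   2. *)
have -> : G z / (z - b') + -1 * (k2 z + (b' - b) * k3 z) = G z * ((b' - b) ^+ 2 / ((z - b) ^+ 2 * (z - b'))).
  by rewrite /k2 /k3; field; rewrite zb0 zb0'.
rewrite !(cabsM, cabsV, cabsX).
have q1 := hr z on; have q2 := cabs_tri b' z b.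
have q3 : r / 2 <= cabs (z - b') by lra.
have gM : cabs (G z) <= M.
  by apply: (@le_trans _ _ (cabs (G m))); [apply: hm; case: zb | rewrite /M; lra].
have d1 : 0 < cabs (z - b) ^+ 2 * cabs (z - b').
  by rewrite mulr_gt0 ?exprn_gt0 // cabs_gt0.
have q4 : r ^+ 3 / 2 <= cabs (z - b) ^+ 2 * cabs (z - b').
  have -> : r ^+ 3 / 2 = r ^+ 2 * (r / 2) by field.
  apply: ler_pM => //; [exact: sqr_ge0 | by rewrite divr_ge0 // ltW |].
  by rewrite lerXn2r // nnegrE ?cabs_ge0 // ltW.
have -> : 2 * M / r ^+ 3 * cabs (b' - b) ^+ 2 = M * (cabs (b' - b) ^+ 2 / (r ^+ 3 / 2)) by field; rewrite gt_eqF.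
apply: ler_pM => //; first exact: cabs_ge0.
  by rewrite mulr_ge0 ?sqr_ge0 // invr_ge0 ltW.
by rewrite ler_wpM2l ?sqr_ge0 // lef_pV2 // posrE ?divr_gt0 ?exprn_gt0.
Qed.

(** The points a + d/(k+2) are pairwise distinct, so a finite list cannot contain all of them. *)
Lemma seq_avoid (lst : seq C) a (d : R) : 0 < d -> exists2 w, cball a d w & w \notin lst.
Proof.
move=> d0; apply: contrapT => hn.
pose f (k : nat) : C := a + (d / k.+2%:R)%:C%C.
have fin k : f k \in lst.
  apply/negPn/negP => h; apply: hn; exists (f k) => //.
  rewrite /cball /mkset /f addrC addKr cabsR ger0_norm; last by rewrite divr_ge0 // ltW.
  by rewrite ltr_pdivrMr // ltr_pMr // ltr1n.
have finj : injective f.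
  move=> i j /addrI /(congr1 (@Re R)) /= /(mulfI (lt0r_neq0 d0)) /invr_inj /eqP.
  by rewrite eqr_nat => /eqP [].
have := @uniq_leq_size _ (map f (iota 0 (size lst).+1)) lst.
rewrite map_inj_uniq // iota_uniq => /(_ isT).
rewrite size_map size_iota ltnn => H.
have : {subset map f (iota 0 (size lst).+1) <= lst} by move=> x /mapP[k _ ->].
by move/H.
Qed.

Lemma between_sq c s z : 0 < s -> sq c s z -> exists2 t, 0 < t & t < s /\ sq c t z.
Proof.
move=> s0 [h1 h2]; exists ((Num.max `|Re z - Re c| `|Im z - Im c| + s) / 2).
  by rewrite divr_gt0 // ltr_wpDl // le_max normr_ge0.
have hm : Num.max `|Re z - Re c| `|Im z - Im c| < s by rewrite gt_max h1.
have m1 : `|Re z - Re c| <= Num.max `|Re z - Re c| `|Im z - Im c| by rewrite le_max lexx.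
have m2 : `|Im z - Im c| <= Num.max `|Re z - Re c| `|Im z - Im c| by rewrite le_max lexx orbT.
by split; [|split]; lra.
Qed.

Lemma sq_pos c s z : sq c s z -> 0 < s.
Proof. by case=> h _; exact: le_lt_trans h. Qed.

(** Off the list g equals the quotient [Phi] / [W] of two Cauchy-type integrals, which is
    differentiable on the whole square; continuity of g extends the equality to the list. *)
Lemma removable lst g c s : holex lst g c s -> hol g c s.
Proof.
move=> hg b hb; have s0 := sq_pos hb; have [t t0 [ts hbt]] := between_sq s0 hb.
pose Phi b := RIs (fun z => ext g c s t z * (z - b)^-1) c t.
pose W b := RIs (fun z => 1 * (z - b)^-1) c t.
have WE b' : RIs (fun z => (z - b')^-1) c t = W b'.
  by rewrite /W; congr RIs; apply/funext => z; rewrite mul1r.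
have W0 b' : sq c t b' -> W b' != 0 by move=> /(cauchy_kernel_neq0 t0); rewrite WE.
have dPhi b' : sq c t b' -> cdif Phi b'.
  by move=> h; apply: (@cauchy_type_cdif (ext g c s t)) => // z; exact: (ext_cont z t0 ts hg).
have dW b' : sq c t b' -> cdif W b'.
  by move=> h; apply: (@cauchy_type_cdif (fun=> 1)) => // z; exact: ccont_cst.
have dQ b' : sq c t b' -> cdif (fun x => Phi x / W x) b'.
  by move=> h; apply: cdif_div; [exact: W0 | exact: dPhi | exact: dW].
have eq1 b' : sq c t b' -> b' \notin lst -> Phi b' / W b' = g b'.
  move=> h1 h2; have := cauchy_formula t0 ts hg h1 h2; rewrite WE -/(Phi b') => ->.
  by rewrite mulfK // W0.
have eq2 b' : sq c t b' -> Phi b' / W b' = g b'.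
  move=> h1; apply/eqP; rewrite -subr_eq0; apply: contrapT => /negP D0.
  have e0 := cabs_gt0 D0.
  have cD : ccont (fun x => Phi x / W x + (-1) * g x) b'.
    apply: ccontD; first exact: (cdif_cont (dQ _ h1)).
    apply: ccontM; first exact: ccont_cst.
    by case: hg => + _; apply; apply: sq_sub h1; exact: ltW.
  have [d d0 hd] := cD _ e0; have [r r0 hr] := sq_open h1.
  have [|w] := @seq_avoid lst b' (Num.min d r); first by rewrite lt_min d0.
  rewrite /cball /mkset lt_min => /andP[w1 w2] wl.
  have := hd w w1; rewrite eq1 //; last exact: hr.
  rewrite !mulN1r subrr sub0r cabsN ltxx //.
have [r r0 hr] := sq_open hbt.
apply: (cdif_ext r0 (g := fun x => Phi x / W x)); last exact: dQ.
by move=> w /hr; exact: eq2.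
Qed.

Lemma removable_point g a (r : R) : 0 < r -> ccont g a ->
  (forall z, cball a r z -> z != a -> cdif g z) -> cdif g a.
Proof.
move=> r0 ca hd; have r20 : 0 < r / 2 by rewrite divr_gt0.
apply: (@removable [:: a] g a (r / 2)); last exact: sqxx.
have sb z : sq a (r / 2) z -> cball a r z by move=> /sq_sub_cball; rewrite (mulrC 2) divfK.
split=> z /sb hz; last by rewrite inE => za; apply: hd.
by have [->//|za] := eqVneq z a; apply: cdif_cont; apply: hd.
Qed.

(* powers of [g] obey the same bound, which removes the constant of Cauchy's formula *)
Lemma weak_max g c s t (M : R) b : hol g c s -> 0 < t -> t < s ->
  (forall z, bsq c t z -> cabs (g z) <= M) -> csq c t b -> cabs (g b) <= M.
Proof.
move=> hg t0 ts hM hb.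
have [hbt|hbn] := pselect (sq c t b); last first.
  apply: hM; apply/bsqP; split => //; move/csqP: hb => [h1 h2].
  apply: contrapT => h3; apply: hbn; split; rewrite lt_neqAle ?h1 ?h2 andbT; apply/eqP => h4; apply: h3; tauto.
have W0 := cauchy_kernel_neq0 t0 hbt.
set W := RIs _ _ _ in W0.
have [r r0 hr] := onlines_dist hbt.
have M0 : 0 <= M.
  apply: (le_trans (cabs_ge0 (g ((Re c + t) +i* Im c)%C))); apply: hM; apply/bsqP; split.
    by apply/csqP; split; rewrite /= ler_distl; apply/andP; split; lra.
  by left; rewrite /= addrAC subrr add0r gtr0_norm.
pose K := 16 * t / r / cabs W.
have cW : 0 < cabs W by exact: cabs_gt0.
have K0 : 0 <= K by rewrite !mulr_ge0 ?invr_ge0 ?ltW.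
have bound n : cabs (g b) ^+ n <= K * M ^+ n.
  have hgn : holex [::] (fun z => g z ^+ n) c s.
    by apply: hol_holex => z /hg h; exact: cdifX.
  have := cauchy_formula t0 ts hgn hbt isT; rewrite -/W => E.
  have B : cabs (RIs (fun z => ext (fun z => g z ^+ n) c s t z * (z - b)^-1) c t) <= 16 * t * (M ^+ n / r).
    apply: RIs_bound => //; first by apply: contlines_cauchy => // z; exact: (ext_cont z t0 ts hgn).
    move=> z zb; rewrite cabsM ext_val //; last by case: zb.
    rewrite cabsX cabsV; apply: ler_pM; rewrite ?exprn_ge0 ?cabs_ge0 ?invr_ge0 ?cabs_ge0 //.
      by rewrite lerXn2r ?nnegrE ?cabs_ge0 //; exact: hM.
    have q := hr z (bsq_onlines zb).
    by rewrite lef_pV2 ?posrE //; exact: lt_le_trans q.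
  move: B; rewrite E cabsM cabsX -ler_pdivlMr //.
  by have -> : 16 * t * (M ^+ n / r) / cabs W = K * M ^+ n by rewrite /K; ring.
rewrite leNgt; apply/negP => h.
have [M00|Mn0] := eqVneq M 0.
  by have := bound 1%N; rewrite !expr1 M00 mulr0; rewrite M00 in h; lra.
have Mp : 0 < M by rewrite lt0r Mn0.
pose y := cabs (g b) / M - 1.
have y0 : 0 < y by rewrite /y subr_gt0 ltr_pdivlMr // mul1r.
have bern n : 1 + n%:R * y <= (1 + y) ^+ n.
  elim: n => [|n ih]; first by rewrite mul0r addr0 expr0.
  rewrite exprS -natr1; apply: (@le_trans _ _ ((1 + y) * (1 + n%:R * y))); last first.
    by rewrite ler_wpM2l //; lra.
  have -> : (1 + y) * (1 + n%:R * y) = 1 + (n%:R + 1) * y + n%:R * (y * y) by ring.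
  by rewrite lerDl mulr_ge0 ?ler0n // mulr_ge0 ?ltW.
have [n h1] : exists n : nat, K / y < n%:R by exists (Num.truncn (K / y)).+1; exact: truncnS_gt.
rewrite ltr_pdivrMr // in h1.
have h2 : (1 + y) ^+ n <= K.
  have -> : 1 + y = cabs (g b) / M by rewrite /y; ring.
  by rewrite expr_div_n ler_pdivrMr ?exprn_gt0.
by have := bern n; move: h1; set u := n%:R * y => h1 h3; lra.
Qed.

(** Holomorphic division by z - a takes the place of power series: iterating it gives Taylor
    expansions and orders of zeros, and bounding the quotient gives Schwarz's lemma and Cauchy's
    estimates. *)
Lemma divdiff g c s a : hol g c s -> sq c s a -> exists q,
  [/\ hol q c s, forall z, g z = g a + (z - a) * q z & cder g a (q a)].
Proof.
move=> hg ha; have [l hl] := hg a ha.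
pose q z := if z == a then l else (g z - g a) * (z - a)^-1.
have qloc z : z != a -> exists2 r, 0 < r & forall w, cball z r w -> (g w - g a) * (w - a)^-1 = q w.
  move=> zb; exists (cabs (z - a)); first by apply: cabs_gt0; rewrite subr_eq0.
  by move=> w; rewrite /cball /mkset /q; case: eqP => // ->; rewrite cabsB ltxx.
have dq z : sq c s z -> z != a -> cdif q z.
  move=> hz za; have [r r0 hr] := qloc z za; apply: (cdif_ext r0 hr).
  apply: cdifM; last by apply: cdifV; [rewrite subr_eq0 | apply: cdifB; [exact: cdif_id|exact: cdif_cst]].
  by apply: cdifB; [exact: hg | exact: cdif_cst].
have cqa : ccont q a.
  move=> e e0; have e20 : 0 < e / 2 by rewrite divr_gt0.
  have [d d0 hd] := hl _ e20; exists d => // w /hd hw.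
  rewrite /q eqxx; case: eqP => [_|/eqP wb]; first by rewrite subrr cabs0.
  have wb0 : w - a != 0 by rewrite subr_eq0.
  have -> : (g w - g a) / (w - a) - l = (g w - g a - l * (w - a)) / (w - a) by field.
  rewrite cabsf ltr_pdivrMr ?cabs_gt0 //; apply: (le_lt_trans hw).
  by rewrite ltr_pM2r ?cabs_gt0 //; lra.
exists q; split.
- move=> z hz; have [->|za] := eqVneq z a; last exact: dq.
  have [r r0 hr] := sq_open ha.
  by apply: (removable_point r0 cqa) => w /hr; exact: dq.
- move=> z; rewrite /q; case: eqP => [->|/eqP za]; first by rewrite subrr mul0r addr0.
  by have : z - a != 0 by [rewrite subr_eq0]; move=> h; field.
- by rewrite /q eqxx.
Qed.

Lemma bsq_dist c t z : bsq c t z -> t <= cabs (z - c).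
Proof.
move=> /bsqP[_ [<-|<-]]; [have := Re_le_cabs (z - c); rewrite ReB | have := Im_le_cabs (z - c); rewrite ImB]; done.
Qed.

(** On the sides of the square |z - c| is at least t, so the divided difference is at most 2 M / t
    there, and by the maximum bound inside as well. *)
Lemma cauchy_lip g c s t (M : R) : hol g c s -> 0 < t -> t < s ->
  (forall z, sq c s z -> cabs (g z) <= M) ->
  (forall z, csq c t z -> cabs (g z - g c) <= 2 * M / t * cabs (z - c)) /\
  (forall l, cder g c l -> cabs l <= 2 * M / t).
Proof.
move=> hg t0 ts hM; have s0 : 0 < s by lra.
have [q [hq eq dq]] := divdiff hg (sqxx c s0).
have qb z : csq c t z -> cabs (q z) <= 2 * M / t.
  move=> hz; apply: (weak_max hq t0 ts _ hz) => w wb.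
  have wc := bsq_dist wb; have wc0 : 0 < cabs (w - c) by lra.
  have w0 : w - c != 0 by apply/eqP => e; rewrite e cabs0 ltxx in wc0.
  have -> : q w = (g w - g c) / (w - c) by rewrite (eq w); field.
  rewrite cabsf; apply: ler_pM; rewrite ?cabs_ge0 ?invr_ge0 ?cabs_ge0 //; last by rewrite lef_pV2 // posrE.
  have : cabs (g w) <= M by apply: hM; apply: (csq_sq ts); case: wb.
  have : cabs (g c) <= M by apply: hM; exact: sqxx.
  have := cabsD (g w) (- g c); rewrite cabsN; lra.
split.
  move=> z hz; have -> : g z - g c = (z - c) * q z by rewrite (eq z) addrC addKr.
  by rewrite cabsM mulrC ler_wpM2r ?cabs_ge0 //; exact: qb.
by move=> l /(cder_uniq dq) <-; apply: qb; apply: sq_csq; exact: sqxx.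
Qed.

Definition cdrv g z : C := if pselect (cdif g z) is left h then projT1 (cid h) else 0.

Lemma cdrvP g z : cdif g z -> cder g z (cdrv g z).
Proof. by move=> h; rewrite /cdrv; case: pselect => // h'; exact: (projT2 (cid h')). Qed.

Lemma cdrv_eq g z l : cder g z l -> cdrv g z = l.
Proof. by move=> h; exact: (cder_uniq (cdrvP (ex_intro _ l h)) h). Qed.

(** Dividing twice, g = g(a) + (z - a) q and q = q(a) + (z - a) p. The product rule expresses g'
    through p and p', and p' is bounded near a by Cauchy's estimate; hence g' has derivative 2 p(a)
    at a. *)
Lemma hol_cdrv g c s : hol g c s -> hol (cdrv g) c s.
Proof.
move=> hg a ha.
have [q [hq eq dq]] := divdiff hg ha.
have [p [hp ep dp]] := divdiff hq ha.
have [r r0 hr] := sq_open ha.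
have [ra ra0 hra] : exists2 ra : R, 0 < ra & forall z, sq a ra z -> sq c s z.
  by exists (r / 2); [rewrite divr_gt0 | move=> z /sq_sub_cball; rewrite (mulrC 2) divfK // => /hr].
have [||m _ hm] := @clbd_max_cabs R (csq a (ra / 2)) p (clbd_rect _ _ _ _).
- by exists a; apply: sq_csq; apply: sqxx; rewrite divr_gt0.
- by move=> z hz; apply: cdif_cont; apply: hp; apply: hra; apply: csq_sq hz; lra.
pose M := cabs (p m); have M0 : 0 <= M by exact: cabs_ge0.
have bp z l : cball a (ra / 4) z -> cder p z l -> cabs l <= 16 * M / ra.
  move=> hz hl.
  have sub w : sq z (ra / 4) w -> csq a (ra / 2) w.
    move=> [h1 h2]; apply/csqP; move/cball_sub_sq: hz => [h3 h4].
    by have := ler_distD (Re z) (Re w) (Re a); have := ler_distD (Im z) (Im w) (Im a); split; lra.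
  have hpz : hol p z (ra / 4) by move=> w /sub hw; apply: hp; apply: hra; apply: csq_sq hw; lra.
  have [|||_ /(_ l hl)] := @cauchy_lip p z (ra / 4) (ra / 8) M hpz; [lra|lra| |].
    by move=> w /sub hw; exact: hm.
  by have -> : 2 * M / (ra / 8) = 16 * M / ra by field; rewrite gt_eqF.
exists (2 * p a) => e e0.
have e40 : 0 < e / 4 by rewrite divr_gt0.
have [d d0 hd] := cdif_cont (hp a ha) e40.
pose K := 16 * M / ra + 1.
have K0 : 0 < K by rewrite ltr_wpDl // divr_ge0 ?mulr_ge0 // ltW.
exists (Num.min (Num.min d (ra / 4)) (e / 2 / K)); first by rewrite !lt_min d0 !divr_gt0.
move=> z; rewrite /cball /mkset !lt_min => /andP[/andP[h1 h2] h3].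
have hz : sq c s z by apply: hra; apply: cball_sub_sq; rewrite /cball /mkset; lra.
have dz := cdrvP (hp z hz).
have D1 : cder (fun w => w - a) z 1.
  by have := cderB (cder_id z) (cder_cst a z); rewrite subr0.
have dqz : cder q z (p z + (z - a) * cdrv p z).
  have := cderD (cder_cst (q a) z) (cderM D1 dz); rewrite add0r mul1r => h.
  by apply: (cder_ext ltr01 _ h) => w _; rewrite -ep.
have dgz : cder g z (q z + (z - a) * (p z + (z - a) * cdrv p z)).
  have := cderD (cder_cst (g a) z) (cderM D1 dqz); rewrite add0r mul1r => h.
  by apply: (cder_ext ltr01 _ h) => w _; rewrite -eq.
rewrite (cdrv_eq dgz) (cdrv_eq dq) (ep z).
have -> : q a + (z - a) * p z + (z - a) * (p z + (z - a) * cdrv p z) - q a - 2 * p a * (z - a) =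
  (z - a) * (2 * (p z - p a) + (z - a) * cdrv p z) by ring.
rewrite cabsM mulrC ler_wpM2r ?cabs_ge0 //; apply: (le_trans (cabsD _ _)); rewrite !cabsM.
have q1 := hd z h1; have q2 := bp z _ h2 dz.
have q3 : cabs (z - a) * cabs (cdrv p z) <= e / 2.
  rewrite ltr_pdivlMr // in h3; apply: le_trans (ltW h3); rewrite ler_wpM2l ?cabs_ge0 // /K; lra.
rewrite cabs_nat; lra.
Qed.

End CauchyConsequences.

(** * Exponential, logarithms, Bloch's argument and Harnack inequalities *)

Section ExpLog.
Variable R : realType.
Local Notation C := (R[i]).
Local Notation Re := complex.Re.
Local Notation Im := complex.Im.
Implicit Types (z w a b c l v : C) (g h q : C -> C) (s t : R).

Definition cexp z : C := ((expR (Re z) * cos (Im z)) +i* (expR (Re z) * sin (Im z)))%C.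

Lemma cexpD z w : cexp (z + w) = cexp z * cexp w.
Proof.
rewrite /cexp ReD ImD expRD cosD sinD; apply/eqP; rewrite eq_complex /=.
by apply/andP; split; apply/eqP; ring.
Qed.

Lemma cexp0 : cexp 0 = 1.
Proof. by rewrite /cexp /= expR0 cos0 sin0 mulr1 mulr0. Qed.

Lemma cabs_cexp z : cabs (cexp z) = expR (Re z).
Proof.
rewrite /cabs /=; have -> : (expR (Re z) * cos (Im z)) ^+ 2 + (expR (Re z) * sin (Im z)) ^+ 2 =
  expR (Re z) ^+ 2 * (cos (Im z) ^+ 2 + sin (Im z) ^+ 2) by ring.
by rewrite cos2Dsin2 mulr1 sqrtr_sqr gtr0_norm // expR_gt0.
Qed.

Lemma cexp_neq0 z : cexp z != 0.
Proof. by apply/eqP => h; have := expR_gt0 (Re z); rewrite -cabs_cexp h cabs0 ltxx. Qed.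

Lemma cexpN z : cexp (- z) = (cexp z)^-1.
Proof. by apply: (mulfI (cexp_neq0 z)); rewrite -cexpD subrr cexp0 mulfV // cexp_neq0. Qed.

Lemma cder_cexp0 : cder cexp 0 1.
Proof.
move=> e e0.
have e1 : 0 < Num.min (e / 6) 1 by rewrite lt_min ltr01 divr_gt0.
have [d1 d10 h1] := derivable_eps (is_derive_expR (0 : R)) e1.
have [d2 d20 h2] := derivable_eps (is_derive_cos (0 : R)) e1.
have [d3 d30 h3] := derivable_eps (is_derive_sin (0 : R)) e1.
exists (Num.min (Num.min d1 d2) (Num.min d3 (Num.min (e / 12) (1 / 2)))).
  by rewrite !lt_min d10 d20 d30 divr_gt0 //=; lra.
move=> z; rewrite /cball /mkset subr0 !lt_min => /andP[/andP[z1 z2] /andP[z3 /andP[z4 z5]]].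
have rx := Re_le_cabs z; have iy := Im_le_cabs z.
set x := Re z in rx *; set y := Im z in iy *.
have {}h1 := h1 x; have {}h2 := h2 y; have {}h3 := h3 y.
rewrite !subr0 expR0 mul1r in h1; rewrite subr0 cos0 sin0 oppr0 mul0r subr0 in h2; rewrite !subr0 sin0 cos0 mul1r subr0 in h3.
have {}h1 := h1 (le_lt_trans rx z1); have {}h2 := h2 (le_lt_trans iy z2); have {}h3 := h3 (le_lt_trans iy z3).
set m := Num.min _ _ in e1 h1 h2 h3.
have m1 : m <= e / 6 by rewrite ge_min lexx.
have m2 : m <= 1 by rewrite ge_min lexx orbT.
have ex1 : `|expR x - 1| <= 2 * `|x|.
  have : m * `|x| <= `|x| by rewrite ler_piMl.
  have := ler_normD (expR x - 1 - x) x; rewrite subrK; lra.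
have ex2 : expR x <= 2.
  have := ler_norm (expR x - 1); lra.
have ep := expR_gt0 x.
apply: (le_trans (cabs_le_ReIm _)); rewrite cexp0 mul1r !ReB !ImB /= -/x -/y subr0.
have -> : expR x * cos y - 1 - x = expR x * (cos y - 1) + (expR x - 1 - x) by ring.
have -> : expR x * sin y - y = expR x * (sin y - y) + (expR x - 1) * y by ring.
have b1 := ler_normD (expR x * (cos y - 1)) (expR x - 1 - x).
have b2 := ler_normD (expR x * (sin y - y)) ((expR x - 1) * y).
rewrite !normrM (gtr0_norm ep) in b1 b2.
have q1 : m * `|y| <= e / 6 * cabs z by apply: ler_pM => //; exact: ltW.
have q2 : m * `|x| <= e / 6 * cabs z by apply: ler_pM => //; exact: ltW.
have q3 : expR x * `|cos y - 1| <= 2 * (e / 6 * cabs z).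
  by apply: ler_pM => //; do ?[exact: (le_trans h2 q1) | exact: ltW ep].
have q4 : expR x * `|sin y - y| <= 2 * (e / 6 * cabs z).
  by apply: ler_pM => //; do ?[exact: (le_trans h3 q1) | exact: ltW ep].
have q5 : `|expR x - 1| * `|y| <= e / 6 * cabs z.
  by apply: ler_pM => //; lra.
have : e * cabs z = 6 * (e / 6 * cabs z) by field.
lra.
Qed.

Lemma cder_cexp z : cder cexp z (cexp z).
Proof.
have D1 : cder (fun w => w - z) z 1.
  by have := cderB (cder_id z) (cder_cst z z); rewrite subr0.
have h0 : cder cexp (z - z) 1 by rewrite subrr; exact: cder_cexp0.
have := cderZ (cexp z) (cder_comp D1 h0); rewrite !mulr1.
by apply: (cder_ext ltr01) => w _; rewrite -cexpD addrC subrK.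
Qed.

Lemma polar v : v != 0 -> exists2 th : R, `|th| <= pi & v = cexp (ln (cabs v) +i* th)%C.
Proof.
move=> v0; have c0 := cabs_gt0 v0.
pose x := Re v / cabs v; pose y := Im v / cabs v.
have xy : x ^+ 2 + y ^+ 2 = 1.
  rewrite /x /y !expr_div_n -mulrDl -cabs_sqr mulfV // expf_neq0 // gt_eqF //.
have x2 : x ^+ 2 <= 1 by have := sqr_ge0 y; lra.
have xb : -1 <= x <= 1.
  by rewrite -ler_norml -(@ler_pXn2r _ 2) ?nnegrE // expr1n real_normK ?num_real.
have sa := sin_acos xb; have [/andP[a0 api] ca] := acos_def xb.
have sa' : sin (acos x) = `|y| by rewrite sa -xy addrC addKr sqrtr_sqr.
have [y0|y0] := leP 0 y.
  exists (acos x); first by rewrite ger0_norm.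
  rewrite /cexp /= lnK ?posrE // ca sa' ger0_norm // /x /y; case: v {v0 x y xy x2 xb sa a0 api ca sa' y0} c0 => p q c0 /=.
  by apply/eqP; rewrite eq_complex /=; apply/andP; split; apply/eqP; field; rewrite gt_eqF.
exists (- acos x); first by rewrite normrN ger0_norm.
rewrite /cexp /= lnK ?posrE // cosN sinN ca sa' ltr0_norm // opprK /x /y; case: v {v0 x y xy x2 xb sa a0 api ca sa' y0} c0 => p q c0 /=.
by apply/eqP; rewrite eq_complex /=; apply/andP; split; apply/eqP; field; rewrite gt_eqF.
Qed.

Lemma polar_near v (y : R) : v != 0 -> exists2 th : R, `|th - y| <= pi & v = cexp (ln (cabs v) +i* th)%C.
Proof.
move=> v0; have [|th hth E] := @polar (v * cexp (0 +i* (- y))%C); first by rewrite mulf_neq0 // cexp_neq0.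
exists (th + y); first by rewrite addrK.
rewrite cabsM cabs_cexp /= expR0 mulr1 in E.
have -> : (ln (cabs v) +i* (th + y))%C = (ln (cabs v) +i* th)%C + (0 +i* y)%C.
  by apply/eqP; rewrite eq_complex /= addr0 !eqxx.
rewrite cexpD -E -mulrA -cexpD.
have -> : (0 +i* (- y))%C + (0 +i* y)%C = 0 :> C by apply/eqP; rewrite eq_complex /= addr0 addNr !eqxx.
by rewrite cexp0 mulr1.
Qed.

Lemma mean_value g (dg : C -> C) c t (M : R) z w : (forall v, sq c t v -> cder g v (dg v)) ->
  (forall v, sq c t v -> cabs (dg v) <= M) -> sq c t z -> sq c t w -> cabs (g w - g z) <= 2 * M * cabs (w - z).
Proof.
move=> hg hM hz hw.
have seg (x : R) : 0 <= x <= 1 -> sq c t (z + (w - z) * x%:C%C).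
  move=> /andP[x0 x1]; case: hz hw => z1 z2 [w1 w2].
  have conv (p q r : R) : `|p - r| < t -> `|q - r| < t -> `|p + (q - p) * x - r| < t.
    rewrite !ltr_distl => /andP[p1 p2] /andP[q1 q2].
    have E : p + (q - p) * x = (1 - x) * p + x * q by ring.
    have [->|xn] := eqVneq x 0; first by rewrite mulr0 addr0; apply/andP.
    have xp : 0 < x by rewrite lt0r xn.
    have f1 : x * q < x * (r + t) by rewrite ltr_pM2l.
    have f2 : x * (r - t) < x * q by rewrite ltr_pM2l.
    have f3 : (1 - x) * p <= (1 - x) * (r + t) by rewrite ler_wpM2l ?subr_ge0 // ltW.
    have f4 : (1 - x) * (r - t) <= (1 - x) * p by rewrite ler_wpM2l ?subr_ge0 // ltW.
    by rewrite E; apply/andP; split; lra.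
  by split; rewrite ?ReD ?ImD ?ReMr ?ImMr ?ReB ?ImB; exact: conv.
have := @rder_bound R (fun x => g (z + (w - z) * x%:C%C)) (fun x => (w - z) * dg (z + (w - z) * x%:C%C)) 0 1 (cabs (w - z) * M) ler01.
rewrite rmorph0 rmorph1 mulr0 mulr1 addr0 subr0 mulr1 addrCA subrr addr0.
have -> : 2 * M * cabs (w - z) = 2 * (cabs (w - z) * M) by ring.
apply.
  by move=> x hx; apply: rder_affine; apply: hg; exact: seg.
by move=> x hx; rewrite cabsM ler_wpM2l ?cabs_ge0 //; apply: hM; exact: seg.
Qed.

(** A primitive F of g'/g makes g exp(-F) constant, and a logarithm of that constant corrects F. *)
Lemma hol_log g c s t : hol g c s -> (forall z, sq c s z -> g z != 0) -> 0 < t -> t < s ->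
  exists2 h, hol h c t & forall z, sq c t z -> cexp (h z) = g z.
Proof.
move=> hg g0 t0 ts.
have hq : hol (fun z => cdrv g z / g z) c s.
  by move=> z hz; apply: cdif_div; [exact: g0 | exact: (hol_cdrv hg) | exact: hg].
have [F hF] := primitive_sq t0 ts (hol_holex hq).
have sub z : sq c t z -> sq c s z by apply: sq_sub; exact: ltW.
pose E z := g z * cexp (- F z).
have dE z : sq c t z -> cder E z 0.
  move=> hz; have dg := cdrvP (hg z (sub z hz)).
  have := cderM dg (cder_comp (cderN (hF z hz)) (cder_cexp (- F z))).
  set l := (X in cder _ _ X); suff -> : l = 0 by [].
  by rewrite /l; have := g0 z (sub z hz); move=> gz; field.
have cE z : sq c t z -> E z = E c.
  move=> hz; apply/eqP; rewrite -subr_eq0; apply/eqP; apply: cabs_eq0; apply/eqP.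
  rewrite eq_le cabs_ge0 andbT.
  have := @mean_value E (fun=> 0) c t 0 c z dE (fun _ _ => ltac:(by rewrite cabs0)) (sqxx c t0) hz.
  by rewrite mulr0 mul0r.
have Ec0 : E c != 0 by rewrite mulf_neq0 ?cexp_neq0 //; apply: g0; apply: sqxx; lra.
have [k _ Ek] := polar Ec0.
exists (fun z => F z + (ln (cabs (E c)) +i* k)%C).
  by move=> z hz; apply: cdifD; [eexists; exact: hF | exact: cdif_cst].
move=> z hz; rewrite cexpD -Ek -(cE z hz) /E cexpN mulrCA mulfV ?mulr1 //; exact: cexp_neq0.
Qed.

(** Distance to the centre in the maximum norm, so that t - [msq c z] is the distance from z to the
    sides of the square in that norm. *)
Definition msq c z : R := Num.max `|Re z - Re c| `|Im z - Im c|.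

Lemma msq_lip c z w : msq c z <= msq c w + cabs (z - w).
Proof.
rewrite /msq ge_max; have := Re_le_cabs (z - w); have := Im_le_cabs (z - w); rewrite ReB ImB => h1 h2.
have m1 : `|Re w - Re c| <= Num.max `|Re w - Re c| `|Im w - Im c| by rewrite le_max lexx.
have m2 : `|Im w - Im c| <= Num.max `|Re w - Re c| `|Im w - Im c| by rewrite le_max lexx orbT.
have := ler_distD (Re w) (Re z) (Re c); have := ler_distD (Im w) (Im z) (Im c).
by move=> h3 h4; apply/andP; split; lra.
Qed.

Lemma msqP c t z : csq c t z <-> msq c z <= t.
Proof. by rewrite /msq ge_max; split => [/csqP [-> ->] //|/andP[h1 h2]]; apply/csqP. Qed.

Lemma msq_sq c t z : sq c t z <-> msq c z < t.
Proof. by rewrite /msq gt_max; split => [[-> ->] //|/andP[h1 h2]]. Qed.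

Lemma msq_sq_shift c a z (r : R) : sq a r z -> msq c z <= msq c a + r.
Proof.
move=> [h1 h2]; rewrite /msq ge_max.
have m1 : `|Re a - Re c| <= Num.max `|Re a - Re c| `|Im a - Im c| by rewrite le_max lexx.
have m2 : `|Im a - Im c| <= Num.max `|Re a - Re c| `|Im a - Im c| by rewrite le_max lexx orbT.
have := ler_distD (Re a) (Re z) (Re c); have := ler_distD (Im a) (Im z) (Im c).
by move=> h3 h4; apply/andP; split; lra.
Qed.

(* Bloch's argument: at a point maximizing (distance to the boundary) * |h'| the
   image contains a disc of comparable radius *)
Lemma bloch h c s t (r0 : R) l : hol h c s -> 0 < t -> t < s -> 0 <= r0 ->
  (forall p, exists2 v, cabs (v - p) <= r0 & forall z, sq c s z -> h z != v) ->
  cder h c l -> cabs l * t <= 32 * 32 * r0.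
Proof.
move=> hh t0 ts r00 om hl.
have hd := hol_cdrv hh.
pose H z := (t - msq c z)%:C%C * cdrv h z.
have cm z : ccont (fun z => (t - msq c z)%:C%C) z.
  move=> e e0; exists e => // w hw; rewrite -rmorphB cabsR; apply: le_lt_trans hw.
  by rewrite ler_norml; have := msq_lip c z w; have := msq_lip c w z; rewrite (cabsB z w) => q1 q2; apply/andP; split; lra.
have cs : csq c t c by apply: sq_csq; exact: sqxx.
have [||a ha hmax] := @clbd_max_cabs R (csq c t) H (clbd_rect _ _ _ _).
- by exists c.
- by move=> z hz; apply: ccontM => //; apply: cdif_cont; apply: hd; apply: csq_sq hz.
have mc : msq c c = 0 by rewrite /msq !subrr normr0 maxxx.
have hc := hmax c cs; rewrite /H mc subr0 !cabsM !cabsR (gtr0_norm t0) (cdrv_eq hl) in hc.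
have ma : msq c a <= t by apply/msqP.
rewrite (ger0_norm (x := t - msq c a)) ?subr_ge0 // in hc.
move: hc; move rhoE : (t - msq c a) => rho; move DE : (cabs (cdrv h a)) => D hc.
have D0 : 0 <= D by rewrite -DE; exact: cabs_ge0.
have rho0' : 0 <= rho by rewrite -rhoE subr_ge0.
rewrite mulrC; apply: (le_trans hc).
have [rE|rn] := eqVneq rho 0; first by rewrite rE mul0r; apply: mulr_ge0.
have rho0 : 0 < rho by rewrite lt0r rn.
have sub1 z : sq a (rho / 2) z -> csq c t z /\ rho / 2 <= t - msq c z.
  move=> /(msq_sq_shift c) q; split; last by lra.
  by apply/msqP; lra.
have subs z : sq a (rho / 2) z -> sq c s z by move=> /sub1 [q _]; apply: csq_sq q.
(* On the square of half-side rho / 2 about a the distance to the sides is still at least rho / 2,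
   so maximality at a bounds |h'| by twice its value at a. *)
have D2 z : sq a (rho / 2) z -> cabs (cdrv h z) <= 2 * D.
  move=> /sub1 [q1 q2]; have := hmax z q1; rewrite /H !cabsM !cabsR DE rhoE.
  rewrite (ger0_norm (x := t - msq c z)); last by lra.
  rewrite (ger0_norm rho0') => q3.
  have q4 : rho / 2 * cabs (cdrv h z) <= rho * D.
    by apply: le_trans q3; rewrite ler_wpM2r ?cabs_ge0.
  have : rho / 2 * cabs (cdrv h z) <= rho / 2 * (2 * D).
    have -> : rho / 2 * (2 * D) = rho * D by field.
    exact: q4.
  by rewrite ler_pM2l // divr_gt0.
have hda : hol (cdrv h) a (rho / 2) by move=> z /subs; exact: hd.
have [|||lip _] := @cauchy_lip R (cdrv h) a (rho / 2) (rho / 4) (2 * D) hda; [lra|lra|exact: D2|].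
(* With this radius the Cauchy estimate for h' leaves an oscillation of at most D / 4 on the square
   where h is compared with its affine part. *)
pose tau := rho / 16 / 16.
have tau0 : 0 < tau by rewrite !divr_gt0.
have tr : rho = 256 * tau by rewrite /tau; field.
have B z : sq a (2 * tau) z -> cabs (cdrv h z - cdrv h a) <= D / 4.
  move=> hz; have z1 : csq a (rho / 4) z by apply: sq_csq; apply: sq_sub hz; lra.
  apply: (le_trans (lip z z1)).
  have : cabs (z - a) <= 4 * tau by have := sq_sub_cball hz; rewrite /cball /mkset; lra.
  move=> q; have -> : D / 4 = 2 * (2 * D) / (rho / 4) * (4 * tau) by rewrite tr; field; rewrite gt_eqF.
  by rewrite ler_wpM2l // !mulr_ge0 ?invr_ge0 ?mulr_ge0 // ltW.
have app z : sq a (2 * tau) z -> cabs (h z - h a - cdrv h a * (z - a)) <= D / 2 * cabs (z - a).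
  move=> hz.
  have dr v : sq a (2 * tau) v -> cder (fun w => h w - cdrv h a * w) v (cdrv h v - cdrv h a).
    move=> hv; apply: cderB; first by apply: cdrvP; apply: hh; apply: subs; apply: sq_sub hv; lra.
    by have := cderZ (cdrv h a) (cder_id v); rewrite mulr1.
  have := @mean_value _ _ a (2 * tau) (D / 4) a z dr B (sqxx a _) hz.
  have -> : h z - cdrv h a * z - (h a - cdrv h a * a) = h z - h a - cdrv h a * (z - a) by ring.
  by have -> : 2 * (D / 4) = D / 2 by [field]; apply; rewrite mulr_gt0.
(* The omitted value nearest to h(a). If r0 < D tau / 4, then |h - v| is larger on the sides of the
   small square than at its centre, which contradicts the maximum bound for 1/(h - v). The opposite
   inequality, with rho = 256 tau, is the claim. *)
have [v hv1 hv2] := om (h a).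
have [lt|ge] := ltP r0 (D * tau / 4); last by rewrite tr; lra.
have low z : bsq a tau z -> D * tau / 2 - r0 <= cabs (h z - v).
  move=> bz; have q1 := bsq_dist bz.
  have hz : sq a (2 * tau) z by apply: (@csq_sq _ _ _ tau); [lra|case: bz].
  have q2 := app z hz.
  have q3 : cabs (cdrv h a * (z - a)) <= cabs (h z - v) + r0 + D / 2 * cabs (z - a).
    have -> : cdrv h a * (z - a) = (h z - v) + (v - h a) - (h z - h a - cdrv h a * (z - a)) by ring.
    by apply: (le_trans (cabsD _ _)); rewrite cabsN; have := cabsD (h z - v) (v - h a); lra.
  rewrite cabsM DE in q3.
  have q4 : D / 2 * tau <= D / 2 * cabs (z - a) by rewrite ler_wpM2l // divr_ge0.
  have : D * cabs (z - a) = D / 2 * cabs (z - a) + D / 2 * cabs (z - a) by field.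
  have : D * tau / 2 = D / 2 * tau by ring.
  lra.
have hi : hol (fun z => (h z - v)^-1) a (2 * tau).
  move=> z hz; have zs : sq c s z by apply: subs; apply: sq_sub hz; lra.
  by apply: cdifV; [rewrite subr_eq0; exact: hv2 | apply: cdifB; [exact: hh | exact: cdif_cst]].
have m0 : 0 < D * tau / 2 - r0 by have : D * tau / 2 = D * tau / 4 + D * tau / 4 by [field]; have := cabs_ge0 (v - h a); lra.
have := @weak_max R _ a (2 * tau) tau (D * tau / 2 - r0)^-1 a hi tau0.
have hav : 0 < cabs (h a - v) by apply: cabs_gt0; rewrite subr_eq0; apply: hv2; apply: csq_sq ha.
have -> : tau < 2 * tau by lra.
move=> /(_ isT) W; have : cabs (h a - v)^-1 <= (D * tau / 2 - r0)^-1.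
  apply: W; last by apply: sq_csq; exact: sqxx.
  by move=> z bz; have q := low z bz; rewrite cabsV lef_pV2 // posrE; lra.
rewrite cabsV lef_pV2 ?posrE // cabsB => q; rewrite tr.
have : D * tau / 2 = D * tau / 4 + D * tau / 4 by field.
lra.
Qed.

(** On the circle of radius exp(Re p) about w0 some value is omitted; its logarithm with argument
    within pi of Im p is omitted by h. So h omits a value within pi of every point of the plane, and
    Bloch's argument bounds h'. *)
Lemma omit_circles_log h c s (g : C -> C) w0 : hol h c s -> (forall z, sq c s z -> cexp (h z) = g z - w0) ->
  (forall r : R, 0 < r -> exists2 p, cabs (p - w0) = r & forall z, sq c s z -> g z != p) ->
  forall z, sq c (s / 3) z -> cabs (h z - h c) <= 64 * 64 * pi.
Proof.
move=> hh eh om.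
have om' p : exists2 v, cabs (v - p) <= pi & forall z, sq c s z -> h z != v.
  have [u hu1 hu2] := om (expR (Re p)) (expR_gt0 _).
  have u0 : u - w0 != 0 by apply/eqP => e; have := expR_gt0 (Re p); rewrite -hu1 e cabs0 ltxx.
  have [th hth E] := polar_near (Im p) u0; rewrite hu1 expRK in E.
  exists (Re p +i* th)%C.
    have -> : (Re p +i* th)%C - p = 'i%C * (th - Im p)%:C%C.
      by case: p {om hu1 E hth} => x y; apply/eqP; rewrite eq_complex /=; apply/andP; split; apply/eqP; ring.
    by rewrite cabsM cabsi mul1r cabsR.
  move=> z hz; apply/eqP => hE; have := hu2 z hz; apply/negP/negPn/eqP.
  by apply: (addIr (- w0)); rewrite -eh // hE -E.
move=> z hz; have s0 : 0 < s by have := sq_pos hz; lra.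
(* The bound is the one of [bloch] with r0 = pi and t = s / 2. *)
have db v : sq c (s / 3) v -> cabs (cdrv h v) <= 64 * 32 * pi / s.
  move=> hv.
  have sub w : sq v (2 * s / 3) w -> sq c s w.
    by move=> /(msq_sq_shift c) q; apply/msq_sq; move/msq_sq: hv; move: q; have := s0; lra.
  have hvs : hol h v (2 * s / 3) by move=> w /sub; exact: hh.
  have := @bloch h v (2 * s / 3) (s / 2) pi (cdrv h v) hvs.
  rewrite ler_pdivlMr // => B.
  have : cabs (cdrv h v) * (s / 2) <= 32 * 32 * pi.
    apply: B; [lra|lra|exact: pi_ge0| |].
      by move=> p; have [v' v1 v2] := om' p; exists v' => // w /sub; exact: v2.
    by apply: cdrvP; apply: hh; apply: sq_sub hv; lra.
  lra.
have dr v : sq c (s / 3) v -> cder h v (cdrv h v).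
  by move=> hv; apply: cdrvP; apply: hh; apply: sq_sub hv; lra.
have s30 : 0 < s / 3 by rewrite divr_gt0.
apply: (le_trans (mean_value dr db (sqxx c s30) hz)).
have q : cabs (z - c) <= s by have := sq_sub_cball hz; rewrite /cball /mkset; lra.
have -> : 64 * 64 * pi = 2 * (64 * 32 * pi / s) * s by field; rewrite gt_eqF.
by rewrite ler_wpM2l // !mulr_ge0 ?invr_ge0 ?pi_ge0 // ltW.
Qed.

(** The Harnack constant: the bound of [omit_circles_log] on the logarithm, exponentiated. Only its
    universality matters. *)
Definition KH : R := expR (64 * 64 * pi).

Lemma KH_ge1 : 1 <= KH.
Proof. by rewrite -expR0 ler_expR; have := pi_ge0 R; lra. Qed.

(** A point outside the hull is surrounded on every circle by points outside V, which g omits; so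
    the logarithm of g - w0 satisfies [omit_circles_log]. The radius 3 s / 4 is what remains after
    taking the logarithm, and its third is s / 4. *)
Lemma hull_harnack V g c s w0 z : open V -> ~ hull V w0 -> hol g c s -> (forall z, sq c s z -> V (g z)) ->
  sq c (s / 4) z -> cabs (g z - w0) <= KH * cabs (g c - w0) /\ cabs (g c - w0) <= KH * cabs (g z - w0).
Proof.
move=> oV nh hg gV hz; have s0 : 0 < s by have := sq_pos hz; lra.
have hgw : hol (fun z => g z - w0) c s by move=> x /hg h; apply: cdifB => //; exact: cdif_cst.
have g0 x : sq c s x -> g x - w0 != 0.
  by move=> /gV h; rewrite subr_eq0; apply/eqP => e; apply: nh; apply: sub_hull => //; rewrite -e.
have t0 : 0 < 3 * s / 4 by lra.
have ts : 3 * s / 4 < s by lra.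
have [h hh eh] := hol_log hgw g0 t0 ts.
have sub x : sq c (3 * s / 4) x -> sq c s x by apply: sq_sub; lra.
have := @omit_circles_log h c (3 * s / 4) g w0 hh eh.
have -> : 3 * s / 4 / 3 = s / 4 by field.
move=> /(_ _ z hz) B.
have {}B : cabs (h z - h c) <= 64 * 64 * pi.
  apply: B => r r0; have [p hp1 hp2] := hull_circle r0 nh.
  by exists p => // x /sub /gV hx; apply/eqP => e; apply: hp2; rewrite -e.
have hz' : sq c (3 * s / 4) z by apply: sq_sub hz; lra.
have hc' : sq c (3 * s / 4) c by exact: sqxx.
rewrite -!eh // !cabs_cexp /KH -!expRD !ler_expR.
have := Re_le_cabs (h z - h c); rewrite ReB.
have := ler_norm (Re (h z) - Re (h c)); have := ler_norm (Re (h c) - Re (h z)); rewrite (distrC (Re (h c))).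
by move=> q1 q2 q3; split; lra.
Qed.

(* Schwarz's lemma for the Cayley transform of a logarithm of [g] *)
Lemma log_harnack g c s z : hol g c s -> (forall z, sq c s z -> 1 < cabs (g z)) -> sq c (s / 12) z ->
  ln (cabs (g z)) <= 3 * ln (cabs (g c)) /\ ln (cabs (g c)) <= 3 * ln (cabs (g z)).
Proof.
move=> hg g1 hz; have s0 : 0 < s by have := sq_pos hz; lra.
have g0 x : sq c s x -> g x != 0.
  by move=> /g1 h; apply/eqP => e; rewrite e cabs0 in h; lra.
have t0 : 0 < 2 * s / 3 by lra.
have ts : 2 * s / 3 < s by lra.
have [h hh eh] := hol_log hg g0 t0 ts.
have reh x : sq c (2 * s / 3) x -> Re (h x) = ln (cabs (g x)) /\ 0 < Re (h x).
  move=> hx; rewrite -eh // cabs_cexp expRK; split => //.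
  have : 1 < cabs (g x) by apply: g1; apply: sq_sub hx; lra.
  by rewrite -eh // cabs_cexp expR_gt1.
have hc : sq c (2 * s / 3) c by exact: sqxx.
have hz' : sq c (2 * s / 3) z by apply: sq_sub hz; lra.
(* The map u -> (u - h(c)) / (u + conj h(c)) sends the right half-plane to the unit disc and h(c) to
   0. *)
pose k := conjc (h c).
have rk : Re k = Re (h c) /\ Im k = - Im (h c) by rewrite /k; case: (h c).
have nz x : sq c (2 * s / 3) x -> h x + k != 0.
  move=> /reh [_ p1]; have [_ p2] := reh c hc; apply/eqP => /(congr1 (@complex.Re R)).
  by rewrite ReD rk.1 /=; lra.
pose phi x := (h x - h c) / (h x + k).
have hphi : hol phi c (2 * s / 3).
  move=> x hx; apply: cdif_div; first exact: nz.
    by apply: cdifB; [exact: hh | exact: cdif_cst].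
  by apply: cdifD; [exact: hh | exact: cdif_cst].
have le1 x : sq c (2 * s / 3) x -> cabs (phi x) <= 1.
  move=> hx; have [_ p1] := reh x hx; have [_ p2] := reh c hc.
  rewrite cabsf ler_pdivrMr ?cabs_gt0 ?nz // mul1r -(@ler_pXn2r _ 2) ?nnegrE ?cabs_ge0 // !cabs_sqr.
  rewrite !ReB !ImB !ReD !ImD rk.1 rk.2.
  rewrite lerD2r -subr_ge0.
  have -> : (Re (h x) + Re (h c)) ^+ 2 - (Re (h x) - Re (h c)) ^+ 2 = 4 * (Re (h x) * Re (h c)) by ring.
  by rewrite !mulr_ge0 // ltW.
have [q [hq eq _]] := divdiff hphi hc.
have phic : phi c = 0 by rewrite /phi subrr mul0r.
have qb : cabs (q z) <= (s / 3)^-1.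
  have s30 : 0 < s / 3 by lra.
  apply: (@weak_max R q c (2 * s / 3) (s / 3)) => //; [lra| |by apply: sq_csq; apply: sq_sub hz; lra].
  move=> w wb; have wc := bsq_dist wb; have wc0 : 0 < cabs (w - c) by lra.
  have w0 : w - c != 0 by apply/eqP => e; rewrite e cabs0 ltxx in wc0.
  have -> : q w = phi w / (w - c) by rewrite (eq w) phic add0r mulrAC mulfV // mul1r.
  rewrite cabsf -[X in _ <= X]mul1r; apply: ler_pM; rewrite ?cabs_ge0 ?invr_ge0 ?cabs_ge0 //.
    by apply: le1; apply: (@csq_sq _ _ _ (s / 3)); [lra|case: wb].
  by rewrite lef_pV2 // posrE.
(* Schwarz's lemma on the square of half-side s / 3 gives (s / 6) / (s / 3); the factor 3 of the
   conclusion is (1 + 1/2) / (1 - 1/2). *)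
have pz : cabs (phi z) <= 1 / 2.
  rewrite (eq z) phic add0r cabsM.
  have q1 : cabs (z - c) <= s / 6 by have := sq_sub_cball hz; rewrite /cball /mkset; lra.
  have -> : 1 / 2 = s / 6 * (s / 3)^-1 :> R by field; rewrite gt_eqF.
  by apply: ler_pM; rewrite ?cabs_ge0.
have [e1 p1] := reh z hz'; have [e2 p2] := reh c hc.
rewrite -e1 -e2.
have : cabs (h z - h c) <= 1 / 2 * cabs (h z + k).
  have -> : h z - h c = phi z * (h z + k) by rewrite /phi divfK // nz.
  by rewrite cabsM ler_wpM2r ?cabs_ge0.
rewrite -(@ler_pXn2r _ 2) ?nnegrE ?mulr_ge0 ?cabs_ge0 // exprMn !cabs_sqr.
rewrite !ReB !ImB !ReD !ImD rk.1 rk.2 => q3.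
have q4 : (2 * (Re (h z) - Re (h c))) ^+ 2 <= (Re (h z) + Re (h c)) ^+ 2.
  have := sqr_ge0 (Im (h z) - Im (h c)).
  have -> : (2 * (Re (h z) - Re (h c))) ^+ 2 = 4 * (Re (h z) - Re (h c)) ^+ 2 by ring.
  by move: q3; have -> : (1 / 2) ^+ 2 = 1 / 4 :> R by [field]; lra.
have : `|2 * (Re (h z) - Re (h c))| <= Re (h z) + Re (h c).
  rewrite -(@ler_pXn2r _ 2) ?nnegrE // ?real_normK ?num_real //; lra.
by rewrite ler_norml => /andP[h1 h2]; split; lra.
Qed.

End ExpLog.

(** * Entire functions: open mapping, maximum modulus, transcendental growth *)

Section EntireFunctions.
Variable R : realType.
Local Notation C := (R[i]).
Local Notation Re := complex.Re.
Local Notation Im := complex.Im.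
Implicit Types (z w a b c l v : C) (f g h q : C -> C) (s t r : R).

Definition ent f := forall z, cdif f z.

Lemma entire_ent f : entire f -> ent f.
Proof. by move=> h z; apply: derivable_cdif; exact: h. Qed.

Lemma ent_hol f c s : ent f -> hol f c s. Proof. by move=> h z _; exact: h. Qed.

Lemma ent_cont f z : ent f -> ccont f z. Proof. by move=> h; exact: cdif_cont. Qed.

Lemma ent_divdiff f a : ent f -> exists2 q, ent q & forall z, f z = f a + (z - a) * q z.
Proof.
move=> hf; have [q [hq eq _]] := divdiff (@ent_hol f a 1 hf) (sqxx a ltr01).
exists q => // z; have [->|za] := eqVneq z a; first by apply: hq; exact: sqxx.
have r0 : 0 < cabs (z - a) by apply: cabs_gt0; rewrite subr_eq0.
apply: (cdif_ext r0 (g := fun w => (f w - f a) * (w - a)^-1)).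
  move=> w hw; have wa : w - a != 0.
    by rewrite subr_eq0; apply/eqP => e; move: hw; rewrite /cball /mkset e cabsB ltxx.
  by rewrite (eq w); field.
apply: cdif_div; first by rewrite subr_eq0.
  by apply: cdifB => //; exact: cdif_cst.
by apply: cdifB; [exact: cdif_id | exact: cdif_cst].
Qed.

Lemma le_half_pow (x M : R) : (forall k : nat, x <= M * 2^-1 ^+ k) -> x <= 0.
Proof.
move=> h; rewrite leNgt; apply/negP => x0.
have M0 : 0 < M by have := h 0%N; rewrite expr0 mulr1; lra.
have [m hm] := small_inv (divr_gt0 x0 M0).
have := hm m (leqnn m); rewrite ltr_pdivlMr // => h1.
have h2 : (2 : R)^-1 ^+ m <= m.+1%:R^-1.
  by rewrite exprVn lef_pV2 ?posrE ?exprn_gt0 // -natrX ler_nat; exact: ltn_expl.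
have h3 : M * 2^-1 ^+ m <= M * m.+1%:R^-1 by rewrite ler_pM2l.
rewrite mulrC in h1; have := h m; move: h1 h3; set p := M * _^-1; set q := M * _; lra.
Qed.

(** If division by z - a never stopped, the maximum bound on a square of half-side T would give
    |g(z)| at most a constant times (|z - a| / T)^k for all k. *)
Lemma zero_order g a : ent g -> (exists z, g z != 0) ->
  exists k h, [/\ ent h, h a != 0 & forall z, g z = (z - a) ^+ k * h z].
Proof.
move=> hg [z gz]; apply: contrapT => hn.
have H k : exists2 h, ent h & forall z, g z = (z - a) ^+ k * h z.
  elim: k => [|k [h hh eh]]; first by exists g => // x; rewrite expr0 mul1r.
  have ha : h a = 0 by apply/eqP; apply: contrapT => /negP h0; apply: hn; exists k, h.
  have [q hq eq] := ent_divdiff a hh; exists q => // x.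
  by rewrite eh (eq x) ha add0r exprSr mulrA.
(* Makes |z - a| / T at most 1/2. *)
pose T := 2 * cabs (z - a) + 1.
have ca := cabs_ge0 (z - a).
have T0 : 0 < T by rewrite /T; lra.
have [||m _ hm] := @clbd_max_cabs R (csq a T) g (clbd_rect _ _ _ _).
- by exists a; apply: sq_csq; exact: sqxx.
- by move=> x _; exact: ent_cont.
have : cabs (g z) <= 0; last by have := cabs_gt0 gz; lra.
apply: (@le_half_pow _ (cabs (g m))) => k.
have [h hh eh] := H k.
have hz : csq a T z by apply: sq_csq; apply: cball_sub_sq; rewrite /cball /mkset /T; lra.
have T2 : T < T + 1 by lra.
have B : cabs (h z) <= cabs (g m) / T ^+ k.
  apply: (@weak_max R h a (T + 1) T _ z (@ent_hol h a (T + 1) hh) T0 T2 _ hz) => w wb; have wd := bsq_dist wb.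
  rewrite ler_pdivlMr ?exprn_gt0 //; apply: (@le_trans _ _ (cabs (g w))); last by apply: hm; case: wb.
  rewrite eh cabsM cabsX mulrC ler_wpM2r ?cabs_ge0 //.
  by rewrite lerXn2r // nnegrE; lra.
rewrite eh cabsM cabsX; apply: (@le_trans _ _ (cabs (z - a) ^+ k * (cabs (g m) / T ^+ k))).
  by rewrite ler_wpM2l ?exprn_ge0.
have -> : cabs (z - a) ^+ k * (cabs (g m) / T ^+ k) = cabs (g m) * (cabs (z - a) / T) ^+ k.
  by rewrite expr_div_n; ring.
rewrite ler_wpM2l ?cabs_ge0 //; apply: lerXn2r; rewrite ?nnegrE ?invr_ge0 //; first by rewrite divr_ge0 // ltW.
by rewrite ler_pdivrMr // /T; lra.
Qed.

(** On a small square f - f(a) is at least m on the sides. A value w omitted within m / 2 of f(a)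
    would make 1/(f - w) larger at the centre than on the sides. *)
Lemma open_map_ent f : ent f -> (exists z, f z != f 0) -> open_map f.
Proof.
move=> hf [z1 hz1] U oU; apply/openCP => _ [a Ua <-].
have hg : ent (fun z => f z - f a) by move=> z; apply: cdifB => //; exact: cdif_cst.
have [|k [h [hh ha eh]]] := zero_order a hg.
  have [e|ne] := eqVneq (f z1) (f a); last by exists z1; rewrite subr_eq0.
  by exists 0; rewrite subr_eq0 -e eq_sym.
have /openCP /(_ a Ua) [r1 r10 hr1] := oU.
have ha0 := cabs_gt0 ha.
have e0 : 0 < cabs (h a) / 2 by rewrite divr_gt0.
have [r2 r20 hr2] := ent_cont a hh e0.
pose t := Num.min r1 r2 / 4.
have m0 : 0 < Num.min r1 r2 by rewrite lt_min r10.
have t0 : 0 < t by rewrite divr_gt0.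
have sub z : sq a (2 * t) z -> cball a r1 z /\ cball a r2 z.
  move=> /sq_sub_cball; rewrite /cball /mkset.
  have -> : 2 * (2 * t) = Num.min r1 r2 by rewrite /t; field.
  by rewrite lt_min => /andP[].
pose m := t ^+ k * (cabs (h a) / 2).
have mp : 0 < m by rewrite mulr_gt0 // exprn_gt0.
exists (m / 2); first by rewrite divr_gt0.
move=> w hw; apply: contrapT => nw.
have om z : sq a (2 * t) z -> f z - w != 0.
  move=> /sub [/hr1 Uz _]; rewrite subr_eq0; apply/eqP => e; apply: nw; by exists z.
have hi : hol (fun z => (f z - w)^-1) a (2 * t).
  by move=> z hz; apply: cdifV; [exact: om | apply: cdifB => //; exact: cdif_cst].
have tt : t < 2 * t by lra.
have B := @weak_max R _ a (2 * t) t (m / 2)^-1 a hi t0 tt.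
have hwm : cabs (f a - w) < m / 2 by rewrite cabsB.
have : cabs (f a - w)^-1 <= (m / 2)^-1.
  apply: B; last by apply: sq_csq; exact: sqxx.
  move=> z bz; have hz : sq a (2 * t) z by apply: (@csq_sq _ _ _ t) => //; case: bz.
  rewrite cabsV lef_pV2 ?posrE ?divr_gt0 ?cabs_gt0 ?om //.
  have q1 : m <= cabs (f z - f a).
    rewrite eh cabsM cabsX /m; apply: ler_pM; first by rewrite exprn_ge0 // ltW.
    - exact: ltW e0.
    - by apply: lerXn2r; rewrite ?nnegrE ?cabs_ge0 ?(ltW t0) //; exact: bsq_dist.
    have [_ /hr2 q] := sub z hz; have := cabsDB (h a) (h z); rewrite (cabsB (h a) (h z)); lra.
  have := cabs_tri w (f z) (f a); rewrite (cabsB w (f a)); lra.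
rewrite cabsV lef_pV2 ?posrE ?divr_gt0 ?cabs_gt0 ?om //; last exact/sqxx/mulr_gt0.
by rewrite leNgt hwm.
Qed.

Lemma open_bigger (V : set C) v : open V -> V v -> exists2 v', V v' & cabs v < cabs v'.
Proof.
move=> /openCP oV /oV [r r0 hr].
have [v0|v0] := eqVneq v 0.
  exists (r / 2)%:C%C; last by rewrite v0 cabs0 cabsR normr_gt0 gt_eqF // divr_gt0.
  by apply: hr; rewrite /cball /mkset v0 subr0 cabsR gtr0_norm ?divr_gt0 //; lra.
have c0 := cabs_gt0 v0.
pose k : R := 1 + r / 2 / cabs v.
have k1 : 1 < k by rewrite ltrDl !divr_gt0.
exists (k%:C%C * v); last by rewrite cabsM cabsR gtr0_norm ?ltr_pMl //; lra.
apply: hr; rewrite /cball /mkset; have -> : k%:C%C * v - v = (k - 1)%:C%C * v by rewrite rmorphB rmorph1; ring.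
rewrite cabsM cabsR gtr0_norm ?subr_gt0 //.
have -> : (k - 1) * cabs v = r / 2 by rewrite /k; field; rewrite gt_eqF.
lra.
Qed.

(** Formulated for continuous open maps, a class that contains all iterates of f at once; openness
    also makes the inequality strict. *)
Lemma max_principle f (U : set C) z : (forall z, ccont f z) -> open_map f -> open U -> bounded U -> U z ->
  exists2 b, boundary U b & cabs (f z) < cabs (f b).
Proof.
move=> cf of_ oU bU Uz.
have [||m Km hm] := @clbd_max_cabs R (closure U) f (closed_closure_bd bU).
- by exists z; apply: subset_closure.
- move=> x _; exact: cf.
have big x : U x -> exists2 y, U y & cabs (f x) < cabs (f y).
  move=> Ux; have [|_ [y Uy <-] h] := @open_bigger (f @` U) (f x) (of_ _ oU); first by exists x.
  by exists y.
have [Um|bm] := closure_open_boundary oU Km.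
  have [y Uy h] := big m Um; have h2 := hm y (subset_closure Uy); lra.
have [y Uy h] := big z Uz; have h2 := hm y (subset_closure Uy).
by exists m; [exact: bm | lra].
Qed.

Lemma ent_iter f n : ent f -> ent (iter n f).
Proof. by move=> hf; elim: n => [|n ih] z; [exact: cdif_id | apply: (cdif_comp (ih z)); exact: hf]. Qed.

Lemma open_map_iter f n : open_map f -> open_map (iter n f).
Proof.
move=> hf; elim: n => [|n ih] U oU.
  by have -> : [set iter 0 f x | x in U] = U by apply/seteqP; split => [_ [x Ux <-]//|x Ux]; exists x.
have -> : [set iter n.+1 f x | x in U] = f @` (iter n f @` U).
  apply/seteqP; split => [_ [x Ux <-]|_ [_ [x Ux <-] <-]]; last by exists x.
  by exists (iter n f x) => //; exists x.
by apply: hf; exact: ih.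
Qed.

Lemma maxmodP f r : (forall z, ccont f z) -> 0 <= r ->
  (exists2 z, cabs z = r & maxmod f r = cabs (f z)) /\ (forall w, cabs w = r -> cabs (f w) <= maxmod f r).
Proof.
move=> cf r0.
have K : clbd [set z : C | cabs z = r].
  by have := clbd_circle (0 : C) r; congr clbd; apply/seteqP; split => z /=; rewrite subr0.
have [||m Km hm] := @clbd_max_cabs R _ f K.
- by exists r%:C%C; rewrite /= cabsR ger0_norm.
- by move=> z _.
have E : maxmod f r = cabs (f m).
  apply/eqP; rewrite eq_le; apply/andP; split.
    by apply: ge_sup; [exists (cabs (f m)), m | move=> _ [w hw <-]; exact: hm].
  apply: ub_le_sup; last by exists m.
  by exists (cabs (f m)) => _ [w hw <-]; exact: hm.
by split; [exists m | move=> w hw; rewrite E; exact: hm].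
Qed.

Lemma maxmod_ge0 f r : (forall z, ccont f z) -> 0 <= r -> 0 <= maxmod f r.
Proof. by move=> cf r0; have [[z _ ->] _] := maxmodP cf r0; exact: cabs_ge0. Qed.

Lemma maxmod_lt f r z : (forall z, ccont f z) -> open_map f -> cabs z < r -> cabs (f z) < maxmod f r.
Proof.
move=> cf of_ zr; have r0 : 0 <= r by apply: ltW; apply: le_lt_trans zr; exact: cabs_ge0.
have zU : cball 0 r z by rewrite /cball /mkset subr0.
have [b /boundary_cball hb h] := max_principle cf of_ (@open_cball R 0 r) (bounded_cball 0 r) zU.
by rewrite subr0 in hb; apply: (lt_le_trans h); have [_] := maxmodP cf r0; apply.
Qed.

Lemma maxmod_ge f r z : (forall z, ccont f z) -> open_map f -> cabs z <= r -> cabs (f z) <= maxmod f r.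
Proof.
move=> cf of_; rewrite le_eqVlt => /orP[/eqP <-|h]; last by apply: ltW; exact: maxmod_lt.
by have [_] := maxmodP cf (cabs_ge0 z); apply.
Qed.

Lemma maxmod_mono f r r' : (forall z, ccont f z) -> open_map f -> 0 <= r -> r < r' -> maxmod f r < maxmod f r'.
Proof. by move=> cf of_ r0 rr; have [[z hz ->] _] := maxmodP cf r0; apply: maxmod_lt => //; rewrite hz. Qed.

Lemma maxmod_mono_le f r r' : (forall z, ccont f z) -> open_map f -> 0 <= r -> r <= r' -> maxmod f r <= maxmod f r'.
Proof. by move=> cf of_ r0; rewrite le_eqVlt => /orP[/eqP -> //|h]; apply: ltW; exact: maxmod_mono. Qed.

(** Covers constants too, since the Taylor remainder to which it is applied can be constant. *)
Lemma maxmod_mono_ent h r r' : ent h -> 0 <= r -> r <= r' -> maxmod h r <= maxmod h r'.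
Proof.
move=> hh r0 rr; have ch z : ccont h z by exact: ent_cont.
have [nc|c] := pselect (exists z, h z != h 0).
  by apply: maxmod_mono_le => //; exact: open_map_ent.
have hc z : h z = h 0 by apply/eqP; apply: contrapT => /negP q; apply: c; exists z.
have r0' : 0 <= r' by exact: le_trans rr.
have [[z _ ->] _] := maxmodP ch r0; have [[w _ ->] _] := maxmodP ch r0'.
by rewrite (hc z) (hc w).
Qed.

Lemma taylor_split f k : ent f -> exists (p : {poly C}) h (B : R),
  [/\ ent h, forall z, f z = p.[z] + z ^+ k.+1 * h z, 0 <= B &
      forall z, 1 <= cabs z -> cabs p.[z] <= B * cabs z ^+ k].
Proof.
move=> hf; elim: k => [|k [p [h [B [hh eh B0 hB]]]]].
  have [q hq eq] := ent_divdiff 0 hf; exists (f 0)%:P, q, (cabs (f 0)); split => //.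
  - by move=> z; rewrite hornerC expr1 (eq z) subr0.
  - exact: cabs_ge0.
  - by move=> z _; rewrite hornerC expr0 mulr1.
have [q hq eq] := ent_divdiff 0 hh.
exists (p + h 0 *: 'X^(k.+1)), q, (B + cabs (h 0)); split => //.
- by move=> z; rewrite !hornerE_comm hornerXn eh (eq z) subr0 [z ^+ k.+2]exprSr; ring.
- by rewrite addr_ge0 ?cabs_ge0.
- move=> z z1; rewrite !hornerE_comm hornerXn; apply: (le_trans (cabsD _ _)); rewrite mulrDl cabsM cabsX lerD2r.
  apply: (le_trans (hB z z1)); rewrite ler_wpM2l //; exact: ler_weXn2l.
Qed.

(** Write f as a polynomial of degree at most d plus z^(d+1) h with h not identically 0. The maximum
    modulus of h does not decrease, so doubling s multiplies the main term by at least 2^(d+1), and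
    the spare factor 2 absorbs the polynomial. *)
Lemma transcendental_growth f d : ent f -> ~ (exists p : {poly C}, forall z, f z = p.[z]) ->
  exists2 S : R, 1 <= S & forall s, S <= s -> 2 ^+ d * maxmod f s <= maxmod f (2 * s) /\ s ^+ d <= maxmod f s.
Proof.
move=> hf nt.
have [p [h [B [hh eh B0 hB]]]] := taylor_split d hf.
have [z0 hz0] : exists z, h z != 0.
  apply: contrapT => hn; apply: nt; exists p => z; rewrite eh.
  have -> : h z = 0 by apply/eqP; apply: contrapT => /negP q; apply: hn; exists z.
  by rewrite mulr0 addr0.
have cf z : ccont f z by exact: ent_cont.
have ch z : ccont h z by exact: ent_cont.
pose c := cabs (h z0).
have c0 : 0 < c by exact: cabs_gt0.
have g0 := cabs_ge0 z0.
have q0 : 0 <= (4 * B + 1) / c by rewrite divr_ge0 // ?(ltW c0) //; lra.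
(* From this radius on, s c is at least 4 B + 1, which makes the main term dominate four times the
   polynomial bound. *)
exists (1 + cabs z0 + (4 * B + 1) / c); first by lra.
move=> s hs; have s1 : 1 <= s by lra.
have s0 : 0 <= s by lra.
have s2 : 0 <= 2 * s by lra.
have cs : 4 * B + 1 <= s * c by rewrite -ler_pdivrMr //; lra.
have hc : c <= maxmod h s.
  apply: (@le_trans _ _ (maxmod h (cabs z0))); last by apply: maxmod_mono_ent => //; lra.
  by have [_] := maxmodP ch g0; apply.
have up : maxmod f s <= B * s ^+ d + s ^+ d.+1 * maxmod h s.
  have [[z hz ->] _] := maxmodP cf s0; rewrite eh; apply: (le_trans (cabsD _ _)).
  rewrite cabsM cabsX hz; apply: lerD; first by rewrite -hz hB // hz.
  by rewrite ler_wpM2l ?exprn_ge0 //; have [_] := maxmodP ch s0; apply.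
have low r : 1 <= r -> r ^+ d.+1 * maxmod h r - B * r ^+ d <= maxmod f r.
  move=> r1; have r0 : 0 <= r by lra.
  have [[z hz ->] _] := maxmodP ch r0; have [_ /(_ z hz) q] := maxmodP cf r0.
  apply: le_trans q; rewrite eh.
  have := cabsDB (z ^+ d.+1 * h z) (- p.[z]); rewrite cabsN opprK addrC cabsM cabsX hz.
  have : cabs p.[z] <= B * r ^+ d by rewrite -hz hB // hz.
  by rewrite (addrC (z ^+ _ * _)); lra.
have sd : 0 <= s ^+ d by rewrite exprn_ge0.
have l1 := low s s1; have l2 := low (2 * s) ltac:(lra).
have mh : maxmod h s <= maxmod h (2 * s) by apply: maxmod_mono_ent => //; lra.
have key : 3 * (B * s ^+ d) + s ^+ d <= maxmod f s.
  apply: le_trans l1; rewrite exprS.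
  have : s * c * s ^+ d <= s * s ^+ d * maxmod h s.
    have -> : s * c * s ^+ d = s * s ^+ d * c by ring.
    by rewrite ler_wpM2l // mulr_ge0.
  have : (4 * B + 1) * s ^+ d <= s * c * s ^+ d by rewrite ler_wpM2r.
  have : (4 * B + 1) * s ^+ d = 4 * (B * s ^+ d) + s ^+ d by ring.
  lra.
have Bs : 0 <= B * s ^+ d by rewrite mulr_ge0.
split; last by lra.
apply: le_trans l2; rewrite exprMn exprS exprMn.
have h2 : 2 * 2 ^+ d * (s ^+ d.+1 * maxmod h s) <= 2 * 2 ^+ d * (s ^+ d.+1 * maxmod h (2 * s)).
  by rewrite ler_wpM2l ?mulr_ge0 ?exprn_ge0 // ler_wpM2l ?exprn_ge0.
have h3 : 2 ^+ d * maxmod f s <= 2 ^+ d * (2 * (s ^+ d.+1 * maxmod h s) - B * s ^+ d).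
  by rewrite ler_wpM2l ?exprn_ge0 //; lra.
have -> : 2 * 2 ^+ d * s ^+ d.+1 * maxmod h (2 * s) - B * (2 ^+ d * s ^+ d) =
   2 * 2 ^+ d * (s ^+ d.+1 * maxmod h (2 * s)) - 2 ^+ d * (B * s ^+ d) by ring.
have : 2 ^+ d * (2 * (s ^+ d.+1 * maxmod h s) - B * s ^+ d) = 2 * 2 ^+ d * (s ^+ d.+1 * maxmod h s) - 2 ^+ d * (B * s ^+ d) by ring.
lra.
Qed.

Lemma transcendental_nonconstant f : ~ (exists p : {poly C}, forall z, f z = p.[z]) -> exists z, f z != f 0.
Proof.
move=> nt; apply: contrapT => hn; apply: nt; exists (f 0)%:P => z; rewrite hornerC.
by apply/eqP; apply: contrapT => /negP q; apply: hn; exists z.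
Qed.

End EntireFunctions.

(** * Lifting functions continuous modulo 1; connected boundaries of hulls *)

Section Lifting.
Variable R : realType.
Local Notation C := (R[i]).
Local Notation Re := complex.Re.
Local Notation Im := complex.Im.
Implicit Types (z w a b c v : C) (t d : R).

Lemma int_small (x : R) : x \is a Num.int -> `|x| < 1 -> x = 0.
Proof.
move=> /intrP [m ->] h; apply/eqP; rewrite intr_eq0; apply: contrapT => /negP m0.
by move: h; rewrite -intr_norm ltNge ler1z -gtz0_ge1 normr_gt0 m0.
Qed.

Lemma cabs_le_coord z w : `|Re z| <= `|Re w| -> `|Im z| <= `|Im w| -> cabs z <= cabs w.
Proof.
move=> h1 h2; rewrite /cabs ler_sqrt ?addr_ge0 ?sqr_ge0 //.
by rewrite -(real_normK (num_real (Re z))) -(real_normK (num_real (Re w)))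
  -(real_normK (num_real (Im z))) -(real_normK (num_real (Im w))); apply: lerD; apply: lerXn2r; rewrite ?nnegrE.
Qed.

(** Continuity modulo 1 at the single scale d, with tolerance 1/8; no limit is taken in the
    arguments that use it. *)
Definition jump (mu : C -> R) d := forall z w, cabs (z - w) < d ->
  exists2 k : R, k \is a Num.int & `|mu z - mu w - k| < 1 / 8.

(** The plane is contracted to 0 by the retractions [p k] onto growing squares. Consecutive
    retractions move a point by less than d, so a lift of mu o p k determines one of mu o p (k+1) by
    choosing the nearby representative. *)
Lemma lift (mu : C -> R) d T : 0 < d -> jump mu d -> exists theta : C -> R,
  (forall z, csq 0 T z -> theta z - mu z \is a Num.int) /\
  (forall z w, csq 0 T z -> csq 0 T w -> cabs (z - w) < d -> `|theta z - theta w| < 1 / 8).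
Proof.
move=> d0 hj; pose e := d / 4.
have e0 : 0 < e by rewrite divr_gt0.
pose p (k : nat) z := cl 0 (k%:R * e) z.
have p_lip k z w : cabs (p k z - p k w) <= cabs (z - w).
  by apply: cabs_le_coord; rewrite !(ReB, ImB) /=; exact: clampR_lip.
have clampS (k : nat) x : `|clampR 0 (k.+1%:R * e) x - clampR 0 (k%:R * e) x| <= e.
  have ke : 0 <= k%:R * e by rewrite mulr_ge0 // ltW.
  have -> : k.+1%:R * e = k%:R * e + e by rewrite -natr1 mulrDl mul1r.
  move: (k%:R * e) ke e0 => m m0 {hj p p_lip}e0; rewrite /clampR ler_norml !minEle !maxEle.
  have q3 : 0 - (m + e) <= 0 + (m + e) by lra.
  have q5 : 0 - m <= 0 + m by lra.
  case: (leP (0 + (m + e)) x) => q1; case: (leP (0 + m) x) => q2; rewrite ?q3 ?q5; try lra;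
   case: (leP (0 - (m + e)) x) => q4; case: (leP (0 - m) x) => q6; apply/andP; split; lra.
have pS k z : cabs (p k.+1 z - p k z) < d.
  apply: (le_lt_trans (cabs_le_ReIm _)); rewrite ReB ImB /=.
  have := clampS k (Re z); have := clampS k (Im z); rewrite /e; lra.
have H k : exists t : C -> R, (forall z, t z - mu (p k z) \is a Num.int) /\
    (forall z w, cabs (z - w) < d -> `|t z - t w| < 1 / 8).
  elim: k => [|k [t [t1 t2]]].
    exists (fun=> mu 0); split; last by move=> *; rewrite subrr normr0; lra.
    move=> z; suff -> : p 0%N z = 0 by rewrite subrr rpred0.
    rewrite /p mul0r /cl /clampR !subr0 !addr0.
    have m0 (x : R) : Num.max 0 (Num.min 0 x) = 0 by apply/max_idPl; rewrite ge_min lexx.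
    by rewrite !m0.
  have st z : exists y, y - mu (p k.+1 z) \is a Num.int /\ `|y - t z| < 1 / 8.
    have [m mi hm] := hj _ _ (pS k z).
    exists (mu (p k.+1 z) + (t z - mu (p k z) - m)); split.
      by rewrite addrC addKr rpredB.
    by have -> : mu (p k.+1 z) + (t z - mu (p k z) - m) - t z = mu (p k.+1 z) - mu (p k z) - m by ring.
  have [t' ht'] := choice st.
  exists t'; split=> [z|z w hzw]; first by have [] := ht' z.
  have [a1 a2] := ht' z; have [b1 b2] := ht' w.
  have c1 := t2 _ _ hzw.
  have [m mi hm] := hj _ _ (le_lt_trans (p_lip k.+1 z w) hzw).
  (* An integer that is a sum of four terms each below 1/8 in modulus. *)
  have n0 : t' z - t' w - (mu (p k.+1 z) - mu (p k.+1 w)) + m = 0.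
    apply: int_small.
      have -> : t' z - t' w - (mu (p k.+1 z) - mu (p k.+1 w)) + m = (t' z - mu (p k.+1 z)) - (t' w - mu (p k.+1 w)) + m by ring.
      by rewrite rpredD // rpredB.
    have -> : t' z - t' w - (mu (p k.+1 z) - mu (p k.+1 w)) + m =
      (t' z - t z) - (t' w - t w) + (t z - t w) - (mu (p k.+1 z) - mu (p k.+1 w) - m) by ring.
    rewrite !ltr_norml in a2 b2 c1 hm *; move: a2 b2 c1 hm => /andP[? ?] /andP[? ?] /andP[? ?] /andP[? ?].
    by apply/andP; split; lra.
  by have -> : t' z - t' w = mu (p k.+1 z) - mu (p k.+1 w) - m by lra.
have [k hk] : exists k : nat, T <= k%:R * e.
  exists (Num.truncn (T / e)).+1; rewrite -ler_pdivrMr //; apply: ltW; exact: truncnS_gt.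
have [t [t1 t2]] := H k; exists t; split; last by move=> z w _ _; exact: t2.
move=> z hz; have := t1 z; suff -> : p k z = z by [].
by apply: cl_id; apply/csqP; move/csqP: hz => [h1 h2]; split; exact: le_trans hk.
Qed.

Lemma locconst (E : set C) (phi : C -> R) d : 0 < d -> connected E ->
  (forall z w, E z -> E w -> cabs (z - w) < d -> phi z = phi w) -> forall z w, E z -> E w -> phi z = phi w.
Proof.
move=> d0 cE h z w Ez Ew; apply: contrapT => ne.
have d20 : 0 < d / 2 by rewrite divr_gt0.
pose X1 := [set v | exists2 u, E u /\ phi u = phi z & cball u (d / 2) v].
pose X2 := [set v | exists2 u, E u /\ phi u <> phi z & cball u (d / 2) v].
have oX (P : C -> Prop) : open [set v | exists2 u, E u /\ P u & cball u (d / 2) v].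
  apply/openCP => v [u hu hv]; have /openCP /(_ v hv) [r r0 hr] := @open_cball R u (d / 2).
  by exists r => // x /hr hx; exists u.
have sub : E `<=` X1.
  apply: (@connected_open_sub _ E X1 X2) => //; [exact: oX | exact: oX | | |].
  - apply/seteqP; split => // v [Ev [[u [Eu u1] hu] [u' [Eu' u2] hu']]]; exfalso; apply: u2.
    rewrite -u1; apply: h => //; rewrite /cball /mkset in hu hu'.
    have := cabs_tri v u' u; rewrite (cabsB u' v); lra.
  - move=> v Ev; have [e|e] := pselect (phi v = phi z); [left|right]; exists v => //; exact: cballxx.
  - by exists z; split => //; exists z => //; exact: cballxx.
have [u [Eu eu] hu] := sub w Ew; apply: ne; rewrite -eu; apply: h => //.
by rewrite /cball /mkset in hu; rewrite cabsB; lra.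
Qed.

Lemma chain_const (K : set C) (phi : C -> R) d z w :
  (forall u v, K u -> K v -> cabs (u - v) < d -> phi u = phi v) -> chain K d z w -> phi w = phi z.
Proof.
move=> h; elim=> // u v hu <- Kv uv; apply: h => //; exact: chainK hu.
Qed.

(** The chain is stopped at its first point outside the disc of radius M, which one step cannot
    carry beyond M + d. *)
Lemma chain_exit (K : set C) d z w (M : R) : chain K d z w -> cabs z <= M -> M < cabs w -> 0 < d ->
  exists2 w', chain (K `&` [set v | cabs v < M + d]) d z w' & M < cabs w'.
Proof.
move=> ch zM Mw d0.
have H : (chain (K `&` [set v | cabs v < M + d]) d z w /\ cabs w <= M) \/
    exists2 w', chain (K `&` [set v | cabs v < M + d]) d z w' & M < cabs w'.
  elim: ch {Mw} => [Kz|u v hu ih Kv uv].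
    by left; split => //; apply: chain_refl; split => //=; lra.
  case: ih => [[ih1 ih2]|]; last by right.
  have hv : cabs v < M + d by have := cabsDB v u; lra.
  have hc : chain (K `&` [set v | cabs v < M + d]) d z v by apply: chain_step ih1 _ uv.
  by have [vM|vM] := leP (cabs v) M; [left | right; exists v].
by case: H => // -[_]; lra.
Qed.

Lemma convex_connected_set (E : set C) : (forall a b, E a -> E b -> csegment a b `<=` E) -> connected E.
Proof.
move=> h; have [[z0 hz0]|h0] := pselect (exists z, E z); last first.
  have -> : E = set0 by apply/seteqP; split => // z hz; apply: h0; exists z.
  exact: connected0.
have -> : E = \bigcup_(w in E) csegment z0 w.
  apply/seteqP; split => z; first by move=> hz; exists z => //; apply: csegmentr.
  by move=> [w hw]; apply: h.
apply: bigcup_connected; first by exists z0 => w _; apply: csegmentl.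
by move=> w _; apply: csegment_connected.
Qed.

(** The annulus is the image of a convex strip piece under the exponential. *)
Lemma annulus_connected (M M' : R) : 0 < M -> 0 < M' -> connected [set z : C | M < cabs z < M'].
Proof.
move=> M0 M0'.
have -> : [set z : C | M < cabs z < M'] = @cexp R @` [set z | ln M < Re z < ln M' /\ `|Im z| <= pi].
  apply/seteqP; split => z.
    move=> /= /andP[h1 h2]; have z0 : z != 0 by apply/eqP => e; rewrite e cabs0 in h1; lra.
    have cz : 0 < cabs z by exact: cabs_gt0.
    have [th hth E] := polar z0; exists (ln (cabs z) +i* th)%C => //=; split => //.
    by rewrite !ltr_ln ?posrE ?h1 ?h2.
  move=> [w [/andP[h1 h2] _] <-] /=; rewrite cabs_cexp.
  by apply/andP; split; [rewrite -[X in X < _]lnK ?posrE // ltr_expR | rewrite -[X in _ < X]lnK ?posrE // ltr_expR].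
apply: connected_continuous_connected; last first.
  by apply: continuous_subspaceT; apply/ccont_continuous => z; apply: cder_cont; exact: cder_cexp.
apply: convex_connected_set => a b [/andP[a1 a2] a3] [/andP[b1 b2] b3] _ [t /= ht <-].
move: ht; rewrite in_itv /= => /andP[t0 t1].
have cv (p q lo hi : R) : lo < p -> p < hi -> lo < q -> q < hi -> lo < p + t * (q - p) < hi.
  move=> h1 h2 h3 h4; have E : p + t * (q - p) = (1 - t) * p + t * q by ring.
  have [->|tn] := eqVneq t 0; first by rewrite mul0r addr0 h1.
  have tp : 0 < t by rewrite lt0r tn.
  have f1 : t * q < t * hi by rewrite ltr_pM2l.
  have f2 : t * lo < t * q by rewrite ltr_pM2l.
  have f3 : (1 - t) * p <= (1 - t) * hi by rewrite ler_wpM2l ?subr_ge0 // ltW.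
  have f4 : (1 - t) * lo <= (1 - t) * p by rewrite ler_wpM2l ?subr_ge0 // ltW.
  by rewrite E; apply/andP; split; lra.
have Rt : Re (a + t%:C%C * (b - a)) = Re a + t * (Re b - Re a).
  by rewrite ReD mulrC ReMr ReB mulrC.
have It : Im (a + t%:C%C * (b - a)) = Im a + t * (Im b - Im a).
  by rewrite ImD mulrC ImMr ImB mulrC.
split; first by rewrite Rt; exact: cv.
rewrite It; have -> : Im a + t * (Im b - Im a) = (1 - t) * Im a + t * Im b by ring.
apply: (le_trans (ler_normD _ _)); rewrite !normrM (ger0_norm t0) ger0_norm ?subr_ge0 //.
have f1 : t * `|Im b| <= t * pi by rewrite ler_wpM2l.
have f2 : (1 - t) * `|Im a| <= (1 - t) * pi by rewrite ler_wpM2l ?subr_ge0.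
lra.
Qed.

Definition cdist (A : set C) z : R := inf [set cabs (z - a) | a in A].

Lemma cdist_le (A : set C) z a : A a -> cdist A z <= cabs (z - a).
Proof. by move=> Aa; apply: ge_inf; [exists 0 => _ [b _ <-]; exact: cabs_ge0 | exists a]. Qed.

Lemma cdist_ge (A : set C) z (r : R) : A !=set0 -> (forall a, A a -> r <= cabs (z - a)) -> r <= cdist A z.
Proof. by move=> [a Aa] h; apply: lb_le_inf; [exists (cabs (z - a)), a | move=> _ [b Ab <-]; exact: h]. Qed.

Lemma cdist_lip (A : set C) z w : A !=set0 -> `|cdist A z - cdist A w| <= cabs (z - w).
Proof.
move=> A0; have H x y : cdist A x - cabs (x - y) <= cdist A y.
  by apply: cdist_ge => // a Aa; have := cdist_le x Aa; have := cabs_tri y x a; lra.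
by rewrite ler_norml; have := H z w; have := H w z; rewrite (cabsB w z) => h1 h2; apply/andP; split; lra.
Qed.

Lemma segment_meets_boundary (G : set C) z w : open G -> G z -> ~ G w ->
  exists2 b, boundary G b & cabs (z - b) <= cabs (z - w).
Proof.
move=> oG Gz nGw; apply: contrapT => hn; apply: nGw.
apply: (@connected_boundary_sub _ (csegment z w) G) => //; [exact: csegment_connected | | | exact: csegmentr].
  apply/seteqP; split => // b [[t /= ht <-] hb]; apply: hn; exists (z + t%:C%C * (w - z)) => //.
  move: ht; rewrite in_itv /= => /andP[t0 t1].
  have -> : z - (z + t%:C%C * (w - z)) = t%:C%C * (z - w) by ring.
  by rewrite cabsM cabsR ger0_norm // ler_piMl ?cabs_ge0.
by exists z; split => //; exact: csegmentl.
Qed.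

Lemma clbd_separated (A B : set C) : clbd A -> closed B -> A `&` B = set0 ->
  exists2 r : R, 0 < r & forall a b, A a -> B b -> r <= cabs (b - a).
Proof.
move=> cA cB AB; have [||r r0 hr] := clbd_lebesgue cA (U := ~` B).
- exact: closed_openC.
- by move=> a Aa Ba; have : (A `&` B) a by []; rewrite AB.
exists r => // a b Aa Bb; rewrite leNgt; apply/negP => h; exact: (hr a Aa b h).
Qed.

(* If the boundary of the filled set G split into two closed pieces A and B, the
   function equal to a bump (0 on A, 1 on B) inside G and to 0 outside would be
   continuous modulo 1, and its lift would differ by 1 between A and B, although
   the complement of G is chain connected. *)
Lemma boundary_hull_connected (V : set C) : open V -> connected V -> bounded V -> V !=set0 -> connected (boundary (hull V)).
Proof.
move=> oV cV bV V0; set G := hull V.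
have oG : open G by exact: open_hull.
have bG : bounded G by exact: hull_bounded.
have cG : connected G by exact: hull_connected.
apply: contrapT => /disconnectedP [X1 [X2 [u1 u2 d12 cov [n1 n2]]]].
have cb := clbd_boundary oG bG.
pose A := boundary G `&` X1; pose B := boundary G `&` X2.
have AE : A = boundary G `&` ~` X2.
  apply/seteqP; split => z [h1 h2]; split => //.
    by move=> h3; have : (X1 `&` X2) z by []; rewrite d12.
  by case: (cov z h1).
have BE : B = boundary G `&` ~` X1.
  apply/seteqP; split => z [h1 h2]; split => //.
    by move=> h3; have : (X1 `&` X2) z by []; rewrite d12.
  by case: (cov z h1).
have cA : clbd A.
  rewrite AE; apply: (clbd_sub _ cb); last exact: subIsetl.
  by apply: closedI; [case: cb | exact: open_closedC].
have cB : closed B by rewrite BE; apply: closedI; [case: cb | exact: open_closedC].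
have AB : A `&` B = set0.
  by apply/seteqP; split => // z [[_ h1] [_ h2]]; have : (X1 `&` X2) z by []; rewrite d12.
have [eta eta0 heta] := clbd_separated cA cB AB.
pose lam z := Num.min 1 (cdist A z / eta).
have lam_lip z w : `|lam z - lam w| <= cabs (z - w) / eta.
  have h : `|cdist A z / eta - cdist A w / eta| <= cabs (z - w) / eta.
    by rewrite -mulrBl normrM (gtr0_norm (x := eta^-1)) ?invr_gt0 // ler_wpM2r ?invr_ge0 ?(ltW eta0) //; exact: cdist_lip.
  apply: le_trans h; rewrite /lam !minEle; move: (cdist A z / eta) (cdist A w / eta) => p q.
  case: (leP 1 p) => h1; case: (leP 1 q) => h2; rewrite ?subrr ?normr0 ?normr_ge0 //.
    by rewrite !ger0_norm ?subr_ge0; lra.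
  by rewrite !ler0_norm ?subr_le0; lra.
have lamA a : A a -> lam a = 0.
  move=> Aa; have : cdist A a = 0.
    apply/eqP; rewrite eq_le; apply/andP; split; first by have := cdist_le a Aa; rewrite subrr cabs0.
    by apply: cdist_ge => // *; exact: cabs_ge0.
  by rewrite /lam => ->; rewrite mul0r minEle ler10.
have lamB b : B b -> lam b = 1.
  move=> Bb; apply/eqP; rewrite /lam; apply/eqP/min_idPl; rewrite ler_pdivlMr // mul1r.
  by apply: cdist_ge => // a Aa; exact: heta.
pose d := eta / 16.
have d0 : 0 < d by rewrite divr_gt0.
have small z w : cabs (z - w) < d -> `|lam z - lam w| < 1 / 16.
  move=> h; apply: (le_lt_trans (lam_lip z w)); rewrite ltr_pdivrMr //; rewrite /d in h; lra.
have [mu hmu1 hmu2] : exists2 mu : C -> R, forall z, G z -> mu z = lam z & forall z, ~ G z -> mu z = 0.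
  by exists (fun z => if pselect (G z) then lam z else 0) => z h; case: pselect.
(* A segment leaving G crosses the boundary at A, where the bump is 0, or at B, where it is 1;
   modulo 1 both agree with the value 0 outside. *)
have jmp z w : G z -> ~ G w -> cabs (z - w) < d -> exists2 k : R, k \is a Num.int & `|mu z - mu w - k| < 1 / 8.
  move=> Gz nGw zw; have [b bb hb] := segment_meets_boundary oG Gz nGw.
  rewrite hmu1 // hmu2 // subr0; have sm := small z b (le_lt_trans hb zw).
  case: (cov b bb) => Xb.
    by exists 0; rewrite ?rpred0 // subr0; rewrite (lamA b) // subr0 in sm; lra.
  by exists 1; rewrite ?rpred1 //; rewrite (lamB b) // in sm; lra.
have hj : jump mu d.
  move=> z w zw; have [Gz|nGz] := pselect (G z); have [Gw|nGw] := pselect (G w).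
  - by exists 0; rewrite ?rpred0 // subr0 !hmu1 //; have := small z w zw; lra.
  - exact: jmp.
  - have [|k ki hk] := jmp w z Gw nGz; first by rewrite cabsB.
    exists (- k); first by rewrite rpredN.
    by have -> : mu z - mu w - - k = - (mu w - mu z - k) by [ring]; rewrite normrN.
  - by exists 0; rewrite ?rpred0 // !hmu2 // !subr0 normr0; lra.
have [M M0 hM] := bounded_cabs_lt bG.
have [th [th1 th2]] := lift (M + d + 1) d0 hj.
have inT z : cabs z < M + d + 1 -> csq 0 (M + d + 1) z.
  by move=> h; apply: sq_csq; apply: cball_sub_sq; rewrite /cball /mkset subr0.
have inTG z : G z -> csq 0 (M + d + 1) z by move=> /hM h; apply: inT; lra.
(* Inside G the lift differs from the bump by an integer that is locally constant at scale d, and G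
   is connected. *)
have c0 z w : G z -> G w -> th z - lam z = th w - lam w.
  apply: (@locconst G (fun z => th z - lam z) d) => // x y Gx Gy xy.
  apply/eqP; rewrite -subr_eq0; apply/eqP; apply: int_small.
    by rewrite -!hmu1 // rpredB // th1 //; exact: inTG.
  have := th2 x y (inTG x Gx) (inTG y Gy) xy; have := small x y xy.
  by rewrite !ltr_norml => /andP[? ?] /andP[? ?]; apply/andP; split; lra.
pose K : set C := ~` G `&` [set v | cabs v < M + d].
have thK x y : K x -> K y -> cabs (x - y) < d -> th x = th y.
  move=> [nGx hx] [nGy hy] xy; have ix : csq 0 (M + d + 1) x by apply: inT; move: hx => /=; lra.
  have iy : csq 0 (M + d + 1) y by apply: inT; move: hy => /=; lra.
  apply/eqP; rewrite -subr_eq0; apply/eqP; apply: int_small; last by have := th2 x y ix iy xy; lra.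
  have := th1 x ix; have := th1 y iy; rewrite !hmu2 // !subr0 => q1 q2; exact: rpredB.
have ngM z : M <= cabs z -> ~ G z by move=> h /hM; lra.
(* Outside G the lift is integer valued, hence constant along chains with steps below d. A boundary
   point is chained to the annulus since G is its own hull. *)
have far z : boundary G z -> exists2 w, M < cabs w < M + d & th w = th z.
  move=> /(boundary_open _ oG) [/closureCP clz nGz].
  have zM : cabs z <= M.
    rewrite leNgt; apply/negP => h; have [|w Gw] := clz (cabs z - M); first by rewrite subr_gt0.
    rewrite /cball /mkset => hw; have := hM w Gw; have := cabsDB z w; rewrite (cabsB z w); lra.
  have [|w ch Mw] := @hull_chain R G z d M d0 nGz; first by move=> /hull_hull.
  have [w' ch' Mw'] := chain_exit ch zM Mw d0.
  exists w'; last exact: (chain_const thK ch').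
  by rewrite Mw' /=; have [_] := chainK ch'.
have outer x y : M < cabs x < M + d -> M < cabs y < M + d -> th x = th y.
  have Mp : 0 < M + d by lra.
  apply: (@locconst [set z | M < cabs z < M + d] th d) => //; first exact: annulus_connected.
  by move=> u v /andP[q1 q2] /andP[q3 q4]; apply: thK; split => //; apply: ngM; exact: ltW.
have near z : boundary G z -> exists2 w, G w & cabs (z - w) < d.
  by move=> [/closureCP /(_ d d0) [w Gw hw] _]; exists w => //; rewrite cabsB.
have [a [ba Xa]] := n1; have [b [bb Xb]] := n2.
have [wa ha ea] := far a ba; have [wb hb eb] := far b bb.
have thab : th a = th b by rewrite -ea -eb; exact: outer.
have val z : boundary G z -> forall x, G x -> `|th z - (th x - lam x) - lam z| < 1 / 4.
  move=> bz x Gx; have [w Gw zw] := near z bz.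
  have iz : csq 0 (M + d + 1) z.
    by apply: inT; have := hM w Gw; have := cabsDB z w; lra.
  rewrite (c0 x w) //; have := th2 z w iz (inTG w Gw) zw; have := small z w zw.
  by rewrite !ltr_norml => /andP[? ?] /andP[? ?]; apply/andP; split; lra.
(* Seen from inside, the lift differs by about 1 between a in A and b in B; seen from outside it is
   equal at both. *)
have [x Vx] := V0; have Gx : G x by exact: sub_hull.
have va := val a ba x Gx; have vb := val b bb x Gx.
rewrite (lamA a) // in va; rewrite (lamB b) // in vb.
rewrite !ltr_norml in va vb; move: va vb thab => /andP[h1 h2] /andP[h3 h4] h5.
by clear -h1 h2 h3 h4 h5; lra.
Qed.

End Lifting.

(** * Closed walks on the integer grid and their crossing numbers *)

Section Walks.
Local Notation pt := (int * int)%type.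
Implicit Types (p q : pt) (u w : nat -> pt) (good : pt -> Prop).

(** Staying in place counts as a step, so that walks can be delayed and can end in a constant
    tail. *)
Definition adj p q := `|p.1 - q.1| + `|p.2 - q.2| <= 1.

Lemma pt_eq p q : p.1 = q.1 -> p.2 = q.2 -> p = q.
Proof. by case: p q => ? ? [? ?] /= -> ->. Qed.

Definition closed_walk u n p := [/\ u 0%N = p, forall i, (n <= i)%N -> u i = p & forall i, adj (u i) (u i.+1)].

(* signed number of crossings of the walk with the vertical half line above [q + (1/2, 0)] *)
Definition crossings u n q : int :=
  \sum_(i < n) (((q.1 < (u i.+1).1)%R : nat)%:Z - ((q.1 < (u i).1)%R : nat)%:Z) * ((q.2 < (u i).2)%R : nat)%:Z.

Lemma closed_sum (phi : pt -> int) u n p : closed_walk u n p -> \sum_(i < n) (phi (u i.+1) - phi (u i)) = 0.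
Proof.
move=> [u0 un _]; rewrite -(big_mkord xpredT (fun i => phi (u i.+1) - phi (u i))) telescope_sumr //.
by rewrite u0 un // subrr.
Qed.

Lemma crossings_up u n p q : closed_walk u n p -> (forall i, u i <> (q.1, q.2 + 1)) ->
  crossings u n q = crossings u n (q.1, q.2 + 1).
Proof.
move=> [_ _ ha] hq; apply: eq_bigr => i _ /=.
have h1 := ha i; have h2 := hq i; have h3 := hq i.+1.
move: h1 h2 h3; rewrite /adj; case: (u i) => x y; case: (u i.+1) => x' y' /=; case: q {hq} => a b /=.
move=> h1 h2 h3.
have h2' : x = a -> y = b + 1 -> False by move=> e1 e2; apply: h2; rewrite e1 e2.
have h3' : x' = a -> y' = b + 1 -> False by move=> e1 e2; apply: h3; rewrite e1 e2.
case: (ltP a x) => q1; case: (ltP a x') => q2; case: (ltP b y) => q3; case: (ltP (b + 1) y) => q4 //=; lia.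
Qed.

(** The two half lines bound a column above [q']. Crossing one but not the other means entering or
    leaving that column, an increment of its indicator [phi], and such increments sum to 0 along a
    closed walk. *)
Lemma crossings_right u n p q q' : closed_walk u n p -> q'.1 = q.1 + 1 -> `|q'.2 - q.2| <= 1 ->
  (forall i, u i <> q) -> (forall i, u i <> q') -> crossings u n q = crossings u n q'.
Proof.
move=> cw e1 e2 hq hq'; have [_ _ ha] := cw.
pose phi (v : pt) : int := (((v.1 == q'.1) && (q'.2 < v.2)%R : bool) : nat)%:Z.
apply/eqP; rewrite -subr_eq0 /crossings -sumrB; apply/eqP; rewrite -[RHS](closed_sum phi cw); apply: eq_bigr => i _.
have h1 := ha i; have h2 := hq i; have h3 := hq i.+1; have h4 := hq' i; have h5 := hq' i.+1.
move: h1 h2 h3 h4 h5; rewrite /phi /adj; case: (u i) => x y; case: (u i.+1) => x' y' /=.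
case: q q' {hq hq' phi} e1 e2 => a b [c d] /= e1 e2 h1 h2 h3 h4 h5.
have h2' : x = a -> y = b -> False by move=> q1 q2; apply: h2; rewrite q1 q2.
have h3' : x' = a -> y' = b -> False by move=> q1 q2; apply: h3; rewrite q1 q2.
have h4' : x = c -> y = d -> False by move=> q1 q2; apply: h4; rewrite q1 q2.
have h5' : x' = c -> y' = d -> False by move=> q1 q2; apply: h5; rewrite q1 q2.
clear h2 h3 h4 h5.
case: (ltP a x) => q1; case: (ltP a x') => q2; case: (ltP b y) => q3; case: (ltP c x) => q4; case: (ltP c x') => q5;
 case: (ltP d y) => q6; case: (ltP d y') => q7; case: (eqVneq x c) => q8; case: (eqVneq x' c) => q9 //=; lia.
Qed.

(** Walks move along sides while avoided cells are linked also through corners. This pairing of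
    adjacencies makes the crossing number constant on connected sets of avoided cells. *)
Lemma crossings_king u n p q q' : closed_walk u n p -> `|q'.1 - q.1| <= 1 -> `|q'.2 - q.2| <= 1 ->
  (forall i, u i <> q) -> (forall i, u i <> q') -> crossings u n q = crossings u n q'.
Proof.
move=> cw h1 h2 hq hq'.
have [e|ne] := eqVneq q'.1 (q.1 + 1); first exact: (crossings_right cw).
have [e|ne'] := eqVneq q'.1 (q.1 - 1).
  by apply/esym; apply: (crossings_right cw) => //; lia.
have e1 : q'.1 = q.1 by lia.
have [e|ne2] := eqVneq q'.2 (q.2 + 1).
  have E : q' = (q.1, q.2 + 1) by apply: pt_eq.
  by rewrite E; apply: (crossings_up cw) => i; rewrite -E; exact: hq'.
have [e|ne3] := eqVneq q'.2 (q.2 - 1).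
  have E : q = (q'.1, q'.2 + 1) by apply: pt_eq => /=; lia.
  by apply/esym; rewrite [in RHS]E; apply: (crossings_up cw) => i; rewrite -E; exact: hq.
by congr crossings; apply: pt_eq; lia.
Qed.

Lemma crossings_far u n p q (M : int) : closed_walk u n p ->
  (forall i, `|(u i).1| <= M /\ `|(u i).2| <= M) -> M < `|q.1| \/ M < `|q.2| -> crossings u n q = 0.
Proof.
move=> cw hM hq; have [_ _ ha] := cw.
have [h|h] := leP M q.2.
  rewrite /crossings big1 // => i _; have [_ h2] := hM i.
  by have -> : (q.2 < (u i).2)%R = false; [lia | rewrite mulr0].
have [h'|h'] := leP q.2 (- M - 1).
  rewrite -[RHS](closed_sum (fun v => ((q.1 < v.1)%R : nat)%:Z) cw); apply: eq_bigr => i _; have [_ h2] := hM i.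
  by have -> : (q.2 < (u i).2)%R = true; [lia | rewrite mulr1].
have {}hq : M < `|q.1| by lia.
rewrite /crossings big1 // => i _; have [h1 _] := hM i; have [h2 _] := hM i.+1.
by have -> : (q.1 < (u i.+1).1)%R = (q.1 < (u i).1)%R; [lia | rewrite subrr mul0r].
Qed.

(** The last condition exempts just the pair 0, n, where a closed walk necessarily agrees. *)
Definition simple_walk u n := forall i j, (i < j)%N -> (j <= n)%N -> (j - i < n)%N -> u i <> u j.

(** At the first visit to the highest row, the walk arrives from below; simplicity forbids going
    straight back or pausing, so it continues sideways. *)
Lemma walk_corner u n p : closed_walk u n p -> simple_walk u n -> (2 < n)%N -> (exists i, p.2 < (u i).2) ->
  exists a, [/\ (a.+2 < n)%N, u a = ((u a.+1).1, (u a.+1).2 - 1), (u a.+2).2 = (u a.+1).2,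
    `|(u a.+2).1 - (u a.+1).1| = 1 & forall i, (u i).2 <= (u a.+1).2].
Proof.
move=> [u0 un ha] su n2 [i0 hi0].
have i0n : (i0 < n)%N by rewrite ltnNge; apply/negP => /un h; rewrite h ltxx in hi0.
have [k [kn hk]] : exists k : nat, (k < n)%N /\ forall i, (u i).2 <= (u k).2.
  have [k _ hk] := @arg_maxP _ _ _ (Ordinal i0n) xpredT (fun i : 'I_n => (u i).2) isT.
  exists k; split => // i; have [h|h] := ltnP i n; first exact: (hk (Ordinal h)).
  rewrite un // -u0; have n0 : (0 < n)%N by exact: leq_ltn_trans i0n.
  exact: (hk (Ordinal n0)).
have kp : p.2 < (u k).2 by exact: lt_le_trans (hk i0).
have [b hb hbm] : exists2 b, (u b).2 == (u k).2 & forall i, (u i).2 == (u k).2 -> (b <= i)%N.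
  have ex : exists b, (u b).2 == (u k).2 by exists k.
  by exists (ex_minn ex); case: ex_minnP => m hm1 hm2.
have {}hb := eqP hb.
case: b hb hbm => [|a] hb hbm; first by rewrite u0 in hb; rewrite hb ltxx in kp.
have an : (a.+1 < n)%N by rewrite ltnNge; apply/negP => /un h; rewrite h in hb; rewrite hb ltxx in kp.
have h1 : (u a).2 <> (u a.+1).2.
  by move=> e; have : (a.+1 <= a)%N by [apply: hbm; rewrite e hb]; rewrite ltnn.
have ad1 := ha a; have ad2 := ha a.+1; rewrite /adj in ad1 ad2.
have m1 := hk a; have m2 := hk a.+2; rewrite -hb in m1 m2.
have ua : u a = ((u a.+1).1, (u a.+1).2 - 1) by apply: pt_eq => /=; lia.
have an2 : (a.+2 < n)%N.
  rewrite ltn_neqAle an andbT; apply/eqP => e.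
  have e2 : u a.+2 = p by rewrite un // e.
  have e3 : u a = u a.+2.
    rewrite ua; apply: pt_eq => /=; rewrite e2 in ad2 m2 *; rewrite -hb in kp; lia.
  by apply: (su a a.+2) e3; lia.
have s1 : u a <> u a.+2 by apply: su; lia.
have s2 : u a.+1 <> u a.+2 by apply: su; lia.
have nd : (u a.+2).2 = (u a.+1).2.
  apply: contrapT => ne; apply: s1; rewrite ua; apply: pt_eq => /=; lia.
have nx : (u a.+2).1 <> (u a.+1).1 by move=> e; apply: s2; apply: pt_eq.
by exists a; split => //; [lia | move=> i; rewrite hb].
Qed.

(** Above q there is only the top cell of its column, visited exactly once. Since q is avoided and
    the walk is simple, the walk passes that cell horizontally, so exactly one step crosses the half
    line. *)
Lemma corner_crossings u n p a q : closed_walk u n p -> simple_walk u n -> (a.+2 < n)%N ->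
  u a = ((u a.+1).1, (u a.+1).2 - 1) -> (u a.+2).2 = (u a.+1).2 ->
  `|(u a.+2).1 - (u a.+1).1| = 1 -> (forall i, (u i).2 <= (u a.+1).2) -> p.2 < (u a.+1).2 ->
  q = ((u a.+2).1, (u a.+1).2 - 1) -> (forall i, u i <> q) -> crossings u n q <> 0.
Proof.
move=> [u0 un ha] su an ua e2 e1 mx hp qE nq.
have ad := ha a.+2; rewrite /adj in ad.
have top2 : u a.+2 = (q.1, q.2 + 1) by rewrite qE; apply: pt_eq => /=; lia.
have an3 : (a.+3 < n)%N \/ a.+3 = n by lia.
have pn : u n = p by apply: un.
have u3 : (u a.+3).1 = q.1 + (q.1 - (u a.+1).1) /\ (u a.+3).2 = (u a.+1).2.
  have s1 : u a.+1 <> u a.+3 by apply: su; lia.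
  have s2 : u a.+2 <> u a.+3 by apply: su; lia.
  have m3 := mx a.+3.
  have q1 : q.1 = (u a.+2).1 by rewrite qE.
  have n1 : (u a.+3).1 = (u a.+1).1 -> (u a.+3).2 = (u a.+1).2 -> False by move=> x y; apply: s1; apply: pt_eq.
  have n2 : (u a.+3).1 = (u a.+2).1 -> (u a.+3).2 = (u a.+2).2 -> False by move=> x y; apply: s2; apply: pt_eq.
  have n3 : (u a.+3).1 = (u a.+2).1 -> (u a.+3).2 = (u a.+1).2 - 1 -> False.
    by move=> x y; apply: (nq a.+3); rewrite qE; apply: pt_eq.
  lia.
have an1 : (a.+1 < n)%N by lia.
have uniq i : (i <= n)%N -> u i = u a.+2 -> i = a.+2.
  move=> hi e; apply: contrapT => ne.
  have [i0|i0] := eqVneq i 0%N; first by rewrite i0 u0 in e; rewrite e e2 ltxx in hp.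
  have [i1|i1] := eqVneq i n; first by rewrite i1 pn in e; rewrite e e2 ltxx in hp.
  have [l|l] := ltnP i a.+2; first by apply: (su i a.+2) e; lia.
  by apply: (su a.+2 i) (esym e); lia.
pose F (i : nat) : int := (((q.1 < (u i.+1).1)%R : nat)%:Z - ((q.1 < (u i).1)%R : nat)%:Z) * ((q.2 < (u i).2)%R : nat)%:Z.
have F0 (i : nat) : (i < n)%N -> i != a.+1 -> i != a.+2 -> F i = 0.
  move=> hi n1 n2; rewrite /F; have adi := ha i; rewrite /adj in adi.
  have m1 := mx i; have m2 := mx i.+1.
  have q2 : q.2 = (u a.+1).2 - 1 by rewrite qE.
  have N1 : (u i).1 = q.1 -> (u i).2 = q.2 + 1 -> False.
    by move=> x y; move/eqP: n2; apply; apply: uniq; [lia | rewrite top2; apply: pt_eq].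
  have N2 : (u i.+1).1 = q.1 -> (u i.+1).2 = q.2 + 1 -> False.
    move=> x y; have : i.+1 = a.+2 by apply: uniq; [lia | rewrite top2; apply: pt_eq].
    by move=> [e]; rewrite e eqxx in n1.
  case: (ltP q.1 (u i.+1).1) => q3; case: (ltP q.1 (u i).1) => q4; case: (ltP q.2 (u i).2) => q5 //=; lia.
have -> : crossings u n q = F a.+1 + F a.+2.
  rewrite /crossings (bigD1 (Ordinal an1)) //= (bigD1 (Ordinal an)) /=; last by rewrite -val_eqE /=; lia.
  rewrite big1 ?addr0 // => i /andP[h1 h2]; exact: (F0 i).
rewrite /F; have [x3 y3] := u3; rewrite x3 e2.
have q1 : q.1 = (u a.+2).1 by rewrite qE.
have q2 : q.2 = (u a.+1).2 - 1 by rewrite qE.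
rewrite q1 q2; case: (ltP (u a.+2).1 (u a.+2).1) => z1; case: (ltP (u a.+2).1 (u a.+1).1) => z2;
 case: (ltP ((u a.+1).2 - 1) (u a.+1).2) => z3; case: (ltP (u a.+2).1 ((u a.+2).1 + ((u a.+2).1 - (u a.+1).1))) => z4 //=; lia.
Qed.

End Walks.

(** * Contracting closed walks among good cells *)

Section WalkContraction.
Local Notation pt := (int * int)%type.
Variable good : pt -> Prop.
Implicit Types (p q v : pt) (u w l : nat -> pt).

(** The cells lie in a two by two block and all combinations of their coordinates are good, so the
    convex hull of their centres stays in good cells ([okbox_conv]). *)
Definition okbox (s : seq pt) := forall p q, p \in s -> q \in s ->
  [/\ `|p.1 - q.1| <= 1, `|p.2 - q.2| <= 1 & good (p.1, q.2)].

Definition upd w (i : nat) q : nat -> pt := fun k => if k == i then q else w k.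

(* homotopy of walks with fixed starting point; a walk is a sequence of cells, eventually constant *)
Inductive hom : (nat -> pt) -> (nat -> pt) -> Prop :=
| hom_refl w : hom w w
| hom_step w i q w' : okbox [:: w i; w i.+1; q] -> okbox [:: w i.+1; q; w i.+2] ->
    hom (upd w i.+1 q) w' -> hom w w'.

Lemma hom_trans w1 w2 w3 : hom w1 w2 -> hom w2 w3 -> hom w1 w3.
Proof. by elim=> // w i q w' h1 h2 _ ih /ih; exact: hom_step. Qed.

Lemma ok4 (x x' y y' : int) (s : seq pt) : `|x - x'| <= 1 -> `|y - y'| <= 1 ->
  good (x, y) -> good (x, y') -> good (x', y) -> good (x', y') ->
  (forall v : pt, v \in s -> (v.1 = x \/ v.1 = x') /\ (v.2 = y \/ v.2 = y')) -> okbox s.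
Proof.
move=> h1 h2 g1 g2 g3 g4 hs a b /hs [a1 a2] /hs [b1 b2]; split; first by lia.
  by lia.
by case: a1 => ->; case: b2 => ->.
Qed.

Lemma ok2 p q (s : seq pt) : adj p q -> good p -> good q -> (forall v, v \in s -> v = p \/ v = q) -> okbox s.
Proof.
rewrite /adj; case: p q => x y [x' y'] /= h g1 g2 hs.
have [e|e] : x = x' \/ y = y' by lia.
  apply: (@ok4 x x y y') => //; [lia|lia|by rewrite e|by rewrite e|].
  by move=> v /hs [] -> /=; rewrite ?e; tauto.
apply: (@ok4 x x' y y) => //; [lia|lia|by rewrite e|by rewrite e|].
by move=> v /hs [] -> /=; rewrite ?e; tauto.
Qed.

Definition gwalk w n p := closed_walk w n p /\ forall i, good (w i).

Definition delay (j : nat) w : nat -> pt := fun k => if (k <= j)%N then w k else w k.-1.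

Lemma delay_shift j w n p : gwalk w n p ->
  hom (delay j w) (delay j.+1 w) /\ hom (delay j.+1 w) (delay j w).
Proof.
move=> [[_ _ ha] hg].
have e0 : delay j w j = w j by rewrite /delay leqnn.
have e1 : delay j w j.+1 = w j by rewrite /delay ltnn.
have e2 : delay j w j.+2 = w j.+1 by rewrite /delay ifF //; lia.
have f0 : delay j.+1 w j = w j by rewrite /delay leqnSn.
have f1 : delay j.+1 w j.+1 = w j.+1 by rewrite /delay leqnn.
have f2 : delay j.+1 w j.+2 = w j.+1 by rewrite /delay ltnn.
have U1 : upd (delay j w) j.+1 (w j.+1) = delay j.+1 w.
  apply/funext => k; rewrite /upd /delay; case: eqP => [->|ne]; first by rewrite leqnn.
  by case: (leqP k j) => h; [rewrite ifT //; lia | rewrite ifF //; lia].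
have U2 : upd (delay j.+1 w) j.+1 (w j) = delay j w.
  apply/funext => k; rewrite /upd /delay; case: eqP => [->|ne]; first by rewrite ltnn.
  by case: (leqP k j) => h; [rewrite ifT //; lia | rewrite ifF //; lia].
split.
  apply: (@hom_step _ j (w j.+1)); rewrite ?e0 ?e1 ?e2 ?U1; last exact: hom_refl.
    by apply: (ok2 (ha j)) => // v; rewrite !inE => /or3P[] /eqP ->; tauto.
  by apply: (ok2 (ha j)) => // v; rewrite !inE => /or3P[] /eqP ->; tauto.
apply: (@hom_step _ j (w j)); rewrite ?f0 ?f1 ?f2 ?U2; last exact: hom_refl.
  by apply: (ok2 (ha j)) => // v; rewrite !inE => /or3P[] /eqP ->; tauto.
by apply: (ok2 (ha j)) => // v; rewrite !inE => /or3P[] /eqP ->; tauto.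
Qed.

(** Elementary moves change one cell at a fixed time. A repetition is therefore pushed forward one
    step at a time until it vanishes in the constant tail; this provides reparametrisation. *)
Lemma delay_hom j w n p : gwalk w n p -> hom (delay j w) w /\ hom w (delay j w).
Proof.
move=> gw; have [[_ wn _] _] := gw.
have D d : hom (delay j w) (delay (j + d) w) /\ hom (delay (j + d) w) (delay j w).
  elim: d => [|d [ih1 ih2]]; first by rewrite addn0; split; exact: hom_refl.
  have [h1 h2] := delay_shift (j + d) gw; rewrite addnS.
  by split; [exact: hom_trans h1 | exact: hom_trans ih2].
have E : delay (j + n) w = w.
  by apply/funext => k; rewrite /delay; case: (leqP k (j + n)) => h //; rewrite !wn //; lia.
by have := D n; rewrite E.
Qed.

Lemma gwalk_delay j w n p : gwalk w n p -> gwalk (delay j w) n.+1 p.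
Proof.
move=> [[w0 wn ha] hg]; split; last by move=> i; rewrite /delay; case: ifP.
split; first by rewrite /delay leq0n.
  move=> i hi; rewrite /delay; case: ifP => _; apply: wn; lia.
move=> i; rewrite /delay /=.
have [h|h] := leqP i.+1 j; first by rewrite ifT //; lia.
have [h2|h2] := leqP i j; first by have -> : i = j by [lia]; rewrite /adj; lia.
by case: i h h2 => // i h h2; exact: ha.
Qed.

Definition delays (m j : nat) w : nat -> pt := fun k =>
  if (k <= j)%N then w k else if (k <= j + m)%N then w j else w (k - m)%N.

Lemma delays_hom m j w n p : gwalk w n p ->
  [/\ hom (delays m j w) w, hom w (delays m j w) & gwalk (delays m j w) (n + m) p].
Proof.
move=> gw; elim: m => [|m [ih1 ih2 ih3]].
  have -> : delays 0 j w = w.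
    by apply/funext => k; rewrite /delays addn0 subn0; case: leqP.
  by rewrite addn0; split => //; exact: hom_refl.
have E : delays m.+1 j w = delay j (delays m j w).
  apply/funext => k; rewrite /delays /delay; case: (leqP k j) => h //.
  have [h2|h2] := leqP k.-1 j.
    by rewrite ifT; [congr w; lia | lia].
  have [h3|h3] := leqP k (j + m.+1); first by rewrite ifT //; lia.
  by rewrite ifF; [congr w; lia | lia].
have [h1 h2] := delay_hom j ih3; rewrite E addnS.
by split; [exact: hom_trans ih1 | exact: hom_trans ih2 h2 | exact: gwalk_delay].
Qed.

Definition plug (i N : nat) u l (v : nat -> pt) : nat -> pt := fun k =>
  if (k < i)%N then u k else if (k < i + N)%N then l (k - i)%N else v (k - i - N)%N.

(** A homotopy consists of finitely many moves, so beyond some time K it touches nothing and can be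
    carried out inside a longer walk. *)
Lemma hom_plug l l' : hom l l' -> exists K, forall N i u (v : nat -> pt), (K <= N)%N -> hom (plug i N u l v) (plug i N u l' v).
Proof.
elim=> [w|w m q w' h1 h2 _ [K hK]].
  by exists 0%N => *; exact: hom_refl.
exists (maxn K m.+3) => N i u v; rewrite geq_max => /andP[KN mN].
have e k : (k < N)%N -> plug i N u w v (i + k)%N = w k.
  by move=> kN; rewrite /plug ifF; [rewrite ifT; [congr w; lia | lia] | lia].
have e0 := e m ltac:(lia); have e1 := e m.+1 ltac:(lia); have e2 := e m.+2 ltac:(lia).
rewrite !addnS in e1 e2.
apply: (@hom_step _ (i + m)%N q); rewrite ?e0 ?e1 ?e2 //.
have -> : upd (plug i N u w v) (i + m).+1 q = plug i N u (upd w m.+1 q) v.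
  apply/funext => k; rewrite /upd /plug; case: eqP => [->|ne].
    by rewrite ifF; [rewrite ifT; [rewrite ifT //; lia | lia] | lia].
  case: (ltnP k i) => h //; case: (ltnP k (i + N)) => h' //.
  by rewrite ifF //; lia.
exact: hK.
Qed.

Inductive bchain q : pt -> Prop :=
| bchain_refl : ~ good q -> bchain q q
| bchain_step q1 q2 : bchain q q1 -> ~ good q2 -> `|q2.1 - q1.1| <= 1 -> `|q2.2 - q1.2| <= 1 -> bchain q q2.

Hypothesis far : forall q (M : int), ~ good q -> exists2 q', bchain q q' & M < `|q'.1| \/ M < `|q'.2|.

(** With e = -1 the reflection that reduces walks going below the base row to walks going above
    it. *)
Definition refl2 (e : int) q : pt := (q.1, e * q.2).

Lemma walk_bounded w n p : closed_walk w n p -> exists M : int, forall i, `|(w i).1| <= M /\ `|(w i).2| <= M.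
Proof.
move=> [w0 wn ha]; exists (`|p.1| + `|p.2| + n%:Z) => i.
have H (k : nat) : `|(w k).1| <= `|p.1| + k%:Z /\ `|(w k).2| <= `|p.2| + k%:Z.
  elim: k => [|k [ih1 ih2]]; first by rewrite w0; lia.
  have := ha k; rewrite /adj; lia.
have [h|h] := leqP n i; first by rewrite wn //; lia.
have := H i; lia.
Qed.

Lemma closed_walk_map (g : pt -> pt) w n p : (forall x y, adj x y -> adj (g x) (g y)) ->
  closed_walk w n p -> closed_walk (fun i => g (w i)) n (g p).
Proof. by move=> hg [w0 wn ha]; split=> [|i /wn ->|i] //; [rewrite w0 | apply: hg]. Qed.

(** A bad cell is linked through bad cells to cells far away, where the crossing number is 0. *)
Lemma bad_crossings e w n p q : e = 1 \/ e = -1 -> gwalk w n p -> ~ good q ->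
  crossings (fun i => refl2 e (w i)) n (refl2 e q) = 0.
Proof.
move=> he [cw hg] bq; have [M hM] := walk_bounded cw; have [q' ch hq'] := far M bq.
have cw' : closed_walk (fun i => refl2 e (w i)) n (refl2 e p).
  by apply: closed_walk_map cw => x y; rewrite /adj /refl2 /=; case: he => ->; lia.
have av v : ~ good v -> forall i, refl2 e (w i) <> refl2 e v.
  move=> bv i [e1 e2]; apply: bv; suff <- : w i = v by [].
  by apply: pt_eq => //; case: he e2 => ->; lia.
have -> : crossings (fun i => refl2 e (w i)) n (refl2 e q) = crossings (fun i => refl2 e (w i)) n (refl2 e q').
  elim: ch {hq'} => // q1 q2 ch -> b2 h1 h2; apply: (crossings_king cw') => //=.
  - by case: he => ->; lia.
  - by apply: av; case: ch.
  - exact: av.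
apply: (crossings_far (M := M) cw') => /=.
  by move=> i; have := hM i; case: he => ->; lia.
by case: he => ->; lia.
Qed.

(** The measure that decreases when an extremal corner is pushed towards the row of the base
    point. *)
Definition mass w n p : nat := \sum_(i < n) `|(w i).2 - p.2|%N.

Lemma simple_walk_map (g : pt -> pt) w n : injective g -> simple_walk w n -> simple_walk (fun i => g (w i)) n.
Proof. by move=> gi sw i j h1 h2 h3 /gi; exact: sw. Qed.

(** The corner at the extremal row is replaced by the diagonally opposite cell [q0]. Were [q0] bad,
    its crossing number would be 0 by [bad_crossings] and nonzero by [corner_crossings]. *)
Lemma push_walk w n p : gwalk w n p -> simple_walk w n -> (2 < n)%N -> (exists i, (w i).2 <> p.2) ->
  exists w', [/\ hom w w', gwalk w' n p & (mass w' n p < mass w n p)%N].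
Proof.
move=> gw sw n2 [i0 hi0]; have [cw hg] := gw.
have [e [he hei]] : exists e : int, (e = 1 \/ e = -1) /\ e * p.2 < e * (w i0).2.
  by have [h|h] := ltP p.2 (w i0).2; [exists 1 | exists (-1)]; split; lia.
pose u i := refl2 e (w i).
have cu : closed_walk u n (refl2 e p).
  by apply: closed_walk_map cw => x y; rewrite /adj /refl2 /=; case: he => ->; lia.
have su : simple_walk u n.
  apply: simple_walk_map sw => x y [e1 e2]; apply: pt_eq => //; case: he e2 => ->; lia.
have [|a [an ua e2 e1 mx]] := walk_corner cu su n2; first by exists i0.
pose q0 : pt := ((w a.+2).1, (w a).2).
have uw i : (w i).2 = e * (u i).2 by rewrite /u /refl2 /=; case: he => ->; lia.
have q0E : refl2 e q0 = ((u a.+2).1, (u a.+1).2 - 1) by rewrite /q0 /refl2 /=; rewrite /u /refl2 /= in ua; case: ua => _ ->.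
have gq : good q0.
  apply: contrapT => bq; have := bad_crossings he gw bq.
  apply: (corner_crossings cu su an ua e2 e1 mx _ q0E).
    have := mx i0; rewrite /u /refl2 /= in hei *; lia.
  move=> i [x1 x2]; apply: bq; suff <- : w i = q0 by [].
  by apply: pt_eq => //; case: he x2 => ->; rewrite /q0 /=; lia.
have wa1 : (w a).1 = (w a.+1).1 by case: ua.
have wa2 : (w a.+2).2 = (w a.+1).2 by rewrite !uw e2.
have da : (w a).2 = (w a.+1).2 - e.
  have : (u a).2 = (u a.+1).2 - 1 by rewrite ua.
  by rewrite /u /refl2 /=; case: he => ->; lia.
have d1 : `|(w a.+2).1 - (w a.+1).1| = 1 by exact: e1.
have ok s : (forall v : pt, v \in s -> [\/ v = w a, v = w a.+1, v = w a.+2 | v = q0]) -> okbox s.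
  move=> hs; apply: (@ok4 (w a.+1).1 (w a.+2).1 (w a).2 (w a.+1).2).
  - by lia.
  - by rewrite da; case: he => ->; lia.
  - by rewrite -wa1; have := hg a; case: (w a).
  - by have := hg a.+1; case: (w a.+1).
  - exact: gq.
  - by rewrite -wa2; have := hg a.+2; case: (w a.+2).
  - by move=> v /hs [] -> /=; rewrite ?wa1 ?wa2; tauto.
exists (upd w a.+1 q0); split.
- apply: (@hom_step _ a q0); last exact: hom_refl.
    by apply: ok => v; rewrite !inE => /or3P[] /eqP ->; [apply: Or41|apply: Or42|apply: Or44].
  by apply: ok => v; rewrite !inE => /or3P[] /eqP ->; [apply: Or42|apply: Or44|apply: Or43].
- have [w0 wn ha] := cw; split; last by move=> i; rewrite /upd; case: ifP.
  split.
  + by rewrite /upd.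
  + by move=> i hi; rewrite /upd ifF; [exact: wn | lia].
  + move=> i; rewrite /upd; case: (eqVneq i a.+1) => [->|n1].
      by rewrite ifF; [rewrite /adj /q0 /= wa2 da; case: he => ->; lia | lia].
    case: (eqVneq i.+1 a.+1) => [[->]|n3]; last exact: ha.
    by rewrite /adj /q0 /= wa1; lia.
- have an1 : (a.+1 < n)%N by lia.
  rewrite /mass (bigD1 (Ordinal an1)) //= [X in (_ < X)%N](bigD1 (Ordinal an1)) //=.
  have -> : (\sum_(i < n | i != Ordinal an1) `|(upd w a.+1 q0 i).2 - p.2| = \sum_(i < n | i != Ordinal an1) `|(w i).2 - p.2|)%N.
    by apply: eq_bigr => i hi; rewrite /upd ifF //; apply/negP => /eqP e'; move/eqP: hi; apply; exact: val_inj.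
  rewrite ltn_add2r /upd eqxx /q0 /= da.
  have hp : e * p.2 < e * (w a.+1).2.
    by have := mx i0; rewrite /u /refl2 /= in hei *; lia.
  by move: hp; case: he => ->; lia.
Qed.

(** After exchanging the coordinates, the corner found by [walk_corner] would need a vertical move,
    which a walk in one row does not make. *)
Lemma row_not_simple w n p : closed_walk w n p -> simple_walk w n -> (2 < n)%N -> (forall i, (w i).2 = p.2) -> False.
Proof.
move=> cw sw n2 hr; have [w0 wn ha] := cw.
have w1 : (w 1%N).1 <> p.1.
  move=> e; have : w 0%N <> w 1%N by apply: sw; lia.
  by apply; rewrite w0; apply: pt_eq => //; rewrite hr.
have [e [he hei]] : exists e : int, (e = 1 \/ e = -1) /\ e * p.1 < e * (w 1%N).1.
  by have [h|h] := ltP p.1 (w 1%N).1; [exists 1 | exists (-1)]; split; lia.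
pose g (v : pt) : pt := (v.2, e * v.1).
have cu : closed_walk (fun i => g (w i)) n (g p).
  by apply: closed_walk_map cw => x y; rewrite /adj /g /=; case: he => ->; lia.
have su : simple_walk (fun i => g (w i)) n.
  apply: simple_walk_map sw => x y [e1 e2]; apply: pt_eq => //; case: he e2 => ->; lia.
have [|a [_ _ _ + _]] := walk_corner cu su n2; first by exists 1%N.
by rewrite /g /= !hr subrr.
Qed.

(** Induction on the length, then on [mass]. A simple walk is pushed; a walk with a repetition has a
    proper subloop, which is contracted and then removed, leaving a shorter walk. *)
Lemma walk_contract w n p : gwalk w n p -> hom w (fun=> p).
Proof.
elim/ltn_ind: n w p => n IH w p gw.
move mE : (mass w n p) => m; elim/ltn_ind: m w mE gw => m IHm w mE gw.
have [cw hg] := gw; have [w0 wn ha] := cw.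
have [sw|nsw] := pselect (simple_walk w n).
  have [n2|n2] := leqP n 2; last first.
    have [hv|hr] := pselect (exists i, (w i).2 <> p.2).
      have [w' [h1 h2 h3]] := push_walk gw sw n2 hv.
      by apply: hom_trans h1 _; apply: (IHm (mass w' n p)) => //; rewrite -mE.
    exfalso; apply: (row_not_simple cw sw n2) => i.
    by apply: contrapT => h; apply: hr; exists i.
  have w2 i : (i != 1)%N -> w i = p.
    by case: i => [|[|i]] // _; apply: wn; lia.
  apply: (@hom_step _ 0%N p).
  - by apply: (ok2 (ha 0%N)) => // v; rewrite !inE w0 => /or3P[] /eqP ->; tauto.
  - by apply: (ok2 (ha 0%N)) => // v; rewrite !inE w0 (w2 2%N) // => /or3P[] /eqP ->; tauto.
  - have -> : upd w 1 p = fun=> p; last exact: hom_refl.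
    by apply/funext => k; rewrite /upd; case: eqP => // /eqP; exact: w2.
have [i [j [ij jn jin wij]]] : exists i j, [/\ (i < j)%N, (j <= n)%N, (j - i < n)%N & w i = w j].
  apply: contrapT => h; apply: nsw => i j h1 h2 h3 h4; apply: h; by exists i, j.
pose l k := if (k <= j - i)%N then w (i + k)%N else w j.
have gl : gwalk l (j - i) (w i).
  split; last by move=> k; rewrite /l; case: ifP.
  split.
  - by rewrite /l leq0n addn0.
  - move=> k hk; rewrite /l; case: leqP => h //.
    by rewrite wij; congr w; lia.
  - move=> k; rewrite /l; case: (leqP k.+1 (j - i)) => h; first by rewrite ifT; [rewrite addnS | lia].
    have [h2|h2] := leqP k (j - i); last by rewrite /adj; lia.
    by have -> : (i + k)%N = j by [lia]; rewrite /adj; lia.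
have hl : hom l (fun=> w i) by apply: IH gl.
have [K hK] := hom_plug hl.
(* The time slot given to the subloop: long enough for its homotopy and for the subloop itself. *)
pose N := maxn K (j - i).+1.
have KN : (K <= N)%N by exact: leq_maxl.
have Nij : (j - i < N)%N by exact: leq_maxr.
have [_ s1 _] := delays_hom (N - (j - i)) j gw.
have E1 : delays (N - (j - i)) j w = plug i N w l (fun k => w (j + k)%N).
  apply/funext => k; rewrite /delays /plug /l.
  have [a1|a1] := ltnP k i; first by rewrite ifT //; lia.
  have [a2|a2] := ltnP k (i + N).
    have [a3|a3] := leqP k j; first by rewrite ifT; [congr w; lia | lia].
    by rewrite ifT; [rewrite ifF //; lia | lia].
  rewrite ifF; last lia.
  have [a3|a3] := leqP k (j + (N - (j - i))); congr w; lia.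
(* The walk without the subloop; delayed by N at time i it is the walk in which the subloop has
   become constant. *)
pose w1 k := if (k <= i)%N then w k else w (k + (j - i))%N.
have gw1 : gwalk w1 (n - (j - i)) p.
  split; last by move=> k; rewrite /w1; case: ifP.
  split.
  - by rewrite /w1 leq0n.
  - move=> k hk; rewrite /w1; case: leqP => h; last by apply: wn; lia.
    have [a1|a1] := leqP n k; first exact: wn.
    have e1 : k = i by lia.
    have e2 : j = n by lia.
    by rewrite e1 wij; apply: wn; lia.
  - move=> k; rewrite /w1; case: (leqP k.+1 i) => h; first by rewrite ifT; [exact: ha | lia].
    have [a1|a1] := leqP k i; last by rewrite addSn; exact: ha.
    have -> : k = i by lia.
    by rewrite wij; have -> : (i.+1 + (j - i))%N = j.+1 by [lia]; exact: ha.
have [s2 _ _] := delays_hom N i gw1.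
have E2 : delays N i w1 = plug i N w (fun=> w i) (fun k => w (j + k)%N).
  apply/funext => k; rewrite /delays /plug /w1.
  have [a1|a1] := ltnP k i; first by rewrite (ltnW a1).
  have [a0|a0] := leqP k i.
    by rewrite ifT; [congr w; lia | lia].
  rewrite leqnn; have [a2|a2] := ltnP k (i + N); first by rewrite ifT //; lia.
  have [a3|a3] := leqP k (i + N).
    by rewrite wij; congr w; lia.
  by rewrite ifF; [congr w; lia | lia].
apply: hom_trans s1 _; rewrite E1; apply: hom_trans (hK N i w _ KN) _; rewrite -E2.
apply: hom_trans s2 _; apply: (IH (n - (j - i))%N) => //; lia.
Qed.

End WalkContraction.

(** * Piecewise linear interpolation *)

Section Interpolation.
Variable R : realType.
Local Notation C := (R[i]).
Local Notation Re := complex.Re.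
Local Notation Im := complex.Im.

Definition ramp (x : R) : R := Num.max 0 (Num.min 1 x).

Lemma ramp0 x : x <= 0 -> ramp x = 0.
Proof. by move=> h; apply/max_idPl; rewrite ge_min h orbT. Qed.
Lemma ramp1 x : 1 <= x -> ramp x = 1.
Proof. by move=> h; rewrite /ramp (min_idPl _) //; apply/max_idPr. Qed.
Lemma ramp_id x : 0 <= x <= 1 -> ramp x = x.
Proof. by move=> /andP[h1 h2]; rewrite /ramp (min_idPr _) //; apply/max_idPr. Qed.
Lemma ramp_in x : 0 <= ramp x <= 1.
Proof. by rewrite /ramp le_max lexx /= ge_max ler01 ge_min lexx. Qed.
Lemma ramp_lip x y : `|ramp x - ramp y| <= `|x - y|.
Proof.
have E z : ramp z = clampR (1 / 2) (1 / 2) z.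
  rewrite /ramp /clampR; have -> : 1 / 2 - 1 / 2 = 0 :> R by ring.
  by have -> : 1 / 2 + 1 / 2 = 1 :> R by field.
by rewrite !E; exact: clampR_lip.
Qed.

(** The polygon through c 0, ..., c N at integer times, constant outside [0, N]. Written as a sum of
    clamped increments, it is continuous without gluing. *)
Fixpoint interp (c : nat -> C) (N : nat) (u : R) : C :=
  if N is n.+1 then interp c n u + (ramp (u - n%:R))%:C%C * (c n.+1 - c n) else c 0%N.

Lemma interp_ge c N u : N%:R <= u -> interp c N u = c N.
Proof.
elim: N => [|N ih] //= h; rewrite -natr1 in h; rewrite ih ?ramp1; [|lra|lra].
by rewrite mul1r addrC subrK.
Qed.

Lemma interpE c N n u : (n < N)%N -> n%:R <= u <= n%:R + 1 ->
  interp c N u = (1 - (u - n%:R))%:C%C * c n + (u - n%:R)%:C%C * c n.+1.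
Proof.
elim: N => [|N ih] // + /andP[h1 h2]; rewrite ltnS leq_eqVlt => /orP[/eqP <-|nN] /=.
  by rewrite interp_ge // ramp_id ?rmorphB ?rmorph1; [ring | apply/andP; split; lra].
rewrite ih ?h1 // ramp0 ?mul0r ?addr0 //.
have : (n.+1%:R : R) <= N%:R by rewrite ler_nat.
by rewrite -natr1; lra.
Qed.

Lemma interp_ccont (c : nat -> C -> C) (r : C -> R) N z : (forall j, ccont (c j) z) ->
  ccont (fun x => (r x)%:C%C) z -> ccont (fun x => interp (fun j => c j x) N (r x)) z.
Proof.
move=> hc hr; elim: N => [|N ih] /=; first exact: hc.
have neg : ccont (fun x => - c N x) z.
  have := ccontM (ccont_cst (-1) z) (hc N); apply: (ccont_ext ltr01) => w _.
  by rewrite mulN1r.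
apply: ccontD => //; apply: ccontM; last exact: ccontD.
move=> e /hr [d d0 hd]; exists d => // w /hd.
rewrite -!rmorphB !cabsR; apply: le_lt_trans; apply: (le_trans (ramp_lip _ _)).
by have -> : r w - N%:R - (r z - N%:R) = r w - r z by ring.
Qed.

Lemma nat_floor (u : R) N : 0 <= u -> u < N%:R -> exists2 n, (n < N)%N & n%:R <= u <= n%:R + 1.
Proof.
move=> u0 uN; exists (Num.truncn u); first by rewrite -(ltr_nat R); apply: le_lt_trans uN; rewrite truncn_le.
by apply/andP; split; [rewrite truncn_le | rewrite natr1; apply: ltW; exact: truncnS_gt].
Qed.

Lemma within_I01 (gamma : R -> C) : {within @I01 R, continuous gamma} -> rcont (fun t => gamma (ramp t)).
Proof.
move=> /subspace_continuousP h t e e0.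
have rt : @I01 R (ramp t) by exact: ramp_in.
have /(h _ rt) : nbhs (gamma (ramp t)) (cball (gamma (ramp t)) e) by apply/nbhsCP; exists e.
move=> /nbhs_ballP [d d0 hd]; exists d => // y hy; apply: hd; last exact: ramp_in.
by rewrite /ball /= distrC; exact: (le_lt_trans (ramp_lip y t) hy).
Qed.

Lemma pair_complex_continuous : continuous (fun p : R * R => (p.1 +i* p.2)%C : C).
Proof.
move=> [x y] A /nbhsCP [e e0 he].
have e20 : 0 < e / 2 by rewrite divr_gt0.
exists (ball x (e / 2), ball y (e / 2)); first by split; exact: nbhsx_ballx.
move=> [x' y'] [/= h1 h2]; apply: he; rewrite /cball /mkset.
apply: (le_lt_trans (cabs_le_ReIm _)); rewrite ReB ImB /=.
rewrite /ball /= distrC in h1; rewrite /ball /= distrC in h2; lra.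
Qed.

End Interpolation.

(** * Hulls of connected open sets are simply connected *)

Section HullSimplyConnected.
Variable R : realType.
Local Notation C := (R[i]).
Local Notation Re := complex.Re.
Local Notation Im := complex.Im.
Local Notation pt := (int * int)%type.

(** Unrolls a homotopy into a finite array of walks in which each elementary square is an [okbox],
    with one time B after which all rows agree. *)
Lemma hom_seq (good : pt -> Prop) w w' : hom good w w' -> (forall i, okbox good [:: w i; w i.+1]) ->
  exists (m : nat) (W : nat -> nat -> pt), [/\ W 0%N = w, W m = w',
    forall j i, (j < m)%N -> okbox good [:: W j i; W j i.+1; W j.+1 i; W j.+1 i.+1],
    forall j, (j <= m)%N -> W j 0%N = w 0%N &
    exists B : nat, forall j i, (j <= m)%N -> (B <= i)%N -> W j i = w i].
Proof.
have sub (s s' : seq pt) : {subset s <= s'} -> okbox good s' -> okbox good s.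
  by move=> ss h p q /ss hp /ss hq; exact: h.
elim=> [{}w okw|{}w k q {}w' h1 h2 _ ih okw].
  by exists 0%N, (fun=> w); split => //; exists 0%N.
have [|m [W [W0 Wm Wq Wz [B hB]]]] := ih.
  move=> i; rewrite /upd; case: (eqVneq i k.+1) => [->|n1].
    by rewrite ifF; [apply: sub h2 => x; rewrite !inE => /orP[] ->; rewrite ?orbT | lia].
  case: (eqVneq i.+1 k.+1) => [[->]|n2]; last exact: okw.
  by apply: sub h1 => x; rewrite !inE => /orP[] ->; rewrite ?orbT.
exists m.+1, (fun j => if j is j'.+1 then W j' else w); split => //.
- move=> [|j] i; last by rewrite ltnS; exact: Wq.
  move=> _; rewrite W0 /upd; case: (eqVneq i k.+1) => [->|n1].
    rewrite ifF; last lia.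
    by apply: sub h2 => x; rewrite !inE => /or4P[] ->; rewrite ?orbT.
  case: (eqVneq i.+1 k.+1) => [[->]|n2].
    by apply: sub h1 => x; rewrite !inE => /or4P[] ->; rewrite ?orbT.
  by apply: sub (okw i) => x; rewrite !inE => /or4P[] ->; rewrite ?orbT.
- by move=> [|j] // hj; rewrite Wz.
- exists (maxn B k.+2) => -[|j] i // hj; rewrite geq_max => /andP[b1 b2].
  by rewrite hB // /upd ifF //; lia.
Qed.

Lemma floor_king (x y : R) : `|x - y| < 1 -> `|Num.floor x - Num.floor y| <= 1.
Proof.
have K (a b : R) : a - b < 1 -> Num.floor a <= Num.floor b + 1.
  move=> h; rewrite -ltzD1 floor_lt_int; have := floorD1_gt b; rewrite !intrD; lra.
rewrite ltr_norml => /andP[h1 h2]; have k1 := K x y h2; have k2 := K y x ltac:(lra); lia.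
Qed.

(** The integers in [xs] differ by at most 1 and X lies in the convex hull of their half-integer
    shifts, expressed by the bounds [lo] and [hi]; so X falls in one of the corresponding unit
    intervals. *)
Lemma conv_floor (xs : seq int) (X : R) : (forall x y, x \in xs -> y \in xs -> `|x - y| <= 1) ->
  (forall lo : R, (forall x : int, x \in xs -> lo <= x%:~R + 1 / 2) -> lo <= X) ->
  (forall hi : R, (forall x : int, x \in xs -> x%:~R + 1 / 2 <= hi) -> X <= hi) -> Num.floor X \in xs.
Proof.
move=> h1 hlo hhi; apply: contrapT => nf.
have ne x : x \in xs -> x <> Num.floor X by move=> hx e; apply: nf; rewrite -e.
have [/andP[f1 f2]] := floor_itv X; rewrite intrD in f2.
have [[x hx xf]|hn] := pselect (exists2 x, x \in xs & x < Num.floor X).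
  have : X <= (Num.floor X)%:~R - 1 / 2; last lra.
  apply: hhi => y hy; have := h1 x y hx hy; have := ne y hy => q1 q2.
  have : y <= Num.floor X - 1 by lia.
  by rewrite -(ler_int R) intrB; lra.
have : (Num.floor X)%:~R + 3 / 2 <= X; last lra.
apply: hlo => y hy; have q1 := ne y hy.
have : Num.floor X + 1 <= y.
  by have : ~ (y < Num.floor X) by [move=> q2; apply: hn; exists y]; lia.
by rewrite -(ler_int R) intrD; lra.
Qed.

Definition cell (e : R) (z : C) : pt := (Num.floor (Re z / e), Num.floor (Im z / e)).
Definition center (e : R) (p : pt) : C := ((e * (p.1%:~R + 1 / 2)) +i* (e * (p.2%:~R + 1 / 2)))%C.

Lemma conv2_ge (lo a b t : R) : 0 <= t <= 1 -> lo <= a -> lo <= b -> lo <= (1 - t) * a + t * b.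
Proof.
move=> /andP[t0 t1] h1 h2; have q1 : (1 - t) * lo <= (1 - t) * a by rewrite ler_wpM2l ?subr_ge0.
have q2 : t * lo <= t * b by rewrite ler_wpM2l.
lra.
Qed.
Lemma conv2_le (hi a b t : R) : 0 <= t <= 1 -> a <= hi -> b <= hi -> (1 - t) * a + t * b <= hi.
Proof.
move=> /andP[t0 t1] h1 h2; have q1 : (1 - t) * a <= (1 - t) * hi by rewrite ler_wpM2l ?subr_ge0.
have q2 : t * b <= t * hi by rewrite ler_wpM2l.
lra.
Qed.

Definition conv2 (t : R) (a b : C) : C := (1 - t)%:C%C * a + t%:C%C * b.

Lemma Re_conv2 t a b : Re (conv2 t a b) = (1 - t) * Re a + t * Re b.
Proof. by rewrite /conv2 ReD !(mulrC _%:C%C) !ReMr !(mulrC (Re _)). Qed.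
Lemma Im_conv2 t a b : Im (conv2 t a b) = (1 - t) * Im a + t * Im b.
Proof. by rewrite /conv2 ImD !(mulrC _%:C%C) !ImMr !(mulrC (Im _)). Qed.

Lemma cabs_conv2 (t : R) (a b c : C) (r : R) : 0 <= t <= 1 -> cabs (a - c) <= r -> cabs (b - c) <= r -> cabs (conv2 t a b - c) <= r.
Proof.
move=> /andP[t0 t1] ha hb.
have -> : conv2 t a b - c = (1 - t)%:C%C * (a - c) + t%:C%C * (b - c).
  by rewrite /conv2 rmorphB rmorph1; ring.
apply: (le_trans (cabsD _ _)); rewrite !cabsM !cabsR !ger0_norm ?subr_ge0 //.
by apply: conv2_le; rewrite ?t0.
Qed.

Lemma okbox_conv (e : R) (G : set C) p1 p2 p3 p4 (a b : R) : 0 < e ->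
  okbox (fun p => forall z, cell e z = p -> G z) [:: p1; p2; p3; p4] -> 0 <= a <= 1 -> 0 <= b <= 1 ->
  G (conv2 a (conv2 b (center e p1) (center e p2)) (conv2 b (center e p3) (center e p4))).
Proof.
move=> e0 ok ha hb; set z := conv2 a _ _.
have fx : Num.floor (Re z / e) \in [:: p1.1; p2.1; p3.1; p4.1].
  apply: conv_floor.
  - move=> x y; have -> : [:: p1.1; p2.1; p3.1; p4.1] = map fst [:: p1; p2; p3; p4] by [].
    by move=> /mapP[q hq ->] /mapP[q' hq' ->]; have [] := ok q q' hq hq'.
  - move=> lo h; rewrite ler_pdivlMr // /z !Re_conv2 /= mulrC.
    have H p : p \in [:: p1; p2; p3; p4] -> e * lo <= e * (p.1%:~R + 1 / 2).
      by move=> hp; rewrite ler_pM2l //; apply: h; exact: (map_f fst hp).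
    by do !apply: conv2_ge => //; apply: H; rewrite !inE eqxx ?orbT.
  - move=> hi h; rewrite ler_pdivrMr // /z !Re_conv2 /= (mulrC hi).
    have H p : p \in [:: p1; p2; p3; p4] -> e * (p.1%:~R + 1 / 2) <= e * hi.
      by move=> hp; rewrite ler_pM2l //; apply: h; exact: (map_f fst hp).
    by do !apply: conv2_le => //; apply: H; rewrite !inE eqxx ?orbT.
have fy : Num.floor (Im z / e) \in [:: p1.2; p2.2; p3.2; p4.2].
  apply: conv_floor.
  - move=> x y; have -> : [:: p1.2; p2.2; p3.2; p4.2] = map snd [:: p1; p2; p3; p4] by [].
    by move=> /mapP[q hq ->] /mapP[q' hq' ->]; have [] := ok q q' hq hq'.
  - move=> lo h; rewrite ler_pdivlMr // /z !Im_conv2 /= mulrC.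
    have H p : p \in [:: p1; p2; p3; p4] -> e * lo <= e * (p.2%:~R + 1 / 2).
      by move=> hp; rewrite ler_pM2l //; apply: h; exact: (map_f snd hp).
    by do !apply: conv2_ge => //; apply: H; rewrite !inE eqxx ?orbT.
  - move=> hi h; rewrite ler_pdivrMr // /z !Im_conv2 /= (mulrC hi).
    have H p : p \in [:: p1; p2; p3; p4] -> e * (p.2%:~R + 1 / 2) <= e * hi.
      by move=> hp; rewrite ler_pM2l //; apply: h; exact: (map_f snd hp).
    by do !apply: conv2_le => //; apply: H; rewrite !inE eqxx ?orbT.
have /mapP[q hq eq] : Num.floor (Re z / e) \in map fst [:: p1; p2; p3; p4] by [].
have /mapP[q' hq' eq'] : Num.floor (Im z / e) \in map snd [:: p1; p2; p3; p4] by [].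
by have [_ _] := ok q q' hq hq'; apply; rewrite /cell eq eq'.
Qed.

Lemma cell_chain (e : R) (G : set C) c w : 0 < e -> chain (~` G) e c w ->
  bchain (fun p => forall z, cell e z = p -> G z) (cell e c) (cell e w).
Proof.
move=> e0; have bad z : ~ G z -> ~ (forall x, cell e x = cell e z -> G x) by move=> nz h; apply: nz; exact: h.
have step (x y : R) : `|x - y| < e -> `|x / e - y / e| < 1.
  by move=> h; rewrite -mulrBl normrM (gtr0_norm (x := e^-1)) ?invr_gt0 // ltr_pdivrMr // mul1r.
elim=> [nc|u v hu ih nv uv]; first by apply: bchain_refl; exact: bad.
apply: bchain_step ih _ _ _; first exact: bad.
  by apply: floor_king; apply: step; rewrite -ReB; exact: le_lt_trans (Re_le_cabs _) uv.
by apply: floor_king; apply: step; rewrite -ImB; exact: le_lt_trans (Im_le_cabs _) uv.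
Qed.

Lemma cell_far (e : R) (M : int) z : 0 < e -> 2 * e * (`|M|%:~R + 1) < cabs z ->
  M < `|(cell e z).1| \/ M < `|(cell e z).2|.
Proof.
move=> e0 h; apply: contrapT => hn.
have K (x : R) : `|Num.floor (x / e)| <= `|M| -> `|x| <= e * (`|M|%:~R + 1).
  move=> hf; have [/andP[f1 f2]] := floor_itv (x / e); rewrite intrD in f2.
  rewrite mulrC -ler_pdivrMr // -{1}(gtr0_norm e0) -normfV -normrM ler_norml.
  have : - `|M| <= Num.floor (x / e) by lia.
  have : Num.floor (x / e) <= `|M| by lia.
  rewrite -!(ler_int R) intrN => q1 q2; apply/andP; split; lra.
have k1 := K (Re z); have k2 := K (Im z).
have {}k1 : `|Re z| <= e * (`|M|%:~R + 1) by apply: k1; have : ~ (M < `|(cell e z).1|) by [tauto]; rewrite /cell /=; lia.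
have {}k2 : `|Im z| <= e * (`|M|%:~R + 1) by apply: k2; have : ~ (M < `|(cell e z).2|) by [tauto]; rewrite /cell /=; lia.
have := cabs_le_ReIm z; move: k1 k2 h; rewrite -!mulrA; set a := e * _; lra.
Qed.

Lemma cell_near (e : R) z w : 0 < e -> `|(cell e z).1 - (cell e w).1| <= 1 -> `|(cell e z).2 - (cell e w).2| <= 1 ->
  cabs (z - w) <= 4 * e.
Proof.
move=> e0 h1 h2; apply: (le_trans (cabs_le_ReIm _)); rewrite ReB ImB.
have K (x y : R) : `|Num.floor (x / e) - Num.floor (y / e)| <= 1 -> `|x - y| <= 2 * e.
  move=> hf; have [/andP[f1 f2]] := floor_itv (x / e); have [/andP[g1 g2]] := floor_itv (y / e).
  rewrite !intrD in f2 g2.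
  have : Num.floor (x / e) <= Num.floor (y / e) + 1 by lia.
  have : Num.floor (y / e) <= Num.floor (x / e) + 1 by lia.
  rewrite -!(ler_int R) !intrD => q1 q2.
  rewrite -ler_pdivrMr // -{1}(gtr0_norm e0) -normfV -normrM mulrBl ler_norml; apply/andP; split; lra.
have := K _ _ h1; have := K _ _ h2; lra.
Qed.

Lemma center_cell (e : R) p : 0 < e -> cell e (center e p) = p.
Proof.
move=> e0; case: p => x y; rewrite /cell /center /=.
have K (n : int) : Num.floor (e * (n%:~R + 1 / 2) / e) = n.
  have -> : e * (n%:~R + 1 / 2) / e = n%:~R + 1 / 2 by field; rewrite gt_eqF.
  by apply: floor_def; rewrite intrD; apply/andP; split; lra.
by rewrite !K.
Qed.

Lemma nat_floor_le (u : R) N : (0 < N)%N -> 0 <= u -> u <= N%:R -> exists2 n, (n < N)%N & n%:R <= u <= n%:R + 1.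
Proof.
move=> N0 u0; rewrite le_eqVlt => /orP[/eqP ->|]; last exact: nat_floor.
by case: N N0 => // N _; exists N => //; rewrite natr1 lexx ler_nat leqnSn.
Qed.

Lemma interp_le0 (c : nat -> C) N (u : R) : u <= 0 -> interp c N u = c 0%N.
Proof.
move=> u0; elim: N => [|N ih] //=; rewrite ih ramp0 ?mul0r ?addr0 //.
by have : (0 : R) <= N%:R by []; lra.
Qed.

Lemma interp_eq (c c' : nat -> C) N (u : R) : (forall j, (j <= N)%N -> c j = c' j) -> interp c N u = interp c' N u.
Proof.
elim: N => [|N ih] /= h; first exact: h.
by rewrite ih ?h // => j hj; apply: h; exact: leq_trans hj _.
Qed.

Lemma interp_cst (k : C) N (u : R) : interp (fun=> k) N u = k.
Proof. by elim: N => [|N ih] //=; rewrite ih subrr mulr0 addr0. Qed.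

Lemma rcont_ccont (phi : R -> C) (r : C -> R) z : rcont phi -> ccont (fun x => (r x)%:C%C) z -> ccont (fun x => phi (r x)) z.
Proof.
move=> hp hr e e0; have [d d0 hd] := hp (r z) e e0; have [d' d0' hd'] := hr d d0.
by exists d' => // w /hd'; rewrite -rmorphB cabsR => /hd.
Qed.

Lemma ccont_Re (z : C) : ccont (fun x : C => (Re x)%:C%C) z.
Proof. by move=> e e0; exists e => // w; rewrite -rmorphB cabsR -ReB; apply: le_lt_trans; exact: Re_le_cabs. Qed.
Lemma ccont_Im (z : C) : ccont (fun x : C => (Im x)%:C%C) z.
Proof. by move=> e e0; exists e => // w; rewrite -rmorphB cabsR -ImB; apply: le_lt_trans; exact: Im_le_cabs. Qed.

Lemma ccontMR (r r' : C -> R) z : ccont (fun x => (r x)%:C%C) z -> ccont (fun x => (r' x)%:C%C) z ->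
  ccont (fun x => (r x * r' x)%:C%C) z.
Proof. by move=> h h'; have := ccontM h h'; apply: (ccont_ext ltr01) => w _; rewrite rmorphM. Qed.
Lemma ccontDR (r r' : C -> R) z : ccont (fun x => (r x)%:C%C) z -> ccont (fun x => (r' x)%:C%C) z ->
  ccont (fun x => (r x + r' x)%:C%C) z.
Proof. by move=> h h'; have := ccontD h h'; apply: (ccont_ext ltr01) => w _; rewrite rmorphD. Qed.
Lemma ccont_rcst (k : R) z : ccont (fun=> k%:C%C) z.
Proof. exact: ccont_cst. Qed.
Lemma ccont_ramp (r : C -> R) z : ccont (fun x => (r x)%:C%C) z -> ccont (fun x => (ramp (r x))%:C%C) z.
Proof.
move=> h e /h [d d0 hd]; exists d => // w /hd; rewrite -!rmorphB !cabsR; apply: le_lt_trans; exact: ramp_lip.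
Qed.

(** The positive distance of a compact loop from the complement of G, with compactness of [0,1]
    applied through cluster points. *)
Lemma loop_radius (G : set C) (gam : R -> C) : open G -> rcont gam -> (forall t, G (gam t)) -> (forall t, gam t = gam (ramp t)) ->
  exists2 rho : R, 0 < rho & forall t, cball (gam t) rho `<=` G.
Proof.
move=> oG cg hG hr; apply: contrapT => hn.
have h1 (n : nat) : exists t, 0 <= t <= 1 /\ ~ (cball (gam t) n.+1%:R^-1 `<=` G).
  apply: contrapT => h2; apply: hn; exists n.+1%:R^-1; first by rewrite invr_gt0.
  by move=> t; rewrite hr; apply: contrapT => h3; apply: h2; exists (ramp t); split => //; exact: ramp_in.
have [u hu] := choice h1.
have [|l _ hl] := @clbd_cluster R _ (fun n => (u n)%:C%C) (clbd_rect 0 1 0 0).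
  by move=> n; split => /=; [exact: (hu n).1 | rewrite lexx].
have /openCP /(_ _ (hG (Re l))) [r r0 hr1] := oG.
have r20 : 0 < r / 2 by rewrite divr_gt0.
have [d d0 hd] := cg (Re l) _ r20; have [m hm] := small_inv r20.
have [n mn hn1] := hl d d0 m.
apply: (hu n).2 => x hx; apply: hr1; move: hx (hm n mn); rewrite /cball /mkset; set q := _^-1 => q1 q2.
have : cabs (gam (u n) - gam (Re l)) < r / 2.
  apply: hd; have := Re_le_cabs ((u n)%:C%C - l); rewrite ReB /=; move: hn1; rewrite /cball /mkset; lra.
have := cabs_tri (gam (u n)) x (gam (Re l)); lra.
Qed.

Lemma loop_unif (gam : R -> C) (e : R) : rcont gam -> (forall t, gam t = gam (ramp t)) -> 0 < e ->
  exists2 d : R, 0 < d & forall t t', `|t' - t| < d -> cabs (gam t' - gam t) < e.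
Proof.
move=> cg hr e0.
have cc z : ccont (fun x => gam (Re x)) z by apply: rcont_ccont => //; exact: ccont_Re.
have [d d0 hd] := clbd_unif (clbd_rect 0 1 0 0) (fun z _ => cc z) e0.
exists d => // t t' tt; rewrite hr (hr t).
have := hd (ramp t)%:C%C (ramp t')%:C%C; apply; first by split => /=; [exact: ramp_in | rewrite lexx].
rewrite /cball /mkset -rmorphB cabsR; exact: le_lt_trans (ramp_lip _ _) tt.
Qed.

Lemma hull_simply_connected (V : set C) : open V -> connected V -> simply_connected (hull V).
Proof.
move=> oV cV; split; first exact: hull_connected.
move=> gamma [cg [g01 gin]]; set G := hull V in gin *.
have oG : open G by exact: open_hull.
pose gam t := gamma (ramp t).
have rg : rcont gam by exact: within_I01.
have gG t : G (gam t) by apply: gin; exact: ramp_in.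
have gr t : gam t = gam (ramp t) by rewrite /gam [ramp (ramp t)]ramp_id // ramp_in.
have gge t : 1 <= t -> gam t = gamma 0 by move=> h; rewrite /gam ramp1 // g01.
have gle t : t <= 0 -> gam t = gamma 0 by move=> h; rewrite /gam ramp0.
have [rho rho0 hrho] := loop_radius oG rg gG gr.
(* Cells close to the loop then lie in G: the estimates below use at most 5 e, which is less than
   rho. *)
pose e := rho / 16.
have e0 : 0 < e by rewrite divr_gt0.
have [d d0 hd] := loop_unif rg gr e0.
have [m0 hm0] := small_inv d0.
pose N := m0.+1.
have Nd : N%:R^-1 < d by exact: hm0.
have N0 : 0 < N%:R :> R by rewrite ltr0n.
pose z (i : nat) := gam (i%:R / N%:R).
(* Consecutive sample points lie in cells that may touch only at a corner. The odd times insert a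
   cell with mixed coordinates, which turns each such move into two side moves. *)
pose w (k : nat) : pt := if odd k then ((cell e (z k./2.+1)).1, (cell e (z k./2)).2) else cell e (z k./2).
pose p := cell e (gamma 0).
have zstep i : cabs (z i.+1 - z i) < e.
  apply: hd; have -> : i.+1%:R / N%:R - i%:R / N%:R = N%:R^-1 :> R by rewrite -natr1; field; rewrite gt_eqF.
  by rewrite gtr0_norm ?invr_gt0.
have king i : `|(cell e (z i.+1)).1 - (cell e (z i)).1| <= 1 /\ `|(cell e (z i.+1)).2 - (cell e (z i)).2| <= 1.
  have step (x y : R) : `|x - y| < e -> `|x / e - y / e| < 1.
    by move=> h; rewrite -mulrBl normrM (gtr0_norm (x := e^-1)) ?invr_gt0 // ltr_pdivrMr // mul1r.
  split; apply: floor_king; apply: step; rewrite -?ReB -?ImB.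
    exact: le_lt_trans (Re_le_cabs _) (zstep i).
  exact: le_lt_trans (Im_le_cabs _) (zstep i).
have zN i : (N <= i)%N -> z i = gamma 0.
  by move=> h; apply: gge; rewrite ler_pdivlMr // mul1r ler_nat.
have wnear k : [/\ `|(w k).1 - (cell e (z k./2)).1| <= 1, `|(w k).2 - (cell e (z k./2)).2| <= 1,
    `|(w k.+1).1 - (cell e (z k./2)).1| <= 1 & `|(w k.+1).2 - (cell e (z k./2)).2| <= 1].
  move: (king k./2); rewrite /w oddS -uphalfE uphalf_half.
  by case: (odd k); rewrite /= ?add1n ?add0n;
    move: (cell e (z k./2.+1)) (cell e (z k./2)) => c1 c2 [k1 k2]; split; lia.
have good_w k : forall x, cell e x = w k -> G x.
  move=> x hx; have [w1 w2 _ _] := wnear k; rewrite -hx in w1 w2.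
  by apply: (hrho (k./2%:R / N%:R)); rewrite /cball /mkset; have := cell_near e0 w1 w2; rewrite /e; lra.
have wcl : closed_walk w (2 * N) p.
  split.
  - by rewrite /w /= /z mul0r gle.
  - move=> i hi; have h1 : (N <= i./2)%N by lia.
    by rewrite /w !zN //; [case: odd; rewrite // /p; case: (cell e (gamma 0)) | lia].
  - move=> i; move: (king i./2); rewrite /adj /w oddS -uphalfE uphalf_half.
    case: (odd i); rewrite /= ?add1n ?add0n; move: (cell e (z i./2.+1)) (cell e (z i./2)) => c1 c2 [k1 k2] /=; lia.
have gw : gwalk (fun p => forall x, cell e x = p -> G x) w (2 * N) p by [].
have far q (M : int) : ~ (forall x, cell e x = q -> G x) ->
    exists2 q', bchain (fun p => forall x, cell e x = p -> G x) q q' & M < `|q'.1| \/ M < `|q'.2|.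
  move=> nb; have [c cq nGc] : exists2 c, cell e c = q & ~ G c.
    by apply: contrapT => h; apply: nb => x hx; apply: contrapT => h2; apply: h; exists x.
  have [|v ch hv] := @hull_chain R G c e (2 * e * (`|M|%:~R + 1)) e0 nGc; first by move=> /hull_hull.
  exists (cell e v); last exact: cell_far hv.
  by rewrite -cq; exact: cell_chain.
have hh := walk_contract far gw.
have okw i : okbox (fun p => forall x, cell e x = p -> G x) [:: w i; w i.+1].
  have [_ _ ha] := wcl; apply: (ok2 (ha i)) => [|| v]; [exact: good_w | exact: good_w |].
  by rewrite !inE => /orP[] /eqP ->; tauto.
have [m [W [W0 Wm Wq Wz [B hB]]]] := hom_seq hh okw.
have [w0 wn ha] := wcl.
(* A number of time steps after which every row of the array is constant at the base cell. *)
pose B1 := (maxn B (2 * N)).+1.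
have BB : (B <= B1)%N by rewrite ltnW // ltnS leq_maxl.
have NB : (2 * N <= B1)%N by rewrite ltnW // ltnS leq_maxr.
have B10 : 0 < B1%:R :> R by rewrite ltr0n.
(* Sample n of the walk is used at time n / B1 but belongs to loop time n / (2 N); this factor
   rescales the loop accordingly. *)
pose lam : R := B1%:R / (2 * N)%:R.
have N20 : 0 < (2 * N)%:R :> R by rewrite ltr0n.
have lam1 : 1 <= lam by rewrite ler_pdivlMr // mul1r ler_nat.
pose PP j t := interp (fun i => center e (W j i)) B1 (B1%:R * t).
pose P j t := if j is j'.+1 then PP j' t else gam (lam * t).
pose M : R := m.+2%:R.
(* For M s up to 1 the loop is reparametrised by the factor [lam]; then it is moved linearly to the
   polygon of the first row, and then from row to row. The first two terms cancel after the first
   phase. *)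
pose Hc (x : C) : C := gam (Im x * (1 + (lam - 1) * ramp (M * Re x))) - gam (lam * Im x)
   + interp (fun j => P j (Im x)) m.+1 (M * Re x - 1).
have HcE s t : Hc (s +i* t)%C = gam (t * (1 + (lam - 1) * ramp (M * s))) - gam (lam * t)
   + interp (fun j => P j t) m.+1 (M * s - 1) by [].
have cMRe x : ccont (fun x => (M * Re x)%:C%C) x by apply: ccontMR; [exact: ccont_rcst | exact: ccont_Re].
have cHc x : ccont Hc x.
  have cl : ccont (fun x => gam (lam * Im x)) x.
    by apply: rcont_ccont => //; apply: ccontMR; [exact: ccont_rcst | exact: ccont_Im].
  apply: ccontD; first apply: ccontD.
  - apply: (@rcont_ccont gam (fun x => Im x * (1 + (lam - 1) * ramp (M * Re x)))) => //.
    apply: ccontMR; first exact: ccont_Im.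
    apply: ccontDR; first exact: ccont_rcst.
    by apply: ccontMR; [exact: ccont_rcst | exact: ccont_ramp].
  - have := ccontM (ccont_cst (-1) x) cl; apply: (ccont_ext ltr01) => v _; by rewrite mulN1r.
  - apply: interp_ccont; last first.
      by apply: (ccontDR (r' := fun=> -1)) => //; exact: ccont_rcst.
    case=> [|j] //=; apply: (interp_ccont (c := fun i _ => center e (W j i))).
      by move=> i; exact: ccont_cst.
    by apply: ccontMR; [exact: ccont_rcst | exact: ccont_Im].
have samp t : @I01 R t -> exists2 n, (n < B1)%N & n%:R <= B1%:R * t <= n%:R + 1.
  move=> /andP[t0 t1]; apply: nat_floor_le => //; first by rewrite mulr_ge0.
  by rewrite ler_piMr.
have PPE j t n : (n < B1)%N -> n%:R <= B1%:R * t <= n%:R + 1 ->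
    PP j t = conv2 (B1%:R * t - n%:R) (center e (W j n)) (center e (W j n.+1)).
  by move=> h1 h2; rewrite /PP (interpE _ h1 h2).
have nearP t : @I01 R t -> cabs (PP 0%N t - gam (lam * t)) <= 5 * e.
  move=> ht; have [n nB hn] := samp t ht; rewrite (PPE _ _ _ nB hn) W0.
  have [w1 w2 w3 w4] := wnear n.
  have c1 : cabs (center e (w n) - z n./2) <= 4 * e by apply: cell_near => //; rewrite center_cell.
  have c2 : cabs (center e (w n.+1) - z n./2) <= 4 * e by apply: cell_near => //; rewrite center_cell.
  have c3 : cabs (gam (lam * t) - z n./2) < e.
    apply: hd; apply: le_lt_trans Nd.
    have -> : lam * t - n./2%:R / N%:R = (B1%:R * t - 2 * n./2%:R) / 2 / N%:R.
      by rewrite /lam natrM; field; rewrite gt_eqF.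
    rewrite normrM (gtr0_norm (x := N%:R^-1)) ?invr_gt0 // -[X in _ <= X]mul1r ler_wpM2r ?invr_ge0 ?(ltW N0) //.
    have nE : n%:R = (odd n)%:R + 2 * n./2%:R :> R by rewrite -{1}(odd_double_half n) natrD -mul2n natrM.
    move: hn => /andP[n1 n2]; rewrite nE in n1 n2.
    have : 0 <= ((odd n)%:R : R) <= 1 by case: (odd n); rewrite ?lexx ?ler01.
    by move: n1 n2; clear => n1 n2 /andP[q1 q2]; rewrite ler_norml; apply/andP; split; lra.
  have hu : 0 <= B1%:R * t - n%:R <= 1 by move: hn; clear => /andP[n1 n2]; apply/andP; split; lra.
  have := cabs_conv2 hu c1 c2.
  set X := conv2 _ _ _ => c4; have := cabs_tri (z n./2) X (gam (lam * t)); rewrite (cabsB (z n./2)); move: c3 c4; clear; lra.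
have HG s t : @I01 R s -> @I01 R t -> G (Hc (s +i* t)%C).
  move=> hs ht; rewrite HcE; have /andP[s0 s1] := hs.
  have Ms : 0 <= M * s <= m.+1%:R + 1.
    rewrite mulr_ge0 //= natr1 /M ler_piMr //.
  have [u1|u1] := leP (M * s) 1.
    by rewrite interp_le0; [rewrite /= subrK; exact: gG | lra].
  rewrite ramp1; last exact: ltW.
  rewrite mulr1; have -> : t * (1 + (lam - 1)) = lam * t by ring.
  rewrite subrr add0r; move: Ms => /andP[Ms0 Ms1].
  have [|||n nm hn] := @nat_floor_le (M * s - 1) m.+1 => //; [by rewrite subr_ge0 ltW|by rewrite lerBlDr|].
  rewrite (interpE _ nm hn).
  have hb : 0 <= M * s - 1 - n%:R <= 1 by move: hn; clear => /andP[n1 n2]; apply/andP; split; lra.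
  (* The move from the loop to the first polygon stays within 5 e of the loop; the later moves stay
     in good cells by [okbox_conv]. *)
  case: n nm hn hb => [|j] nm hn hb.
    apply: (hrho (lam * t)); rewrite /cball /mkset; apply: (@le_lt_trans _ _ (5 * e)); last by rewrite /e; lra.
    apply: (cabs_conv2 hb); last exact: nearP.
    by rewrite subrr cabs0 mulr_ge0 // ltW.
  have [k kB hk] := samp t ht; rewrite /= !(PPE _ _ _ kB hk).
  apply: okbox_conv => //; first exact: Wq.
  by move: hk; clear => /andP[n1 n2]; apply/andP; split; lra.
exists (fun x => Hc (x.1 +i* x.2)%C); split.
- apply: continuous_subspaceT => x; apply: continuous_comp; first exact: pair_complex_continuous.
  by apply/ccontP; exact: cHc.
- by move=> [s t] [hs ht]; exact: HG.
- move=> t ht; rewrite !HcE mulr0 ramp0 // mulr0 addr0 mulr1 interp_le0; last lra.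
  by rewrite /= subrK /gam ramp_id.
- move=> t ht; rewrite !HcE mulr1.
  have M1 : 1 <= M by rewrite /M ler1n.
  rewrite ramp1 // mulr1.
  have eM : m.+1%:R <= M - 1 by rewrite /M -natr1; lra.
  rewrite !interp_ge //= /PP Wm !interp_cst.
  have -> : t * (1 + (lam - 1)) = lam * t by ring.
  by rewrite mul0r mulr0 !subrr.
- move=> s /andP[s0 s1]; rewrite !HcE mul0r mulr0 mul1r mulr1.
  have r0 : 0 <= ramp (M * s) by have /andP[] := ramp_in (M * s).
  rewrite (gge (1 + _)); last by rewrite lerDl mulr_ge0 // subr_ge0.
  rewrite (gge lam) // (gle 0) //; congr (_ + _); apply: interp_eq => -[|j] hj /=.
    by rewrite mulr0 mulr1 (gge lam) // (gle 0).
  rewrite /PP mulr0 mulr1 interp_le0 // interp_ge // Wz // hB // w0 wn //.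
Qed.

End HullSimplyConnected.

(** * A piecewise affine angle function *)

Section Angle.
Variable R : realType.
Local Notation C := (R[i]).
Local Notation Re := complex.Re.
Local Notation Im := complex.Im.

Definition taxi (z : C) : R := `|Re z| + `|Im z|.

(* Turns counted on the diamond [taxi z = cst]; the value is only meaningful modulo 1 and for [z != 0]. *)
Definition ang (z : C) : R := if 0 <= Im z then (1 - Re z / taxi z) / 4 else (3 + Re z / taxi z) / 4.

Lemma taxi_ge z : cabs z <= taxi z.
Proof. exact: cabs_le_ReIm. Qed.

(** Within a half-plane the angle varies with Re z / [taxi z]. Across the negative real axis the two
    formulas agree, both giving 1/2, and across the positive one they differ by 1. *)
Lemma ang_jump (z w : C) : z != 0 -> 32 * cabs (w - z) <= cabs z ->
  exists2 k : R, k \is a Num.int & `|ang w - ang z - k| < 1 / 16.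
Proof.
move=> z0 h; have cz := cabs_gt0 z0; have s0 := taxi_ge z.
have := Re_le_cabs (w - z); have := Im_le_cabs (w - z); rewrite ReB ImB.
move: (cabs (w - z)) h => e h hy hx.
have sp : 0 < taxi z by lra.
have es : 32 * e <= taxi z by lra.
have x1 : `|Re z| <= `|Re w| + e by have := ler_normD (Re w) (Re z - Re w); rewrite addrCA subrr addr0 distrC; lra.
have x2 : `|Re w| <= `|Re z| + e by have := ler_normD (Re z) (Re w - Re z); rewrite addrCA subrr addr0; lra.
have y1 : `|Im z| <= `|Im w| + e by have := ler_normD (Im w) (Im z - Im w); rewrite addrCA subrr addr0 distrC; lra.
have y2 : `|Im w| <= `|Im z| + e by have := ler_normD (Im z) (Im w - Im z); rewrite addrCA subrr addr0; lra.
have tz : taxi z = `|Re z| + `|Im z| by []. have tw : taxi w = `|Re w| + `|Im w| by [].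
have sw : 0 < taxi w by lra.
have q1 : `|Re w / taxi w - Re z / taxi z| < 1 / 8.
  have -> : Re w / taxi w - Re z / taxi z = ((Re w - Re z) * taxi w + Re w * (taxi z - taxi w)) / (taxi z * taxi w).
    by field; rewrite !gt_eqF.
  rewrite normrM normfV (gtr0_norm (mulr_gt0 sp sw)) ltr_pdivrMr ?mulr_gt0 //.
  apply: (le_lt_trans (ler_normD _ _)); rewrite !normrM (gtr0_norm sw).
  have k1 : `|Re w - Re z| * taxi w <= e * taxi w by rewrite ler_wpM2r // ltW.
  have k2 : `|Re w| * `|taxi z - taxi w| <= taxi w * (2 * e).
    apply: ler_pM => //; first by rewrite tw lerDl.
    by rewrite ler_norml; apply/andP; split; lra.
  have k3 : 32 * e * taxi w <= taxi z * taxi w by rewrite ler_wpM2r // ltW.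
  have k4 : 0 < taxi z * taxi w by rewrite mulr_gt0.
  lra.
have mixed (u v : C) : 0 < taxi u -> 0 < taxi v -> `|Re v / taxi v - Re u / taxi u| < 1 / 8 ->
    `|Im u| <= taxi u / 16 -> 0 <= Im u -> Im v < 0 -> exists2 k : R, k \is a Num.int & `|ang v - ang u - k| < 1 / 16.
  move=> u0 v0; rewrite ltr_norml => /andP[d1 d2] hu u1 v1; rewrite /ang u1 leNgt v1 /=.
  have E : `|Re u / taxi u| = 1 - `|Im u| / taxi u.
    by rewrite normrM normfV (gtr0_norm u0) /taxi; field; rewrite gt_eqF.
  have l1 : `|Im u| / taxi u <= 1 / 16 by rewrite ler_pdivrMr //; lra.
  have l0 : 0 <= `|Im u| / taxi u by rewrite divr_ge0 // ltW.
  have [p|p] := leP 0 (Re u / taxi u).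
    rewrite ger0_norm // in E; exists 1; rewrite ?rpred1 // ltr_norml; move: d1 d2 l1 l0 E; clear => *; apply/andP; split; lra.
  rewrite ltr0_norm // in E; exists 0; rewrite ?rpred0 // ltr_norml; move: d1 d2 l1 l0 E; clear => *; apply/andP; split; lra.
have [zi|zi] := leP 0 (Im z); have [wi|wi] := leP 0 (Im w).
- exists 0; rewrite ?rpred0 // /ang zi wi; move: q1; clear; rewrite !ltr_norml => /andP[? ?]; apply/andP; split; lra.
- apply: mixed => //; move: hy; rewrite ler_norml => /andP[? ?]; rewrite ger0_norm //; lra.
- have [||||||k ki hk] := mixed w z => //.
  + by rewrite distrC.
  + move: hy; rewrite ler_norml => /andP[? ?]; rewrite ger0_norm //; lra.
  exists (- k); first by rewrite rpredN.
  by have -> : ang w - ang z - - k = - (ang z - ang w - k) by [ring]; rewrite normrN.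
- exists 0; rewrite ?rpred0 // /ang !leNgt zi wi /=; move: q1; clear; rewrite !ltr_norml => /andP[? ?]; apply/andP; split; lra.
Qed.

Definition diamond (S : R) (u : R) : C := interp (nth 0 [:: S%:C%C; (0 +i* S)%C; (- S)%:C%C; (0 +i* (- S))%C; S%:C%C]) 4 (4 * u).

(** On the diamond this angle is affine on each edge, so u is its angle modulo 1 by plain
    arithmetic. *)
Lemma diamond_ang (S u : R) : 0 < S -> 0 <= u <= 1 ->
  taxi (diamond S u) = S /\ ang (diamond S u) - u \is a Num.int.
Proof.
move=> S0 /andP[u0 u1].
have [|||n n4 hn] := @nat_floor_le R (4 * u) 4 => //; [lra|lra|].
have Sn : S != 0 by rewrite gt_eqF.
rewrite /diamond (interpE _ n4 hn) -/(conv2 _ _ _); move: hn; move: n4.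
have key (t x y v : R) : `|x| + `|y| = S -> (if 0 <= y then (1 - x / S) / 4 else (3 + x / S) / 4) - v \is a Num.int ->
   taxi (x +i* y)%C = S /\ ang (x +i* y)%C - v \is a Num.int.
  by move=> h1 h2; rewrite /ang /taxi /= h1.
have cE (z : C) : z = (Re z +i* Im z)%C by case: z.
case: n => [|[|[|[|n]]]] // _ /andP[h1 h2]; rewrite [conv2 _ _ _]cE Re_conv2 Im_conv2 /=; apply: (key 0).
- have a1 : 0 <= (4 * u) * S by rewrite mulr_ge0 //; lra.
  have a2 : 0 <= (1 - 4 * u) * S by rewrite mulr_ge0; lra.
  rewrite !ger0_norm; lra.
- have a1 : 0 <= (4 * u) * S by rewrite mulr_ge0 //; lra.
  rewrite ifT; last lra.
  have -> : (1 - ((1 - (4 * u - 0)) * S + (4 * u - 0) * 0) / S) / 4 - u = 0 by field.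
  exact: rpred0.
- have a1 : 0 <= (4 * u - 1) * S by rewrite mulr_ge0 //; lra.
  have a2 : 0 <= (2 - 4 * u) * S by rewrite mulr_ge0; lra.
  rewrite ler0_norm ?ger0_norm; lra.
- have a2 : 0 <= (2 - 4 * u) * S by rewrite mulr_ge0; lra.
  rewrite ifT; last lra.
  have -> : (1 - ((1 - (4 * u - 1)) * 0 + (4 * u - 1) * - S) / S) / 4 - u = 0 by field.
  exact: rpred0.
- have a1 : 0 <= (4 * u - 2) * S by rewrite mulr_ge0 //; lra.
  have a2 : 0 <= (3 - 4 * u) * S by rewrite mulr_ge0; lra.
  rewrite !ler0_norm; lra.
- have [e|e] := eqVneq (4 * u) 2.
    have -> : u = 1 / 2 by lra.
    rewrite ifT; last by rewrite (_ : 4 * (1 / 2) - 2 = 0 :> R); lra.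
    have -> : (1 - ((1 - (4 * (1 / 2) - 2)) * - S + (4 * (1 / 2) - 2) * 0) / S) / 4 - 1 / 2 = 0 by field.
    exact: rpred0.
  have a1 : 0 < (4 * u - 2) * S by rewrite mulr_gt0 // subr_gt0 lt_neqAle eq_sym e.
  rewrite ifF; last by apply/negbTE; rewrite -ltNge; lra.
  have -> : (3 + ((1 - (4 * u - 2)) * - S + (4 * u - 2) * 0) / S) / 4 - u = 0 by field.
  exact: rpred0.
- have a1 : 0 <= (4 * u - 3) * S by rewrite mulr_ge0 //; lra.
  have a2 : 0 <= (4 - 4 * u) * S by rewrite mulr_ge0; lra.
  rewrite ger0_norm ?ler0_norm; lra.
- have [e|e] := eqVneq u 1.
    rewrite e ifT; last by rewrite (_ : 1 - (4 * 1 - 3) = 0 :> R); lra.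
    have -> : (1 - ((1 - (4 * 1 - 3)) * 0 + (4 * 1 - 3) * S) / S) / 4 - 1 = -1 by field.
    by rewrite rpredN rpred1.
  have a1 : 0 < (4 - 4 * u) * S by rewrite mulr_gt0 //; have : u < 1 by [rewrite lt_neqAle e]; lra.
  rewrite ifF; last by apply/negbTE; rewrite -ltNge; lra.
  have -> : (3 + ((1 - (4 * u - 3)) * 0 + (4 * u - 3) * S) / S) / 4 - u = 0 by field.
  exact: rpred0.
Qed.

Lemma diamond01 S : diamond S 0 = diamond S 1.
Proof. by rewrite /diamond mulr0 mulr1 interp_le0 // interp_ge. Qed.

Lemma diamond_unif S (e : R) : 0 < e -> exists2 d : R, 0 < d & forall u v, 0 <= u <= 1 -> 0 <= v <= 1 ->
  `|v - u| < d -> cabs (diamond S v - diamond S u) < e.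
Proof.
move=> e0; have cc z : ccont (fun x : C => diamond S (Re x)) z.
  apply: (interp_ccont (c := fun j _ => nth 0 _ j) (r := fun x => 4 * Re x)); first by move=> j; exact: ccont_cst.
  by apply: ccontMR; [exact: ccont_rcst | exact: ccont_Re].
have [d d0 hd] := clbd_unif (clbd_rect 0 1 0 0) (fun z _ => cc z) e0.
exists d => // u v hu hv h; have := hd u%:C%C v%:C%C; apply; first by split => //=; rewrite lexx.
by rewrite /cball /mkset -rmorphB cabsR.
Qed.

Lemma int_close (x y : R) : x - y \is a Num.int -> `|x - y| < 1 -> x = y.
Proof. by move=> h1 h2; apply/eqP; rewrite -subr_eq0; apply/eqP; exact: int_small. Qed.

(** Along the diamond th(D u) - u is locally constant, yet D 0 = D 1 would make it drop by 1. *)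
Lemma no_branch (z0 : C) (th : C -> R) (S d : R) : 0 < S -> 0 < d ->
  (forall z, taxi (z - z0) = S -> th z - ang (z - z0) \is a Num.int) ->
  (forall z w, taxi (z - z0) = S -> taxi (w - z0) = S -> cabs (z - w) < d -> `|th z - th w| < 1 / 2) -> False.
Proof.
move=> S0 d0 h1 h2; have [d' d0' hd'] := diamond_unif S d0.
pose D u := z0 + diamond S u.
have DB u : D u - z0 = diamond S u by rewrite /D addrC addKr.
pose d1 := Num.min d' (1 / 4).
have d10 : 0 < d1 by rewrite lt_min d0' /=; lra.
have H := @locconst R (csegment 0 1) (fun x => th (D (Re x)) - Re x) d1 d10 (@csegment_connected R 0 1).
have in01 x : csegment (0 : C) 1 x -> 0 <= Re x <= 1.
  by move=> [t /=]; rewrite in_itv /= => ht <-; rewrite add0r subr0 mulr1 /=.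
have : th (D (Re (0 : C))) - Re (0 : C) = th (D (Re (1 : C))) - Re (1 : C).
  apply: H; [|exact: csegmentl|exact: csegmentr].
  move=> z w /in01 hz /in01 hw; rewrite /d1 lt_min => /andP[zw1 zw2].
  have [t1 i1] := diamond_ang S0 hz; have [t2 i2] := diamond_ang S0 hw.
  have rz : `|Re z - Re w| <= cabs (z - w) by rewrite -ReB; exact: Re_le_cabs.
  apply: int_close.
    have -> : th (D (Re z)) - Re z - (th (D (Re w)) - Re w) = (th (D (Re z)) - ang (D (Re z) - z0)) + (ang (diamond S (Re z)) - Re z)
      - ((th (D (Re w)) - ang (D (Re w) - z0)) + (ang (diamond S (Re w)) - Re w)) by rewrite !DB; ring.
    by apply: rpredB; apply: rpredD => //; apply: h1; rewrite DB.
  have : `|th (D (Re z)) - th (D (Re w))| < 1 / 2.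
    apply: h2; rewrite ?DB // /D opprD addrACA subrr add0r; apply: hd' => //; lra.
  move: rz; rewrite ler_norml !ltr_norml => /andP[? ?] /andP[? ?]; apply/andP; split; lra.
rewrite /= /D diamond01; lra.
Qed.

End Angle.

(** * Monodromy of the angle in a simply connected set *)

Section AngleLift.
Variable R : realType.
Local Notation C := (R[i]).
Local Notation Re := complex.Re.
Local Notation Im := complex.Im.
Variables (W : set C) (z0 : C).
Hypothesis nWz0 : ~ W z0.
Local Notation A z := (ang (z - z0)).

(** The ratio 128 of the radii gives |w - z| < r / 64 while z0, lying outside W, is at distance at
    least r from x; so [ang_jump] applies. *)
Definition wstep (z w : C) := exists x r, [/\ cball x r `<=` W, cball x (r / 8 / 16) z & cball x (r / 8 / 16) w].

Lemma wstep_sym z w : wstep z w -> wstep w z.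
Proof. by move=> [x [r [h1 h2 h3]]]; exists x, r. Qed.

Lemma cball_avoid x (r : R) : cball x r `<=` W -> r <= cabs (x - z0).
Proof. by move=> h; rewrite leNgt; apply/negP => h1; apply: nWz0; apply: h; rewrite /cball /mkset cabsB. Qed.

Lemma cball_jump x (r : R) z w : cball x r `<=` W -> cball x (r / 8 / 16) z -> cball x (r / 8 / 16) w ->
  exists2 k : R, k \is a Num.int & `|A w - A z - k| < 1 / 16.
Proof.
move=> /cball_avoid h1; rewrite /cball /mkset => h2 h3.
have c0 := cabs_ge0 (z - x); have q1 := cabs_tri z x z0; have q2 := cabs_tri x w z; rewrite (cabsB x z) in q1 q2.
apply: ang_jump; first by apply/eqP => e; rewrite e cabs0 in q1; lra.
have -> : w - z0 - (z - z0) = w - z by ring.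
lra.
Qed.

(** Discrete continuation of the angle: a point together with a representative of its angle moves by
    small steps inside W. *)
Inductive lpath (p : C) (a : R) : C -> R -> Prop :=
| lpath_refl : lpath p a p a
| lpath_step z b w c : lpath p a z b -> wstep z w -> c - A w \is a Num.int -> `|c - b| < 1 / 16 -> lpath p a w c.

Lemma lpath_trans p a z b w c : lpath p a z b -> lpath z b w c -> lpath p a w c.
Proof. by move=> h1; elim=> // z' b' w' c' _ ih h2 h3 h4; exact: lpath_step ih h2 h3 h4. Qed.

Lemma lpath_int p a z b : a - A p \is a Num.int -> lpath p a z b -> b - A z \is a Num.int.
Proof. by move=> h []. Qed.

Lemma lpath_sym p a z b : a - A p \is a Num.int -> lpath p a z b -> lpath z b p a.
Proof.
move=> hp; elim=> [|z' b' w' c' h1 ih h2 h3 h4]; first exact: lpath_refl.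
apply: (lpath_trans (z := z') (b := b')) => //.
apply: lpath_step; [exact: lpath_refl|exact: wstep_sym|exact: lpath_int h1|by rewrite distrC].
Qed.

Lemma lpath_seq p a z b : a - A p \is a Num.int -> lpath p a z b -> exists N (c : nat -> C) (th : nat -> R),
  [/\ c 0%N = p, th 0%N = a, c N = z, th N = b &
    [/\ (forall i, th i - A (c i) \is a Num.int), (forall i, (i < N)%N -> wstep (c i) (c i.+1)) &
    (forall i, (i < N)%N -> `|th i.+1 - th i| < 1 / 16)]].
Proof.
move=> hp; elim=> [|z' b' w d h1 [N [c [th [c0 t0 cN tN [i1 i2 i3]]]]] h2 h3 h4].
  by exists 0%N, (fun=> p), (fun=> a); split.
exists N.+1, (fun i => if (i <= N)%N then c i else w), (fun i => if (i <= N)%N then th i else d).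
rewrite ltnn; split => //; split.
- by move=> i; case: ifP.
- move=> i; rewrite ltnS => iN'; rewrite iN'; move: iN'; rewrite leq_eqVlt => /orP[/eqP ->|iN]; first by rewrite ltnn cN.
  by rewrite iN; exact: i2.
- move=> i; rewrite ltnS => iN'; rewrite iN'; move: iN'; rewrite leq_eqVlt => /orP[/eqP ->|iN]; first by rewrite ltnn tN.
  by rewrite iN; exact: i3.
Qed.

(** The homotopy, extended to the plane by clamping its parameters, stays away from z0; its angle is
    continuous modulo 1 and lifts over the parameter square. *)
Lemma homotopy_branch (H : R * R -> C) : {within @sq01 R, continuous H} -> (forall p, @sq01 R p -> W (H p)) ->
  exists (th : R -> R -> R) (d : R), [/\ 0 < d, (forall s t, @I01 R s -> @I01 R t -> th s t - A (H (s, t)) \is a Num.int) &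
   forall s t s' t', @I01 R s -> @I01 R t -> @I01 R s' -> @I01 R t' -> `|s - s'| < d -> `|t - t'| < d ->
     `|th s t - th s' t'| < 1 / 8].
Proof.
move=> cH hW; pose Hc (z : C) := H (ramp (Re z), ramp (Im z)).
have in_sq (x y : R) : @sq01 R (ramp x, ramp y) by split; exact: ramp_in.
have cHc z : ccont Hc z.
  move=> e e0; move/subspace_continuousP: cH => /(_ _ (in_sq (Re z) (Im z))) h.
  have /h : nbhs (Hc z) (cball (Hc z) e) by apply/nbhsCP; exists e.
  move=> /nbhs_ballP [d d0 hd]; exists d => // w; rewrite /cball /mkset => hw; apply: hd; last exact: in_sq.
  split; rewrite /ball /= distrC; apply: (le_lt_trans (ramp_lip _ _)); rewrite -?ReB -?ImB.
    exact: le_lt_trans (Re_le_cabs _) hw.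
  exact: le_lt_trans (Im_le_cabs _) hw.
have cH0 z : ccont (fun z => Hc z - z0) z by apply: ccontD => //; exact: ccont_cst.
have [|z1 _ hz1] := clbd_min_cabs (clbd_rect 0 1 0 1) _ (fun z _ => cH0 z).
  by exists 0; split => /=; rewrite lexx ler01.
pose rho := cabs (Hc z1 - z0).
have rho0 : 0 < rho.
  apply: cabs_gt0; apply/eqP => /eqP; rewrite subr_eq0 => /eqP e; apply: nWz0; rewrite -e; apply: hW; exact: in_sq.
have ramp2 (x : R) : ramp (ramp x) = ramp x by rewrite ramp_id // ramp_in.
have Hr z : Hc z = Hc (ramp (Re z) +i* ramp (Im z))%C by rewrite /Hc /= !ramp2.
have hrho z : rho <= cabs (Hc z - z0) by rewrite Hr; apply: hz1; split => /=; exact: ramp_in.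
have [|d d0 hd] := clbd_unif (clbd_rect 0 1 0 1) (fun z _ => cHc z) (e := rho / 32); first by rewrite divr_gt0.
have hj : jump (fun z => A (Hc z)) d.
  move=> w z zw.
  have [||k ki hk] := @ang_jump R (Hc z - z0) (Hc w - z0).
  - by apply/eqP => e; have := hrho z; rewrite e cabs0; lra.
  - have -> : Hc w - z0 - (Hc z - z0) = Hc w - Hc z by ring.
    have : cabs (Hc w - Hc z) < rho / 32; last by have := hrho z; lra.
    rewrite Hr [Hc z]Hr; apply: hd; first by split => /=; exact: ramp_in.
    rewrite /cball /mkset; apply: le_lt_trans zw; apply: cabs_le_coord; rewrite !(ReB, ImB) /=; exact: ramp_lip.
  by exists k => //; lra.
have [th [th1 th2]] := lift 1 d0 hj.
have sqI s t : @I01 R s -> @I01 R t -> csq 0 1 (s +i* t)%C.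
  by move=> /andP[s0 s1] /andP[t0 t1]; apply/csqP; rewrite /= !subr0 !ger0_norm.
exists (fun s t => th (s +i* t)%C), (d / 2); split; first by rewrite divr_gt0.
  move=> s t hs ht; have := th1 _ (sqI s t hs ht); rewrite /Hc /= !ramp_id //.
move=> s t s' t' hs ht hs' ht' q1 q2; apply: th2; try exact: sqI.
apply: (le_lt_trans (cabs_le_ReIm _)); rewrite ReB ImB /=; lra.
Qed.

Lemma I01_locconst (phi : R -> R) d a b : 0 < d -> a <= b ->
  (forall s t, a <= s <= b -> a <= t <= b -> `|s - t| < d -> phi s = phi t) -> phi a = phi b.
Proof.
move=> d0 ab h.
have H := @locconst R (csegment a%:C%C b%:C%C) (fun x => phi (Re x)) d d0 (@csegment_connected R _ _).
have inab x : csegment (a%:C%C : C) b%:C%C x -> a <= Re x <= b.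
  move=> [t /=]; rewrite in_itv /= => /andP[t0 t1] <-; rewrite -rmorphB -rmorphM -rmorphD /=.
  have q1 : 0 <= t * (b - a) by rewrite mulr_ge0 // subr_ge0.
  have q2 : t * (b - a) <= b - a by rewrite ler_piMl // subr_ge0.
  apply/andP; split; lra.
apply: (H _ a%:C%C b%:C%C); [|exact: csegmentl|exact: csegmentr].
move=> z w /inab hz /inab hw zw; apply: h => //; rewrite -ReB; exact: le_lt_trans (Re_le_cabs _) zw.
Qed.

Hypothesis oW : open W.
Hypothesis loops : forall gamma, loop_in W gamma -> null_homotopic_in W gamma.

Lemma rep_near (b x : R) (y k : R) : k \is a Num.int -> b - x \is a Num.int -> `|y - x - k| < 1 / 16 ->
  exists2 b', b' - y \is a Num.int & `|b' - b| < 1 / 16.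
Proof.
move=> ki bi h; exists (y + (b - x - k)); first by rewrite addrC addKr rpredB.
by have -> : y + (b - x - k) - b = y - x - k by ring.
Qed.

(** The polygon through the steps is a loop in W, and a null homotopy carries a branch of its angle.
    The change of the branch around the loop is the same for all s and is 0 for the final constant
    loop. *)
Lemma lpath_loop p a b : a - A p \is a Num.int -> lpath p a p b -> b = a.
Proof.
move=> hp /(lpath_seq hp) [N [c [tt [c0 t0 cN tN [i1 i2 i3]]]]].
have [N0|N0] := posnP N; first by rewrite -t0 -tN N0.
have Np : 0 < N%:R :> R by rewrite ltr0n.
pose gam (t : R) := interp c N (N%:R * t).
have seg t i : (i < N)%N -> i%:R <= N%:R * t <= i%:R + 1 -> forall x r, cball x r (c i) -> cball x r (c i.+1) -> cball x r (gam t).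
  move=> iN ht x r h1 h2; rewrite /gam (interpE _ iN ht) -/(conv2 _ _ _).
  have hu : 0 <= N%:R * t - i%:R <= 1 by move: ht => /andP[? ?]; apply/andP; split; lra.
  rewrite /cball /mkset in h1 h2 *.
  have [h|h] := leP (cabs (c i - x)) (cabs (c i.+1 - x)).
    apply: le_lt_trans h2; exact: (cabs_conv2 hu h).
  apply: le_lt_trans h1; exact: (cabs_conv2 hu (lexx _) (ltW h)).
have samp t : @I01 R t -> exists2 n, (n < N)%N & n%:R <= N%:R * t <= n%:R + 1.
  move=> /andP[q0 q1]; apply: nat_floor_le => //; first by rewrite mulr_ge0 // ltW.
  by rewrite ler_piMr // ltW.
have lg : loop_in W gam.
  split; last split.
  - apply: continuous_subspaceT => t; have cc z : ccont (fun x : C => gam (Re x)) z.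
      apply: (interp_ccont (c := fun j _ => c j) (r := fun x => N%:R * Re x)); first by move=> j; exact: ccont_cst.
      by apply: ccontMR; [exact: ccont_rcst | exact: ccont_Re].
    move=> B /nbhsCP [e e0 he]; have [d d0 hd] := cc t%:C%C e e0.
    apply/nbhs_ballP; exists d => // t'; rewrite /ball /= distrC => ht; apply: he.
    by have := hd t'%:C%C; apply; rewrite /cball /mkset -rmorphB cabsR.
  - by rewrite /gam mulr0 mulr1 interp_le0 // interp_ge // c0 cN.
  - move=> t /samp [n nN hn]; have [x [r [xr x1 x2]]] := i2 n nN.
    apply: xr; have := seg t n nN hn x _ x1 x2; rewrite /cball /mkset; have := cabs_ge0 (c n - x); move: x1; rewrite /cball /mkset; lra.
have [H [cH HW H0 H1 Hs]] := loops lg.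
have [th [d [d0 th1 th2]]] := homotopy_branch cH HW.
have I0 : @I01 R 0 by rewrite /I01 /mkset lexx ler01.
have I1 : @I01 R 1 by rewrite /I01 /mkset lexx ler01.
(* The loops of the homotopy are closed, so this difference is an integer, and it varies little with
   s. *)
have E1 : th 0 0 - th 0 1 = th 1 0 - th 1 1.
  apply: (@I01_locconst (fun s => th s 0 - th s 1) d) => // s t hs ht st; apply: int_close.
    have -> : th s 0 - th s 1 - (th t 0 - th t 1) = (th s 0 - A (H (s, 0))) - (th s 1 - A (H (s, 1))) -
       ((th t 0 - A (H (t, 0))) - (th t 1 - A (H (t, 1)))) by rewrite !(Hs _ hs) !(Hs _ ht); ring.
    by apply: rpredB; apply: rpredB; apply: th1.
  have z1 : `|0 - 0 : R| < d by rewrite subrr normr0.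
  have z2 : `|1 - 1 : R| < d by rewrite subrr normr0.
  have := th2 _ _ _ _ hs I0 ht I0 st z1; have := th2 _ _ _ _ hs I1 ht I1 st z2.
  rewrite !ltr_norml => /andP[? ?] /andP[? ?]; apply/andP; split; lra.
have z1 : `|1 - 1 : R| < d by rewrite subrr normr0.
have z2 : `|0 - 0 : R| < d by rewrite subrr normr0.
have E2 : th 1 0 = th 1 1.
  apply: (@I01_locconst (th 1) d) => // s t hs ht st; apply: int_close.
    have -> : th 1 s - th 1 t = (th 1 s - A (H (1, s))) - (th 1 t - A (H (1, t))) by rewrite (H1 _ hs) (H1 _ ht); ring.
    by apply: rpredB; apply: th1.
  have := th2 _ _ _ _ I1 hs I1 ht z1 st; lra.
have thg t : @I01 R t -> th 0 t - A (gam t) \is a Num.int by move=> ht; rewrite -H0 //; exact: th1.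
(* The branch along s = 0 and the discrete continuation differ by a constant: on each step both are
   compared with local representatives [be t] close to [tt i]. *)
have main i : (i <= N)%N -> th 0 (i%:R / N%:R) - tt i = th 0 0 - tt 0%N.
  elim: i => [|i ih] iN; first by rewrite mul0r.
  rewrite -ih; last exact: ltnW.
  have iN1 : i%:R + 1 <= N%:R :> R by rewrite natr1 ler_nat.
  have i0 : 0 <= i%:R :> R by [].
  have inI t : i%:R / N%:R <= t <= i.+1%:R / N%:R -> @I01 R t /\ i%:R <= N%:R * t <= i%:R + 1.
    rewrite ler_pdivrMr // ler_pdivlMr // -natr1 => /andP[q1 q2]; split; last first.
      by apply/andP; split; rewrite mulrC.
    apply/andP; split; rewrite -(ler_pM2r Np) ?mul0r ?mul1r; lra.
  have [x [r [xr x1 x2]]] := i2 i iN.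
  have ex t : exists b, i%:R / N%:R <= t <= i.+1%:R / N%:R -> b - A (gam t) \is a Num.int /\ `|b - tt i| < 1 / 16.
    have [ht|ht] := pselect (i%:R / N%:R <= t <= i.+1%:R / N%:R); last by exists 0.
    have [tI tN'] := inI t ht.
    have [k ki hk] := cball_jump xr x1 (seg t i iN tN' x _ x1 x2).
    by have [b' h1 h2] := rep_near ki (i1 i) hk; exists b'.
  have [be hbe] := choice ex.
  have le1 : i%:R / N%:R <= i.+1%:R / N%:R :> R by rewrite ler_pM2r ?invr_gt0 // ler_nat.
  have := @I01_locconst (fun t => th 0 t - be t) d _ _ d0 le1.
  have gi (j : nat) : (j <= N)%N -> gam (j%:R / N%:R) = c j.
    move=> jN; rewrite /gam mulrCA mulfV ?gt_eqF // mulr1.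
    move: jN; rewrite leq_eqVlt => /orP[/eqP ->|jN]; first by rewrite interp_ge.
    rewrite (interpE _ jN); last by rewrite lexx lerDl ler01.
    by rewrite subrr subr0 rmorph1 rmorph0 mul1r mul0r addr0.
  have [|b1 b2] := hbe (i%:R / N%:R); first by rewrite lexx le1.
  have [|b3 b4] := hbe (i.+1%:R / N%:R); first by rewrite lexx le1.
  rewrite gi ?(ltnW iN) // in b1; rewrite gi // in b3.
  have e1 : be (i%:R / N%:R) = tt i.
    apply: int_close; last lra.
    have -> : be (i%:R / N%:R) - tt i = (be (i%:R / N%:R) - A (c i)) - (tt i - A (c i)) by ring.
    by rewrite rpredB.
  have e2 : be (i.+1%:R / N%:R) = tt i.+1.
    apply: int_close; last first.
      by move: b4 (i3 i iN); clear; rewrite !ltr_norml => /andP[? ?] /andP[? ?]; apply/andP; split; lra.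
    have -> : be (i.+1%:R / N%:R) - tt i.+1 = (be (i.+1%:R / N%:R) - A (c i.+1)) - (tt i.+1 - A (c i.+1)) by ring.
    by rewrite rpredB.
  rewrite e1 e2 => -> // s t hs ht st.
  have [hs1 hs2] := hbe s hs; have [ht1 ht2] := hbe t ht.
  have [sI _] := inI s hs; have [tI _] := inI t ht.
  apply: int_close.
    have -> : th 0 s - be s - (th 0 t - be t) = (th 0 s - A (gam s)) - (be s - A (gam s)) - ((th 0 t - A (gam t)) - (be t - A (gam t))) by ring.
    by apply: rpredB; apply: rpredB => //; exact: thg.
  have := th2 _ _ _ _ I0 sI I0 tI z2 st; move: hs2 ht2; clear.
  rewrite !ltr_norml => /andP[? ?] /andP[? ?] /andP[? ?]; apply/andP; split; lra.
have := main N (leqnn N); rewrite divff ?gt_eqF // tN t0; lra.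
Qed.

(** The angle is continued from one point p. Connectedness makes every point reachable, and
    [lpath_loop] makes the value independent of the path. *)
Lemma simply_connected_branch : connected W -> exists al : C -> R,
  (forall z, W z -> al z - A z \is a Num.int) /\ forall z w, wstep z w -> `|al w - al z| < 1 / 16.
Proof.
move=> cW; have [[p Wp]|hn] := pselect (exists p, W p); last first.
  exists (fun=> 0); split=> [z Wz|z w _]; first by case: hn; exists z.
  by rewrite subrr normr0; lra.
pose X := [set z | exists b, lpath p (A p) z b].
have pi : A p - A p \is a Num.int by rewrite subrr rpred0.
have ext z w b : lpath p (A p) z b -> wstep z w -> exists2 b', lpath p (A p) w b' & `|b' - b| < 1 / 16.
  move=> hb zw; have [x [r [h1 h2 h3]]] := zw; have [k ki hk] := cball_jump h1 h2 h3.
  have [b' q1 q2] := rep_near ki (lpath_int pi hb) hk; exists b' => //; exact: lpath_step hb zw q1 q2.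
have near z : W z -> exists2 r : R, 0 < r & forall w, cball z r w -> wstep z w.
  move=> Wz; have /openCP /(_ z Wz) [r r0 hr] := oW; exists (r / 8 / 16); first by rewrite !divr_gt0.
  by move=> w hw; exists z, r; split => //; apply: cballxx; rewrite !divr_gt0.
have wW z w : wstep z w -> W w.
  move=> [x [r [h1 h2 h3]]]; apply: h1; move: h3; rewrite /cball /mkset; have := cabs_ge0 (w - x); lra.
have XW : W `<=` [set z | W z /\ X z].
  apply: (@connected_open_sub _ W _ [set z | W z /\ ~ X z]) => //.
  - apply/openCP => z [Wz [b hb]]; have [r r0 hr] := near z Wz; exists r => // w /hr zw; split; first exact: wW zw.
    by have [b' h _] := ext _ _ _ hb zw; exists b'.
  - apply/openCP => z [Wz nX]; have [r r0 hr] := near z Wz; exists r => // w /hr zw; split; first exact: wW zw.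
    by move=> [b hb]; apply: nX; have [b' h _] := ext _ _ _ hb (wstep_sym zw); exists b'.
  - by apply/seteqP; split => // z [_ [[_ h1] [_ h2]]].
  - by move=> z Wz; have [h|h] := pselect (X z); [left|right].
  - by exists p; split => //; split => //; exists (A p); exact: lpath_refl.
have ex z : exists b, W z -> lpath p (A p) z b.
  by have [Wz|h] := pselect (W z); [have [_ [b hb]] := XW z Wz; exists b | exists 0].
have [al hal] := choice ex; exists al; split=> [z /hal h|z w zw]; first exact: lpath_int h.
have hz := hal z (wW _ _ (wstep_sym zw)); have hw := hal w (wW _ _ zw).
have [b' hb h] := ext _ _ _ hz zw.
suff -> : al w = b' by [].
by apply: lpath_loop (lpath_int pi hb) _; exact: lpath_trans (lpath_sym pi hb) hw.
Qed.

End AngleLift.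

(** * Simply connected open sets contain their hulls *)

Section SimplyConnectedHull.
Variable R : realType.
Local Notation C := (R[i]).
Local Notation Re := complex.Re.
Local Notation Im := complex.Im.

(* A branch of the angle on W, cut off away from the boundary of U inside U, glues with
   the angle outside U to a function that lifts to the plane; the lift is a branch of the
   angle on a large diamond. *)
Lemma simply_connected_hull (W : set C) : open W -> simply_connected W -> hull W `<=` W.
Proof.
move=> oW [cW loops] z0 [U [oU bU Uz0 UW]]; apply: contrapT => nW.
have [al [al1 al2]] := simply_connected_branch nW oW loops cW.
have bd0 : boundary U !=set0 by apply: boundary_nonempty => //; exists z0.
have [eta4 e40 heta] := clbd_lebesgue (clbd_boundary oU bU) oW UW.
pose eta := eta4 / 4.
have eta0 : 0 < eta by rewrite divr_gt0.
have near z w b : boundary U b -> cabs (z - b) < 2 * eta -> cabs (w - z) < eta / 64 -> wstep W z w.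
  move=> bb zb wz; exists z, (2 * eta); split.
  - move=> x; rewrite /cball /mkset => xz; apply: (heta b bb); rewrite /cball /mkset; have := cabs_tri z x b; rewrite /eta in zb xz *; lra.
  - apply: cballxx; lra.
  - rewrite /cball /mkset; lra.
clearbody eta; pose N := [set z | exists2 b, boundary U b & cabs (z - b) < 2 * eta].
have bN : bounded N.
  have [_ [M hM]] := clbd_boundary oU bU; exists (M + 2 * eta) => z [b /hM h1 h2].
  have := cabsDB z b; lra.
have [|s [s1 s2]] := clbd_net bN (r := eta / 64); first by rewrite divr_gt0.
(* A bound for the branch near the boundary of U, from its values on a finite net. It is needed
   because [lam] multiplies the branch. *)
pose B := \sum_(c <- s) `|al c| + 1.
have B1 : 1 <= B by rewrite lerDr sumr_ge0.
have hB z : N z -> `|al z| <= B.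
  move=> Nz; have [c cs hc] := s2 z Nz; have [b bb cb] := s1 c cs.
  have zc : `|al z - al c| < 1 / 16 by apply: al2; apply: near bb cb _.
  have : `|al c| <= \sum_(c <- s) `|al c| by rewrite (big_rem c) //= lerDl sumr_ge0.
  have := ler_normD (al z - al c) (al c); rewrite subrK /B; lra.
clearbody B; have /openCP /(_ z0 Uz0) [rho rho0 hrho] := oU.
pose lam z := Num.max 0 (1 - cdist (boundary U) z / eta).
have lam_lip z w : `|lam z - lam w| <= cabs (z - w) / eta.
  have h : `|cdist (boundary U) z / eta - cdist (boundary U) w / eta| <= cabs (z - w) / eta.
    by rewrite -mulrBl normrM (gtr0_norm (x := eta^-1)) ?invr_gt0 // ler_wpM2r ?invr_ge0 ?(ltW eta0) //; exact: cdist_lip.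
  apply: le_trans h; rewrite /lam !maxEle; move: (cdist _ z / eta) (cdist _ w / eta) => p q.
  case: (leP 0 (1 - p)) => h1; case: (leP 0 (1 - q)) => h2; rewrite ?subrr ?normr0 ?normr_ge0 //.
  - by have -> : 1 - p - (1 - q) = - (p - q) by [ring]; rewrite normrN.
  - by rewrite subr0 ger0_norm // ler0_norm; lra.
  - by rewrite sub0r normrN !ger0_norm; lra.
have lam0 z : 0 <= lam z by rewrite /lam le_max lexx.
have lam1 z : lam z <= 1.
  have : 0 <= cdist (boundary U) z / eta by rewrite divr_ge0 ?(ltW eta0) //; apply: cdist_ge => // *; exact: cabs_ge0.
  by rewrite /lam ge_max ler01 /=; lra.
have lamN z : lam z != 0 -> exists2 b, boundary U b & cabs (z - b) < eta.
  move=> h; apply: contrapT => hn; move/eqP: h; apply; apply/max_idPl; rewrite subr_le0 ler_pdivlMr // mul1r.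
  by apply: cdist_ge => // a ha; rewrite leNgt; apply/negP => q; apply: hn; exists a.
have lamb b z : boundary U b -> 1 - cabs (z - b) / eta <= lam z.
  by move=> bb; rewrite /lam le_max lerD2l lerN2 ler_pM2r ?invr_gt0 // cdist_le ?orbT.
(* The first entry keeps the variation of the cut-off times B below 1/64; the second lets [ang_jump]
   apply outside U, at distance at least rho from z0. *)
clearbody lam; pose d := Num.min (eta / (64 * B)) (rho / 32).
have B0 : 0 < B by lra.
have d0 : 0 < d by rewrite lt_min !divr_gt0 // mulr_gt0.
have d1 : d <= eta / (64 * B) by rewrite ge_min lexx.
have d2 : d <= rho / 32 by rewrite ge_min lexx orbT.
have d3 : d <= eta / 64.
  by apply: (le_trans d1); rewrite ler_pM2l // lef_pV2 ?posrE ?mulr_gt0 // ler_peMr.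
have d4 z w : cabs (z - w) < d -> cabs (z - w) / eta * B <= 1 / 64.
  move=> /ltW h; have -> : cabs (z - w) / eta * B = cabs (z - w) * (64 * B / eta) / 64 by field; rewrite gt_eqF.
  rewrite ler_pM2r ?invr_gt0 //.
  have : cabs (z - w) <= eta / (64 * B) by exact: le_trans h d1.
  rewrite ler_pdivlMr ?mulr_gt0 // => h'; rewrite mulrA ler_pdivrMr // mul1r //.
clearbody d; have [mu hmu1 hmu2] : exists2 mu : C -> R, forall z, U z -> mu z = lam z * al z & forall z, ~ U z -> mu z = ang (z - z0).
  by exists (fun z => if pselect (U z) then lam z * al z else ang (z - z0)) => z h; case: pselect.
have jUU z w : cabs (z - w) < d -> lam z != 0 -> `|lam z * al z - lam w * al w| < 1 / 8.
  move=> zw /lamN [b bb zb].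
  have Nz : N z by exists b => //; lra.
  have st : `|al w - al z| < 1 / 16 by apply: al2; apply: (near _ _ b) => //; [lra | rewrite cabsB; lra].
  have -> : lam z * al z - lam w * al w = (lam z - lam w) * al z - lam w * (al w - al z) by ring.
  apply: (le_lt_trans (ler_normB _ _)); rewrite !normrM (ger0_norm (lam0 w)).
  have q1 : `|lam z - lam w| * `|al z| <= 1 / 64.
    apply: le_trans (d4 z w zw); apply: ler_pM => //; exact: hB.
  have q2 : lam w * `|al w - al z| <= 1 * `|al w - al z| by rewrite ler_wpM2r.
  lra.
(* Next to the boundary of U the cut-off is almost 1, and there the branch equals the angle up to an
   integer. *)
have jUn z w : U z -> ~ U w -> cabs (z - w) < d -> exists2 k : R, k \is a Num.int & `|mu z - mu w - k| < 1 / 8.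
  move=> Uz nUw zw; have [b bb hb] := segment_meets_boundary oU Uz nUw.
  rewrite hmu1 // hmu2 //.
  have zb : cabs (z - b) < 2 * eta by lra.
  have st : wstep W z w by apply: near bb zb _; rewrite cabsB; lra.
  have [x [r [h1 h2 h3]]] := st.
  have Ww : W w by apply: h1; move: h3; rewrite /cball /mkset; have := cabs_ge0 (w - x); lra.
  exists (al w - ang (w - z0)); first exact: al1.
  have -> : lam z * al z - ang (w - z0) - (al w - ang (w - z0)) = - ((1 - lam z) * al z + (al w - al z)) by ring.
  rewrite normrN; apply: (le_lt_trans (ler_normD _ _)); have := al2 _ _ st.
  have : `|(1 - lam z) * al z| <= 1 / 64; last lra.
  apply: le_trans (d4 z b (le_lt_trans hb zw)); rewrite normrM; apply: ler_pM => //.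
    by rewrite ger0_norm ?subr_ge0 //; have := lamb b z bb; lra.
  by apply: hB; exists b.
have hj : jump mu d.
  move=> z w zw; have [Uz|nUz] := pselect (U z); have [Uw|nUw] := pselect (U w).
  - rewrite !hmu1 //; exists 0; rewrite ?rpred0 // subr0.
    have [ez|ez] := eqVneq (lam z) 0; last exact: jUU.
    have [ew|ew] := eqVneq (lam w) 0; first by rewrite ez ew !mul0r subrr normr0; lra.
    by rewrite distrC; apply: jUU; rewrite // cabsB.
  - exact: jUn.
  - have [|k ki hk] := jUn w z Uw nUz; first by rewrite cabsB.
    exists (- k); first by rewrite rpredN.
    by have -> : mu z - mu w - - k = - (mu w - mu z - k) by [ring]; rewrite normrN.
  - rewrite !hmu2 //.
    have fw : rho <= cabs (w - z0) by rewrite leNgt; apply/negP => h; apply: nUw; exact: hrho.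
    have [||k ki hk] := @ang_jump R (w - z0) (z - z0).
    + by apply/eqP => e; rewrite e cabs0 in fw; lra.
    + have -> : z - z0 - (w - z0) = z - w by ring.
      lra.
    by exists k => //; lra.
have [M M0 hM] := bounded_cabs_lt bU.
(* Large enough that the diamond about z0 lies outside U, where the glued function is the angle
   itself. *)
pose S := 2 * (M + cabs z0 + 1).
have cz0 := cabs_ge0 z0.
have [th [th1 th2]] := lift (S + cabs z0 + 1) d0 hj.
have inT z : taxi (z - z0) = S -> csq 0 (S + cabs z0 + 1) z /\ ~ U z.
  move=> hz; split.
    apply: sq_csq; apply: cball_sub_sq; rewrite /cball /mkset subr0.
    have := cabsDB z z0; have := taxi_ge (z - z0); lra.
  move=> /hM h; have := Re_le_cabs (z - z0); have := Im_le_cabs (z - z0); rewrite /taxi /S in hz.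
  have := cabsD z (- z0); rewrite cabsN; lra.
apply: (@no_branch R z0 th S d) => //; first by rewrite /S; lra.
  by move=> z /inT [h1 h2]; rewrite -hmu2 //; exact: th1.
by move=> z w /inT [h1 _] /inT [h2 _] h3; have := th2 z w h1 h2 h3; lra.
Qed.

End SimplyConnectedHull.

(** * Uniformly convergent subsequences of equi-Lipschitz families *)

Section UniformSubsequence.
Variable R : realType.
Local Notation C := (R[i]).
Variables (F : nat -> C -> C) (V : set C) (M L : R).
Hypothesis L0 : 0 < L.
Hypothesis bdV : bounded V.
Hypothesis bdF : forall n z, V z -> cabs (F n z) <= M.
Hypothesis lipF : forall n z w, V z -> V w -> cabs (F n z - F n w) <= L * cabs (z - w).

Definition infinite_idx (X : set nat) := forall N : nat, exists2 n, (N <= n)%N & X n.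

Lemma refine_points (s : seq C) (X : set nat) (e : R) : 0 < e -> (forall c, c \in s -> V c) -> infinite_idx X ->
  exists Y : set nat, [/\ infinite_idx Y, Y `<=` X & forall c n m, c \in s -> Y n -> Y m -> cabs (F n c - F m c) < e].
Proof.
move=> e0; elim: s X => [|c s ih] X hs hX; first by exists X; split.
have [|Y [Y1 Y2 Y3]] := ih X _ hX; first by move=> x xs; apply: hs; rewrite inE xs orbT.
have Vc : V c by apply: hs; rewrite inE eqxx.
have [u hu] := choice (fun N => let: ex_intro2 n h1 h2 := Y1 N in ex_intro (fun n => (N <= n)%N /\ Y n) n (conj h1 h2)).
have [l hl] := @cluster_seq R (fun N => F (u N) c) M (fun N => bdF _ Vc).
exists (Y `&` [set n | cabs (F n c - l) < e / 2]); split.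
- move=> N; have [n nN hn] := hl (e / 2) (divr_gt0 e0 (ltr0Sn R 1)) N; have [q1 q2] := hu n.
  by exists (u n); [exact: leq_trans nN q1 | split].
- by move=> n [/Y2].
- move=> x n m; rewrite inE => /orP[/eqP ->|xs] [Yn hn] [Ym hm]; last exact: Y3.
  rewrite /= in hn hm; have := cabs_tri l (F n c) (F m c); rewrite (cabsB l); lra.
Qed.

Lemma refine_unif (X : set nat) (e : R) : 0 < e -> infinite_idx X ->
  exists Y : set nat, [/\ infinite_idx Y, Y `<=` X & forall z n m, V z -> Y n -> Y m -> cabs (F n z - F m z) < e].
Proof.
move=> e0 hX; have d0 : 0 < e / 4 / L by rewrite !divr_gt0.
have [s [s1 s2]] := clbd_net bdV d0.
have [Y [Y1 Y2 Y3]] := refine_points (divr_gt0 e0 (ltr0Sn R 1)) s1 hX.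
exists Y; split => // z n m Vz Yn Ym; have [c cs] := s2 z Vz; rewrite /cball /mkset ltr_pdivlMr // mulrC => hc.
have q1 := lipF n Vz (s1 c cs); have q2 := lipF m Vz (s1 c cs); have q3 := Y3 c n m cs Yn Ym.
have := cabs_tri (F n c) (F n z) (F m z); have := cabs_tri (F m c) (F n c) (F m z); rewrite (cabsB (F m c) (F m z)); lra.
Qed.

(** Arzela-Ascoli by a diagonal choice: on the nested infinite index sets [X k] the oscillation is
    below 1/k for k > 0, and [psi k] is taken from [X k]. *)
Lemma montel_lip : exists psi : nat -> nat, (forall k, (psi k < psi k.+1)%N) /\ exists g : C -> C,
  forall e : R, 0 < e -> exists N : nat, forall k z, (N <= k)%N -> V z -> cabs (F (psi k) z - g z) < e.
Proof.
have inv0 (k : nat) : 0 < k.+1%:R^-1 :> R by rewrite invr_gt0.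
have ex (p : set nat * nat) : exists Y : set nat, infinite_idx p.1 ->
    [/\ infinite_idx Y, Y `<=` p.1 & forall z n m, V z -> Y n -> Y m -> cabs (F n z - F m z) < p.2.+1%:R^-1].
  have [h|h] := pselect (infinite_idx p.1); last by exists set0.
  by have [Y hY] := refine_unif (inv0 p.2) h; exists Y.
have [nxt hnxt] := choice ex.
pose X := fix X k := if k is k'.+1 then nxt (X k', k') else setT.
have Xinf k : infinite_idx (X k).
  by elim: k => [|k ih] /=; [move=> N; exists N | have [] := hnxt (X k, k) ih].
have Xsub k : X k.+1 `<=` X k by have [] := hnxt (X k, k) (Xinf k).
have Xosc k z n m : V z -> X k.+1 n -> X k.+1 m -> cabs (F n z - F m z) < k.+1%:R^-1.
  by have [_ _ h] := hnxt (X k, k) (Xinf k); exact: h.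
have Xmono i j : (i <= j)%N -> X j `<=` X i.
  elim: j => [|j ih]; first by rewrite leqn0 => /eqP ->.
  rewrite leq_eqVlt => /orP[/eqP -> //|]; rewrite ltnS => /ih h x /Xsub; exact: h.
have ex2 (p : nat * nat) : exists n, (p.2 < n)%N /\ X p.1 n by have [n n1 n2] := Xinf p.1 p.2.+1; exists n.
have [pick hpick] := choice ex2.
pose psi := fix psi k := if k is k'.+1 then pick (k, psi k') else pick (0%N, 0%N).
have psiX k : X k (psi k) by case: k => [|k]; [have [] := hpick (0%N, 0%N) | have [] := hpick (k.+1, psi k)].
exists psi; split; first by move=> k; have [] := hpick (k.+1, psi k).
have ex3 z : exists l, V z -> forall k n, (k.+1 <= n)%N -> cabs (F (psi n) z - l) <= 2 * k.+1%:R^-1.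
  have [Vz|h] := pselect (V z); last by exists 0.
  have [l hl] := @cluster_seq R (fun n => F (psi n) z) M (fun n => bdF _ Vz).
  exists l => _ k n kn; have [m mk hm] := hl _ (inv0 k) k.+1.
  have := Xosc k z (psi n) (psi m) Vz (Xmono _ _ kn _ (psiX n)) (Xmono _ _ mk _ (psiX m)).
  have := cabs_tri (F (psi m) z) (F (psi n) z) l; set q := _^-1 in hm *; lra.
have [g hg] := choice ex3; exists g => e e0.
have [m hm] := small_inv (divr_gt0 e0 (ltr0Sn R 1)); exists m.+1 => k z mk Vz.
have := hg z Vz m k mk; have := hm m (leqnn m); set q := _^-1; lra.
Qed.

End UniformSubsequence.

(** * Normality of the iterates, Fatou and Julia sets *)

Section Normality.
Variable R : realType.
Local Notation C := (R[i]).
Variable f : C -> C.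
Hypothesis hf : ent f.
Hypothesis of_ : open_map f.

Lemma hol_lip (g : C -> C) c (s M : R) : hol g c s -> 0 < s -> 0 < M -> (forall z, sq c s z -> cabs (g z) <= M) ->
  forall z w, cball c (s / 16) z -> cball c (s / 16) w -> cabs (g z - g w) <= 8 * M / s * cabs (z - w).
Proof.
move=> hg s0 M0 hM z w hz hw.
have sub x : sq w (s / 2) x -> sq c s x.
  have := cball_sub_sq hw; rewrite /sq /mkset => -[h1 h2] [h3 h4].
  have := ler_distD (complex.Re w) (complex.Re x) (complex.Re c); have := ler_distD (complex.Im w) (complex.Im x) (complex.Im c).
  by split; lra.
have [||||h _] := @cauchy_lip R g w (s / 2) (s / 4) M; [by move=> x /sub /hg|lra|lra|by move=> x /sub /hM|].
have zw : csq w (s / 4) z.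
  apply: sq_csq; apply: cball_sub_sq; rewrite /cball /mkset in hz hw *.
  have := cabs_tri c z w; rewrite (cabsB c w); lra.
have := h z zw; have -> : 2 * M / (s / 4) = 8 * M / s by field; rewrite gt_eqF.
by [].
Qed.

Lemma near_oo (P : nat -> Prop) : (\forall n \near \oo, P n) <-> exists N : nat, forall n, (N <= n)%N -> P n.
Proof. by split=> [[N _ h]|[N h]]; exists N => // n /= nN; exact: h. Qed.

Lemma psi_ge (psi : nat -> nat) k : (forall k, (psi k < psi k.+1)%N) -> (k <= psi k)%N.
Proof. by move=> h; elim: k => // k ih; exact: leq_ltn_trans ih (h k). Qed.

(* Harnack's inequality compares the iterates near z0 with their values at z0, which either have a
   bounded subsequence or tend to infinity. *)
Lemma omit_normal (U : set C) z0 (r : R) : open U -> U z0 ->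
  (forall n, exists2 w, cabs w < r & ~ hull (iter n f @` U) w) -> ~ julia f z0.
Proof.
move=> oU Uz0 hn; have /openCP /(_ z0 Uz0) [s2 s20 hs2] := oU.
pose s := s2 / 2; have s0 : 0 < s by rewrite divr_gt0.
have sU z : sq z0 s z -> U z.
  by move=> /sq_sub_cball h; apply: hs2; move: h; rewrite /s /cball /mkset; lra.
have har n z : sq z0 (s / 4) z -> exists2 w, cabs w < r &
    cabs (iter n f z - w) <= KH R * cabs (iter n f z0 - w) /\ cabs (iter n f z0 - w) <= KH R * cabs (iter n f z - w).
  move=> hz; have [w wr nw] := hn n; exists w => //.
  apply: (hull_harnack (V := iter n f @` U) (s := s)) => //; first exact: open_map_iter.
    exact: ent_hol (ent_iter n hf).
  by move=> x /sU Ux; exists x.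
have K1 := KH_ge1 R; have K0 : 0 < KH R by lra.
have r0 : 0 < r by have [w wr _] := hn 0%N; have := cabs_ge0 w; lra.
have up n z : sq z0 (s / 4) z -> cabs (iter n f z) <= KH R * (cabs (iter n f z0) + r) + r.
  move=> /(har n) [w wr [h _]]; have := cabsDB (iter n f z) w.
  have : KH R * cabs (iter n f z0 - w) <= KH R * (cabs (iter n f z0) + r).
    by rewrite ler_wpM2l ?(ltW K0) //; have := cabsD (iter n f z0) (- w); rewrite cabsN; lra.
  lra.
have lo n z : sq z0 (s / 4) z -> cabs (iter n f z0) <= KH R * (cabs (iter n f z) + r) + r.
  move=> /(har n) [w wr [_ h]]; have := cabsDB (iter n f z0) w.
  have : KH R * cabs (iter n f z - w) <= KH R * (cabs (iter n f z) + r).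
    by rewrite ler_wpM2l ?(ltW K0) //; have := cabsD (iter n f z) (- w); rewrite cabsN; lra.
  lra.
have s40 : 0 < s / 4 by rewrite divr_gt0.
have s160 : 0 < s / 4 / 16 by rewrite divr_gt0.
have inq z : cball z0 (s / 4 / 16) z -> sq z0 (s / 4) z.
  by move=> h; apply: cball_sub_sq; move: h; rewrite /cball /mkset; lra.
move=> hJ; apply: hJ; exists (cball z0 (s / 4 / 16)); split; [exact: open_cball | split; first exact: cballxx].
move=> m; have [[B hB]|hB] := pselect (exists B : R, forall N : nat, exists2 k, (N <= k)%N & cabs (iter (m k) f z0) <= B).
  (* Bounded subsequence: [v] makes the indices strictly increasing, Harnack's inequality bounds
     these iterates near z0, and Cauchy's estimate makes them equi-Lipschitz. *)
  have [u hu] := choice (fun N => let: ex_intro2 n h1 h2 := hB N in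
     ex_intro (fun n => (N <= n)%N /\ cabs (iter (m n) f z0) <= B) n (conj h1 h2)).
  have [v hv] : exists v : nat -> nat, (forall k, (v k < v k.+1)%N) /\ forall k, cabs (iter (m (v k)) f z0) <= B.
    exists (fun k => iter k (fun n => u n.+1) (u 0%N)); split => [k|[|k]] /=; [|exact: (hu 0%N).2|exact: (hu _).2].
    exact: (hu _).1.
  have B0 : 0 <= B by apply: le_trans (hv.2 0%N); exact: cabs_ge0.
  pose M := KH R * (B + r) + r.
  have M0 : 0 < M by rewrite ltr_wpDl // mulr_ge0 ?(ltW K0) // addr_ge0 ?(ltW r0).
  have hM k z : sq z0 (s / 4) z -> cabs (iter (m (v k)) f z) <= M.
    move=> /(up (m (v k))) h; apply: (le_trans h); rewrite /M lerD2r ler_wpM2l ?(ltW K0) // lerD2r; exact: hv.2.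
  have L0 : 0 < 8 * M / (s / 4) by rewrite divr_gt0 // mulr_gt0.
  have [psi [psi1 [g hg]]] := @montel_lip R (fun k => iter (m (v k)) f) (cball z0 (s / 4 / 16)) M _ L0 (bounded_cball _ _)
      (fun n z hz => hM n z (inq z hz))
      (fun n => hol_lip (@ent_hol R _ z0 (s / 4) (ent_iter (m (v n)) hf)) s40 M0 (hM n)).
  have vm i j : (i < j)%N -> (v i < v j)%N.
    elim: j => // j ih; rewrite ltnS leq_eqVlt => /orP[/eqP ->|/ih h]; first exact: hv.1.
    exact: ltn_trans h (hv.1 j).
  exists (fun k => v (psi k)); split; first by move=> k; apply: vm; exact: psi1.
  left; exists g => K KV _ e e0; have [N hN] := hg e e0; apply/near_oo; exists N => k Nk z /KV; exact: hN.
have ex (p : nat * nat) : exists k, (p.2 < k)%N /\ p.1%:R < cabs (iter (m k) f z0).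
  have nB : ~ (forall N : nat, exists2 k, (N <= k)%N & cabs (iter (m k) f z0) <= p.1%:R) by move=> h; apply: hB; exists p.1%:R.
  have [N hN] : exists N : nat, forall k, (N <= k)%N -> p.1%:R < cabs (iter (m k) f z0).
    apply: contrapT => h; apply: nB => N; apply: contrapT => h2; apply: h; exists N => k Nk.
    by rewrite ltNge; apply/negP => h3; apply: h2; exists k.
  by exists (maxn N p.2.+1); split; [exact: leq_maxr | apply: hN; exact: leq_maxl].
have [pick hpick] := choice ex.
pose psi := fix psi k := if k is k'.+1 then pick (k, psi k') else pick (0%N, 0%N).
exists psi; split; first by move=> k; have [] := hpick (k.+1, psi k).
right=> K KV _ T; apply/near_oo.
have [N hN] : exists N : nat, KH R * (`|T| + r) + r <= N%:R.
  exists (Num.truncn (KH R * (`|T| + r) + r)).+1; apply: ltW; exact: truncnS_gt.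
exists N => k Nk z /KV /inq hz.
have q1 : k%:R < cabs (iter (m (psi k)) f z0) by case: (k) => [|j]; [have [] := hpick (0%N, 0%N) | have [] := hpick (j.+1, psi j)].
have q2 := lo (m (psi k)) z hz.
have q3 : N%:R <= k%:R :> R by rewrite ler_nat.
have q4 : KH R * (`|T| + r) < KH R * (cabs (iter (m (psi k)) f z) + r) by lra.
rewrite ltr_pM2l // in q4; have := ler_norm T; lra.
Qed.

Lemma fatou_normal z : ~ julia f z -> exists U, [/\ open U, U z & normal_family_on (fun n => iter n f) U].
Proof. by move=> h; apply: contrapT => h2; apply: h => -[U [h3 [h4 h5]]]; apply: h2; exists U. Qed.

Lemma open_fatou : open (Defs.fatou f).
Proof.
apply/openCP => z /fatou_normal [U [oU Uz nU]]; have /openCP /(_ z Uz) [r r0 hr] := oU.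
by exists r => // w /hr Uw h; apply: h; exists U.
Qed.

Lemma escapingP z : escaping f z <-> forall M : R, exists N : nat, forall n, (N <= n)%N -> M < cabs (iter n f z).
Proof. by split=> h M; apply/near_oo; exact: h. Qed.

(** If the orbit of y returned to a bounded set infinitely often, a subsequence would either
    converge to a finite limit, against the escape of x, or tend to infinity, against these
    returns. *)
Lemma normal_escaping (U : set C) x y : normal_family_on (fun n => iter n f) U -> U x -> U y -> escaping f x -> escaping f y.
Proof.
move=> nU Ux Uy /escapingP hx; apply/escapingP => M; apply: contrapT => hn.
have ex (N : nat) : exists n, (N <= n)%N /\ cabs (iter n f y) <= M.
  apply: contrapT => h; apply: hn; exists N => n Nn; rewrite ltNge; apply/negP => h2; apply: h; by exists n.
have [m hm] := choice ex.
have [psi [psi1 [[g hg]|hg]]] := nU m.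
  have sx : [set x] `<=` U by move=> _ ->.
  have /near_oo [N hN] := hg _ sx (@compact_set1 _ x) 1 ltr01.
  have [N' hN'] := hx (cabs (g x) + 1).
  pose k := maxn N N'.
  have h1 := hN k (leq_maxl _ _) x erefl.
  have h2 : (N' <= m (psi k))%N.
    by apply: leq_trans (hm _).1; apply: leq_trans (psi_ge k psi1); exact: leq_maxr.
  have := hN' _ h2; have := cabsDB (iter (m (psi k)) f x) (g x); lra.
have sy : [set y] `<=` U by move=> _ ->.
have /near_oo [N hN] := hg _ sy (@compact_set1 _ y) M.
have := hN N (leqnn N) y erefl; have := (hm (psi N)).2; lra.
Qed.

Lemma fatou_escaping (D : set C) : connected D -> D `<=` Defs.fatou f -> D `&` escaping f !=set0 -> D `<=` escaping f.
Proof.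
move=> cD DF [x [Dx Ix]].
have o1 (P : set C) : (forall U x y, normal_family_on (fun n => iter n f) U -> U x -> U y -> P x -> P y) -> open (Defs.fatou f `&` P).
  move=> hP; apply/openCP => z [/fatou_normal [U [oU Uz nU]] Pz]; have /openCP /(_ z Uz) [r r0 hr] := oU.
  exists r => // w /hr Uw; split; first by move=> h; apply: h; exists U.
  exact: hP nU Uz Uw Pz.
have : D `<=` Defs.fatou f `&` escaping f; last by move=> h z /h [].
apply: (@connected_open_sub _ D _ (Defs.fatou f `&` ~` escaping f)) => //.
- by apply: o1 => U a b; exact: normal_escaping.
- by apply: o1 => U a b nU Ua Ub na hb; apply: na; exact: normal_escaping nU Ub Ua hb.
- by apply/seteqP; split => // z [_ [[_ h1] [_ h2]]].
- by move=> z Dz; have [h|h] := pselect (escaping f z); [left|right]; split => //; exact: DF.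
- by exists x; split => //; split => //; exact: DF.
Qed.

Lemma clbd_compact (K : set C) : clbd K -> compact K.
Proof.
move=> [cK [M hM]].
pose T : set (R * R) := `[- M, M]%classic `*` `[- M, M]%classic.
have cT : compact ((fun p : R * R => (p.1 +i* p.2)%C : C) @` T).
  apply: continuous_compact; first by apply: continuous_subspaceT; exact: pair_complex_continuous.
  by apply: compact_setX; exact: segment_compact.
apply: (subclosed_compact cK cT) => z /hM h; exists (complex.Re z, complex.Im z); last by case: (z).
by split; rewrite /= in_itv /= -ler_norml; apply: le_trans h; [exact: Re_le_cabs|exact: Im_le_cabs].
Qed.

(** Counterexamples would cluster at a point of the Fatou set; normality near it forces a
    subsequence of these iterates to tend to infinity uniformly there. *)
Lemma all_escaping_unif : (forall z, Defs.fatou f z) -> (forall z, escaping f z) -> forall (r M : R),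
  exists N : nat, forall n z, (N <= n)%N -> cabs z <= r -> M < cabs (iter n f z).
Proof.
move=> hF hI r M; apply: contrapT => hn.
have ex (N : nat) : exists p : nat * C, [/\ (N <= p.1)%N, cabs p.2 <= r & cabs (iter p.1 f p.2) <= M].
  apply: contrapT => h; apply: hn; exists N => n z Nn zr; rewrite ltNge; apply/negP => h2; apply: h; by exists (n, z).
have [p hp] := choice ex.
have [|l _ hl] := @clbd_cluster R _ (fun n => (p n).2) (clbd_cdisc 0 r).
  by move=> n; rewrite /= subr0; have [] := hp n.
have [U [oU Ul nU]] := fatou_normal (hF l); have /openCP /(_ l Ul) [d d0 hd] := oU.
pose K := [set z : C | cabs (z - l) <= d / 2].
have KU : K `<=` U by move=> z hz; apply: hd; rewrite /cball /mkset; move: hz; rewrite /K /mkset; lra.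
have cK : compact K by apply: clbd_compact; exact: clbd_cdisc.
have ex2 (N : nat) : exists n, (N <= n)%N /\ K (p n).2.
  have [n Nn h] := hl (d / 2) (divr_gt0 d0 (ltr0Sn R 1)) N; exists n; split => //; exact: ltW.
have [u hu] := choice ex2.
have [psi [psi1 [[g hg]|hg]]] := nU (fun k => (p (u k)).1).
  have sx : [set l] `<=` U by move=> _ ->.
  have /near_oo [N hN] := hg _ sx (@compact_set1 _ l) 1 ltr01.
  have /escapingP /(_ (cabs (g l) + 1)) [N' hN'] := hI l.
  pose k := maxn N N'.
  have h1 := hN k (leq_maxl _ _) l erefl.
  have h2 : (N' <= (p (u (psi k))).1)%N.
    have [h3 _ _] := hp (u (psi k)); apply: leq_trans h3; apply: leq_trans (hu _).1.
    by apply: leq_trans (psi_ge k psi1); exact: leq_maxr.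
  have := hN' _ h2; have := cabsDB (iter (p (u (psi k))).1 f l) (g l); lra.
have /near_oo [N hN] := hg _ KU cK M.
have := hN N (leqnn N) _ (hu (psi N)).2; have [_ _] := hp (u (psi N)); lra.
Qed.

(** Normality near f(z) is pulled back through f, at the price of lowering every exponent by one. *)
Lemma julia_forward z : julia f z -> julia f (f z).
Proof.
move=> hz hU; apply: hz; case: hU => U [oU [Uz nU]].
have cf : continuous f by apply/ccont_continuous => x; exact: ent_cont.
exists (f @^-1` U); split; [by move/continuousP: cf; apply | split => // m].
(* Exponent 0 cannot be lowered: if it occurs infinitely often, the identity itself is a convergent
   subsequence. *)
have [h0|h0] := pselect (forall N : nat, exists n, (N <= n)%N /\ m n = 0%N).
  have [u hu] := choice h0; exists (fun k => iter k (fun n => u n.+1) (u 0%N)); split.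
    by move=> k /=; exact: (hu _).1.
  left; exists id => K KU _ e e0; apply/near_oo; exists 0%N => n _ x Kx.
  have -> : m (iter n (fun n => u n.+1) (u 0%N)) = 0%N by case: n => [|n] /=; exact: (hu _).2.
  by rewrite /= subrr cabs0.
have [N hN] : exists N : nat, forall n, (N <= n)%N -> m n <> 0%N.
  by apply: contrapT => h; apply: h0 => N; apply: contrapT => h2; apply: h; exists N => n Nn e; apply: h2; exists n.
have [psi [psi1 hp]] := nU (fun k => (m (N + k)%N).-1).
exists (fun k => (N + psi k)%N); split; first by move=> k; rewrite ltn_add2l; exact: psi1.
have E k x : iter (m (N + psi k)%N) f x = iter (m (N + psi k)%N).-1 f (f x).
  rewrite -iterSr prednK //; have := hN (N + psi k)%N (leq_addr _ _); by case: (m _).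
have cK K : compact K -> compact (f @` K) by move=> cK; apply: continuous_compact => //; exact: continuous_subspaceT.
case: hp => [[g hg]|hg]; [left; exists (fun x => g (f x)) => K KU cpK e e0 | right => K KU cpK M].
  have sub : f @` K `<=` U by move=> _ [x /KU h <-].
  have /near_oo [N' hN'] := hg _ sub (cK _ cpK) e e0; apply/near_oo; exists N' => k hk x Kx.
  by rewrite E; apply: hN' => //; exists x.
have sub : f @` K `<=` U by move=> _ [x /KU h <-].
have /near_oo [N' hN'] := hg _ sub (cK _ cpK) M; apply/near_oo; exists N' => k hk x Kx.
by rewrite E; apply: hN' => //; exists x.
Qed.

End Normality.

(** * Covering by hulls, fast escaping points, existence of Julia points *)

Section FastEscape.
Variable R : realType.
Local Notation C := (R[i]).
Variable f : C -> C.
Hypothesis hf : ent f.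
Hypothesis cf : forall z, ccont f z.
Hypothesis of_ : open_map f.
Local Notation M := (maxmod f).

Lemma ccont_iter n z : ccont (iter n f) z.
Proof. by apply: ent_cont; exact: ent_iter. Qed.

Lemma image_iterD m n (U : set C) : iter (m + n) f @` U = iter m f @` (iter n f @` U).
Proof.
apply/seteqP; split => [_ [x Ux <-]|_ [_ [x Ux <-] <-]].
  by exists (iter n f x); [exists x | rewrite -iterD].
by exists x => //; rewrite iterD.
Qed.

Lemma sub_hull_iter0 (U : set C) : open U -> U `<=` hull (iter 0 f @` U).
Proof. by move=> oU z Uz; apply: sub_hull; [exact: (open_map_iter (n := 0) of_) | exists z]. Qed.

Lemma iter_maxmod_lt n r z : cabs z < r -> cabs (iter n f z) < iter n M r.
Proof. by move=> h; elim: n => [|n ih] //=; exact: maxmod_lt. Qed.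

Lemma iter_maxmod_ge0 n r : 0 <= r -> 0 <= iter n M r.
Proof. by move=> h; elim: n => [|n ih] //=; exact: maxmod_ge0. Qed.

Lemma iter_maxmod_mono n r r' : 0 <= r -> r <= r' -> iter n M r <= iter n M r'.
Proof. by move=> h hr; elim: n => [|n ih] //=; apply: maxmod_mono_le => //; exact: iter_maxmod_ge0. Qed.

(* A point where [f^(n+l)] is large was large at all earlier times, by the maximum principle;
   a cluster point of such boundary points is fast escaping. *)
Lemma fast_boundary (U : set C) (R0 : R) l : open U -> bounded U ->
  (forall n, exists2 z, U z & iter n M R0 <= cabs (iter (n + l) f z)) -> boundary U `&` fast_escaping f R0 !=set0.
Proof.
move=> oU bU h.
have ex n : exists b, boundary U b /\ iter n M R0 <= cabs (iter (n + l) f b).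
  have [z Uz hz] := h n; have [b bb hb] := max_principle (ccont_iter (n + l)) (open_map_iter (n := n + l) of_) oU bU Uz.
  by exists b; split => //; exact: le_trans hz (ltW hb).
have [b hb] := choice ex.
have early j n : (j <= n)%N -> iter j M R0 <= cabs (iter (j + l) f (b n)).
  move=> jn; rewrite leNgt; apply/negP => q; have [_] := hb n; apply/negP; rewrite -ltNge.
  have -> : (n + l = n - j + (j + l))%N by rewrite addnA subnK.
  rewrite iterD; have -> : iter n M R0 = iter (n - j) M (iter j M R0) by rewrite -iterD subnK.
  exact: iter_maxmod_lt.
have [x bx hx] := clbd_cluster (clbd_boundary oU bU) (fun n => (hb n).1).
exists x; split => //; exists l => j; rewrite leNgt; apply/negP => q.
pose e := iter j M R0 - cabs (iter (j + l) f x).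
have e0 : 0 < e by rewrite subr_gt0.
have [d d0 hd] := ccont_iter (j + l) x e0.
have [n jn hn] := hx d d0 j; have := hd _ hn; have := early j n jn.
have := cabsDB (iter (j + l) f (b n)) (iter (j + l) f x); rewrite /e; lra.
Qed.

Lemma fast_star (U : set C) (R0 : R) : open U -> bounded U -> U `&` fast_escaping f R0 !=set0 ->
  boundary U `&` fast_escaping f R0 !=set0.
Proof. by move=> oU bU [z [Uz [l hl]]]; apply: (fast_boundary (l := l)) => // n; exists z. Qed.

Lemma fast_sub_escaping (R0 : R) : (fun n => iter n M R0) @ \oo --> +oo%R -> fast_escaping f R0 `<=` escaping f.
Proof.
move=> /cvgryPgt h z [l hl]; apply/escapingP => T; have /near_oo [N hN] := h T.
exists (N + l)%N => n nN; have q : (N <= n - l)%N by lia.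
by have := hN _ q; have := hl (n - l)%N; rewrite subnK; [lra | lia].
Qed.

(** If M(R0) < R0, monotonicity would keep all the iterates below R0. The inequality is what makes
    A(f) forward invariant. *)
Lemma diverge_maxmod_ge (R0 : R) : 0 < R0 -> (fun n => iter n M R0) @ \oo --> +oo%R -> R0 <= M R0.
Proof.
move=> R00 /cvgryPgt h; rewrite leNgt; apply/negP => q.
have dec n : iter n M R0 <= R0.
  elim: n => // n ih; apply: le_trans (ltW q); rewrite /=; apply: maxmod_mono_le => //.
  by apply: iter_maxmod_ge0; exact: ltW.
have /near_oo [N hN] := h R0; have := hN N (leqnn N); have := dec N; lra.
Qed.

Lemma fast_forward (R0 : R) z : 0 < R0 -> R0 <= M R0 -> fast_escaping f R0 z -> fast_escaping f R0 (f z).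
Proof.
move=> R00 h [l hl]; exists l => n; rewrite -iterSr -addSn.
apply: le_trans (hl n.+1); rewrite iterSr; apply: iter_maxmod_mono => //; exact: ltW.
Qed.

Lemma escaping_forward z : escaping f z -> escaping f (f z).
Proof.
move=> /escapingP h; apply/escapingP => T; have [N hN] := h T; exists N => n Nn.
by rewrite -iterSr; apply: hN; exact: leqW.
Qed.

Lemma escaping_iter n z : escaping f (iter n f z) <-> escaping f z.
Proof.
split=> /escapingP h; apply/escapingP => T; have [N hN] := h T.
  exists (N + n)%N => m mn; have -> : m = (m - n + n)%N by lia.
  by rewrite iterD; apply: hN; lia.
by exists N => m Nm; rewrite -iterD; apply: hN; lia.
Qed.

Lemma forward_iter (E : set C) n z : (forall z, E z -> E (f z)) -> E z -> E (iter n f z).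
Proof. by move=> h Ez; elim: n => [|n ih] //=; exact: h. Qed.

Hypothesis nt : ~ (exists p : {poly C}, forall z, f z = p.[z]).

(** The factor 32 leaves room for Harnack's inequality from 0 to the circle of radius 2 s inside the
    disc of radius 32 s. The exponent 10 is chosen to outgrow the factor 3 of [log_harnack] in
    [julia_nonempty]. *)
Definition expanding (S : R) := 2 <= S /\ forall s, S <= s -> s ^+ 10 <= M s /\
  cball 0 (32 * M s) `<=` hull (f @` cball 0 (32 * s)).

Lemma expanding_exists : exists S, expanding S.
Proof.
have K1 := KH_ge1 R; have K0 : 0 < KH R by lra.
(* If w0 in the disc of radius 32 M(s) were missed, Harnack's inequality would give M(2s) at most 33
   KH M(s) + 32 M(s), hence at most 65 KH M(s), below 2^d M(s). *)
pose d := (Num.truncn (65 * KH R) + 10)%N.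
have hd : 65 * KH R < 2 ^+ d.
  apply: (@lt_le_trans _ _ d%:R); last by rewrite -natrX ler_nat ltnW // ltn_expl.
  by apply: (lt_le_trans (truncnS_gt _)); rewrite ler_nat /d -addn1 leq_add2l.
have d10 : (10 <= d)%N by exact: leq_addl.
clearbody d; have [S S1 hS] := transcendental_growth d hf nt.
exists (S + 1); split; first lra.
move=> s Ss; have [g1 g2] := hS s ltac:(lra).
have s1 : 1 <= s by lra.
split; first by apply: le_trans g2; exact: ler_weXn2l.
have Mp : 0 < M s by apply: lt_le_trans g2; rewrite exprn_gt0 //; lra.
move=> w0; rewrite {1}/cball /mkset subr0 => hw; apply: contrapT => nh.
have s20 : 0 <= 2 * s by lra.
have [[z hz Mz] _] := maxmodP cf s20.
have zin : sq 0 (16 * s / 4) z by apply: cball_sub_sq; rewrite /cball /mkset subr0 hz; lra.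
have [||h _] := @hull_harnack R (f @` cball 0 (32 * s)) f 0 (16 * s) w0 z (of_ (@open_cball R _ _)) nh _ _ zin.
- exact: ent_hol.
- move=> x /sq_sub_cball hx; exists x => //; move: hx; rewrite /cball /mkset; lra.
have f0 : cabs (f 0) <= M s by apply: maxmod_ge => //; rewrite cabs0 (le_trans ler01).
have q1 : KH R * cabs (f 0 - w0) <= KH R * (33 * M s).
  rewrite ler_wpM2l ?(ltW K0) //; have := cabsD (f 0) (- w0); rewrite cabsN => q; apply: (le_trans q); lra.
have q2 : 1 * M s <= KH R * M s by rewrite ler_wpM2r // ltW.
have q3 : 65 * KH R * M s < 2 ^+ d * M s by rewrite ltr_pM2r.
have := cabsDB (f z) w0; rewrite -Mz; lra.
Qed.

(** The covering step composes because f maps hulls into hulls and the hull of a hull adds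
    nothing. *)
Lemma expanding_iter S r : expanding S -> S <= r -> forall n, [/\ S <= iter n M r,
  10 ^+ n * ln r <= ln (iter n M r) & cball 0 (32 * iter n M r) `<=` hull (iter n f @` cball 0 (32 * r))].
Proof.
move=> [S2 hS] Sr; elim=> [|n [h1 h2 h3]].
  split => //; first by rewrite expr0 mul1r.
  by apply: sub_hull_iter0; exact: open_cball.
have [g1 g2] := hS _ h1.
have x1 : 1 <= iter n M r by lra.
have le1 : iter n M r <= iter n M r ^+ 10 by rewrite exprS ler_peMr ?exprn_ege1 //; lra.
split.
- by rewrite /=; lra.
- rewrite exprS -mulrA; apply: (@le_trans _ _ (10 * ln (iter n M r))); first by rewrite ler_pM2l.
  have -> : 10 * ln (iter n M r) = ln (iter n M r ^+ 10) by rewrite lnXn ?mulr_natl //; lra.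
  by rewrite ler_ln ?posrE //=; [apply: exprn_gt0 | apply: lt_le_trans g1; apply: exprn_gt0]; lra.
- have E : iter n.+1 f @` cball 0 (32 * r) = f @` (iter n f @` cball 0 (32 * r)) by exact: (image_iterD 1 n).
  rewrite E => z /g2 hz; apply: hull_hull; apply: hull_mono hz => _ [x /h3 hx <-].
  by apply: hull_image => //; exists x.
Qed.

Lemma expanding_diverge S r : expanding S -> S <= r -> (fun n => iter n M r) @ \oo --> +oo%R.
Proof.
move=> eS Sr; have [S2 hS] := eS.
have x1 n : 2 <= iter n M r by have [h _ _] := expanding_iter eS Sr n; lra.
have lin n : 1 + n%:R <= iter n M r.
  elim: n => [|n ih]; first by have := x1 0%N; lra.
  have [h _ _] := expanding_iter eS Sr n; have [g1 _] := hS _ h.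
  have : iter n M r * 2 <= iter n M r ^+ 10.
    rewrite exprS; apply: ler_wpM2l; first by have := x1 n; lra.
    by apply: (le_trans (x1 n)); rewrite exprS ler_peMr ?exprn_ege1 //; have := x1 n; lra.
  rewrite /= -natr1; have := x1 n; lra.
apply/cvgryPgt => T; apply/near_oo; exists (Num.truncn T) => n hn.
have := truncnS_gt T; have : ((Num.truncn T).+1%:R : R) <= n.+1%:R by rewrite ler_nat ltnS.
by have := lin n; rewrite -natr1; lra.
Qed.

Lemma hull_large (U : set C) (r : R) : 0 < r -> U `<=` cball 0 r -> cball 0 (2 * r) `<=` hull U -> False.
Proof.
move=> r0 Ur h; have : cball (0 : C) (2 * r) r%:C%C by rewrite /cball /mkset subr0 cabsR gtr0_norm //; lra.
by move=> /h /(hull_sub_cball r0 Ur); rewrite /cball /mkset subr0 cabsR gtr0_norm // ltxx.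
Qed.

(** The hull of f^(n+l)(U) contains a disc of radius 32 M^n(r), so the image itself leaves the disc
    of radius M^n(r); this feeds [fast_boundary]. *)
Lemma expanding_fast S r (U : set C) l (R0 : R) : expanding S -> S <= r -> 0 <= R0 -> R0 <= r -> open U -> bounded U ->
  cball 0 (32 * r) `<=` hull (iter l f @` U) -> boundary U `&` fast_escaping f R0 !=set0.
Proof.
move=> eS Sr R00 R0r oU bU hU; apply: (fast_boundary (l := l)) => // n.
apply: contrapT => hn; have [h1 _ h3] := expanding_iter eS Sr n; have [S2 _] := eS.
apply: (@hull_large (iter (n + l) f @` U) (iter n M r)); first lra.
  move=> _ [z Uz <-]; rewrite /cball /mkset subr0 ltNge; apply/negP => q; apply: hn; exists z => //.
  by apply: le_trans q; exact: iter_maxmod_mono.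
rewrite image_iterD => z hz.
have : hull (iter n f @` cball 0 (32 * r)) z by apply: h3; move: hz; rewrite /cball /mkset; lra.
move=> hz2; apply: hull_hull; apply: hull_mono hz2 => _ [x /hU hx <-].
by apply: hull_image; [exact: ccont_iter | exact: open_map_iter | exists x].
Qed.

Lemma julia_hull z0 (U : set C) (r : R) : julia f z0 -> open U -> U z0 -> exists n, cball 0 r `<=` hull (iter n f @` U).
Proof.
move=> hJ oU Uz; apply: contrapT => hn; apply: (omit_normal hf of_ oU Uz (r := r)) hJ => n.
apply: contrapT => h; apply: hn; exists n => w; rewrite /cball /mkset subr0 => hw.
by apply: contrapT => h2; apply: h; exists w.
Qed.

Lemma julia_fast (U : set C) (R0 : R) : 0 <= R0 -> open U -> bounded U -> U `&` julia f !=set0 ->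
  boundary U `&` fast_escaping f R0 !=set0.
Proof.
move=> R00 oU bU [z [Uz Jz]]; have [S eS] := expanding_exists.
have [l hl] := julia_hull (32 * (`|S| + R0)) Jz oU Uz.
apply: (expanding_fast (r := `|S| + R0) eS _ _ _ oU bU hl) => //; first by have := ler_norm S; lra.
by rewrite lerDr.
Qed.

Lemma julia_nonempty : julia f !=set0.
Proof.
apply: contrapT => hJ.
have hF z : Defs.fatou f z by move=> h; apply: hJ; exists z.
have [S eS] := expanding_exists; have [S2 _] := eS.
(* One fast escaping point exists on a large circle; the whole plane being a connected part of the
   Fatou set, every point then escapes. *)
have hI z : escaping f z.
  have [||b [_ hb]] := @expanding_fast S S (cball 0 (32 * S)) 0 S eS (lexx _) _ (lexx _) (@open_cball R _ _) (bounded_cball _ _).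
  - lra.
  - by apply: sub_hull_iter0; exact: open_cball.
  apply: (@fatou_escaping R f setT) => //; first exact: setT_connected.
  by exists b; split => //; apply: fast_sub_escaping hb; exact: expanding_diverge eS (lexx S).
(* The discs needed, of radius 32 S and one containing f(0), must lie in the disc of radius s / 12
   on which [log_harnack] compares values. *)
pose s := 12 * (32 * S + cabs (f 0) + 1).
have c0 := cabs_ge0 (f 0).
have s0 : 0 < s by rewrite /s; lra.
have [N hN] := all_escaping_unif hF hI (2 * s) 1.
have har n z : (N <= n)%N -> cabs z < s / 12 -> ln (cabs (iter n f z)) <= 3 * ln (cabs (iter n f 0)).
  move=> Nn hz; have [|||] := @log_harnack R (iter n f) 0 s z => //.
  - exact: ent_hol (ent_iter n hf).
  - move=> x /sq_sub_cball; rewrite /cball /mkset subr0 => hx; apply: hN => //; exact: ltW.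
  - by apply: cball_sub_sq; rewrite /cball /mkset subr0.
pose b n := ln (cabs (iter n f 0)).
(* Harnack's inequality at the point f(0), whose nth iterate is the next iterate of 0. *)
have up k : b (N + k)%N <= 3 ^+ k * b N.
  elim: k => [|k ih]; first by rewrite addn0 expr0 mul1r.
  have : b (N + k.+1)%N <= 3 * b (N + k)%N.
    by rewrite /b addnS iterSr; apply: har; [exact: leq_addr | rewrite /s; lra].
  rewrite exprS -mulrA; lra.
(* Some point of the disc of radius 32 S has an nth iterate of modulus at least M^n(S); Harnack's
   inequality transfers this to 0. *)
have lo n : (N <= n)%N -> 10 ^+ n * ln S <= 3 * b n.
  move=> Nn; have [h1 h2 h3] := expanding_iter eS (lexx S) n; apply: (le_trans h2).
  have [z zS hz] : exists2 z, cball 0 (32 * S) z & iter n M S <= cabs (iter n f z).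
    apply: contrapT => hn; apply: (@hull_large (iter n f @` cball 0 (32 * S)) (iter n M S)); first lra.
      move=> _ [x Ux <-]; rewrite /cball /mkset subr0 ltNge; apply/negP => q; apply: hn; by exists x.
    by move=> x hx; apply: h3; move: hx; rewrite /cball /mkset; lra.
  rewrite /cball /mkset subr0 in zS.
  apply: le_trans (har n z Nn _); last by rewrite /s; lra.
  by rewrite ler_ln ?posrE; lra.
have lnS : 0 < ln S by rewrite ln_gt0; lra.
have bN : 0 < b N by rewrite ln_gt0 //; apply: hN; rewrite // cabs0; lra.
have : ln S <= 0; last lra.
(* Growth by 10 per step against at most 3, which is less than 10 / 2, leaves the factor 2^-k. *)
apply: (@le_half_pow R _ (3 * b N)) => k.
have q1 := lo (N + k)%N (leq_addr _ _); have q2 := up k.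
have p10 (j : nat) : 1 <= (10 : R) ^+ j by rewrite exprn_ege1 //; lra.
have q3 : 10 ^+ k * ln S <= 10 ^+ (N + k) * ln S.
  by rewrite ler_wpM2r ?(ltW lnS) // exprD ler_peMl // (le_trans ler01).
have p0 : 0 < (10 : R) ^+ k by exact: lt_le_trans ltr01 (p10 k).
rewrite -(ler_pM2l p0); apply: (le_trans q3); apply: (le_trans q1).
have q4 : (3 : R) ^+ k <= (10 * 2^-1) ^+ k by apply: lerXn2r; rewrite ?nnegrE; lra.
have q5 : 3 ^+ k * b N <= (10 * 2^-1) ^+ k * b N by rewrite ler_wpM2r // ltW.
rewrite exprMn in q5.
have -> : 10 ^+ k * (3 * b N * 2^-1 ^+ k) = 3 * (10 ^+ k * 2^-1 ^+ k * b N) by ring.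
lra.
Qed.

End FastEscape.

(** * From separation to spiders' webs *)

Section Webs.
Variable R : realType.
Local Notation C := (R[i]).
Variable f : C -> C.
Hypothesis hf : ent f.
Hypothesis cf : forall z, ccont f z.
Hypothesis of_ : open_map f.
Hypothesis nt : ~ (exists p : {poly C}, forall z, f z = p.[z]).

Lemma connected_iter n (U : set C) : connected U -> connected (iter n f @` U).
Proof.
move=> cU; apply: connected_continuous_connected => //; apply: continuous_subspaceT.
by apply/ccont_continuous => z; exact: ccont_iter.
Qed.

(** Stronger than the domains in [spiders_web]: connected boundaries serve [web_connected] and
    [escaping_star], and the discs give the exhaustion. *)
Definition web_seq (E : set C) (G : nat -> set C) :=
  [/\ (forall n, [/\ bounded (G n), domain (G n), simply_connected (G n), boundary (G n) `<=` E & G n `<=` G n.+1]),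
      (forall n, connected (boundary (G n))) & forall n, cball 0 n%:R `<=` G n.+1].

(** Passing to the component of z0 makes all images and hulls connected; its boundary is still in E.
    Each next hull is chosen to contain a disc that includes the previous one. *)
Lemma web_seq_exists (E : set C) z0 : (forall z, E z -> E (f z)) -> julia f z0 -> separates E z0 ->
  exists G, web_seq E G.
Proof.
move=> fE Jz [U0 [oU0 bU0 Uz0 UE0]].
pose U := connected_component U0 z0.
have oU : open U by exact: open_component.
have Uz : U z0 by exact: connected_component_refl.
have bU : bounded U by have [B hB] := bU0; exists B => z /connected_component_sub /hB.
have UE : boundary U `<=` E by move=> z /(boundary_component oU0) /UE0.
pose V k := iter k f @` U.
have oV k : open (V k) by exact: (open_map_iter (n := k) of_).
have cV k : connected (V k) by apply: connected_iter; exact: component_connected.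
have bbV k := boundary_image (ccont_iter hf k) (open_map_iter (n := k) of_) oU bU.
have V0 k : V k !=set0 by exists (iter k f z0), z0.
have bdE k : boundary (hull (V k)) `<=` E.
  move=> z /(boundary_hull (oV k)) /(bbV k).2 [x /UE Ex <-]; exact: forward_iter.
have bH k : bounded (hull (V k)) by apply: hull_bounded; exact: (bbV k).1.
have ex (p : nat * nat) : exists k, hull (V p.1) `<=` hull (V k) /\ cball 0 p.2%:R `<=` hull (V k).
  have [B B0 hB] := bounded_cabs_lt (bH p.1).
  have [k hk] := julia_hull hf of_ (B + p.2%:R) Jz oU Uz.
  exists k; split => z hz; apply: hk; rewrite /cball /mkset subr0.
    by apply: (lt_le_trans (hB z hz)); rewrite lerDl.
  by move: hz; rewrite /cball /mkset subr0 => h; apply: (lt_le_trans h); rewrite lerDr ltW.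
have [nxt hnxt] := choice ex.
pose k := fix k n := if n is n'.+1 then nxt (k n', n') else 0%N.
exists (fun n => hull (V (k n))); split.
- move=> n; split => //; [| exact: hull_simply_connected | exact: (hnxt (k n, n)).1].
  split; first exact: open_hull.
  split; first exact: hull_connected.
  by have [v Vv] := V0 (k n); exists v; exact: sub_hull.
- by move=> n; apply: boundary_hull_connected => //; exact: (bbV _).1.
- by move=> n; exact: (hnxt (k n, n)).2.
Qed.

Lemma web_seq_cover E G : web_seq E G -> \bigcup_n G n = setT.
Proof.
move=> [_ _ h]; apply/seteqP; split => // z _; exists (Num.truncn (cabs z)).+2 => //; apply: h.
by rewrite /cball /mkset subr0 truncnS_gt.
Qed.

Lemma web_seq_web (E : set C) G : web_seq E G ->
  (forall U, open U -> bounded U -> U `&` E !=set0 -> boundary U `&` E !=set0) -> spiders_web E.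
Proof.
move=> wG star; have cov := web_seq_cover wG; have [h1 h2 _] := wG; split; last by exists G.
apply: (web_connected (G := G)) => // n; have [b1 [b2 [_ b3]] _ b4 b5] := h1 n => //.
Qed.

Lemma web_separates (E : set C) z : spiders_web E -> separates E z.
Proof.
move=> [_ [G [h cov]]]; have [n _ Gz] : (\bigcup_n G n) z by rewrite cov.
by have [b1 [b2 _] _ b4 _] := h n; exists (G n).
Qed.

(* The images of a component of U in the Fatou set are pairwise disjoint and avoid the escaping boundaries
   of the web, except for finitely many images per boundary; so its boundary is driven to infinity. *)
Lemma escaping_star G (U : set C) : web_seq (escaping f) G -> open U -> bounded U -> U `&` escaping f !=set0 ->
  boundary U `&` escaping f !=set0.
Proof.
move=> [wG cG covG] oU bU [x [Ux Ix]].
have [UJ|UJ] := pselect (U `&` julia f !=set0).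
  have [S eS] := expanding_exists hf cf of_ nt; have [S2 _] := eS.
  have [|b [b1 b2]] := @julia_fast R f hf cf of_ nt U S _ oU bU UJ; first lra.
  exists b; split => //; apply: fast_sub_escaping b2; exact: expanding_diverge eS (lexx S).
have UF : U `<=` Defs.fatou f by move=> z Uz Jz; apply: UJ; exists z.
pose D := connected_component U x.
have Dx : D x by exact: connected_component_refl.
have DU : D `<=` U by exact: connected_component_sub.
have oD : open D by exact: open_component.
have cD : connected D by exact: component_connected.
have bD : bounded D by have [B hB] := bU; exists B => z /DU /hB.
have DI : D `<=` escaping f by apply: fatou_escaping => //; [move=> z /DU /UF | exists x].
apply: contrapT => hn.
have nbI z : boundary D z -> ~ escaping f z by move=> /(boundary_component oU) bz Iz; apply: hn; exists z.
pose I n := iter n f @` D.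
have oI n : open (I n) by exact: (open_map_iter (n := n) of_).
have cI n : connected (I n) by exact: connected_iter.
have bI n := boundary_image (ccont_iter hf n) (open_map_iter (n := n) of_) oD bD.
have bdI n z : boundary (I n) z -> ~ escaping f z.
  by move=> /(bI n).2 [y by_ <-]; rewrite escaping_iter; exact: nbI.
have II n : I n `<=` escaping f by move=> _ [y Dy <-]; apply/escaping_iter; exact: DI.
(* If a later image meets an earlier one, it lies inside it, as its points escape and the boundary
   of the earlier one does not. Then f^p maps that bounded image into itself and its points could
   not escape. *)
have disj n p z : (0 < p)%N -> I n z -> ~ I (p + n)%N z.
  move=> p0 z1 z2.
  have sub : I (p + n)%N `<=` I n.
    apply: connected_boundary_sub => //; last by exists z.
    by apply/seteqP; split => // y [/II h /bdI].
  have inv k y : I n y -> I n (iter (p * k) f y).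
    move=> Iy; elim: k => [|k ih]; first by rewrite muln0.
    by rewrite mulnS iterD; apply: sub; rewrite /I image_iterD; exists (iter (p * k) f y).
  have [B hB] := (bI n).1; have /escapingP /(_ B) [N hN] := II n z z1.
  have pN : (N <= p * N)%N by rewrite leq_pmull.
  have := hN _ pN; have := hB _ (inv N z z1); lra.
(* The connected escaping boundary of [G k] lies in at most one image, so late images miss it; a
   late image meeting [G k] would lie inside, while the orbit of x has left [G k]. *)
have evt k : exists N : nat, forall n z, (N <= n)%N -> I n z -> ~ G k z.
  have [[B hB] [oGk _] _ bGk _] := wG k.
  have /escapingP /(_ B) [N1 hN1] := Ix.
  have [N2 hN2] : exists N2 : nat, forall n z, (N2 <= n)%N -> boundary (G k) z -> ~ I n z.
    have [[n0 [y [by_ Iy]]]|h0] := pselect (exists n, boundary (G k) `&` I n !=set0); last first.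
      by exists 0%N => n z _ bz Iz; apply: h0; exists n, z.
    exists n0.+1 => n z n0n bz.
    have sub : boundary (G k) `<=` I n0.
      apply: connected_boundary_sub => //; last by exists y.
      by apply/seteqP; split => // v [/bGk h /bdI].
    have := @disj n0 (n - n0)%N z; rewrite subnK; last exact: ltnW.
    by apply; [rewrite subn_gt0 | exact: sub].
  exists (maxn N1 N2) => n z; rewrite geq_max => /andP[n1 n2] Iz Gz.
  have sub : I n `<=` G k.
    apply: connected_boundary_sub => //; last by exists z.
    by apply/seteqP; split => // v [Iv bv]; case: (hN2 n v n2 bv).
  have : G k (iter n f x) by apply: sub; exists x.
  by move=> /hB; have := hN1 n n1; lra.
have [b bb] : boundary D !=set0 by apply: boundary_nonempty => //; exists x.
(* A boundary point b with f^n(b) in a disc for some late n would bring nearby points of D into a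
   [G k] that late images avoid. *)
apply: (nbI b bb); apply/escapingP => T.
have [N hN] := evt (Num.truncn T).+2; exists N => n Nn; rewrite ltNge; apply/negP => q.
have Gb : G (Num.truncn T).+2 (iter n f b).
  by apply: covG; rewrite /cball /mkset subr0; apply: (le_lt_trans q); exact: truncnS_gt.
have [_ [/openCP oGk _] _ _ _] := wG (Num.truncn T).+2.
have [e e0 he] := oGk _ Gb; have [d d0 hd] := ccont_iter hf n b e0.
have [/closureCP /(_ d d0) [w Dw hw] _] := bb.
by apply: (hN n (iter n f w) Nn); [exists w | apply: he; exact: hd].
Qed.

(** Otherwise the connected boundary of the hull of D lies in a single Fatou component W. That
    component is simply connected, so it contains its hull, hence the Julia point z0. *)
Lemma julia_star : ~ (exists U, fatou_component f U /\ multiply_connected U) ->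
  forall U, open U -> bounded U -> U `&` julia f !=set0 -> boundary U `&` julia f !=set0.
Proof.
move=> hsc U oU bU [z0 [Uz Jz]]; apply: contrapT => hn.
pose D := connected_component U z0.
have Dz : D z0 by exact: connected_component_refl.
have oD : open D by exact: open_component.
have cD : connected D by exact: component_connected.
have bD : bounded D by have [B hB] := bU; exists B => z /connected_component_sub /hB.
have D0 : D !=set0 by exists z0.
have bF : boundary (hull D) `<=` Defs.fatou f.
  by move=> z /(boundary_hull oD) /(boundary_component oU) bz Jz'; apply: hn; exists z.
have bH : bounded (hull D) by exact: hull_bounded.
have Hz : hull D z0 by exact: sub_hull.
have [b bb] : boundary (hull D) !=set0.
  by apply: boundary_nonempty => //; [exact: open_hull | exists z0].
pose W := connected_component (Defs.fatou f) b.
have bW : boundary (hull D) `<=` W.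
  by apply: connected_component_max => //; exact: boundary_hull_connected.
have oW : open W by apply: open_component; exact: open_fatou.
have sW : simply_connected W.
  by apply: contrapT => h; apply: hsc; exists W; split => //; exists b => //; exact: bF.
have : W z0.
  apply: (simply_connected_hull oW sW); exists (hull D); split => //; exact: open_hull.
by move=> /connected_component_sub; apply.
Qed.

End Webs.

Theorem theorem1p6 (R : realType) (f : R[i] -> R[i]) :
  transcendental_entire f ->
  (spiders_web (escaping f) <->
     exists2 z, julia f z & separates (escaping f) z) /\
  (forall R0 : R, 0 < R0 ->
     (fun n => iter n (maxmod f) R0) @ \oo --> +oo ->
     (spiders_web (fast_escaping f R0) <->
        exists2 z, julia f z & separates (fast_escaping f R0) z)) /\
  ((~ exists U, fatou_component f U /\ multiply_connected U) ->
     (spiders_web (julia f) <->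
        exists2 z, julia f z & separates (julia f) z)).
Proof.
move=> [/entire_ent hf nt].
have cf z : ccont f z by exact: ent_cont.
have of_ : open_map f by apply: open_map_ent => //; exact: transcendental_nonconstant.
(* This point serves all three direct implications, since a web separates every point. *)
have [z0 Jz0] := julia_nonempty hf cf of_ nt.
split; last split.
- split=> [w|[z Jz sz]]; first by exists z0 => //; exact: web_separates.
  have [G wG] := web_seq_exists hf of_ (@escaping_forward R f) Jz sz.
  by apply: (web_seq_web wG) => U; exact: escaping_star wG.
- move=> R0 R00 div; split=> [w|[z Jz sz]]; first by exists z0 => //; exact: web_separates.
  have hR := diverge_maxmod_ge cf of_ R00 div.
  have [|G wG] := web_seq_exists hf of_ _ Jz sz; first by move=> x; exact: fast_forward.
  by apply: (web_seq_web wG) => U; exact: fast_star.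
- move=> hsc; split=> [w|[z Jz sz]]; first by exists z0 => //; exact: web_separates.
  have [G wG] := web_seq_exists hf of_ (julia_forward hf) Jz sz.
  by apply: (web_seq_web wG); exact: julia_star.
Qed.
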